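(* Let $M$ be a compact Hausdorff space, $\mu$ a Borel regular probability measure on $M$, and $f:M\to M$ a homeomorphism preserving $\mu$. Let $G$ be a closed subgroup of $\mathrm{GL}(d,\mathbb{R})$ acting transitively on the projective space $\mathbb{R}\mathrm{P}^{d-1}$, and let $C(M,G)$ be the space of continuous maps $M\to G$ with the $C^0$ topology. Then $A_0\in C(M,G)$ is a point of continuity of the map $$C(M,G)\ni A\mapsto(\mathrm{LE}_1(A),\dots,\mathrm{LE}_{d-1}(A))\in\mathbb{R}^{d-1}$$ if and only if the Oseledets splitting of the cocycle $F_{A_0}$ is either dominated or trivial at $x$ for $\mu$-almost every $x\in M$. Consequently, there exists a residual subset $\mathcal{R}\subset C(M,G)$ such that for every $A\in\mathcal{R}$ and $\mu$-almost every $x\in M$, the Oseledets splitting of $F_A$ at $x$ is either trivial or dominated.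
   Context: For $A\in C(M,G)$ the linear cocycle is $F_A:M\times\mathbb{R}^d\to M\times\mathbb{R}^d$, $F_A(x,v)=(f(x),A(x)v)$; write $A^n(x)$ for the linear part of $F_A^n$ over $x$ ($n\in\mathbb{Z}$), so $A^n(x)=A(f^{n-1}(x))\cdots A(x)$ for $n\ge1$. Oseledets' theorem: for $\mu$-a.e. $x$ there are $k(x)$, numbers $\hat\lambda_1(x)>\cdots>\hat\lambda_{k(x)}(x)$ and an $A$-invariant measurable splitting $\mathbb{R}^d=E^1_x\oplus\cdots\oplus E^{k(x)}_x$ (that is, $A(x)E^j_x=E^j_{f(x)}$) with $\lim_{n\to\pm\infty}\frac1n\log\|A^n(x)v\|=\hat\lambda_j(x)$ for $v\in E^j_x\setminus\{0\}$. The Lyapunov exponents $\lambda_1(A,x)\ge\cdots\ge\lambda_d(A,x)$ are the $\hat\lambda_j(x)$ repeated with multiplicity $\dim E^j_x$, and $\mathrm{LE}_j(A)=\int_M[\lambda_1(A,x)+\cdots+\lambda_j(A,x)]\,d\mu(x)$. The Oseledets splitting is trivial at $x$ if $k(x)=1$, i.e. all Lyapunov exponents at $x$ are equal. Domination: over an $f$-invariant set $\Gamma$, an $A$-invariant splitting $\mathbb{R}^d=E^1_x\oplus E^2_x$ ($x\in\Gamma$) into non-zero subspaces of constant dimensions is dominated, written $E^1\succ E^2$, if there is $m\in\mathbb{N}$ with $\|A^m(x)|_{E^2_x}\|\cdot\|(A^m(x)|_{E^1_x})^{-1}\|\le\frac12$ for all $x\in\Gamma$. A splitting $E^1\oplus\cdots\oplus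 E^k$ is dominated if $E^1\oplus\cdots\oplus E^j\succ E^{j+1}\oplus\cdots\oplus E^k$ for all $1\le j<k$, and dominated at $x$ if it is dominated when restricted to the orbit $\{f^n(x):n\in\mathbb{Z}\}$. Residual means containing a dense $G_\delta$ subset. *)

(* Defs.v *)
From HB Require Import structures.
From mathcomp Require Export all_boot all_order all_algebra.
From mathcomp Require Export all_classical all_reals all_analysis.
From mathcomp Require Export borel_hierarchy.
Export numFieldNormedType.Exports.

Set Implicit Arguments.
Unset Strict Implicit.
Unset Printing Implicit Defensive.

Import Order.TTheory GRing.Theory Num.Theory.
Local Open Scope classical_set_scope.
Local Open Scope ring_scope.

Record homeomorphism (M : topologicalType) := Homeomorphism {
  homeo_fun :> M -> M;
  homeo_inv : M -> M;
  homeo_funK : cancel homeo_fun homeo_inv;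
  homeo_invK : cancel homeo_inv homeo_fun;
  homeo_fun_continuous : continuous homeo_fun;
  homeo_inv_continuous : continuous homeo_inv }.

Definition iterz (M : topologicalType) (f : homeomorphism M) (n : int) (x : M)
    : M :=
  match n with
  | Posz m => iter m f x
  | Negz m => iter m.+1 (homeo_inv f) x
  end.

Definition orbitz (M : topologicalType) (f : homeomorphism M) (x : M) : set M :=
  [set y | exists n : int, y = iterz f n x].

Section LinearAlgebra.
Variables (R : realType) (d : nat).
Implicit Types (B : 'M[R]_d) (E : {vspace 'cV[R]_d}).

(* The norm [`|v|] provided by the library on matrices is the sup norm. *)
Definition enorm (v : 'cV[R]_d) : R := Num.sqrt (\sum_i v i 0 ^+ 2).

Definition img B E : {vspace 'cV[R]_d} := (linfun (mulmx B) @: E)%VS.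

(* The norm of the restriction of B to E, intended for E non-zero. *)
Definition opnorm_on B E : R :=
  sup [set enorm (B *m v) | v in [set v | v \in E /\ enorm v = 1]].

(* R^d is the direct sum of the non-zero subspaces E 0, ..., E (k - 1). *)
Definition is_splitting (k : nat) (E : nat -> {vspace 'cV[R]_d}) : Prop :=
  [/\ forall i, (i < k)%N -> E i != 0%VS,
      directv (\sum_(i < k) E i) &
      (\sum_(i < k) E i)%VS = fullv].

(* "Closed" is relative to GL(d, R), which is not closed in 'M[R]_d. *)
Definition closed_subgroup_GL (G : set 'M[R]_d) : Prop :=
  [/\ exists2 C : set 'M[R]_d, closed C & G = C `&` [set B | B \in unitmx],
      G 1%:M,
      forall B1 B2, G B1 -> G B2 -> G (B1 *m B2) &
      forall B, G B -> G (invmx B)].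

(* Points of the projective space are the one-dimensional subspaces. *)
Definition projectively_transitive (G : set 'M[R]_d) : Prop :=
  forall L1 L2 : {vspace 'cV[R]_d}, \dim L1 = 1%N -> \dim L2 = 1%N ->
  exists2 B, G B & img B L1 = L2.

End LinearAlgebra.

Section Cocycle.
Variables (R : realType) (d : nat) (M : topologicalType) (f : homeomorphism M).
Variable A : M -> 'M[R]_d.

Fixpoint cocycle_nat (n : nat) (x : M) : 'M[R]_d :=
  if n is m.+1 then A (iter m f x) *m cocycle_nat m x else 1%:M.

(* Negative iterates of F_A : (x, v) |-> (f x, A x v) are
   F_A^{-m} (x, v) = (f^{-m} x, A^m(f^{-m} x)^{-1} v). *)
Definition cocycle (n : int) (x : M) : 'M[R]_d :=
  match n with
  | Posz m => cocycle_nat m x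
  | Negz m => invmx (cocycle_nat m.+1 (iterz f n x))
  end.

Definition two_sided_exponent (x : M) (v : 'cV[R]_d) (l : R) : Prop :=
  (fun n : nat => (n%:R)^-1 * ln (enorm (cocycle n%:Z x *m v))) @ \oo --> l /\
  (fun n : nat => (- n%:R)^-1 * ln (enorm (cocycle (- n%:Z) x *m v)))
    @ \oo --> l.

(* [s] lists the pairs (j-th exponent, E^j) of the Oseledets decomposition at
   x. It is determined by x: E^j consists of 0 and of the vectors v with
   two-sided exponent the j-th one. In particular the splitting is
   automatically A-invariant on orbits. *)
Definition is_oseledets (x : M) (s : seq (R * {vspace 'cV[R]_d})) : Prop :=
  [/\ sorted (fun a b : R => b < a) (unzip1 s),
      is_splitting (size s) (nth 0%VS (unzip2 s)) &
      forall p, p \in s -> forall v, v \in p.2 -> v != 0 ->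
        two_sided_exponent x v p.1].

(* Junk value [::] outside the full-measure set given by Oseledets' theorem. *)
Definition oseledets (x : M) : seq (R * {vspace 'cV[R]_d}) :=
  xget [::] [set s | is_oseledets x s].

Definition oseledets_number (x : M) : nat := size (oseledets x).

Definition oseledets_space (i : nat) (x : M) : {vspace 'cV[R]_d} :=
  nth 0%VS (unzip2 (oseledets x)) i.

(* [lyapunov i x] is lambda_{i+1}(A, x): indices start at 0. *)
Definition lyapunov (i : nat) (x : M) : R :=
  nth 0 (flatten [seq nseq (\dim p.2) p.1 | p <- oseledets x]) i.

Definition invariant_splitting (Gam : set M) (k : nat)
    (E : nat -> M -> {vspace 'cV[R]_d}) : Prop :=
  [/\ forall x, Gam x -> is_splitting k (E^~ x),
      forall i x, (i < k)%N -> Gam x -> img (A x) (E i x) = E i (f x) &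
      forall i x y, (i < k)%N -> Gam x -> Gam y -> \dim (E i x) = \dim (E i y)].

(* The inverse of the restriction of A^m(x) to E1 x is defined on the image
   of E1 x. *)
Definition dominates (Gam : set M) (E1 E2 : M -> {vspace 'cV[R]_d}) : Prop :=
  exists m : nat, forall x, Gam x ->
    opnorm_on (cocycle m%:Z x) (E2 x) *
    opnorm_on (invmx (cocycle m%:Z x)) (img (cocycle m%:Z x) (E1 x)) <= 2^-1.

Definition dominated_splitting (Gam : set M) (k : nat)
    (E : nat -> M -> {vspace 'cV[R]_d}) : Prop :=
  invariant_splitting Gam k E /\
  forall j, (0 < j < k)%N ->
    dominates Gam (fun x => \sum_(0 <= i < j) E i x)%VS
                  (fun x => \sum_(j <= i < k) E i x)%VS.

Definition oseledets_trivial_at (x : M) : Prop := oseledets_number x = 1%N.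

Definition oseledets_dominated_at (x : M) : Prop :=
  dominated_splitting (orbitz f x) (oseledets_number x) oseledets_space.

End Cocycle.

Section Measure.
Variables (R : realType) (M : ptopologicalType).
Variable mu : probability (g_sigma_algebraType (@open M)) R.

Definition borel_regular : Prop :=
  forall B : set (g_sigma_algebraType (@open M)), measurable B ->
    mu B = ereal_inf [set mu U | U in [set U : set M | open U /\ B `<=` U]] /\
    mu B = ereal_sup [set mu K | K in [set K : set M | compact K /\ K `<=` B]].

Definition preserves (f : M -> M) : Prop :=
  forall B : set (g_sigma_algebraType (@open M)), measurable B ->
    mu (f @^-1` B) = mu B.

Definition LE (d : nat) (f : homeomorphism M) (A : M -> 'M[R]_d) (j : nat) : R :=
  Rintegral mu setT (fun x => \sum_(i < j) lyapunov f A i x).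

End Measure.

(* As a type, it carries the subspace topology of uniform convergence, which is
   the C^0 topology. *)
Definition cont_maps (R : realType) (d : nat) (M : ptopologicalType)
    (G : set 'M[R]_d) : set {uniform M -> 'M[R]_d} :=
  [set A : M -> 'M[R]_d | continuous A /\ forall x, G (A x)].
Arguments cont_maps {R d} M G.

(* Coordinate j (from 0) is LE_{j+1}. *)
Definition LE_map (R : realType) (d : nat) (M : ptopologicalType)
    (mu : probability (g_sigma_algebraType (@open M)) R)
    (f : homeomorphism M) (G : set 'M[R]_d) (A : cont_maps M G)
    : 'rV[R]_(d.-1) :=
  \row_(j < d.-1) LE mu f (set_val A) j.+1.

Definition residual (T : topologicalType) (S : set T) : Prop :=
  exists D : set T, [/\ Gdelta D, dense D & D `<=` S].

(* Main.v *)
(** The p-minors of X, summed in absolute value, give a submultiplicative [minor_sum p X];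
    Kingman's theorem yields the exponents, and the Cauchy-Binet inequality [star] yields
    Oseledets' theorem.

    LE_p is an infimum of continuous functions, hence upper semicontinuous.  If the splitting
    is dominated or trivial almost everywhere, then domination is uniform on a set of almost
    full measure, and a cone argument gives lower semicontinuity.  Otherwise domination fails
    at some index p on a set of positive measure.  Transitivity and Baire's theorem in G
    provide small elements of G, joined to 1 by short paths, moving every direction a little,
    so that a small perturbation along an orbit segment sends a fast vector to a slow one.
    Doing this on disjoint towers, with Urysohn functions, lowers LE_p by a fixed amount.

    The residual set consists of the maps where no LE_p jumps across a rational value; it is
    dense by Baire's theorem in C(M,G). *)
Require Import Defs.
From mathcomp Require Import zify ring lra.
From mathcomp Require Import fingroup perm measurable_realfun.
Set Implicit Arguments.
Unset Strict Implicit.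
Unset Printing Implicit Defensive.
Import Order.TTheory GRing.Theory Num.Theory.
Local Open Scope classical_set_scope.
Local Open Scope ring_scope.

(** The inequality [star] is the engine. It bounds the volume growth of a product X Y by two terms,
    one small when the inverse of Y contracts a vector v, the other small when X contracts v. If the
    product is known to be large, one small term forces the other to be large, which gives the
    dichotomy of growth rates, and both cannot be small, which gives transversality of the forward
    and backward slow spaces. Conversely, once a perturbation sends a vector that is slow in the
    past to one that is slow in the future, both terms are small and the exponents drop.

    Three obstacles shape the rest. Without ergodicity, exponents and domination constants vary from
    point to point and become uniform only off sets of small measure. M need not be metrizable, so
    near coverings, Urysohn functions and regularity of the measure replace metric arguments. G is
    any closed subgroup, so perturbations must follow paths inside G, built here by hand. The
    Oseledets spaces are never shown to be measurable: only exponents obtained from minors, and sets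
    given by open or closed conditions, are integrated. *)

Local Notation borel M := (g_sigma_algebraType (@open M)).
Local Notation dominated_or_trivial f A x :=
  (oseledets_dominated_at f A x \/ oseledets_trivial_at f A x).

(** * Cauchy-Binet and sums of minors *)

Section CauchyBinet.
Variables (R : realType) (p d : nat).
Implicit Types (X : 'M[R]_(p, d)) (Y : 'M[R]_(d, p)).
Local Notation idx := {ffun 'I_p -> 'I_d}.

Lemma det_mulmx_rows X Y :
  \det (X *m Y) = \sum_(s : idx) (\prod_i X i (s i)) * \det (rowsub s Y).
Proof.
rewrite /determinant; under eq_bigr => sg _.
  under eq_bigr => i _ do rewrite mxE.
  rewrite bigA_distr_bigA mulr_sumr.
  over.
rewrite exchange_big /=; apply: eq_bigr => s _.
rewrite mulr_sumr; apply: eq_bigr => sg _.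
rewrite big_split /= mulrCA; congr (_ * (_ * _)).
by apply: eq_bigr => i _; rewrite mxE.
Qed.

(** The sum runs over all maps, not only the increasing ones, so each index set occurs p! times. The
    proof averages the row expansion over the permutations g, after precomposing the summation index
    with g. *)
Lemma Cauchy_Binet X Y :
  p`!%:R * \det (X *m Y) = \sum_(s : idx) \det (colsub s X) * \det (rowsub s Y).
Proof.
have E (g : 'S_p) : \det (X *m Y) =
    \sum_(s : idx) (-1) ^+ g * (\prod_i X i (s (g i))) * \det (rowsub s Y).
  rewrite det_mulmx_rows.
  rewrite (reindex_inj (h := fun s : idx => [ffun i => s (g i)])) /=; last first.
    move=> s1 s2 /ffunP s12; apply/ffunP => i.
    by have := s12 (g^-1%g i); rewrite !ffunE permKV.
  apply: eq_bigr => s _.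
  have -> : rowsub [ffun i => s (g i)] Y = row_perm g (rowsub s Y).
    by apply/matrixP => i j; rewrite !mxE ffunE.
  rewrite row_permE det_mulmx det_perm mulrA [X in X * _]mulrC.
  by congr (_ * _ * _); apply: eq_bigr => i _; rewrite ffunE.
rewrite mulr_natl -(card_Sn p) -sumr_const.
rewrite (eq_bigr _ (fun g _ => E g)) exchange_big /=.
apply: eq_bigr => s _; rewrite -mulr_suml; congr (_ * _).
rewrite /determinant; apply: eq_bigr => g _; congr (_ * _).
by apply: eq_bigr => i _; rewrite mxE.
Qed.
End CauchyBinet.

Section Minors.
Variables (R : realType) (d : nat).
Implicit Types (X Y : 'M[R]_d) (v z : 'cV[R]_d).

(** Up to the factor p!^2, the entrywise l^1 norm of the p-th exterior power of X. With all maps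
    instead of increasing ones it is submultiplicative without any constant. *)
Definition minor_sum (p : nat) X : R :=
  \sum_(s : {ffun 'I_p -> 'I_d}) \sum_(t : {ffun 'I_p -> 'I_d})
    `|\det (mxsub s t X)|.

Lemma minor_sum_ge0 p X : 0 <= minor_sum p X.
Proof. by apply: sumr_ge0 => s _; apply: sumr_ge0. Qed.

Lemma le_minor_sum p X (s t : 'I_p -> 'I_d) : `|\det (mxsub s t X)| <= minor_sum p X.
Proof.
rewrite /minor_sum (bigD1 (finfun s)) //= (bigD1 (finfun t)) //=.
have -> : mxsub (finfun s) (finfun t) X = mxsub s t X.
  by apply/matrixP => i j; rewrite !mxE !ffunE.
rewrite -addrA lerDl addr_ge0 ?sumr_ge0 // => s' _.
by rewrite sumr_ge0.
Qed.

Lemma minor_sumM p X Y : minor_sum p (X *m Y) <= minor_sum p X * minor_sum p Y.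
Proof.
rewrite /minor_sum mulr_suml; apply: ler_sum => s _.
under [leLHS]eq_bigr => t _.
  have -> : mxsub s t (X *m Y) = rowsub s X *m colsub t Y.
    by apply/matrixP => i j; rewrite !mxE; apply: eq_bigr => k _; rewrite !mxE.
  over.
rewrite [leRHS](_ : _ = \sum_(t : {ffun 'I_p -> 'I_d})
   \sum_(r : {ffun 'I_p -> 'I_d}) \sum_(r' : {ffun 'I_p -> 'I_d})
    `|\det (mxsub s r X)| * `|\det (mxsub r' t Y)|); last first.
  rewrite mulr_suml [RHS]exchange_big; apply: eq_bigr => r _ /=.
  rewrite [RHS]exchange_big mulr_sumr; apply: eq_bigr => r' _ /=.
  by rewrite mulr_sumr.
apply: ler_sum => t _.
apply: (@le_trans _ _ (`|p`!%:R * \det (rowsub s X *m colsub t Y)|)).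
  by rewrite normrM ler_peMl // normr_nat ler1n fact_gt0.
rewrite Cauchy_Binet; apply: le_trans (ler_norm_sum _ _ _) _.
apply: ler_sum => r _; rewrite normrM (bigD1 r) //=.
have -> : mxsub s r X = colsub r (rowsub s X) by apply/matrixP => i j; rewrite !mxE.
have -> : mxsub r t Y = rowsub r (colsub t Y) by apply/matrixP => i j; rewrite !mxE.
by rewrite lerDl sumr_ge0 // => r' _; rewrite mulr_ge0.
Qed.

Lemma minor_sum0 X : minor_sum 0 X = 1.
Proof.
rewrite /minor_sum (big_pred1 [ffun i : 'I_0 => False_rect 'I_d (notF (ltn_ord i))]).
  rewrite (big_pred1 [ffun i : 'I_0 => False_rect 'I_d (notF (ltn_ord i))]).
    by rewrite det_mx00 normr1.
  by move=> s; apply/esym/eqP/ffunP => -[].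
by move=> s; apply/esym/eqP/ffunP => -[].
Qed.

Lemma minor_sum_big p X : (d < p)%N -> minor_sum p X = 0.
Proof.
move=> dp; apply: big1 => s _; apply: big1 => t _; apply/normr0P/eqP.
have /injectivePn [i [j ij sij]] : ~~ injectiveb s.
  apply/negP => /injectiveP inj; have := leq_card _ inj.
  by rewrite !card_ord leqNgt dp.
by apply: (determinant_alternate ij) => k; rewrite !mxE sij.
Qed.

(** Submultiplicativity applied to the product of X and its inverse, since the identity has a
    principal minor equal to 1. *)
Lemma minor_sum_gt0 p X : X \in unitmx -> (p <= d)%N -> 0 < minor_sum p X.
Proof.
move=> uX pd; rewrite lt_neqAle minor_sum_ge0 andbT; apply/eqP => w0.
have : minor_sum p 1%:M <= 0.
  by rewrite -(mulmxV uX) (le_trans (minor_sumM _ _ _)) // -w0 mul0r.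
apply/negP; rewrite -ltNge.
apply: lt_le_trans (le_minor_sum 1%:M (widen_ord pd) (widen_ord pd)).
have -> : mxsub (widen_ord pd) (widen_ord pd) 1%:M = 1%:M :> 'M[R]_p.
  by apply/matrixP => i j; rewrite !mxE.
by rewrite det1 normr1.
Qed.

(* Expanding along the first column, in which all entries but the first one
   vanish. *)
Lemma minor_ext p Y z (i : 'I_d) (r t : 'I_p -> 'I_d) :
  (forall k, (Y *m z) (r k) 0 = 0) ->
  (Y *m z) i 0 * \det (mxsub r t Y) =
  \sum_q z q 0 * \det (mxsub (fun k => oapp r i (unlift ord0 k))
                             (fun k => oapp t q (unlift ord0 k)) Y).
Proof.
move=> rz.
pose r' (k : 'I_p.+1) := oapp r i (unlift ord0 k).
pose cof k : R := cofactor (mxsub r' (fun k => oapp t i (unlift ord0 k)) Y) k ord0.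
transitivity (\sum_k (Y *m z) (r' k) 0 * cof k).
  rewrite big_ord_recl big1 => [|k _]; last by rewrite /r' liftK /= rz mul0r.
  rewrite addr0 /r' unlift_none /= /cof /cofactor addn0 expr0 mul1r.
  congr (_ * \det _); apply/matrixP => a b; rewrite !mxE /r' /=.
  by rewrite !liftK.
under eq_bigr => k _ do rewrite mxE mulr_suml.
rewrite exchange_big; apply: eq_bigr => q _ /=.
rewrite (expand_det_col _ ord0) mulr_sumr; apply: eq_bigr => k _.
rewrite !mxE unlift_none /= -mulrA mulrCA; congr (_ * (_ * _)).
rewrite /cof /cofactor; congr (_ * \det _); apply/matrixP => a b.
by rewrite !mxE !liftK.
Qed.
End Minors.

(** * Sup norms of matrices and a submultiplicative variant *)

Section Norms.
Variables (R : realType).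

Lemma le_mx_entry m n (A : 'M[R]_(m, n)) i j : `|A i j| <= `|A|.
Proof.
rewrite [leRHS]/Num.norm /= mx_normrE.
exact: (le_bigmax _ (fun ij : 'I_m * 'I_n => `|A ij.1 ij.2|) (i, j)).
Qed.

Lemma mx_norm_le m n (A : 'M[R]_(m, n)) (c : R) :
  0 <= c -> (forall i j, `|A i j| <= c) -> `|A| <= c.
Proof.
move=> c0 Ac; rewrite [leLHS]/Num.norm /= mx_normrE.
by apply/bigmax_leP; split => // -[i j] _; exact: Ac.
Qed.

Lemma mx_norm_attained m n (A : 'M[R]_(m, n)) :
  A != 0 -> exists i j, `|A i j| = `|A|.
Proof.
rewrite -normr_eq0 => /(@mx_norm_neq0 R m n A)[[i j] /= E].
by exists i, j; rewrite [RHS]/Num.norm /= E.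
Qed.

(** An upper bound for the operator norm of the sup norm, without suprema over vectors. It is
    submultiplicative, and on columns it is the sup norm itself. *)
Definition mnorm m n (A : 'M[R]_(m, n)) : R := n%:R * `|A|.

Lemma mnorm_ge0 m n (A : 'M[R]_(m, n)) : 0 <= mnorm A.
Proof. by rewrite mulr_ge0. Qed.

Lemma normrM_mx m n p (A : 'M[R]_(m, n)) (B : 'M[R]_(n, p)) :
  `|A *m B| <= mnorm A * `|B|.
Proof.
apply: mx_norm_le => [|i j]; first by rewrite mulr_ge0 ?mnorm_ge0.
rewrite mxE; apply: le_trans (ler_norm_sum _ _ _) _.
rewrite /mnorm -mulrA mulr_natl -[X in _ *+ X](card_ord n) -sumr_const.
by apply: ler_sum => k _; rewrite normrM ler_pM // le_mx_entry.
Qed.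

Lemma mnormM m n p (A : 'M[R]_(m, n)) (B : 'M[R]_(n, p)) :
  mnorm (A *m B) <= mnorm A * mnorm B.
Proof.
rewrite {1}/mnorm (le_trans (ler_wpM2l _ (normrM_mx A B))) //.
by rewrite /mnorm; lra.
Qed.

Lemma mnormD m n (A B : 'M[R]_(m, n)) : mnorm (A + B) <= mnorm A + mnorm B.
Proof. by rewrite /mnorm -mulrDr ler_wpM2l // ler_normD. Qed.

Lemma mnormN m n (A : 'M[R]_(m, n)) : mnorm (- A) = mnorm A.
Proof. by rewrite /mnorm normrN. Qed.

Lemma norm_le_mnorm m n (A : 'M[R]_(m, n)) : `|A| <= mnorm A.
Proof.
case: n A => [A|n A]; last by rewrite /mnorm ler_peMl // ler1n.
by rewrite /mnorm mul0r (_ : A = 0) ?normr0 //; apply/matrixP => i [].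
Qed.

End Norms.

(** * The inequality on minors of a product *)

Section StarInequality.
Variables (R : realType) (d : nat).
Implicit Types (X Y : 'M[R]_d) (v z : 'cV[R]_d).

Lemma minor_laplace p X (s t : 'I_p.+1 -> 'I_d) k (v : 'cV[R]_d) :
  X *m delta_mx (t k) 0 = v ->
  `|\det (mxsub s t X)| <= p.+1%:R * (`|v| * minor_sum p X).
Proof.
move=> Xv; rewrite (expand_det_col _ k); apply: le_trans (ler_norm_sum _ _ _) _.
rewrite mulr_natl -[X in _ *+ X](card_ord p.+1) -sumr_const; apply: ler_sum => i _.
rewrite normrM ler_pM //.
  rewrite -Xv; apply: le_trans (le_mx_entry _ (s i) 0).
  by rewrite -colE !mxE.
rewrite /cofactor normrM normrX normrN1 expr1n mul1r.
apply: le_trans (le_minor_sum X (s \o lift i) (t \o lift k)).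
by rewrite le_eqVlt; apply/orP; left; apply/eqP; congr (`|\det _|); apply/matrixP => a b; rewrite !mxE.
Qed.

(** [Y *m z] vanishes on the rows r and is 1 on row i, so [minor_ext] writes the p-minor as a
    combination of minors of size p + 1 with the entries of z as coefficients. *)
Lemma minor_avoid p Y z (i : 'I_d) (r t : 'I_p -> 'I_d) :
  Y *m z = delta_mx i 0 -> (forall k, r k != i) ->
  `|\det (mxsub r t Y)| <= d%:R * (`|z| * minor_sum p.+1 Y).
Proof.
move=> Yz ri; have := @minor_ext _ _ p Y z i r t.
rewrite Yz mxE !eqxx mul1r => -> => [|k]; last by rewrite mxE (negbTE (ri k)).
apply: le_trans (ler_norm_sum _ _ _) _.
rewrite mulr_natl -[X in _ *+ X](card_ord d) -sumr_const; apply: ler_sum => q _.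
by rewrite normrM ler_pM ?le_mx_entry ?le_minor_sum.
Qed.

Definition nidx p : R := #|{ffun 'I_p -> 'I_d}|%:R.

Lemma minor_sum_le p X (c : R) :
  (forall s t : {ffun 'I_p -> 'I_d}, `|\det (mxsub s t X)| <= c) ->
  minor_sum p X <= nidx p ^+ 2 * c.
Proof.
move=> Xc; rewrite /minor_sum expr2 -mulrA /nidx mulr_natl -sumr_const.
apply: ler_sum => s _; rewrite mulr_natl -sumr_const.
by apply: ler_sum => t _; exact: Xc.
Qed.

Lemma minor_sum_const p (a : R) X : (forall i j, `|X i j| <= a) -> 0 <= a ->
  minor_sum p X <= nidx p ^+ 2 * (p`!%:R * a ^+ p).
Proof.
move=> Xa a0; apply: minor_sum_le => s t.
rewrite /determinant; apply: le_trans (ler_norm_sum _ _ _) _.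
rewrite mulr_natl -(card_Sn p) -sumr_const; apply: ler_sum => g _.
rewrite normrM normrX normrN1 expr1n mul1r normr_prod.
rewrite -[X in a ^+ X](card_ord p) -prodr_const; apply: ler_prod => i _.
by rewrite normr_ge0 mxE Xa.
Qed.

(* Cauchy-Binet, split according to whether the middle index set contains i. *)
Lemma star_delta p X Y z (i : 'I_d) : Y *m z = delta_mx i 0 ->
  minor_sum p.+1 (X *m Y) <=
  nidx p.+1 ^+ 3 * (d%:R * (minor_sum p.+1 X * minor_sum p.+2 Y * `|z|)
   + p.+1%:R * (`|X *m (delta_mx i 0 : 'cV[R]_d)| * minor_sum p X * minor_sum p.+1 Y)).
Proof.
move=> Yz; set B1 := _ * (_ * `|z|); set B2 := p.+1%:R * _.
have B10 : 0 <= B1 by rewrite !mulr_ge0 ?minor_sum_ge0.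
have B20 : 0 <= B2 by rewrite !mulr_ge0 ?minor_sum_ge0.
rewrite exprSr -mulrA; apply: minor_sum_le => s t.
have -> : mxsub s t (X *m Y) = rowsub s X *m colsub t Y.
  by apply/matrixP => a b; rewrite !mxE; apply: eq_bigr => k _; rewrite !mxE.
apply: (@le_trans _ _ (`|p.+1`!%:R * \det (rowsub s X *m colsub t Y)|)).
  by rewrite normrM ler_peMl // normr_nat ler1n fact_gt0.
rewrite Cauchy_Binet; apply: le_trans (ler_norm_sum _ _ _) _.
rewrite /nidx mulr_natl -sumr_const; apply: ler_sum => r _; rewrite normrM.
have -> : colsub r (rowsub s X) = mxsub s r X by apply/matrixP => a b; rewrite !mxE.
have -> : rowsub r (colsub t Y) = mxsub r t Y by apply/matrixP => a b; rewrite !mxE.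
have [/existsP[k /eqP rk]|nr] := boolP [exists k, r k == i].
  apply: (@le_trans _ _ B2); last by rewrite lerDr.
  rewrite /B2 mulrA ler_pM ?le_minor_sum //.
  by apply: minor_laplace (k) _ _; rewrite rk.
apply: (@le_trans _ _ B1); last by rewrite lerDl.
have ri k : r k != i by apply: contra nr => ?; apply/existsP; exists k.
have H := minor_avoid t Yz ri.
apply: le_trans (ler_pM _ _ (le_minor_sum X s r) H) _ => //.
by rewrite /B1; lra.
Qed.

(** The matrix sending the i-th unit vector to v and fixing the other ones; [basis_from] is its
    inverse when [v i 0] is nonzero. *)
Definition basis_to (v : 'cV[R]_d) (i : 'I_d) : 'M[R]_d :=
  1%:M + (v - delta_mx i 0) *m delta_mx 0 i.
Definition basis_from (v : 'cV[R]_d) (i : 'I_d) : 'M[R]_d :=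
  1%:M - (v i 0)^-1 *: ((v - delta_mx i 0) *m delta_mx 0 i).

Lemma basis_toK v i : v i 0 != 0 -> basis_to v i *m basis_from v i = 1%:M.
Proof.
move=> vi; rewrite /basis_to /basis_from; set a := v - _; set b := delta_mx 0 i.
have ba : b *m a = (v i 0 - 1)%:M.
  rewrite /b -rowE; apply/matrixP => x y; rewrite !ord1 !mxE !eqxx.
  by rewrite mulr1n.
set N := a *m b; have NN : N *m N = (v i 0 - 1) *: N.
  by rewrite /N -mulmxA [b *m _]mulmxA ba mul_scalar_mx -scalemxAr.
rewrite mulmxBr mulmx1 -scalemxAr mulmxDl mul1mx NN.
have -> : N + (v i 0 - 1) *: N = v i 0 *: N by rewrite scalerBl scale1r addrC subrK.
by rewrite scalerA mulVf // scale1r addrK.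
Qed.

Lemma basis_to_delta v i : basis_to v i *m delta_mx i 0 = v.
Proof.
rewrite /basis_to mulmxDl mul1mx -mulmxA mul_delta_mx.
have -> : delta_mx 0 0 = 1%:M :> 'M[R]_1 by apply/matrixP => x y; rewrite !ord1 !mxE.
by rewrite mulmx1 addrC subrK.
Qed.

Lemma basis_bounds v i : `|v i 0| = `|v| -> `|v| = 1 ->
  (forall a b, `|basis_to v i a b| <= 3) /\ (forall a b, `|basis_from v i a b| <= 3).
Proof.
move=> vi v1.
have B a b : `|(1%:M : 'M[R]_d) a b| <= 1.
  by rewrite mxE; case: eqP => _; rewrite ?normr1 ?normr0.
have N a b : `|((v - delta_mx i 0) *m delta_mx 0 i : 'M[R]_d) a b| <= 2.
  rewrite mxE big_ord1 !mxE eqxx /= andbT.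
  have va : `|v a 0| <= 1 by rewrite -v1 le_mx_entry.
  case: (b == i); rewrite /= ?mulr0 ?normr0 // ?mulr1.
  apply: le_trans (ler_normB _ _) _.
  by case: (a == i); rewrite /= ?normr1 ?normr0; lra.
split=> a b; rewrite mxE.
  by apply: le_trans (ler_normD _ _) _; have := B a b; have := N a b; lra.
rewrite [X in _ + X]mxE; apply: le_trans (ler_normB _ _) _.
rewrite [X in _ + `|X|]mxE normrM normfV vi v1 invr1 mul1r.
by have := B a b; have := N a b; lra.
Qed.

(** Reduced to [star_delta] by a change of basis taking the i-th unit vector to v, where i is a
    coordinate at which v attains its norm. That choice bounds the entries of the change of basis
    and of its inverse by 3, so C does not depend on v. *)
Lemma star p : exists2 C : R, 0 < C & forall X Y v, `|v| = 1 -> Y \in unitmx ->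
  minor_sum p.+1 (X *m Y) <=
  C * (minor_sum p.+1 X * minor_sum p.+2 Y * `|invmx Y *m v|
       + `|X *m v| * minor_sum p X * minor_sum p.+1 Y).
Proof.
have [K [K0 Kc]] : exists K : nat -> R, (forall q, 0 <= K q) /\
    forall q X, (forall i j, `|X i j| <= 3) -> minor_sum q X <= K q.
  exists (fun q => nidx q ^+ 2 * (q`!%:R * 3 ^+ q)); split => q.
    by rewrite !mulr_ge0 ?exprn_ge0.
  by move=> X X3; exact: minor_sum_const.
exists (nidx p.+1 ^+ 3 * (d%:R * (K p.+1 * K p.+2) + p.+1%:R * (K p * K p.+1)) + 1).
  rewrite ltr_wpDl // mulr_ge0 ?exprn_ge0 ?ler0n //.
  by apply: addr_ge0; apply: mulr_ge0 => //; exact: mulr_ge0.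
move=> X Y v v1 uY.
have [i [j]] : exists i j, `|v i j| = `|v|.
  by apply: mx_norm_attained; rewrite -normr_eq0 v1 oner_neq0.
rewrite ord1 => vi.
have v0 : v i 0 != 0 by rewrite -normr_eq0 vi v1 oner_neq0.
have [Bt Bf] := basis_bounds vi v1.
set O := basis_to v i in Bt; set O' := basis_from v i in Bf.
have OO : O *m O' = 1%:M by exact: basis_toK.
have Ov : O *m delta_mx i 0 = v by exact: basis_to_delta.
have O'v : O' *m v = delta_mx i 0 by rewrite -Ov mulmxA (mulmx1C OO) mul1mx.
have XY : X *m Y = (X *m O) *m (O' *m Y).
  by rewrite mulmxA -[X *m O *m O']mulmxA OO mulmx1.
have Yz : (O' *m Y) *m (invmx Y *m v) = delta_mx i 0.
  by rewrite -mulmxA [Y *m _]mulmxA mulmxV // mul1mx.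
rewrite XY; apply: le_trans (star_delta p (X *m O) Yz) _.
have wt q : minor_sum q (X *m O) <= minor_sum q X * K q.
  apply: le_trans (minor_sumM _ _ _) _; rewrite ler_wpM2l ?minor_sum_ge0 //.
  exact: Kc.
have wf q : minor_sum q (O' *m Y) <= K q * minor_sum q Y.
  apply: le_trans (minor_sumM _ _ _) _; rewrite ler_wpM2r ?minor_sum_ge0 //.
  exact: Kc.
have XOi : X *m O *m delta_mx i 0 = X *m v by rewrite -mulmxA Ov.
rewrite XOi; set a := minor_sum p.+1 X; set b := minor_sum p.+2 Y.
set c := `|invmx Y *m v|; set e := `|X *m v|; set h := minor_sum p X.
set k := minor_sum p.+1 Y.
have [a0 b0 h0 k0] : [/\ 0 <= a, 0 <= b, 0 <= h & 0 <= k].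
  by split; exact: minor_sum_ge0.
have [c0 e0] : 0 <= c /\ 0 <= e by split; exact: normr_ge0.
have N0 : 0 <= nidx p.+1 ^+ 3 by rewrite exprn_ge0.
move: (nidx p.+1 ^+ 3) N0 => N N0.
apply: (@le_trans _ _ (N * (d%:R * (a * K p.+1 * (K p.+2 * b) * c)
    + p.+1%:R * (e * (h * K p) * (K p.+1 * k))))).
  rewrite ler_wpM2l // lerD // ler_wpM2l //.
    by rewrite ler_wpM2r // ler_pM ?minor_sum_ge0 // ?wt ?wf.
  by rewrite ler_pM ?mulr_ge0 ?minor_sum_ge0 // ?ler_wpM2l // ?wt ?wf.
rewrite [leLHS](_ : _ = N * d%:R * (K p.+1 * K p.+2) * (a * b * c)
   + N * p.+1%:R * (K p * K p.+1) * (e * h * k)); last by ring.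
(* The constant is a sum of the two products needed and 1; multiplied by both terms it yields the
   left-hand side plus nonnegative cross terms. *)
rewrite [leRHS](_ : _ = (N * d%:R * (K p.+1 * K p.+2) * (a * b * c)
   + N * p.+1%:R * (K p * K p.+1) * (e * h * k)) +
   (N * d%:R * (K p.+1 * K p.+2) * (e * h * k)
   + N * p.+1%:R * (K p * K p.+1) * (a * b * c) + (a * b * c + e * h * k))); last by ring.
have f1 : 0 <= a * b * c by rewrite !mulr_ge0.
have f2 : 0 <= e * h * k by rewrite !mulr_ge0.
have f3 : 0 <= N * d%:R * (K p.+1 * K p.+2) by rewrite !mulr_ge0 ?K0.
have f4 : 0 <= N * p.+1%:R * (K p * K p.+1) by rewrite !mulr_ge0 ?K0.
by rewrite lerDl; do !apply: addr_ge0 => //; exact: mulr_ge0.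
Qed.
End StarInequality.

(** * Singular values and singular spaces through maximal minors *)

Section Pivot.
Variables (R : realType) (d : nat).
Implicit Types (X Y : 'M[R]_d) (v z : 'cV[R]_d).

(** A maximal minor is comparable to the sum of all of them, and by Cramer's rule quotients with it
    as denominator are at most 1. *)
Lemma pivot p X : (p <= d)%N -> X \in unitmx ->
  exists s t : {ffun 'I_p -> 'I_d},
    0 < `|\det (mxsub s t X)| /\
    (forall s' t' : 'I_p -> 'I_d, `|\det (mxsub s' t' X)| <= `|\det (mxsub s t X)|) /\
    minor_sum p X <= nidx R d p ^+ 2 * `|\det (mxsub s t X)|.
Proof.
move=> pd uX.
pose F (st : {ffun 'I_p -> 'I_d} * {ffun 'I_p -> 'I_d}) : R := `|\det (mxsub st.1 st.2 X)|.
pose i0 : {ffun 'I_p -> 'I_d} := finfun (widen_ord pd).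
have [[s t] _ mx] := @arg_maxP _ _ _ (i0, i0) xpredT F erefl.
have mx' (s' t' : 'I_p -> 'I_d) : `|\det (mxsub s' t' X)| <= `|\det (mxsub s t X)|.
  have := mx (finfun s', finfun t') erefl; rewrite /F /=.
  have -> // : mxsub (finfun s') (finfun t') X = mxsub s' t' X.
  by apply/matrixP => a b; rewrite !mxE !ffunE.
exists s, t; split; last by split => //; apply: minor_sum_le.
rewrite lt_neqAle normr_ge0 andbT eq_sym; apply/eqP => E.
have := minor_sum_gt0 uX pd; rewrite lt_neqAle => /andP[/eqP + _]; apply.
apply/esym/eqP; rewrite eq_le minor_sum_ge0 andbT.
apply: le_trans (@minor_sum_le _ _ _ _ 0 _) _; last by rewrite mulr0.
by move=> s' t'; rewrite -E.
Qed.

Definition cols p (t : 'I_p -> 'I_d) : 'M[R]_(d, p) := colsub t 1%:M.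
Definition rows p (s : 'I_p -> 'I_d) : 'M[R]_(p, d) := rowsub s 1%:M.

Lemma colsE m p t (X : 'M[R]_(m, d)) : X *m cols t = colsub t X :> 'M[R]_(m, p).
Proof. by rewrite -[in RHS](mulmx1 X) -mulmx_colsub. Qed.

Lemma invmx_entry p (A : 'M[R]_p) (B : 'M[R]_(p, d)) k j : A \in unitmx ->
  (invmx A *m B) k j * \det A =
    \det (\matrix_(a, b) if b == k then B a j else A a b).
Proof.
move=> uA; rewrite [RHS](expand_det_col _ k) mxE mulr_suml; apply: eq_bigr => l _.
rewrite mxE eqxx /invmx uA !mxE.
rewrite mulrC mulrA mulrA divff ?mul1r; last by rewrite -unitfE -unitmxE.
rewrite mulrC; congr (_ * _); rewrite /cofactor; congr (_ * \det _).
apply/matrixP => a b; rewrite !mxE.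
by rewrite eq_sym (negbTE (neq_lift _ _)).
Qed.

Lemma idem_factor (P : 'M[R]_d) : P *m P = P -> row_base P *m col_base P = 1%:M.
Proof.
move=> PP; have E : col_base P *m row_base P = P := mulmx_base P.
apply: (row_full_inj (col_base_full P)); rewrite mulmx1.
apply: (row_free_inj (row_base_free P)).
have <- : (col_base P *m row_base P) *m (col_base P *m row_base P) =
    col_base P *m (row_base P *m col_base P) *m row_base P by rewrite !mulmxA.
by rewrite E PP.
Qed.

Lemma rank_idem (P : 'M[R]_d) : P *m P = P -> (\rank P)%:R = \tr P.
Proof.
move=> PP; have E : col_base P *m row_base P = P := mulmx_base P.
by rewrite -[in RHS]E mxtrace_mulC idem_factor // mxtrace1.
Qed.

(** Subspaces are carried as kernels of bounded idempotents: these pass to limits, and by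
    [rank_idem] the trace keeps track of the dimension. *)
Definition kerv (P : 'M[R]_d) : {vspace 'cV[R]_d} := lker (linfun (mulmx P)).

Lemma mem_kerv P v : (v \in kerv P) = (P *m v == 0).
Proof. by rewrite memv_ker lfunE. Qed.

Lemma dim_kerv P (k : nat) : P *m P = P -> \tr P = k%:R -> \dim (kerv P) = (d - k)%N.
Proof.
move=> PP trP; have rk : \rank P = k.
  by apply/eqP; rewrite -(eqr_nat R) (rank_idem PP) trP.
pose C := col_base P; pose Q := row_base P.
have RC : Q *m C = 1%:M by exact: idem_factor.
have CQ : C *m Q = P := mulmx_base P.
have E : limg (linfun (mulmx P)) = limg (linfun (mulmx C : 'cV[R]_(\rank P) -> 'cV[R]_d)).
  apply/vspaceP => v; apply/memv_imgP/memv_imgP => -[u _ ->].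
    by exists (Q *m u); rewrite ?memvf // !lfunE /= mulmxA CQ.
  exists (C *m u); rewrite ?memvf // !lfunE /= mulmxA.
  congr (_ *m _); transitivity (C *m Q *m C); last by rewrite CQ.
  by rewrite -mulmxA RC mulmx1.
have dE : \dim (limg (linfun (mulmx P : 'cV[R]_d -> 'cV[R]_d))) = k.
  rewrite E limg_dim_eq; first by rewrite dimvf /dim /= rk muln1.
  apply/eqP; rewrite -subv0; apply/subvP => u /memv_capP [_].
  rewrite memv_ker lfunE /= memv0 => /eqP Cu.
  by rewrite -[u]mul1mx -RC -mulmxA Cu mulmx0.
have := limg_ker_dim (linfun (mulmx P : 'cV[R]_d -> 'cV[R]_d)) fullv.
rewrite dE (capv_idPr (subvf _)) dimvf /dim /= muln1 => H.
by rewrite -[LHS](addnK k); congr (_ - _)%N; exact: H.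
Qed.

(** With s, t the pivot, [P *m v = 0] says that [X *m v] vanishes on the rows s; then [minor_ext]
    bounds its other entries by minors of size p + 1 divided by the pivot. The kernel replaces the
    span of the d - p weakest singular directions. *)
Lemma contracted_kernel p : exists2 C : R, 0 < C & forall X, X \in unitmx -> (p <= d)%N ->
  exists P : 'M[R]_d, [/\ P *m P = P, `|P| <= C, \tr P = p%:R &
    forall v, P *m v = 0 -> `|X *m v| * minor_sum p X <= C * (minor_sum p.+1 X * `|v|)].
Proof.
exists (nidx R d p ^+ 2 * d%:R + p%:R * 1 + 1).
  by rewrite ltr_wpDl // addr_ge0 ?mulr_ge0 ?exprn_ge0.
move=> X uX pd; have [s [t [A0 [mx wA]]]] := pivot pd uX.
set A := mxsub s t X in A0 mx wA.
have uA : A \in unitmx by rewrite unitmxE unitfE -normr_gt0.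
pose N := invmx A *m rowsub s X.
have Nt : N *m cols t = 1%:M.
  rewrite /N -mulmxA colsE (_ : colsub t (rowsub s X) = A) ?mulVmx //.
  by apply/matrixP => a b; rewrite !mxE.
(* By Cramer's rule each entry of N is a minor of X divided by the pivot. *)
have N1 : `|N| <= 1.
  apply: mx_norm_le => // k j; rewrite -(ler_pM2r A0) mul1r -normrM invmx_entry //.
  apply: le_trans (mx s (fun b => if b == k then j else t b)).
  rewrite le_eqVlt; apply/orP; left; apply/eqP; congr (`|\det _|).
  by apply/matrixP => a b; rewrite !mxE; case: (b == k).
have c1 : `|cols t| <= 1.
  by apply: mx_norm_le => // a b; rewrite !mxE; case: eqP; rewrite ?normr1 ?normr0.
exists (cols t *m N); split.
- by rewrite mulmxA -[cols t *m N *m _]mulmxA Nt mulmx1.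
- apply: le_trans (normrM_mx _ _) _.
  apply: (@le_trans _ _ (p%:R * 1 * 1)); first by rewrite /mnorm !ler_pM ?mulr_ge0.
  by rewrite mulr1; have := @mulr_ge0 R (nidx R d p ^+ 2) d%:R (exprn_ge0 _ _) (ler0n _ _); rewrite /nidx => /(_ (ler0n _ _)); lra.
- by rewrite mxtrace_mulC Nt mxtrace1.
- move=> v Pv.
  have Nv : N *m v = 0.
    have -> : N *m v = N *m (cols t *m N *m v) by rewrite !mulmxA Nt mul1mx.
    by rewrite Pv mulmx0.
  have sv k : (X *m v) (s k) 0 = 0.
    have : rowsub s X *m v = 0.
      by rewrite -[rowsub s X](mulKVmx uA) -/N -mulmxA Nv mulmx0.
    by move=> /matrixP /(_ k 0); rewrite mul_rowsub_mx !mxE.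
  have B i : `|(X *m v) i 0| * `|\det A| <= d%:R * (minor_sum p.+1 X * `|v|).
    rewrite -normrM (minor_ext i t sv); apply: le_trans (ler_norm_sum _ _ _) _.
    rewrite mulr_natl -[Y in _ *+ Y](card_ord d) -sumr_const; apply: ler_sum => q _.
    by rewrite normrM mulrC ler_pM ?le_mx_entry ?le_minor_sum.
  have Xv : `|X *m v| * `|\det A| <= d%:R * (minor_sum p.+1 X * `|v|).
    rewrite -ler_pdivlMr //; apply: mx_norm_le => [|i j].
      by rewrite divr_ge0 ?mulr_ge0 ?minor_sum_ge0.
    by rewrite ler_pdivlMr // ord1 B.
  have W0 : 0 <= minor_sum p.+1 X * `|v| by rewrite mulr_ge0 ?minor_sum_ge0.
  apply: le_trans (ler_wpM2l (normr_ge0 _) wA) _.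
  rewrite mulrCA; apply: le_trans (ler_wpM2l _ Xv) _; first by rewrite exprn_ge0.
  rewrite [leLHS]mulrA ler_wpM2r // -addrA lerDl addr_ge0 // mulr1 //.
Qed.

(** Here [P *m v = 0] puts v in the span of the pivot columns of X, and Cramer's rule expresses its
    coefficients on them by p-minors divided by the pivot. *)
Lemma expanded_image p : exists2 C : R, 0 < C &
  forall X, X \in unitmx -> (p.+1 <= d)%N ->
  exists P : 'M[R]_d, [/\ P *m P = P, `|P| <= C, \tr P = (d - p.+1)%:R &
    forall v, P *m v = 0 ->
      `|invmx X *m v| * minor_sum p.+1 X <= C * (minor_sum p X * `|v|)].
Proof.
exists (nidx R d p.+1 ^+ 2 * p.+1%:R + (p.+1%:R + 1)).
  by rewrite ltr_wpDl ?ltr_wpDr // ?mulr_ge0 ?exprn_ge0.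
have K0 : 0 <= nidx R d p.+1 ^+ 2 * p.+1%:R by rewrite mulr_ge0 ?exprn_ge0.
move=> X uX pd; have [s [t [A0 [mx wA]]]] := pivot pd uX.
set A := mxsub s t X in A0 mx wA.
have uA : A \in unitmx by rewrite unitmxE unitfE -normr_gt0.
pose D := colsub t X *m invmx A.
have sD : rows s *m D = 1%:M.
  rewrite /D mulmxA /rows mul_rowsub_mx mul1mx (_ : rowsub s (colsub t X) = A) ?mulmxV //.
  by apply/matrixP => a b; rewrite !mxE.
have D1 : `|D| <= 1.
  apply: mx_norm_le => // j k; rewrite -(ler_pM2r A0) mul1r -normrM.
  have -> : D j k = (invmx A^T *m (colsub t X)^T) k j.
    by rewrite -trmx_inv -trmx_mul [RHS]mxE.
  rewrite -(det_tr A) invmx_entry ?unitmx_tr // det_tr.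
  apply: le_trans (mx (fun b => if b == k then j else s b) t).
  rewrite le_eqVlt; apply/orP; left; apply/eqP; rewrite -det_tr; congr (`|\det _|).
  by apply/matrixP => a b; rewrite !mxE; case: (a == k).
have r1 : `|rows s| <= 1.
  by apply: mx_norm_le => // a b; rewrite !mxE; case: eqP; rewrite ?normr1 ?normr0.
have e1 : `|1%:M : 'M[R]_d| <= 1.
  by apply: mx_norm_le => // a b; rewrite !mxE; case: eqP; rewrite ?normr1 ?normr0.
have DD : (D *m rows s) *m (D *m rows s) = D *m rows s.
  by rewrite mulmxA -[D *m _ *m _]mulmxA sD mulmx1.
exists (1%:M - D *m rows s); split.
- by rewrite mulmxBr mulmx1 mulmxBl mul1mx DD subrr subr0.
- apply: le_trans (ler_normB _ _) _.
  have : `|D *m rows s| <= p.+1%:R * 1 * 1.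
    by apply: le_trans (normrM_mx _ _) _; rewrite /mnorm !ler_pM ?mulr_ge0.
  by rewrite !mulr1; move: K0 e1; lra.
- by rewrite linearB /= mxtrace1 mxtrace_mulC sD mxtrace1 natrB.
- move=> v /eqP; rewrite mulmxBl mul1mx subr_eq0 => /eqP vD.
  have -> : invmx X *m v = cols t *m (invmx A *m (rows s *m v)).
    by rewrite {1}vD /D -colsE -!mulmxA (mulKmx uX).
  set c := invmx A *m _.
  have cb : `|c| * `|\det A| <= p.+1%:R * (minor_sum p X * `|v|).
    rewrite -ler_pdivlMr //; apply: mx_norm_le => [|i j].
      by rewrite divr_ge0 ?mulr_ge0 ?minor_sum_ge0.
    rewrite ler_pdivlMr // -normrM /c mxE mulr_suml.
    apply: le_trans (ler_norm_sum _ _ _) _.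
    rewrite mulr_natl -[Y in _ *+ Y](card_ord p.+1) -sumr_const.
    apply: ler_sum => k _; rewrite mulrAC normrM ler_pM //.
      rewrite /invmx uA !mxE mulrAC mulVf ?mul1r; last by rewrite -normr_gt0.
      rewrite /cofactor normrM normrX normrN1 expr1n mul1r.
      apply: le_trans (le_minor_sum X (s \o lift k) (t \o lift i)).
      by rewrite le_eqVlt; apply/orP; left; apply/eqP; congr (`|\det _|); apply/matrixP => a b; rewrite !mxE.
    by rewrite ord1 /rows mul_rowsub_mx mul1mx mxE; exact: le_mx_entry.
  have tc : `|cols t *m c| <= `|c|.
    clearbody c; apply: mx_norm_le => // i j.
    have [/existsP[k /eqP tk]|nt] := boolP [exists k, t k == i]; last first.
      rewrite mxE big1 ?normr0 // => k _; rewrite !mxE.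
      have /negbTE -> : i != t k by apply: contra nt => /eqP ->; apply/existsP; exists k.
      by rewrite mul0r.
    rewrite mxE (bigD1 k) //= big1 => [|l lk].
      by rewrite addr0 !mxE tk eqxx mul1r le_mx_entry.
    rewrite !mxE -tk (inj_eq _) 1?eq_sym ?(negbTE lk) ?mul0r //.
    move=> a b tab; apply/eqP/negPn/negP => ab.
    move: A0; rewrite -det_tr (@determinant_alternate _ _ _ a b ab) ?normr0 ?ltxx //.
    by move=> l'; rewrite !mxE tab.
  have W0 : 0 <= minor_sum p X * `|v| by rewrite mulr_ge0 ?minor_sum_ge0.
  apply: (@le_trans _ _ (`|c| * (nidx R d p.+1 ^+ 2 * `|\det A|))).
    by rewrite ler_pM ?minor_sum_ge0.
  rewrite mulrCA; apply: le_trans (ler_wpM2l _ cb) _; first by rewrite exprn_ge0.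
  by rewrite [leLHS]mulrA ler_wpM2r // lerDl addr_ge0.
Qed.
End Pivot.

Section Gain.
Variables (R : realType) (d : nat).
Implicit Types (X Y : 'M[R]_d) (v z : 'cV[R]_d) (U V : {vspace 'cV[R]_d}).

(** Comparable, up to constants depending on d, to the singular value of X of rank p + 1 in
    decreasing order. *)
Definition gain p X : R := minor_sum p.+1 X / minor_sum p X.

Lemma gain_ge0 p X : 0 <= gain p X.
Proof. by rewrite divr_ge0 ?minor_sum_ge0. Qed.

Lemma gain_gt0 p X : X \in unitmx -> (p < d)%N -> 0 < gain p X.
Proof. by move=> uX pd; rewrite divr_gt0 ?minor_sum_gt0 // ltnW. Qed.

Lemma gain_full X : gain d X = 0.
Proof. by rewrite /gain minor_sum_big // mul0r. Qed.

Lemma meet_nonzero U V : (d < \dim U + \dim V)%N ->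
  exists v, [/\ v \in U, v \in V & v != 0].
Proof.
move=> dUV; have : (U :&: V)%VS != 0%VS.
  rewrite -dimv_eq0 -lt0n; have := dimv_sum_cap U V; have := dimvS (subvf (U + V)%VS).
  by rewrite dimvf /dim /= muln1; lia.
move=> UV0; exists (vpick (U :&: V)%VS).
have := memv_pick (U :&: V)%VS; rewrite memv_cap => /andP[-> ->].
by rewrite vpick0.
Qed.

Lemma uniform_const (P : nat -> R -> Prop) n :
  (forall p (C C' : R), C <= C' -> P p C -> P p C') ->
  (forall p, exists2 C : R, 0 < C & P p C) ->
  exists2 C : R, 1 <= C & forall p, (p <= n)%N -> P p C.
Proof.
move=> mono ex; elim: n => [|n [C C1 PC]].
  have [C C0 P0] := ex 0%N; exists (C + 1); first by lra.
  by move=> p; rewrite leqn0 => /eqP ->; apply: mono P0; lra.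
have [C' C'0 P'] := ex n.+1; exists (C + C'); first by lra.
move=> p; rewrite leq_eqVlt => /predU1P[->|]; first by apply: mono P'; lra.
by rewrite ltnS => /PC; apply: mono; lra.
Qed.

Lemma gain_spaces_ex p : exists2 C : R, 0 < C & (p <= d)%N -> forall X, X \in unitmx ->
  (exists U, \dim U = (d - p)%N /\ forall v, v \in U -> `|X *m v| <= C * (gain p X * `|v|)) /\
  ((p < d)%N -> exists V, \dim V = p.+1 /\
    forall v, v \in V -> gain p X * `|v| <= C * `|X *m v|).
Proof.
have [C C0 HC] := contracted_kernel R d p; have [D D0 HD] := expanded_image R d p.
exists (C + D); first by rewrite addr_gt0.
move=> pd X uX; have wp := minor_sum_gt0 uX pd; split.
  have [P [PP _ trP PX]] := HC X uX pd.
  exists (kerv P); split; first exact: dim_kerv.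
  move=> v; rewrite mem_kerv => /eqP /PX.
  rewrite -ler_pdivlMr // /gain => /le_trans; apply.
  rewrite -[leLHS]mulrA mulrAC; apply: ler_wpM2r.
    by rewrite !mulr_ge0 ?invr_ge0 ?minor_sum_ge0.
  by rewrite lerDl ltW.
move=> pd'; have [P [PP _ trP PX]] := HD X uX pd'.
exists (linfun (mulmx (invmx X)) @: kerv P)%VS; split.
  rewrite limg_dim_eq; first by rewrite (dim_kerv PP trP); lia.
  apply/eqP; rewrite -subv0; apply/subvP => u /memv_capP [_].
  rewrite memv_ker lfunE /= memv0 => /eqP Cu.
  by rewrite -[u](mulKVmx uX) Cu mulmx0.
move=> v /memv_imgP[u + ->]; rewrite lfunE /= mem_kerv => /eqP /PX H.
rewrite mulKVmx // /gain mulrAC ler_pdivrMr // mulrC.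
apply: le_trans H _; rewrite [minor_sum _ _ * `|u|]mulrC mulrA.
by rewrite ler_wpM2r ?minor_sum_ge0 // ler_wpM2r // lerDr ltW.
Qed.

(** U and V stand for the spans of the d - p weakest and of the p + 1 strongest singular directions.
    Intersecting them with an arbitrary subspace of complementary size gives the min-max property
    [gain_extremal]. *)
Lemma gain_spaces : exists2 C : R, 1 <= C & forall p, (p <= d)%N ->
  forall X, X \in unitmx ->
  (exists U, \dim U = (d - p)%N /\ forall v, v \in U -> `|X *m v| <= C * (gain p X * `|v|)) /\
  ((p < d)%N -> exists V, \dim V = p.+1 /\
    forall v, v \in V -> gain p X * `|v| <= C * `|X *m v|).
Proof.
have [|C C1 CP] := @uniform_const (fun p C => (p <= d)%N -> forall X, X \in unitmx ->
  (exists U, \dim U = (d - p)%N /\ forall v, v \in U -> `|X *m v| <= C * (gain p X * `|v|)) /\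
  ((p < d)%N -> exists V, \dim V = p.+1 /\
    forall v, v \in V -> gain p X * `|v| <= C * `|X *m v|)) d _ gain_spaces_ex.
  move=> p C C' CC' H pd X uX; have [[U [dU HU]] HV] := H pd X uX; split.
    exists U; split => // v /HU /le_trans; apply.
    by rewrite ler_wpM2r // mulr_ge0 ?gain_ge0.
  move=> /HV [V [dV H']]; exists V; split => // v /H' /le_trans; apply.
  by rewrite ler_wpM2r.
by exists C => // p pd; exact: CP.
Qed.

Lemma gain_extremal : exists2 C : R, 1 <= C & forall p, (p < d)%N ->
  forall X, X \in unitmx ->
  (forall V (k : R), (p < \dim V)%N -> (forall v, v \in V -> k * `|v| <= `|X *m v|) ->
    k <= C * gain p X) /\
  (forall U (k : R), (d <= \dim U + p)%N -> (forall v, v \in U -> `|X *m v| <= k * `|v|) ->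
    gain p X <= C * k).
Proof.
have [C C1 HC] := gain_spaces; exists C => // p pd X uX.
have [[U [dU HU]] /(_ pd) [V [dV HV]]] := HC p (ltnW pd) X uX; split.
  move=> W k dW HW; have [|v [vU vW v0]] := @meet_nonzero U W; first by rewrite dU; lia.
  have nv : 0 < `|v| by rewrite normr_gt0.
  by rewrite -(ler_pM2r nv) -mulrA (le_trans (HW _ vW)) // HU.
move=> W k dW HW; have [|v [vV vW v0]] := @meet_nonzero V W; first by rewrite dV; lia.
have nv : 0 < `|v| by rewrite normr_gt0.
rewrite -(ler_pM2r nv) -[leRHS]mulrA (le_trans (HV _ vV)) // ler_wpM2l ?HW //.
by apply: le_trans C1.
Qed.

Lemma gain_decreasing : exists2 C : R, 1 <= C & forall p, (p.+1 < d)%N ->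
  forall X, X \in unitmx -> gain p.+1 X <= C * gain p X.
Proof.
have [C C1 HC] := gain_spaces; have [D D1 HD] := gain_extremal.
have C0 : 0 < C by apply: lt_le_trans C1.
exists (C * D); first by rewrite mulr_ege1.
move=> p pd X uX; have [_ /(_ pd) [V [dV HV]]] := HC p.+1 (ltnW pd) X uX.
have [H _] := HD p (ltnW pd) X uX.
have := H V (C^-1 * gain p.+1 X); rewrite dV => /(_ (leqnSn _)) H'.
rewrite -mulrA -ler_pdivrMl //; apply: H' => v vV.
by rewrite -mulrA ler_pdivrMl // HV.
Qed.
End Gain.

(** * Means of bounded measurable functions and upper limits *)

Section BoundedMean.
Context (dd : measure_display) (T : measurableType dd) (R : realType).
Variable mu : probability T R.
Implicit Types (h k : T -> R) (u : nat -> T -> R).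

Definition bmf h := measurable_fun setT h /\ exists C : R, forall x, `|h x| <= C.
Definition mean h : R := Rintegral mu setT h.

Lemma bmf_integrable h : bmf h -> mu.-integrable setT (EFin \o h).
Proof.
move=> [mh [C hC]]; apply: measurable_bounded_integrable => //.
  by rewrite [X in (X < _)%E](_ : _ = 1%E) ?ltry //; exact: probability_setT.
exists C; split; first by rewrite num_real.
by move=> x Cx t _ /=; rewrite (le_trans (hC t)) // ltW.
Qed.

Lemma bmf_cst (c : R) : bmf (fun=> c).
Proof. by split; [exact: measurable_cst|exists `|c|]. Qed.

Lemma bmfD h k : bmf h -> bmf k -> bmf (fun x => h x + k x).
Proof.
move=> [mh [C hC]] [mk [D kD]]; split; first exact: measurable_funD.
exists (C + D) => x; apply: le_trans (ler_normD _ _) _.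
by rewrite lerD.
Qed.

Lemma bmfM h k : bmf h -> bmf k -> bmf (fun x => h x * k x).
Proof.
move=> [mh [C hC]] [mk [D kD]]; split; first exact: measurable_funM.
by exists (C * D) => x; rewrite normrM ler_pM.
Qed.

Lemma bmfZ c h : bmf h -> bmf (fun x => c * h x).
Proof. by move=> bh; apply: bmfM => //; exact: bmf_cst. Qed.

Lemma bmfN h : bmf h -> bmf (fun x => - h x).
Proof.
by move=> /(bmfZ (-1)); congr bmf; apply/funext => x; rewrite mulN1r.
Qed.

Lemma bmfB h k : bmf h -> bmf k -> bmf (fun x => h x - k x).
Proof. by move=> bh bk; apply: bmfD => //; exact: bmfN. Qed.

Lemma bmf_indic (A : set T) : measurable A -> bmf (\1_A).
Proof.
move=> mA; split; first exact: measurable_indic.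
by exists 1 => x; rewrite indicE ger0_norm ?lern1 ?leq_b1.
Qed.

Lemma bmf_comp h (f : T -> T) : measurable_fun setT f -> bmf h -> bmf (h \o f).
Proof.
move=> mf [mh [C hC]]; split; first exact: measurableT_comp.
by exists C => x; exact: hC.
Qed.

Lemma bmf_sum (I : Type) (r : seq I) (h : I -> T -> R) :
  (forall i, bmf (h i)) -> bmf (fun x => \sum_(i <- r) h i x).
Proof.
move=> bh; elim: r => [|i r IH].
  by rewrite (_ : (fun _ => _) = fun=> 0); [exact: bmf_cst|apply/funext => x; rewrite big_nil].
rewrite (_ : (fun _ => _) = fun x => h i x + \sum_(j <- r) h j x); first exact: bmfD.
by apply/funext => x; rewrite big_cons.
Qed.

Lemma meanD h k : bmf h -> bmf k -> mean (fun x => h x + k x) = mean h + mean k.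
Proof. by move=> bh bk; rewrite /mean RintegralD //; exact: bmf_integrable. Qed.

Lemma meanZ c h : bmf h -> mean (fun x => c * h x) = c * mean h.
Proof. by move=> bh; rewrite /mean RintegralZl //; exact: bmf_integrable. Qed.

Lemma meanN h : bmf h -> mean (fun x => - h x) = - mean h.
Proof.
move=> bh; rewrite -mulN1r -meanZ //; congr mean.
by apply/funext => x; rewrite mulN1r.
Qed.

Lemma meanB h k : bmf h -> bmf k -> mean (fun x => h x - k x) = mean h - mean k.
Proof. by move=> bh bk; rewrite meanD ?meanN //; exact: bmfN. Qed.

Lemma mean_cst (c : R) : mean (fun=> c) = c.
Proof. rewrite /mean Rintegral_cst // [X in fine X](_ : _ = 1%E) ?mulr1 //.
exact: probability_setT. Qed.

Lemma mean_sum (I : Type) (r : seq I) (h : I -> T -> R) :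
  (forall i, bmf (h i)) ->
  mean (fun x => \sum_(i <- r) h i x) = \sum_(i <- r) mean (h i).
Proof.
move=> bh; elim: r => [|i r IH].
  rewrite big_nil -[RHS](mean_cst 0); congr mean.
  by apply/funext => x; rewrite big_nil.
rewrite big_cons -IH -meanD //; last exact: bmf_sum.
by congr mean; apply/funext => x; rewrite big_cons.
Qed.

Lemma mean_le h k : bmf h -> bmf k -> (forall x, h x <= k x) -> mean h <= mean k.
Proof.
by move=> bh bk hk; apply: le_Rintegral => //; try exact: bmf_integrable; move=> x _; exact: hk.
Qed.

Lemma mean_indic (A : set T) : measurable A -> mean (\1_A) = fine (mu A).
Proof. by move=> mA; rewrite /mean /Rintegral integral_indic // setIT. Qed.

Lemma mean_cvg u h (C : R) : (forall n, measurable_fun setT (u n)) ->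
  measurable_fun setT h -> (forall n x, `|u n x| <= C) ->
  {ae mu, forall x, u ^~ x @ \oo --> h x} -> (fun n => mean (u n)) @ \oo --> mean h.
Proof.
move=> mu_ mh uC uh.
have H1 n : measurable_fun setT (EFin \o u n) by exact/measurable_EFinP.
have H2 : measurable_fun setT (EFin \o h) by exact/measurable_EFinP.
have H3 : {ae mu, forall x, setT x ->
    (fun n => (EFin \o u n) x) @ \oo --> (EFin \o h) x}.
  by apply: filterS uh => x ux _ /=; apply: cvg_EFin; first exact: nearW.
have H4 : {ae mu, forall x n, setT x -> (`|(EFin \o u n) x| <= (EFin \o fun=> C) x)%E}.
  by apply: aeW => x n _ /=; rewrite lee_fin.
have [ih _ cv] := dominated_convergence measurableT H1 H2 H3
  (bmf_integrable (bmf_cst C)) H4.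
rewrite /mean /Rintegral.
apply: (@fine_cvg R _ \oo _ (fun n => \int[mu]_x (u n x)%:E)%E _).
rewrite fineK //; exact: integrable_fin_num.
Qed.

Lemma mean_ae0 h : bmf h -> (forall x, 0 <= h x) -> mean h = 0 ->
  {ae mu, forall x, h x = 0}.
Proof.
move=> bh h0 Ih.
have mE : measurable_fun setT (EFin \o h) by apply/measurable_EFinP; case: bh.
have := (@ae_eq_integral_abs _ T R mu setT measurableT (EFin \o h) mE).1.
have -> : (\int[mu]_x `|(EFin \o h) x| = 0)%E.
  transitivity (\int[mu]_x (EFin \o h) x)%E.
    by apply: eq_integral => x _ /=; rewrite ger0_norm.
  by rewrite -[LHS]fineK; [rewrite -[fine _]/(mean h) Ih|exact: integrable_fin_num (bmf_integrable bh)].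
move=> /(_ erefl); apply: filterS => x /(_ I) /=.
by case.
Qed.

Lemma mean_comp h (f : T -> T) : measurable_fun setT f ->
  (forall B, measurable B -> mu (f @^-1` B) = mu B) -> bmf h -> mean (h \o f) = mean h.
Proof.
move=> mf pf bh; rewrite /mean /Rintegral; congr fine.
rewrite -[RHS](_ : \int[pushforward mu f]_(y in setT) (EFin \o h) y = _)%E.
  rewrite (integral_pushforward mf) ?preimage_setT //.
    by apply/measurable_EFinP; case: bh.
  exact: (bmf_integrable (bmf_comp mf bh)).
apply: eq_measure_integral => B mB _; exact: pf.
Qed.

(** The device that turns one-sided pointwise bounds into equalities: only the means have to be
    compared in the opposite direction. *)
Lemma mean_ae_eq h k : bmf h -> bmf k -> {ae mu, forall x, h x <= k x} ->
  mean k <= mean h -> {ae mu, forall x, h x = k x}.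
Proof.
move=> bh bk hk kh.
pose w x := Num.max (k x - h x) 0.
have bw : bmf w.
  have bkh := bmfB bk bh; split.
    by apply: measurable_maxr => //; case: bkh.
  case: bkh => _ [C wC]; exists C => x; rewrite /w; case: (leP (k x - h x) 0) => // _.
  by rewrite normr0; apply: le_trans (wC x).
have mw : mean w = mean (fun x => k x - h x).
  rewrite /mean /Rintegral; congr fine; apply: ae_eq_integral => //.
  - by apply/measurable_EFinP; case: bw.
  - by apply/measurable_EFinP; case: (bmfB bk bh).
  by apply: filterS hk => x hkx _ /=; congr EFin; rewrite /w max_l // subr_ge0.
have w0 : mean w = 0.
  apply/eqP; rewrite eq_le; apply/andP; split.
    by rewrite mw meanB // subr_le0.
  rewrite -[leLHS](mean_cst 0); apply: mean_le => //; first exact: bmf_cst.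
  by move=> x; rewrite /w le_max lexx orbT.
have wp x : 0 <= w x by rewrite /w le_max lexx orbT.
have := mean_ae0 bw wp w0; apply: filterS2 hk => x hkx wx.
by move: wx; rewrite /w max_l ?subr_ge0 // => /eqP; rewrite subr_eq0 => /eqP.
Qed.

Definition lsup u (x : T) : R := limn_sup (u ^~ x).

Lemma lsup_bounded u (C : R) x : (forall n x, `|u n x| <= C) ->
  has_ubound (range (u ^~ x)) /\ has_lbound (range (u ^~ x)).
Proof.
move=> uC; split; [exists C|exists (- C)] => _ [n _ <-].
  by have := uC n x; rewrite ler_norml => /andP[].
by have := uC n x; rewrite ler_norml => /andP[].
Qed.

Section Lsup.
Variables (u : nat -> T -> R) (C : R).
Hypotheses (mu_ : forall n, measurable_fun setT (u n)) (uC : forall n x, `|u n x| <= C).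

Lemma sups_cvg x : sups (u ^~ x) @ \oo --> lsup u x.
Proof.
have [ub lb] := lsup_bounded x uC.
have -> : lsup u x = inf (range (sups (u ^~ x))).
  by apply/cvg_lim => //; exact: cvg_sups_inf.
exact: cvg_sups_inf.
Qed.

Lemma le_sups n m x : (n <= m)%N -> u m x <= sups (u ^~ x) n.
Proof.
move=> nm; apply: ub_le_sup; last by exists m.
by apply: has_ubound_sdrop; have [] := lsup_bounded x uC.
Qed.

Lemma sups_le n (c : R) x : (forall m, (n <= m)%N -> u m x <= c) -> sups (u ^~ x) n <= c.
Proof.
move=> uc; apply: ge_sup; first by exists (u n x), n => /=.
by move=> _ [m /= nm <-]; exact: uc.
Qed.

Lemma sups_norm n x : `|sups (u ^~ x) n| <= C.
Proof.
rewrite ler_norml; apply/andP; split.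
  by apply: le_trans (le_sups x (leqnn n)); have := uC n x; rewrite ler_norml => /andP[].
by apply: sups_le => m _; have := uC m x; rewrite ler_norml => /andP[].
Qed.

Lemma lsup_le (c : R) x : (exists n0, forall n, (n0 <= n)%N -> u n x <= c) -> lsup u x <= c.
Proof.
move=> [n0 H]; apply: (@le_trans _ _ (sups (u ^~ x) n0)); last exact: sups_le.
rewrite /lsup /limn_sup; apply: nonincreasing_cvgn_ge; last by apply/cvg_ex; exists (lsup u x); exact: sups_cvg.
by apply: nonincreasing_sups; have [] := lsup_bounded x uC.
Qed.

Lemma lsup_ub x (e : R) : 0 < e -> exists n0, forall n, (n0 <= n)%N -> u n x <= lsup u x + e.
Proof.
move=> e0; have /cvgrPdist_le /(_ e e0) [n0 _ H] := sups_cvg (x := x).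
exists n0 => n n0n; apply: le_trans (le_sups x (leqnn n)) _.
by have := H n n0n; rewrite /= ler_distlC => /andP[].
Qed.

Lemma lsup_freq x (e : R) n0 : 0 < e -> exists2 n, (n0 <= n)%N & lsup u x - e <= u n x.
Proof.
move=> e0; apply: contrapT => H.
have : lsup u x <= lsup u x - e.
  apply: lsup_le; exists n0 => n n0n; rewrite leNgt; apply/negP => /ltW Hn.
  by apply: H; exists n.
by lra.
Qed.

Lemma bmf_lsup : bmf (lsup u).
Proof.
split.
  apply: measurable_fun_limn_sup => // t _; first by have [] := lsup_bounded t uC.
  by have [] := lsup_bounded t uC.
exists C => x; rewrite ler_norml; apply/andP; split; last first.
  by apply: lsup_le; exists 0%N => n _; have := uC n x; rewrite ler_norml => /andP[].
apply/ler_addgt0Pr => e e0; have [n0 H] := lsup_ub x e0.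
apply: le_trans (H n0 (leqnn _)).
by have := uC n0 x; rewrite ler_norml => /andP[].
Qed.

(** Reverse Fatou: dominated convergence for the decreasing suprema of the tails. *)
Lemma mean_lsup (a : R) : (forall n, a <= mean (u n)) -> a <= mean (lsup u).
Proof.
move=> au.
have ms n : measurable_fun setT (fun x => sups (u ^~ x) n).
  by apply: measurable_fun_sups => // t _; have [] := lsup_bounded t uC.
have cv := @mean_cvg (fun n x => sups (u ^~ x) n) (lsup u) C ms bmf_lsup.1
   (fun n x => sups_norm n x) (aeW _ (fun x => sups_cvg (x := x))).
rewrite -(cvg_lim _ cv) //; apply: limr_ge.
  by apply/cvg_ex; eexists; exact: cv.
apply: nearW => n.
apply: le_trans (au n) _; apply: mean_le => [||x]; last exact: le_sups.
  by split => //; exists C.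
by split; [exact: ms|exists C; exact: sups_norm].
Qed.
End Lsup.
End BoundedMean.

Lemma archi_le (R : realType) (a e : R) : 0 < e ->
  exists n0, forall n, (n0 <= n)%N -> a <= e * n%:R.
Proof.
move=> e0; exists (Num.truncn (a / e)).+1 => n nn.
rewrite mulrC -ler_pdivrMr //; apply/ltW/(lt_le_trans (truncnS_gt _)).
by rewrite ler_nat.
Qed.

(** * Kingman's theorem for bounded increments *)

Section Subadditive.
Context (dd : measure_display) (T : measurableType dd) (R : realType).
Variables (mu : probability T R) (f : T -> T).
Hypotheses (mf : measurable_fun setT f)
  (pf : forall B, measurable B -> mu (f @^-1` B) = mu B).
Section Sequence.
Variables (g : nat -> T -> R) (C : R).
Hypotheses (mg : forall n, measurable_fun setT (g n))
  (gC : forall n x, `|g n x| <= C * n%:R)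
  (gD : forall m n x, g (m + n)%N x <= g n x + g m (iter n f x))
  (gS : forall n x, `|g n.+1 x - g n (f x)| <= C).

Definition avg n x : R := g n x / n%:R.
(** The lower limit of g n / n, written as minus an upper limit so that the facts on [lsup]
    apply. *)
Definition linf (x : T) : R := - lsup (fun n y => - avg n y) x.

Lemma sub_C0 (x : T) : 0 <= C.
Proof. by have := gC 1 x; rewrite mulr1; apply: le_trans. Qed.

Lemma avg_le n x : `|avg n x| <= C.
Proof.
case: n => [|n]; first by rewrite /avg invr0 mulr0 normr0 (sub_C0 x).
by rewrite /avg normrM normfV normr_nat ler_pdivrMr ?ltr0n.
Qed.

Lemma avgN_le n x : `|- avg n x| <= C.
Proof. by rewrite normrN avg_le. Qed.

Lemma m_avg n : measurable_fun setT (avg n).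
Proof. by apply: measurable_funM => //; exact: measurable_cst. Qed.

Lemma m_avgN n : measurable_fun setT (fun x => - avg n x).
Proof. by apply: measurableT_comp => //; exact: m_avg. Qed.

Lemma avgE n x : g n x = n%:R * avg n x.
Proof.
case: n => [|n]; last by rewrite /avg mulrC divfK // pnatr_eq0.
by rewrite mul0r; apply/eqP; rewrite -normr_le0 (le_trans (gC 0 x)) // mulr0.
Qed.

Lemma bmf_g n : bmf (g n).
Proof. by split => //; exists (C * n%:R). Qed.

Lemma bmf_avg n : bmf (avg n).
Proof. by split; [exact: m_avg|exists C; exact: avg_le]. Qed.

Lemma bmf_linf : bmf linf.
Proof. exact/bmfN/(bmf_lsup m_avgN avgN_le). Qed.

Lemma linf_norm x : `|linf x| <= C.
Proof.
rewrite /linf normrN ler_norml; apply/andP; split.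
  apply/ler_addgt0Pr => e e0; have [n0 H] := lsup_ub avgN_le x e0.
  apply: le_trans (H n0 (leqnn _)).
  by have := avgN_le n0 x; rewrite ler_norml => /andP[].
by apply: (lsup_le avgN_le); exists 0%N => n _; have := avgN_le n x; rewrite ler_norml => /andP[].
Qed.

Lemma linf_lb x (e : R) : 0 < e -> exists n0, forall n, (n0 <= n)%N -> linf x - e <= avg n x.
Proof.
move=> e0; have [n0 H] := lsup_ub avgN_le x e0.
by exists n0 => n /H; rewrite /linf; lra.
Qed.

Lemma linf_freq x (e : R) n0 : 0 < e -> exists2 n, (n0 <= n)%N & avg n x <= linf x + e.
Proof.
move=> e0; have [n n0n H] := lsup_freq avgN_le x n0 e0.
by exists n => //; rewrite /linf; move: H; lra.
Qed.

Lemma avg_shift n x : (0 < n)%N -> `|avg n (f x) - avg n.+1 x| <= 2 * C / n%:R.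
Proof.
move=> n0; have n0' : 0 < n%:R :> R by rewrite ltr0n.
rewrite ler_pdivlMr //.
have -> : `|avg n (f x) - avg n.+1 x| * n%:R =
    `|(g n (f x) - g n.+1 x) + avg n.+1 x|.
  rewrite -[X in _ * X](ger0_norm (ltW n0')) -normrM mulrBl; congr `|_|.
  rewrite [g n.+1 x]avgE [g n _]avgE -natr1; ring.
apply: le_trans (ler_normD _ _) _; rewrite distrC.
by have := gS n x; have := avg_le n.+1 x; lra.
Qed.

Lemma small_inv (e : R) : 0 < e -> exists n0, forall n, (n0 <= n)%N -> 2 * C / n%:R <= e /\ (0 < n)%N.
Proof.
move=> e0; exists (Num.truncn (2 * `|C| / e)).+1 => n nn; have n0 : (0 < n)%N by apply: leq_trans nn.
split=> //; rewrite ler_pdivrMr ?ltr0n //.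
have : 2 * `|C| / e <= n%:R.
  by apply/ltW/(lt_le_trans (truncnS_gt _)); rewrite ler_nat.
by rewrite ler_pdivrMr // => H; have := ler_norm C; lra.
Qed.

Lemma linf_inv x : linf (f x) = linf x.
Proof.
apply/eqP; rewrite eq_le; apply/andP; split; apply/ler_addgt0Pr => e e0;
  have e4 : 0 < e / 4 by [lra]; have [n1 H1] := small_inv e4.
- have [n2 H2] := linf_lb (f x) e4.
  have [[|n] nn H3] := linf_freq x (maxn n1 n2).+1 e4 => //.
  move: nn; rewrite ltnS geq_max => /andP[/H1[H4 n0] /H2 H5].
  by have := avg_shift x n0; rewrite ler_distlC => /andP[? ?]; lra.
- have [n2 H2] := linf_lb x e4.
  have [n nn H3] := linf_freq (f x) (maxn n1 n2) e4.
  move: nn; rewrite geq_max => /andP[/H1[H4 n0] n2n].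
  have H5 := H2 n.+1 (leqW n2n).
  by have := avg_shift x n0; rewrite ler_distlC => /andP[? ?]; lra.
Qed.

Lemma linf_iter n x : linf (iter n f x) = linf x.
Proof. by elim: n => // n IH; rewrite iterS linf_inv. Qed.

(** The points from which no stretch of length at most K has an average at most [linf x + e]; as K
    grows these sets shrink to a null set. *)
Definition slow (e : R) (K : nat) : set T :=
  [set x | forall n, (0 < n <= K)%N -> n%:R * (linf x + e) < g n x].

Lemma m_slow e K : measurable (slow e K).
Proof.
rewrite (_ : slow e K = \bigcap_(n in [set n | (0 < n <= K)%N])
    (fun x => g n x - n%:R * (linf x + e)) @^-1` `]0, +oo[%classic); last first.
  apply/seteqP; split => x H n /H; rewrite /= in_itv /= andbT subr_gt0 //.
apply: bigcap_measurableType => // n _; rewrite -[X in measurable X]setTI.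
have [m _] : bmf (fun x => g n x - n%:R * (linf x + e)).
  apply: bmfB; [exact: bmf_g|apply: bmfZ].
  by apply: bmfD; [exact: bmf_linf|exact: bmf_cst].
by apply: m => //; exact: measurable_itv.
Qed.

Definition visits (B : set T) (k : nat) (x : T) : R := \sum_(i < k) \1_B (iter i f x).

(** Cut the orbit greedily: off the slow set take a stretch of length at most K with average at most
    [linf + e], on the slow set advance by one step. Such a step costs 2 C, namely C for g itself
    and C because [linf x] may be as low as - C. The last, truncated stretch gives the term in K. *)
Lemma slow_bound (e : R) K k x : 0 <= e ->
  g k x <= k%:R * (linf x + e) + 2 * C * visits (slow e K) k x + 2 * C * K%:R.
Proof.
move=> e0; have C0 := sub_C0 x.
elim/ltn_ind: k x => k IH x.
have Lx := linf_norm x; move: (Lx); rewrite ler_norml => /andP[Lx1 Lx2].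
have v0 j y : 0 <= visits (slow e K) j y.
  by apply: sumr_ge0 => i _; rewrite indicE ler0n.
have visD i j : visits (slow e K) (i + j) x =
    visits (slow e K) i x + visits (slow e K) j (iter i f x).
  rewrite /visits big_split_ord /=; congr (_ + _); apply: eq_bigr => l _.
  by rewrite addnC iterD.
case: k IH => [|k] IH.
  rewrite avgE !mul0r add0r addr_ge0 // !mulr_ge0 //; exact: v0.
have [xB|xB] := pselect (slow e K x).
  have H := gD k 1 x; rewrite addn1 in H; apply: le_trans H _.
  have := IH k (ltnSn _) (f x); rewrite linf_inv => H.
  have -> : visits (slow e K) k.+1 x = 1 + visits (slow e K) k (f x).
    by rewrite -add1n visD /visits big_ord1 /= indicE mem_set.
  have := gC 1 x; rewrite mulr1 ler_norml => /andP[_ H1].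
  by rewrite -natr1 mulrDl mul1r !mulrDr mulr1; lra.
have [n [/andP[n0 nK] gn]] : exists n, (0 < n <= K)%N /\ g n x <= n%:R * (linf x + e).
  apply: contrapT => H; apply: xB => n nK; rewrite ltNge; apply/negP => gn.
  by apply: H; exists n.
have [nk|kn] := leqP n k.+1; last first.
  have := gC k.+1 x; rewrite ler_norml => /andP[_ H1].
  have H2 : - (C * k.+1%:R) <= k.+1%:R * (linf x + e).
    have : 0 <= k.+1%:R * (linf x + e + C) by apply: mulr_ge0 => //; lra.
    by rewrite mulrDr; lra.
  have H3 : C * k.+1%:R <= C * K%:R.
    by rewrite ler_wpM2l // ler_nat (leq_trans (ltnW kn)).
  have := v0 k.+1 x; have := mulr_ge0 C0 (v0 k.+1 x); lra.
have E : k.+1 = (n + (k.+1 - n))%N by rewrite subnKC.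
have H := gD (k.+1 - n) n x; rewrite subnK // in H; apply: le_trans H _.
have [|H1] := (IH (k.+1 - n)%N _ (iter n f x), erefl true); first by lia.
move=> _; have := H1; rewrite linf_iter => H2.
move: (k.+1 - n)%N E H2 => j E H2; rewrite E visD natrD mulrDl !mulrDr.
have := mulr_ge0 C0 (v0 n x); move: H2 gn; rewrite !mulrDr; lra.
Qed.

Lemma iter_meas n : measurable_fun setT (iter n f).
Proof.
elim: n => [|n IH]; first exact: measurable_id.
by rewrite (_ : iter n.+1 f = f \o iter n f) //; exact: measurableT_comp.
Qed.

Lemma iter_pres n B : measurable B -> mu (iter n f @^-1` B) = mu B.
Proof.
elim: n B => [//|n IH] B mB.
have -> : iter n.+1 f @^-1` B = iter n f @^-1` (f @^-1` B) by [].
by rewrite IH ?pf // -[X in measurable X]setTI; exact: mf.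
Qed.

Lemma mean_iter (h : T -> R) n : bmf h -> mean mu (fun x => h (iter n f x)) = mean mu h.
Proof. by move=> bh; apply: mean_comp => //; [exact: iter_meas|exact: iter_pres]. Qed.

Lemma bmf_iter (h : T -> R) n : bmf h -> bmf (fun x => h (iter n f x)).
Proof. by move=> bh; apply: bmf_comp => //; exact: iter_meas. Qed.

Lemma bmf_visits B k : measurable B -> bmf (visits B k).
Proof.
by move=> mB; apply: bmf_sum => i; apply: bmf_iter; exact: bmf_indic.
Qed.

Lemma mean_visits B k : measurable B -> mean mu (visits B k) = k%:R * mean mu (\1_B).
Proof.
move=> mB; rewrite /visits mean_sum; last by move=> i; apply: bmf_iter; exact: bmf_indic.
rewrite (eq_bigr (fun=> mean mu (\1_B))) => [|i _]; last by rewrite mean_iter //; exact: bmf_indic.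
by rewrite sumr_const card_ord mulr_natl.
Qed.

Lemma mean_slow (e : R) : 0 < e -> (fun K => mean mu (\1_(slow e K))) @ \oo --> (0 : R).
Proof.
move=> e0; rewrite -(mean_cst mu 0).
apply: (@mean_cvg _ _ _ _ _ _ 1).
- by move=> n; have [] := bmf_indic R (m_slow e n).
- exact: measurable_cst.
- by move=> n x; rewrite indicE ger0_norm ?lern1 ?leq_b1.
apply: aeW => x; have [n n1 H] := linf_freq x 1 e0.
apply: cvg_near_cst; exists n => // K /= nK; rewrite indicE memNset // => /(_ n).
by rewrite n1 nK avgE ltr_pM2l ?ltr0n // => /(_ isT); rewrite ltNge H.
Qed.

(** Integrate [slow_bound]: K is fixed first, making the visits rare, and then n absorbs the term in
    K. No ergodic theorem is needed, since the mean number of visits is computed by invariance. *)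
Lemma mean_g_le (e : R) : 0 < e ->
  exists n0, forall n, (n0 <= n)%N -> mean mu (g n) <= n%:R * (mean mu linf + e).
Proof.
move=> e0; have e2 : 0 < e / 4 by lra.
have C0 : 0 <= `|C| by [].
have /cvgrPdist_le /(_ (e / (8 * (`|C| + 1)))) := mean_slow e2.
case; first by rewrite divr_gt0 // mulr_gt0 // ltr_wpDl.
move=> K _ /(_ K (leqnn _)) /=; rewrite sub0r normrN => mK.
have [n1 H1] : exists n1, forall n, (n1 <= n)%N -> 2 * `|C| * K%:R <= n%:R * (e / 4).
  exists (Num.truncn (2 * `|C| * K%:R / (e / 4))).+1 => n nn.
  rewrite -ler_pdivrMr //; apply/ltW/(lt_le_trans (truncnS_gt _)).
  by rewrite ler_nat.
exists n1 => n /H1 H2.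
have bs := bmf_indic R (m_slow (e / 4) K).
have bL := bmfD bmf_linf (bmf_cst _ (e / 4)).
have bv := bmf_visits n (m_slow (e / 4) K).
have : mean mu (g n) <= mean mu (fun x => n%:R * (linf x + e / 4) +
   2 * `|C| * visits (slow (e / 4) K) n x + 2 * `|C| * K%:R).
  apply: mean_le => [||x]; first exact: bmf_g.
    by do ?apply: bmfD; [exact: bmfZ|exact: bmfZ|exact: bmf_cst].
  rewrite (ger0_norm (sub_C0 x)); apply: slow_bound; exact: ltW.
rewrite meanD; last exact: bmf_cst.
  2: by apply: bmfD; exact: bmfZ.
rewrite meanD; [|exact: bmfZ|exact: bmfZ].
rewrite meanZ // meanZ // mean_cst meanD ?mean_cst; [|exact: bmf_linf|exact: bmf_cst].
rewrite mean_visits; last exact: m_slow.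
move=> H; apply: le_trans H _; rewrite !mulrDr.
have : 2 * `|C| * (n%:R * mean mu (\1_(slow (e / 4) K))) <= n%:R * (e / 4).
  rewrite mulrCA ler_wpM2l //.
  apply: (@le_trans _ _ (2 * `|C| * (e / (8 * (`|C| + 1))))).
    by rewrite ler_wpM2l ?mulr_ge0 //; exact: le_trans (ler_norm _) mK.
  have c1 : `|C| + 1 != 0 by rewrite gt_eqF // ltr_wpDl.
  have z1 : `|C| / (`|C| + 1) <= 1 by rewrite ler_pdivrMr ?mul1r ?lerDl // ltr_wpDl.
  have ez := ler_wpM2l (ltW e0) z1.
  rewrite [leLHS](_ : _ = (e * (`|C| / (`|C| + 1))) / 4); last by field.
  by move: ez; lra.
by have := mulr_ge0 (ler0n R n) (ltW e0); move: H2; lra.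
Qed.

Lemma avg_mul n k x : (0 < n)%N ->
  avg (k.+1 * n) x <= (\sum_(j < k.+1) avg n (iter (j * n) f x)) / k.+1%:R.
Proof.
move=> n0; have nR : 0 < n%:R :> R by rewrite ltr0n.
have H : g (k.+1 * n)%N x <= \sum_(j < k.+1) g n (iter (j * n) f x).
  elim: k => [|k IH]; first by rewrite big_ord1 mul1n mul0n.
  rewrite mulSn big_ord_recr /=; apply: le_trans (gD _ _ _) _.
  by rewrite lerD.
rewrite {1}/avg natrM invfM [_^-1 * _]mulrC mulrA; apply: ler_wpM2r; first by rewrite invr_ge0.
rewrite ler_pdivrMr // mulr_suml.
by apply: le_trans H _; apply: ler_sum => j _; rewrite /avg -mulrA mulVf ?mulr1 // gt_eqF.
Qed.

(** Along multiples of n, subadditivity bounds the average of g by an ergodic average of [avg n],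
    whose mean is that of [avg n]. Reverse Fatou applies, and a lower limit along multiples is at
    least the full lower limit. *)
Lemma mean_g_ge n : n%:R * mean mu linf <= mean mu (g n).
Proof.
case: n => [|n].
  rewrite mul0r -(mean_cst mu 0); apply: mean_le => [||x]; [exact: bmf_cst|exact: bmf_g|].
  by rewrite avgE mul0r.
rewrite mulrC -ler_pdivlMr ?ltr0n //.
have -> : mean mu (g n.+1) / n.+1%:R = mean mu (avg n.+1).
  rewrite mulrC -meanZ; last exact: bmf_g.
  by congr mean; apply/funext => x; rewrite /avg mulrC.
pose v k x := - avg (k.+1 * n.+1) x.
have mv k : measurable_fun setT (v k) by exact: m_avgN.
have vC k x : `|v k x| <= C by exact: avgN_le.
have : - mean mu (avg n.+1) <= mean mu (lsup v).
  apply: (@mean_lsup _ _ _ mu v C mv vC) => k; rewrite /v meanN; last exact: bmf_avg.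
  rewrite lerN2.
  pose s x := k.+1%:R^-1 * \sum_(j < k.+1) avg n.+1 (iter (j * n.+1) f x).
  have bs : bmf s by apply/bmfZ/bmf_sum => j; apply: bmf_iter; exact: bmf_avg.
  apply: (@le_trans _ _ (mean mu s)).
    apply: mean_le => // [|x]; first exact: bmf_avg.
    by rewrite /s mulrC; exact: avg_mul.
  rewrite /s meanZ; last by apply/bmf_sum => j; apply: bmf_iter; exact: bmf_avg.
  rewrite mean_sum; last by move=> j; apply: bmf_iter; exact: bmf_avg.
  rewrite (eq_bigr (fun=> mean mu (avg n.+1))); last first.
    by move=> j _; rewrite mean_iter //; exact: bmf_avg.
  by rewrite sumr_const card_ord -[X in _ * X]mulr_natl mulKf ?pnatr_eq0.
rewrite lerNl; apply: le_trans.
rewrite -meanN; last exact: (bmf_lsup mv vC).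
apply: mean_le => [||x]; [exact: bmf_linf|exact/bmfN/(bmf_lsup mv vC)|].
rewrite lerN2; apply/ler_addgt0Pr => e e0.
have [n0 H] := lsup_ub avgN_le x e0.
apply: (lsup_le vC); exists n0 => k n0k; apply: H.
by apply: leq_trans (leqW n0k) _; rewrite leq_pmulr.
Qed.
End Sequence.

Section Visits.
Variable B : nat -> set T.
Hypotheses (mB : forall K, measurable (B K))
  (B0 : (fun K => mean mu (\1_(B K))) @ \oo --> (0 : R)).

Let g K n (x : T) : R := - visits (B K) n x.

Let mg K n : measurable_fun setT (g K n).
Proof. by have [] := bmfN (bmf_visits n (mB K)). Qed.

Let ind01 K x : 0 <= (\1_(B K) x : R) <= 1.
Proof. by rewrite indicE ler0n lern1 leq_b1. Qed.

Let gC K n x : `|g K n x| <= 1 * n%:R.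
Proof.
rewrite normrN mul1r ger0_norm; last first.
  by apply: sumr_ge0 => i _; have /andP[] := ind01 K (iter i f x).
rewrite -[X in _ <= X%:R](card_ord n) -sumr_const; apply: ler_sum => i _.
by have /andP[] := ind01 K (iter i f x).
Qed.

Let gD K m n x : g K (m + n)%N x <= g K n x + g K m (iter n f x).
Proof.
rewrite /g -opprD lerN2 /visits addnC big_split_ord /= lerD2l.
by apply: ler_sum => i _; rewrite addnC iterD.
Qed.

Let gS K n x : `|g K n.+1 x - g K n (f x)| <= 1.
Proof.
rewrite /g opprK addrC /visits big_ord_recl /=.
have -> : \sum_(i < n) \1_(B K) (f (iter i f x)) = \sum_(i < n) \1_(B K) (iter i f (f x)) :> R.
  by apply: eq_bigr => i _; rewrite -iterSr iterS.
rewrite opprD addrCA subrr addr0 normrN ger0_norm; by have /andP[] := ind01 K x.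
Qed.

(** Minus the number of visits is itself subadditive, so [mean_g_le] bounds the mean of the upper
    frequency of visits to B K by the measure of B K. The infimum of these frequencies over large K
    then has mean 0. *)
Lemma visits_small : {ae mu, forall x, forall dl : R, 0 < dl ->
  exists K n0, forall n, (n0 <= n)%N -> visits (B K) n x <= dl * n%:R}.
Proof.
pose l K := linf (g K).
have bl K : bmf (l K) by exact: (bmf_linf (mg K) (gC K)).
have lC K x : `|l K x| <= 1 by exact: (linf_norm (gC K)).
have l0 K x : l K x <= 0.
  apply/ler_addgt0Pr => e e0; have [n0 H] := linf_lb (gC K) x e0.
  have := H n0 (leqnn _); rewrite lerBlDr => /le_trans; apply.
  rewrite lerD2r /avg mulr_le0_ge0 ?invr_ge0 // oppr_le0.
  by apply: sumr_ge0 => i _; have /andP[] := ind01 K (iter i f x).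
have ml K : - mean mu (\1_(B K)) <= mean mu (l K).
  apply/ler_addgt0Pr => e e0.
  have [n0 /(_ n0.+1 (leqnSn _))] := mean_g_le (mg K) (gC K) (gD K) (gS K) e0.
  rewrite /g meanN; last exact: bmf_visits.
  by rewrite mean_visits // -mulrN ler_pM2l ?ltr0n.
have ml' K : measurable_fun setT (l K) by have [] := bl K.
have bW := bmf_lsup ml' lC.
have W0 x : lsup l x <= 0 by apply: (lsup_le lC); exists 0%N.
have mW : 0 <= mean mu (lsup l).
  apply/ler_addgt0Pr => e e0; rewrite -lerBlDr sub0r.
  have /cvgrPdist_le /(_ e e0) [K0 _ HK] := B0.
  have : - e <= mean mu (lsup (fun K => l (K0 + K)%N)).
    apply: (@mean_lsup _ _ _ mu (fun K => l (K0 + K)%N) 1 (fun K => ml' _) (fun K x => lC _ x)) => K.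
    apply: le_trans (ml _); rewrite lerN2.
    have := HK (K0 + K)%N (leq_addr _ _); rewrite /= sub0r normrN.
    exact: le_trans (ler_norm _).
  have bW' := bmf_lsup (fun K => ml' (K0 + K)%N) (fun K x => lC (K0 + K)%N x).
  move=> /le_trans; apply; apply: (mean_le mu bW' bW) => x.
  apply/ler_addgt0Pr => e' e'0; have [n0 H] := lsup_ub lC x e'0.
  apply: (@lsup_le _ _ _ (fun K => l (K0 + K)%N) 1 (fun K x => lC _ x)); exists n0 => n n0n.
  by apply: H; rewrite (leq_trans n0n) // leq_addl.
have := @mean_ae_eq _ _ _ mu (lsup l) (fun=> 0) bW (bmf_cst _ 0) (aeW mu W0).
rewrite mean_cst => /(_ mW); apply: filterS => x Wx dl dl0.
have dl2 : 0 < dl / 2 by lra.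
have [K _ HK] := lsup_freq lC x 0 dl2.
have [n0 H] := linf_lb (gC K) x dl2.
exists K, n0.+1 => n n0n; have n_gt0 : 0 < n%:R :> R by rewrite ltr0n (leq_trans _ n0n).
have := H n (ltnW n0n); move: HK; rewrite Wx -/(l K x) => HK H'.
have : - dl <= avg (g K) n x by lra.
by rewrite /avg ler_pdivlMr // mulNr lerN2.
Qed.
End Visits.
End Subadditive.

(** * Estimates in both time directions for invertible maps *)

Section TwoSided.
Context (dd : measure_display) (T : measurableType dd) (R : realType).
Variables (mu : probability T R) (f fi : T -> T).
Hypotheses (fK : cancel f fi) (fiK : cancel fi f)
  (mf : measurable_fun setT f) (mfi : measurable_fun setT fi)
  (pf : forall B, measurable B -> mu (f @^-1` B) = mu B).
Variables (g : nat -> T -> R) (C : R).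
Hypotheses (mg : forall n, measurable_fun setT (g n))
  (gC : forall n x, `|g n x| <= C * n%:R)
  (gD : forall m n x, g (m + n)%N x <= g n x + g m (iter n f x))
  (gS : forall n x, `|g n.+1 x - g n (f x)| <= C)
  (gS' : forall n x, `|g n.+1 x - g n x| <= C).

Lemma pres_inv B : measurable B -> mu (fi @^-1` B) = mu B.
Proof.
move=> mB; rewrite -pf; last by rewrite -[X in measurable X]setTI; exact: mfi.
by congr (mu _); apply/seteqP; split => x /=; rewrite fK.
Qed.

Lemma iter_fiK n : cancel (iter n fi) (iter n f).
Proof. by elim: n => // n IH x; rewrite iterSr [iter n.+1 fi x]iterS fiK IH. Qed.

Lemma iter_ffi i j x : (i <= j)%N -> iter i f (iter j fi x) = iter (j - i) fi x.
Proof. by move=> ij; rewrite -{1}(subnKC ij) iterD iter_fiK. Qed.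

Lemma linf_iter_inv n x : linf g (iter n fi x) = linf g x.
Proof. by rewrite -[in RHS](iter_fiK n x) (linf_iter gC gS). Qed.

Let L := linf g.

(** [slow_bound] at a shifted point of the orbit, with the visits counted over the whole window,
    makes the bound uniform over all stretches. The window has length 4 n because the growth
    dichotomy compares time n with times between 2 n and 4 n. *)
Lemma upper_ae : {ae mu, forall x, forall dl : R, 0 < dl ->
  exists n0, forall n, (n0 <= n)%N ->
    (forall a k, (a + k <= 4 * n)%N -> g k (iter a f x) <= k%:R * L x + dl * n%:R) /\
    (forall a k, (k <= a <= 4 * n)%N -> g k (iter a fi x) <= k%:R * L x + dl * n%:R)}.
Proof.
suff key (j : nat) : {ae mu, forall x, exists n0, forall n, (n0 <= n)%N ->
    (forall a k, (a + k <= 4 * n)%N -> g k (iter a f x) <= k%:R * L x + j.+1%:R^-1 * n%:R) /\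
    (forall a k, (k <= a <= 4 * n)%N -> g k (iter a fi x) <= k%:R * L x + j.+1%:R^-1 * n%:R)}.
  have /ae_foralln := key; apply: filterS => x H dl dl0.
  have [n0 Hn] := H (Num.truncn dl^-1).
  have ldl : (Num.truncn dl^-1).+1%:R^-1 <= dl.
    by rewrite invf_ple ?posrE // ltW // truncnS_gt.
  exists n0 => n /Hn [H1 H2]; split=> a k ak.
    by apply: le_trans (H1 a k ak) _; rewrite lerD2l ler_wpM2r.
  by apply: le_trans (H2 a k ak) _; rewrite lerD2l ler_wpM2r.
set ej : R := j.+1%:R^-1; have ej0 : 0 < ej by rewrite invr_gt0 ltr0n.
(* Three errors are collected: at most 4 e n from the at most 4 n steps at rate [linf + e], and e n
   each from the visits and from K. *)
pose e := ej / 16; have e0 : 0 < e by rewrite divr_gt0.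
have eE : ej = 16 * e by rewrite /e; field.
have m0 := mean_slow mu mg gC e0.
have ms K := m_slow mg gC e K.
have V1 := visits_small mf pf ms m0.
have V2 := visits_small mfi pres_inv ms m0.
apply: filterS2 V1 V2 => x V1 V2.
have C0 := sub_C0 gC x.
have [dl dl0 Hdl] : exists2 dl : R, 0 < dl & 2 * C * dl * 5 <= e.
  exists (e / (10 * (C + 1))); first by rewrite divr_gt0 // mulr_gt0 // ltr_wpDl.
  have c1 : C + 1 != 0 by rewrite gt_eqF // ltr_wpDl.
  rewrite [leLHS](_ : _ = e * (C / (C + 1))); last by field.
  by rewrite ler_piMr ?(ltW e0) // ler_pdivrMr ?mul1r ?lerDl // ltr_wpDl.
have [K1 [n1 H1]] := V1 dl dl0; have [K2 [n2 H2]] := V2 dl dl0.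
have vis B k y : visits R f B k y = \sum_(i < k) \1_B (iter i f y) by [].
have [n3 H3] : exists n3, forall n, (n3 <= n)%N ->
    2 * C * K1%:R <= e * n%:R /\ 2 * C * K2%:R <= e * n%:R.
  have [i Hi] := archi_le (2 * C * K1%:R) e0; have [i' Hi'] := archi_le (2 * C * K2%:R) e0.
  exists (maxn i i') => n; rewrite geq_max => /andP[ni ni'].
  by split; [exact: Hi|exact: Hi'].
have n45 n : (0 < n)%N -> (4 * n).+1%:R <= 5 * n%:R :> R.
  by move=> n0; rewrite -natrM ler_nat; lia.
exists (maxn 1 (maxn n1 (maxn n2 n3))) => n.
rewrite !geq_max => /and4P[n_gt0 n1n n2n n3n].
have nR : 0 <= n%:R :> R by [].
have [H3a H3b] := H3 n n3n; split=> a k ak.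
  have := slow_bound gC gD gS K1 k (iter a f x) (ltW e0).
  rewrite (linf_iter gC gS) -/L => Hs; apply: le_trans Hs _.
  have kn : k%:R <= 4 * n%:R :> R by rewrite -natrM ler_nat; lia.
  have : visits R f (slow g e K1) k (iter a f x) <= dl * (4 * n).+1%:R.
    apply: le_trans (H1 (4 * n).+1 _); last by clear -n1n; lia.
    have -> : (4 * n).+1 = (a + (k + ((4 * n).+1 - a - k)))%N by clear -ak; lia.
    rewrite /visits !big_split_ord /= addrCA.
    under eq_bigr => i _ do rewrite -iterD addnC.
    rewrite lerDl addr_ge0 //; apply: sumr_ge0 => i _; by rewrite indicE.
  have := n45 n n_gt0.
  move=> Hn Hv.
  have : 2 * C * visits R f (slow g e K1) k (iter a f x) <= 2 * C * (dl * (5 * n%:R)).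
    by rewrite ler_wpM2l ?mulr_ge0 // (le_trans Hv) // ler_wpM2l // ltW.
  have : 2 * C * dl * 5 * n%:R <= e * n%:R by rewrite ler_wpM2r.
  have : k%:R * e <= 4 * n%:R * e by rewrite ler_wpM2r // ltW.
  by rewrite eE mulrDr; have := mulr_ge0 (ltW e0) nR; move: H3a; lra.
move: ak => /andP[ka an].
have := slow_bound gC gD gS K2 k (iter a fi x) (ltW e0).
rewrite linf_iter_inv -/L => Hs; apply: le_trans Hs _.
have kn : k%:R <= 4 * n%:R :> R by rewrite -natrM ler_nat; lia.
have : visits R f (slow g e K2) k (iter a fi x) <= dl * (4 * n).+1%:R.
  apply: le_trans (H2 (4 * n).+1 _); last by clear -n2n; lia.
  (* The k points starting at [iter a fi x] are met in reverse order by the inverse orbit of x, at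
     the times a - k + 1 to a. *)
  have -> : (4 * n).+1 = ((a - k).+1 + (k + (4 * n - a)))%N by clear -ka an; lia.
  rewrite /visits [leRHS]big_split_ord /= [X in _ + X]big_split_ord /=.
  rewrite addrCA.
  rewrite (_ : \sum_(i < k) _ = \sum_(i < k) \1_(slow g e K2) (iter ((a - k).+1 + i) fi x)).
    by rewrite lerDl addr_ge0 //; apply: sumr_ge0 => i _; rewrite indicE.
  rewrite (reindex_inj rev_ord_inj) /=; apply: eq_bigr => i _.
  rewrite iter_ffi; last by have := ltn_ord i; clear -ka; lia.
  by rewrite (_ : (a - (k - i.+1))%N = (a - k + i).+1) //; have := ltn_ord i; clear -ka; lia.
have := n45 n n_gt0.
move=> Hn Hv.
have : 2 * C * visits R f (slow g e K2) k (iter a fi x) <= 2 * C * (dl * (5 * n%:R)).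
  by rewrite ler_wpM2l ?mulr_ge0 // (le_trans Hv) // ler_wpM2l // ltW.
have : 2 * C * dl * 5 * n%:R <= e * n%:R by rewrite ler_wpM2r.
have : k%:R * e <= 4 * n%:R * e by rewrite ler_wpM2r // ltW.
by rewrite eE mulrDr; have := mulr_ge0 (ltW e0) nR; move: H3b; lra.
Qed.

(** [G n x = g n (iter n fi x)] is subadditive for the inverse map with the same means as g, and
    [upper_ae] bounds its lower limit by L; comparing means gives equality. *)
Lemma lower_bwd_ae : {ae mu, forall x, forall dl : R, 0 < dl ->
  exists n0, forall n, (n0 <= n)%N -> n%:R * (L x - dl) <= g n (iter n fi x)}.
Proof.
pose G n x := g n (iter n fi x).
have GC n x : `|G n x| <= C * n%:R by exact: gC.
have mG n : measurable_fun setT (G n).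
  by apply: measurableT_comp => //; exact: iter_meas.
have GD m n x : G (m + n)%N x <= G n x + G m (iter n fi x).
  rewrite /G addrC addnC; apply: le_trans (gD n m (iter (n + m) fi x)) _.
  by rewrite iter_ffi ?leq_addl // addnK addnC iterD.
have GS n x : `|G n.+1 x - G n (fi x)| <= C by rewrite /G -iterSr.
have bL := bmf_linf mG GC; have bL' := bmf_linf mg gC.
have mLL : mean mu L <= mean mu (linf G).
  apply/ler_addgt0Pr => e e0.
  have [n0 /(_ n0.+1 (leqnSn _))] := mean_g_le mfi pres_inv mG GC GD GS e0.
  have := mean_g_ge mf pf mg gC gD n0.+1.
  have -> : mean mu (G n0.+1) = mean mu (g n0.+1).
    by apply: mean_iter => //; [exact: pres_inv|exact: bmf_g mg gC _].
  by move=> /le_trans H /H; rewrite ler_pM2l ?ltr0n.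
have LL : {ae mu, forall x, linf G x <= L x}.
  have := upper_ae; apply: filterS => x H.
  apply/ler_addgt0Pr => e e0; have e2 : 0 < e / 2 by rewrite divr_gt0.
  have [n0 Hn] := H _ e2; have [n1 Hn1] := linf_lb GC x e2.
  pose n := (maxn n0 n1).+1.
  have [_ /(_ n n)] := Hn n (leqW (leq_maxl _ _)).
  move=> /(_ ltac:(lia)).
  have := Hn1 n (leqW (leq_maxr _ _)).
  rewrite {1}/avg -/(G n x) ler_pdivlMr ?ltr0n //.
  move: (linf G x) (L x) (G n x) => a b c Ha Hb.
  have := le_trans Ha Hb; rewrite [_ * n%:R]mulrC [_ * n%:R]mulrC -mulrDr.
  by rewrite ler_pM2l ?ltr0n // lerBlDr -addrA -splitr.
have := mean_ae_eq bL bL' LL mLL; apply: filterS => x E dl dl0.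
have [n0 H] := linf_lb GC x dl0; exists n0.+1 => n nn.
have := H n (ltnW nn); rewrite E {1}/avg ler_pdivlMr ?ltr0n ?(leq_trans _ nn) //.
by rewrite mulrC.
Qed.

(** The comparison of means controls an upper limit here, so the bound holds for infinitely many n
    only. That suffices for the contradiction in [transversal]. *)
Lemma lower_mid_ae : {ae mu, forall x, forall (dl : R) n0, 0 < dl ->
  exists2 n, (n0 <= n)%N & (2 * n)%:R * (L x - dl) <= g (2 * n) (iter n fi x)}.
Proof.
pose V n x := avg g (2 * n.+1) (iter n.+1 fi x).
have VC n x : `|V n x| <= C by exact: avg_le.
have bV n : bmf (V n) by apply: bmf_iter => //; exact: bmf_avg.
have mV n : measurable_fun setT (V n) by case: (bV n).
have bL := bmf_linf mg gC.
have m1 : mean mu L <= mean mu (lsup V).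
  apply: (@mean_lsup _ _ _ mu V C mV VC) => n.
  rewrite (mean_iter mfi pres_inv); last exact: bmf_avg.
  rewrite [leRHS](_ : _ = (2 * n.+1)%:R^-1 * mean mu (g (2 * n.+1)%N)); last first.
    rewrite -meanZ; last exact: bmf_g mg gC _.
    by congr mean; apply/funext => x; rewrite /avg mulrC.
  rewrite mulrC ler_pdivlMr ?ltr0n // mulrC.
  exact: (mean_g_ge mf pf mg gC gD).
have VL : {ae mu, forall x, lsup V x <= L x}.
  have := upper_ae; apply: filterS => x H.
  apply/ler_addgt0Pr => e e0; have e2 : 0 < e / 2 by lra.
  have [n0 Hn] := H _ e0.
  apply: (lsup_le VC); exists n0 => n n0n; rewrite /V /avg ler_pdivrMr ?ltr0n //.
  rewrite mul2n -addnn.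
  have := gD n.+1 n.+1 (iter n.+1 fi x); rewrite iter_fiK => /le_trans; apply.
  have [/(_ 0%N n.+1) H1 /(_ n.+1 n.+1) H2] := Hn n.+1 (leqW n0n).
  have {}H1 := H1 ltac:(lia); have {}H2 := H2 ltac:(lia).
  by rewrite natrD mulrDl !mulrDr; move: H1 H2 => /=; lra.
have := mean_ae_eq (bmf_lsup mV VC) bL VL m1; apply: filterS => x E dl n0 dl0.
have [n nn] := lsup_freq VC x n0 dl0; rewrite E /V /avg => H.
exists n.+1; first exact: leqW.
by move: H; rewrite ler_pdivlMr ?ltr0n // mulrC.
Qed.
End TwoSided.

(** * Slow and fast vectors of a sequence of matrices *)

Section Cluster.
Variable R : realType.

Lemma rV_cluster n (u : nat -> 'rV[R]_n) (C : R) : (forall k, `|u k| <= C) ->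
  exists l, forall (e : R) k0, 0 < e -> exists2 k, (k0 <= k)%N & `|u k - l| <= e.
Proof.
move=> uC; pose A : set 'rV[R]_n := [set v | `|v| <= C].
have cA : compact A.
  apply: bounded_closed_compact.
    exists C; split; first exact: num_real.
    by move=> x Cx v; rewrite /A /= => /le_trans; apply; exact: ltW.
  rewrite (_ : A = (fun v => `|v|) @^-1` [set x | x <= C]) //.
  apply: preimage_closed; last exact: closed_le.
  by move=> x _; exact: norm_continuous.
have [|l [_ cl]] := cA (u @ \oo) _; first by exists 0%N => // k _ /=; exact: uC.
exists l => e k0 e0.
have [||v [[k /= k0k <-]]] := cl [set u k | k in [set k | (k0 <= k)%N]] (ball l e).
- exists k0 => // k /= k0k; by exists k.
- exact: nbhsx_ballx.
by rewrite -ball_normE /= => lk; exists k => //; rewrite distrC ltW.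
Qed.

Lemma mx_cluster m n (u : nat -> 'M[R]_(m, n)) (C : R) : (forall k, `|u k| <= C) ->
  exists l, forall (e : R) k0, 0 < e -> exists2 k, (k0 <= k)%N & `|u k - l| <= e.
Proof.
move=> uC; have C0 : 0 <= C by apply: le_trans (uC 0%N).
have [|l H] := @rV_cluster _ (fun k => mxvec (u k)) C.
  move=> k; apply: mx_norm_le => // i j; rewrite ord1.
  case/mxvec_indexP: j => a b; rewrite mxvecE; apply: le_trans (uC k); exact: le_mx_entry.
exists (vec_mx l) => e k0 e0; have [k k0k Hk] := H e k0 e0; exists k => //.
apply: mx_norm_le => [|i j]; first exact: ltW.
apply: le_trans Hk; rewrite -[X in _ <= `|_ - X|]vec_mxK -linearB /=.
by apply: le_trans (le_mx_entry _ 0 (mxvec_index i j)); rewrite mxvecE.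
Qed.
End Cluster.

Section Dichotomy.
Variables (R : realType) (d : nat) (Z : nat -> 'M[R]_d) (alpha beta C : R) (q : nat).
Implicit Type v : 'cV[R]_d.
Hypotheses (ab : alpha < beta).
Hypothesis step : forall e dl : R, 0 < e -> 0 < dl -> exists n0, forall n m,
  (n0 <= n)%N -> (2 * n <= m <= 4 * n)%N ->
  forall v, expR (n%:R * (alpha + e)) * `|v| <= `|Z n *m v| ->
    expR ((m - n)%:R * beta - dl * m%:R) * `|Z n *m v| <= `|Z m *m v|.
Hypothesis proj : forall dl : R, 0 < dl -> exists n0, forall n, (n0 <= n)%N ->
  exists P : 'M[R]_d, [/\ P *m P = P, `|P| <= C, \tr P = q%:R &
    forall v, P *m v = 0 -> `|Z n *m v| <= expR (n%:R * (alpha + dl)) * `|v|].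

Definition slowv v := forall dl : R, 0 < dl -> exists n0, forall n, (n0 <= n)%N ->
  `|Z n *m v| <= expR (n%:R * (alpha + dl)) * `|v|.
Definition fastv v := forall dl : R, 0 < dl -> exists n0, forall n, (n0 <= n)%N ->
  expR (n%:R * (beta - dl)) * `|v| <= `|Z n *m v|.

Lemma slowvZ c v : slowv v -> slowv (c *: v).
Proof.
move=> sv dl dl0; have [n0 H] := sv dl dl0; exists n0 => n /H {}H.
by rewrite -scalemxAr !normrZ mulrCA ler_wpM2l.
Qed.

(* The sum u + v may be much smaller than u and v, hence the constant. *)
Lemma slowvD u v : slowv u -> slowv v -> slowv (u + v).
Proof.
move=> su sv; have [->|uv0] := eqVneq (u + v) 0.
  by move=> dl dl0; exists 0%N => n _; rewrite mulmx0 normr0 mulr0.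
move=> dl dl0; have dl2 : 0 < dl / 2 by rewrite divr_gt0.
have [n1 H1] := su _ dl2; have [n2 H2] := sv _ dl2.
have nuv : 0 < `|u + v| by rewrite normr_gt0.
have [n3 H3] := archi_le ((`|u| + `|v|) / `|u + v|) dl2.
exists (maxn n1 (maxn n2 n3)) => n; rewrite !geq_max => /and3P[/H1 {}H1 /H2 {}H2 /H3 {}H3].
rewrite mulmxDr; apply: le_trans (ler_normD _ _) _; apply: le_trans (lerD H1 H2) _.
rewrite -mulrDr; move: H3; rewrite ler_pdivrMr // => H3.
apply: le_trans (ler_wpM2l (expR_ge0 _) H3) _.
rewrite mulrA ler_wpM2r //.
apply: le_trans (_ : expR (n%:R * (alpha + dl / 2)) * expR (dl / 2 * n%:R) <= _).
  by rewrite ler_wpM2l ?expR_ge0 //; apply: le_trans (expR_ge1Dx _); rewrite lerDr.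
by rewrite -expRD ler_expR; lra.
Qed.

Let S n a v := expR (n%:R * a) * `|v| <= `|Z n *m v|.

Lemma rateW n a b v : b <= a -> S n a v -> S n b v.
Proof.
move=> ba; apply: le_trans; rewrite ler_wpM2r // ler_expR.
by rewrite ler_wpM2l.
Qed.

Lemma one_step (e dl : R) : 0 < e -> 0 < dl -> exists n0, forall n m a v,
  (n0 <= n)%N -> (2 * n <= m <= 4 * n)%N -> alpha + e <= a <= beta ->
  S n a v -> S m ((a + beta) / 2 - dl) v.
Proof.
move=> e0 dl0; have [n0 H] := step e0 dl0; exists n0 => n m a v n0n nm /andP[ea ab'] Sn.
have := H n m n0n nm v (rateW ea Sn); apply: le_trans.
apply: (@le_trans _ _ (expR ((m - n)%:R * beta - dl * m%:R) * (expR (n%:R * a) * `|v|))).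
  rewrite mulrA ler_wpM2r // -expRD ler_expR.
  have /andP[nm1 nm2] := nm.
  have -> : (m - n)%:R = m%:R - n%:R :> R by rewrite natrB //; lia.
  have n2m : 2 * n%:R <= m%:R :> R by rewrite -natrM ler_nat.
  have : 0 <= (m%:R - 2 * n%:R) * (beta - a) :> R by rewrite mulr_ge0 // subr_ge0.
  by move: (m%:R : R) (n%:R : R) => x y; lra.
by rewrite ler_wpM2l // expR_ge0.
Qed.

(** Each doubling of the time halves the distance of the rate to beta; the losses dl add up
    geometrically to at most 2 dl. The bounds on e and dl keep the rate above alpha + e, so that
    [step] stays applicable. *)
Lemma chain (e dl : R) : 0 < e -> e <= (beta - alpha) / 4 ->
  0 < dl -> dl <= (beta - alpha) / 8 ->
  exists n0, forall n v, (n0 <= n)%N -> S n (alpha + e) v ->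
  (forall m, (2 * n <= m)%N -> S m (alpha + 2 * e) v) /\
  (forall j m, (2 ^ j.+1 * n <= m)%N -> S m (beta - (beta - alpha) / 2 ^+ j - 2 * dl) v).
Proof.
move=> e0 e4 dl0 dl8; have [n0 H] := one_step e0 dl0; exists (maxn n0 1) => n v.
rewrite geq_max => /andP[n0n n1] Sn.
pose a j := iter j (fun a => (a + beta) / 2 - dl) (alpha + e).
have aS j : a j.+1 = (a j + beta) / 2 - dl by [].
have a_lb j : alpha + e <= a j <= beta.
  elim: j => [|j /andP[IH1 IH2]]; first by rewrite /a /=; apply/andP; split; lra.
  by rewrite aS; apply/andP; split; lra.
have a1 : alpha + 2 * e <= a 1%N by rewrite /a /=; lra.
have aj j : beta - (beta - alpha) / 2 ^+ j - 2 * dl <= a j.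
  elim: j => [|j IH]; first by rewrite expr0 invr1 mulr1 /a /=; lra.
  rewrite aS exprS invfM; move: IH; set t := (2 ^+ j)^-1.
  by rewrite mulrA [(beta - alpha) / 2]mulrC -mulrA; lra.
(* A time m > 4 n is reached from its half, which is still at least 2 n and where the rate is
   already sufficient. *)
have step1 m : (2 * n <= m)%N -> S m (a 1%N) v.
  elim/ltn_ind: m => m IH nm.
  have [m4|m4] := leqP m (4 * n).
    by apply: (H n m (a 0%N) v n0n); rewrite ?nm.
  have Sm : S m./2 (a 0%N) v.
    apply: rateW (IH m./2 _ _); [|lia|lia].
    by rewrite /a /=; move: a1; rewrite /a /=; lra.
  by apply: (H m./2 m (a 0%N) v); rewrite ?a_lb //; lia.
have stepj j m : (2 ^ j.+1 * n <= m)%N -> S m (a j.+1) v.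
  elim: j m => [|j IH] m jm; first by apply: step1; move: jm; rewrite expn1.
  have hm : (2 ^ j.+1 * n <= m./2)%N by move: jm; rewrite expnS; lia.
  apply: (H m./2 m (a j.+1) v); rewrite ?a_lb //; last exact: IH.
    have : (0 < 2 ^ j.+1)%N by rewrite expn_gt0.
    by move: (2 ^ j.+1)%N hm => x; nia.
  have : (0 < 2 ^ j.+1)%N by rewrite expn_gt0.
  by move=> ?; have m2 : (0 < m./2)%N by [nia]; move: m2; clear; lia.
split=> [m /step1|j m jm]; first exact: rateW.
apply: rateW (stepj j m jm); apply: le_trans (aj j.+1).
rewrite exprS invfM.
have : 0 <= (beta - alpha) / 2 ^+ j by rewrite divr_ge0 ?exprn_ge0 // subr_ge0 ltW.
set t := (2 ^+ j)^-1 => t0.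
by rewrite mulrA [(beta - alpha) / 2]mulrC -mulrA; lra.
Qed.

Lemma small_eps (e : R) : 0 < e -> exists2 e', 0 < e' & e' <= e /\ e' <= (beta - alpha) / 8.
Proof.
move=> e0; exists (Num.min e ((beta - alpha) / 8)).
  by rewrite lt_min e0 divr_gt0 // subr_gt0.
by rewrite ge_min lexx ge_min lexx orbT.
Qed.

Lemma halving (a e : R) : 0 < e -> exists j, a / 2 ^+ j <= e.
Proof.
move=> e0; have [j H] := archi_le a e0; exists j.
rewrite ler_pdivrMr ?exprn_gt0 //; apply: le_trans (H j (leqnn _)) _.
by rewrite ler_wpM2l ?(ltW e0) // -natrX ler_nat ltnW // ltn_expl.
Qed.

(** A vector that is not slow exceeds the rate alpha + e at arbitrarily late times, and from one of
    them [chain] takes over. *)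
Lemma slow_or_fast v : slowv v \/ fastv v.
Proof.
have [|nf] := pselect (slowv v); first by left.
right=> dl dl0.
have [e [e0 He]] : exists e : R, 0 < e /\ forall n0, exists2 n, (n0 <= n)%N & S n (alpha + e) v.
  apply: contrapT => H; apply: nf => e e0.
  apply: contrapT => H'; apply: H; exists e; split => // n0.
  apply: contrapT => H''; apply: H'; exists n0 => n n0n.
  by rewrite leNgt; apply/negP => /ltW Sn; apply: H''; exists n.
have [e' e'0 [e'e e'8]] := small_eps e0.
have dl4 : 0 < dl / 4 by rewrite divr_gt0.
have [dl' dl'0 [dl'dl dl'8]] := small_eps dl4.
have e'4 : e' <= (beta - alpha) / 4 by move: ab; lra.
have [n0 H] := chain e'0 e'4 dl'0 dl'8.
have [n n0n Sn] := He n0.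
have [_ Hj] := H n v n0n (rateW (lerD (lexx alpha) e'e) Sn).
have dl2 : 0 < dl / 2 by rewrite divr_gt0.
have [j jH] := halving (beta - alpha) dl2.
exists (2 ^ j.+1 * n)%N => m jm; apply: rateW (Hj j m jm).
by move: jH; set t := _ / 2 ^+ j; lra.
Qed.

(** A cluster point of the idempotents given by [proj] is an idempotent with the same trace, so its
    kernel has the required dimension. The bound holds from a time common to all vectors of the
    kernel. *)
Lemma slow_space : exists F : {vspace 'cV[R]_d}, \dim F = (d - q)%N /\
  forall dl : R, 0 < dl -> exists n0, forall n, (n0 <= n)%N ->
  forall v, v \in F -> `|Z n *m v| <= expR (n%:R * (alpha + dl)) * `|v|.
Proof.
pose e0 := (beta - alpha) / 8; have e00 : 0 < e0 by rewrite divr_gt0 // subr_gt0.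
have e04 : e0 <= (beta - alpha) / 4 by rewrite /e0; move: ab; lra.
have [N1 HP] := proj e00.
have /choice [P HP'] : forall k, exists P : 'M[R]_d,
   [/\ P *m P = P, `|P| <= C, \tr P = q%:R &
    forall v, P *m v = 0 -> `|Z (N1 + k)%N *m v| <= expR ((N1 + k)%:R * (alpha + e0)) * `|v|].
  by move=> k; apply: HP; exact: leq_addr.
have [|Pl cl] := @mx_cluster R d d P C; first by move=> k; have [] := HP' k.
have C0 : 0 <= C by have [_ H _ _] := HP' 0%N; apply: le_trans H.
have small_eq0 m n (A : 'M[R]_(m, n)) (K : R) : 0 <= K ->
    (forall e : R, 0 < e -> `|A| <= K * e) -> A = 0.
  move=> K0 H; apply/eqP; rewrite -normr_le0; apply/ler_addgt0Pr => e e_gt0.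
  rewrite add0r; apply: le_trans (H (e / (K + 1)) _) _.
    by rewrite divr_gt0 // ltr_wpDl.
  by rewrite mulrCA ler_piMr ?(ltW e_gt0) // ler_pdivrMr ?mul1r ?lerDl // ltr_wpDl.
have PlPl : Pl *m Pl = Pl.
  apply/eqP; rewrite -subr_eq0; apply/eqP.
  apply: (small_eq0 _ _ _ (mnorm Pl + d%:R * C + 1)).
    by rewrite !addr_ge0 ?mnorm_ge0 ?mulr_ge0.
  move=> e e_gt0; have [k _ Hk] := cl e 0%N e_gt0; have [PP PC _ _] := HP' k.
  have -> : Pl *m Pl - Pl = - (Pl *m (P k - Pl)) - (P k - Pl) *m P k + (P k - Pl).
    rewrite mulmxBr mulmxBl PP opprB opprB; set a := Pl *m Pl; set b := Pl *m P k.
    by rewrite !addrA !subrK.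
  apply: le_trans (ler_normD _ _) _; rewrite mulrDl mul1r lerD //.
  apply: le_trans (ler_normB _ _) _; rewrite normrN mulrDl lerD //.
    by apply: le_trans (normrM_mx _ _) _; rewrite ler_wpM2l ?mnorm_ge0.
  apply: le_trans (normrM_mx _ _) _; rewrite /mnorm mulrAC ler_pM ?mulr_ge0 //.
  by rewrite ler_wpM2l.
have trPl : \tr Pl = q%:R.
  apply/eqP; rewrite -subr_eq0; apply/eqP.
  have : (\tr Pl - q%:R)%:M = 0 :> 'M[R]_1.
    apply: (small_eq0 _ _ _ d%:R) => // e e_gt0.
    have [k _ Hk] := cl e 0%N e_gt0; have [_ _ trP _] := HP' k.
    apply: mx_norm_le => [|i j]; first by rewrite mulr_ge0 // ltW.
    rewrite !ord1 mxE mulr1n -trP -linearB /= /mxtrace.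
    apply: le_trans (ler_norm_sum _ _ _) _.
    rewrite mulr_natl -[X in _ *+ X](card_ord d) -sumr_const; apply: ler_sum => i0 _.
    by apply: le_trans (le_mx_entry _ _ _) _; rewrite distrC.
  by move=> /matrixP /(_ 0 0); rewrite !mxE mulr1n.
exists (kerv Pl); split; first exact: dim_kerv.
move=> dl dl0; have [e e_gt0 [edl e8]] := small_eps dl0.
have e4 : e <= (beta - alpha) / 4 by move: ab; lra.
have [n1 Hn1] := chain e_gt0 e4 e_gt0 e8.
have [j jH] := halving (beta - alpha) e00.
exists n1 => n n1n v; rewrite mem_kerv => /eqP Plv.
rewrite leNgt; apply/negP => Sn.
pose E := expR (n%:R * (alpha + dl)).
have E0 : 0 < E by exact: expR_gt0.
(* At a large time k the vector v would be expanded at a rate close to beta,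
   whereas the vectors of ker (P k) near v are not. *)
pose D := `|Z n *m v| - E * `|v|.
have D0 : 0 < D by rewrite subr_gt0.
pose K := (mnorm (Z n) + E) * (d%:R * `|v|).
have K0 : 0 <= K by rewrite !mulr_ge0 // addr_ge0 ?mnorm_ge0 // ltW.
have DK0 : 0 < D / (K + 1) by rewrite divr_gt0 // ltr_wpDl.
have [k kk Hk] := cl (D / (K + 1)) (2 ^ j.+1 * n).+1 DK0.
have [PP _ _ HPk] := HP' k.
pose w := v - (P k - Pl) *m v.
have Pw : P k *m w = 0.
  by rewrite /w mulmxBr mulmxBl Plv subr0 mulmxA PP subrr.
have vw : `|v - w| <= d%:R * `|v| * (D / (K + 1)).
  rewrite /w opprB addrC subrK; apply: le_trans (normrM_mx _ _) _.
  by rewrite /mnorm mulrAC ler_wpM2l // mulr_ge0.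
have small : (mnorm (Z n) + E) * `|v - w| < D.
  apply: le_lt_trans (ler_wpM2l _ vw) _; first by rewrite addr_ge0 ?mnorm_ge0 // ltW.
  rewrite [ltLHS](_ : _ = D * (K / (K + 1))); last by rewrite /K; ring.
  rewrite gtr_pMr // ltr_pdivrMr ?mul1r ?ltrDl //.
  by rewrite ltr_wpDl.
have Sw : E * `|w| < `|Z n *m w|.
  have h1 : `|Z n *m v| <= `|Z n *m w| + mnorm (Z n) * `|v - w|.
    rewrite -{1}(subrK w v) mulmxDr addrC; apply: le_trans (ler_normD _ _) _.
    by rewrite lerD2l normrM_mx.
  have h2 : E * `|w| <= E * `|v| + E * `|v - w|.
    rewrite -mulrDr ler_wpM2l ?(ltW E0) //.
    rewrite -{1}(subKr v w); exact: ler_normB.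
  by move: small; rewrite /D mulrDl; lra.
have w0 : 0 < `|w|.
  rewrite normr_gt0; apply/eqP => w0; move: Sw.
  by rewrite w0 mulmx0 !normr0 mulr0 ltxx.
have Sn' : S n (alpha + e) w.
  by apply: rateW (ltW Sw); rewrite lerD2l.
have [_ Hj] := Hn1 n w n1n Sn'.
have jk : (2 ^ j.+1 * n <= N1 + k)%N by apply: leq_trans (ltnW kk) (leq_addl _ _).
have H1 := Hj j _ jk; rewrite /S in H1.
have := le_trans H1 (HPk w Pw).
rewrite ler_pM2r // ler_expR ler_pM2l; last first.
  by rewrite ltr0n (leq_trans _ (leq_addl _ _)) // (leq_trans _ kk).
by move: jH e8; rewrite /e0; move: ab; lra.
Qed.
End Dichotomy.

(** * Slow spaces at a regular point *)

Section RegularPoint.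
Variables (R : realType) (d : nat) (M : topologicalType) (f : homeomorphism M) (A : M -> 'M[R]_d).
Hypothesis uA : forall x, A x \in unitmx.
Local Notation fi := (homeo_inv f).
Local Notation X := (cocycle_nat f A).

Lemma iter_homeoK n : cancel (iter n f) (iter n fi).
Proof. by elim: n => // n IH x; rewrite iterSr [iter n.+1 f x]iterS homeo_funK IH. Qed.

Lemma iter_homeo_invK n : cancel (iter n fi) (iter n f).
Proof. by elim: n => // n IH x; rewrite iterSr [iter n.+1 fi x]iterS homeo_invK IH. Qed.

Lemma iter_homeo_sub i j x : (i <= j)%N -> iter i f (iter j fi x) = iter (j - i) fi x.
Proof. by move=> ij; rewrite -{1}(subnKC ij) iterD iter_homeo_invK. Qed.

Lemma cocycle_natD m n x : X (m + n) x = X m (iter n f x) *m X n x.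
Proof.
elim: m => [|m IH] /=; first by rewrite mul1mx.
by rewrite IH mulmxA iterD.
Qed.

Lemma cocycle_nat_unit n x : X n x \in unitmx.
Proof. by elim: n => [|n IH] /=; [exact: unitmx1|rewrite unitmx_mul uA IH]. Qed.

Lemma cocycle_back n x : cocycle f A (- n%:Z) x = invmx (X n (iter n fi x)).
Proof.
case: n => [|n]; last by rewrite -NegzE.
by rewrite oppr0 /= invmx1.
Qed.
Local Notation w := minor_sum.

(* [Lam p] is the sum of the p largest exponents at x. *)
Record regular (Lam : nat -> R) (x : M) : Prop := Regular {
  reg_up : forall p, (p <= d)%N -> forall dl : R, 0 < dl ->
    exists n0, forall n, (n0 <= n)%N ->
    (forall a k, (0 < k)%N -> (a + k <= 4 * n)%N ->
       w p (X k (iter a f x)) <= expR (k%:R * Lam p + dl * n%:R)) /\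
    (forall a k, (0 < k)%N -> (k <= a <= 4 * n)%N ->
       w p (X k (iter a fi x)) <= expR (k%:R * Lam p + dl * n%:R));
  reg_fwd : forall p, (p <= d)%N -> forall dl : R, 0 < dl ->
    exists n0, forall n, (n0 <= n)%N -> expR (n%:R * (Lam p - dl)) <= w p (X n x);
  reg_bwd : forall p, (p <= d)%N -> forall dl : R, 0 < dl ->
    exists n0, forall n, (n0 <= n)%N ->
    expR (n%:R * (Lam p - dl)) <= w p (X n (iter n fi x));
  reg_mid : forall p, (p <= d)%N -> forall dl : R, 0 < dl -> forall n0,
    exists2 n, (n0 <= n)%N &
    expR ((2 * n)%:R * (Lam p - dl)) <= w p (X (2 * n) (iter n fi x)) }.

Definition exponent (Lam : nat -> R) p : R := Lam p.+1 - Lam p.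

Lemma const_expR (c e : R) : 0 < e -> exists n0, forall n, (n0 <= n)%N -> c <= expR (e * n%:R).
Proof.
move=> e0; have [n0 H] := archi_le c e0; exists n0 => n /H Hc.
by apply: le_trans (expR_ge1Dx _); lra.
Qed.

Variables (Lam : nat -> R) (x : M).
Hypothesis reg : regular Lam x.
Local Notation lam := (exponent Lam).

Record bnd q (dl : R) n : Prop := Bnd {
  bnd_up : forall a k, (0 < k)%N -> (a + k <= 4 * n)%N ->
       w q (X k (iter a f x)) <= expR (k%:R * Lam q + dl * n%:R);
  bnd_upb : forall a k, (0 < k)%N -> (k <= a <= 4 * n)%N ->
       w q (X k (iter a fi x)) <= expR (k%:R * Lam q + dl * n%:R);
  bnd_lo : expR (n%:R * (Lam q - dl)) <= w q (X n x);
  bnd_lob : expR (n%:R * (Lam q - dl)) <= w q (X n (iter n fi x)) }.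

Lemma reg_bounds p : (p <= d)%N -> forall dl : R, 0 < dl ->
  exists n0, forall n, (n0 <= n)%N -> bnd p dl n.
Proof.
move=> pd dl dl0; have [n1 H1] := reg_up reg pd dl0.
have [n2 H2] := reg_fwd reg pd dl0; have [n3 H3] := reg_bwd reg pd dl0.
exists (maxn n1 (maxn n2 n3)) => n; rewrite !geq_max => /and3P[/H1[? ?] /H2 ? /H3 ?].
by split.
Qed.

Lemma reg_bounds3 p : (p.+1 < d)%N -> forall dl : R, 0 < dl ->
  exists n0, forall n, (n0 <= n)%N ->
  (0 < n)%N /\ [/\ bnd p dl n, bnd p.+1 dl n & bnd p.+2 dl n].
Proof.
move=> pd dl dl0; have [n1 H1] := @reg_bounds p ltac:(lia) dl dl0.
have [n2 H2] := @reg_bounds p.+1 ltac:(lia) dl dl0.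
have [n3 H3] := @reg_bounds p.+2 ltac:(lia) dl dl0.
exists (maxn 1 (maxn n1 (maxn n2 n3))) => n; rewrite !geq_max => /and4P[n0 /H1 ? /H2 ? /H3 ?].
by split.
Qed.

Lemma dominate_sum (C a b s t : R) : 0 < C -> expR t <= C * (expR a + s * expR b) ->
  2 * C <= expR (t - a) -> expR (t - b) <= 2 * C * s.
Proof.
move=> C0 H1 H2.
have : C * expR a <= expR t / 2.
  rewrite ler_pdivlMr // mulrAC [C * 2]mulrC.
  by apply: le_trans (ler_wpM2r (expR_ge0 _) H2) _; rewrite -expRD subrK.
have eb : 0 < expR b by exact: expR_gt0.
rewrite expRD expRN ler_pdivrMr // -mulrA.
by move: H1; rewrite mulrDr; lra.
Qed.

(** The arithmetic shared by both time directions: the decay of i makes the first term of [star] at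
    most half of the left-hand side, so the second one bounds y / z from below. *)
Lemma step_bound (C e dl eta W y z i a1 a2 b1 b2 L0 L1 L2 : R) n m :
  0 < C -> 0 < z -> 0 < eta -> eta <= e / 16 -> eta <= dl / 16 -> (2 * n <= m <= 4 * n)%N ->
  2 * C <= expR (e / 2 * n%:R) -> 2 * C <= expR (dl / 2 * m%:R) ->
  expR (m%:R * (L1 - eta)) <= W -> W <= C * (a1 * a2 * i + y / z * b1 * b2) ->
  [/\ 0 <= a1, 0 <= a2, 0 <= i, 0 <= b1 & 0 <= b2] -> 0 <= y ->
  [/\ a1 <= expR ((m - n)%:R * L1 + eta * n%:R), a2 <= expR (n%:R * L2 + eta * n%:R),
      i <= expR (- (n%:R * (L2 - L1 + e))), b1 <= expR ((m - n)%:R * L0 + eta * n%:R) &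
      b2 <= expR (n%:R * L1 + eta * n%:R)] ->
  expR ((m - n)%:R * (L1 - L0) - dl * m%:R) * z <= y.
Proof.
move=> C0 z0 eta0 etae etad /andP[nm mn] H2 H3 lo S [a10 a20 i0 b10 b20] y0 [t1 t2 ti t3 t4].
have mnR : (m - n)%:R = m%:R - n%:R :> R by rewrite natrB //; apply: leq_trans nm; rewrite leq_pmull.
have n2m : m%:R <= 4 * n%:R :> R by rewrite -natrM ler_nat.
have en : eta * n%:R <= e / 16 * n%:R by rewrite ler_wpM2r.
have dn : eta * m%:R <= dl / 16 * m%:R by rewrite ler_wpM2r.
have enm : eta * m%:R <= 4 * (eta * n%:R) by rewrite mulrCA ler_wpM2l // ltW.
have nm' : n%:R <= m%:R :> R by rewrite ler_nat; apply: leq_trans nm; rewrite leq_pmull.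
have dnm : eta * n%:R <= eta * m%:R by rewrite ler_wpM2l // ltW.
pose a := (m - n)%:R * L1 + eta * n%:R + (n%:R * L2 + eta * n%:R) - n%:R * (L2 - L1 + e).
pose b := (m - n)%:R * L0 + eta * n%:R + (n%:R * L1 + eta * n%:R).
have D : expR (m%:R * (L1 - eta) - b) <= 2 * C * (y / z).
  apply: (@dominate_sum C a b) => //.
    apply: le_trans lo _; apply: le_trans S _; rewrite ler_wpM2l ?(ltW C0) // lerD //.
      by rewrite /a expRD [expR (_ + _ + _)]expRD !ler_pM ?mulr_ge0.
    by rewrite -mulrA ler_wpM2l ?divr_ge0 ?(ltW z0) // /b expRD ler_pM.
  by apply: le_trans H2 _; rewrite ler_expR /a mnR; lra.
rewrite -ler_pdivlMr //.
have C2 : 0 < 2 * C by rewrite mulr_gt0.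
rewrite -(ler_pM2l C2); apply: le_trans D.
apply: le_trans (ler_wpM2r (expR_ge0 _) H3) _.
by rewrite -expRD ler_expR /b mnR; lra.
Qed.

Lemma step_setup p : (p.+1 < d)%N -> forall C e dl : R, 0 < e -> 0 < dl ->
  exists eta n0, [/\ 0 < eta, eta <= e / 16, eta <= dl / 16 &
  forall n m, (n0 <= n)%N -> (2 * n <= m <= 4 * n)%N ->
    [/\ 2 * C <= expR (e / 2 * n%:R), 2 * C <= expR (dl / 2 * m%:R), (0 < n)%N, (0 < m - n)%N &
        [/\ bnd p eta n, bnd p.+1 eta n, bnd p.+2 eta n & bnd p.+1 eta m]]].
Proof.
move=> pd C e dl e0 dl0; pose eta := Num.min (e / 16) (dl / 16).
have eta0 : 0 < eta by rewrite lt_min !divr_gt0.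
have [n1 H1] := reg_bounds3 pd eta0.
have [n2 H2] := const_expR (2 * C) (divr_gt0 e0 (ltr0n R 2)).
have [n3 H3] := const_expR (2 * C) (divr_gt0 dl0 (ltr0n R 2)).
exists eta, (maxn n1 (maxn n2 n3)); split=> //; rewrite ?ge_min ?lexx ?orbT // => n m.
rewrite !geq_max => /and3P[n1n n2n n3n] /andP[nm mn].
have nm' : (n <= m)%N by lia.
have [n_gt0 [Hn0 Hn1 Hn2]] := H1 n n1n; have [_ [_ Hm1 _]] := H1 m (leq_trans n1n nm').
split=> //; [exact: H2|exact: H3 (leq_trans n3n nm')|lia].
Qed.

(** [star] for the product up to time m factored at time n, at the direction u of [X n x *m v]. An
    expansion of v beyond the rate lam p.+1 makes the preimage of u short, so the remaining factor
    must expand u. *)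
Lemma fwd_step p : (p.+1 < d)%N -> forall e dl : R, 0 < e -> 0 < dl ->
  exists n0, forall n m, (n0 <= n)%N -> (2 * n <= m <= 4 * n)%N ->
  forall v : 'cV[R]_d, expR (n%:R * (lam p.+1 + e)) * `|v| <= `|X n x *m v| ->
    expR ((m - n)%:R * lam p - dl * m%:R) * `|X n x *m v| <= `|X m x *m v|.
Proof.
move=> pd e dl e0 dl0; have [C C0 HC] := star R d p.
have [eta [n0 [eta0 etae etad H]]] := step_setup pd C e0 dl0; exists n0 => n m n0n nm v vn.
have [H2 H3 n_gt0 mn_gt0 [Hn0 Hn1 Hn2 Hm1]] := H n m n0n nm.
have [->|v0] := eqVneq v 0; first by rewrite !mulmx0 normr0 mulr0.
have nm' : (n <= m)%N by rewrite ltnW // -subn_gt0.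
have n_4 : (0 + n <= 4 * n)%N by rewrite leq_pmull.
have nm_4 : (n + (m - n) <= 4 * n)%N by rewrite subnKC // (andP nm).2.
have Zv0 : 0 < `|X n x *m v|.
  by apply: lt_le_trans vn; rewrite mulr_gt0 ?expR_gt0 ?normr_gt0.
set z := `|X n x *m v| in vn Zv0 *.
pose u := z^-1 *: (X n x *m v).
have u1 : `|u| = 1 by rewrite /u normrZ gtr0_norm ?invr_gt0 // mulVf ?gt_eqF.
pose T := X (m - n) (iter n f x).
have XT : X m x = T *m X n x by rewrite -cocycle_natD subnK.
have Tu : `|T *m u| = `|X m x *m v| / z.
  by rewrite /u -scalemxAr mulmxA -XT normrZ gtr0_norm ?invr_gt0 // mulrC.
have iu : `|invmx (X n x) *m u| <= expR (- (n%:R * (lam p.+1 + e))).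
  rewrite /u -scalemxAr mulKmx ?cocycle_nat_unit // normrZ gtr0_norm ?invr_gt0 //.
  by rewrite expRN ler_pdivrMl // ler_pdivlMr ?expR_gt0 // mulrC.
have S := HC T (X n x) u u1 (cocycle_nat_unit _ _).
rewrite -XT Tu in S.
apply: (step_bound C0 Zv0 eta0 etae etad nm H2 H3 (bnd_lo Hm1) S) => //.
  by split; rewrite ?minor_sum_ge0.
split; first exact: (bnd_up Hn1).
- exact: (bnd_up Hn2 n_gt0 n_4).
- exact: iu.
- exact: (bnd_up Hn0).
- exact: (bnd_up Hn1 n_gt0 n_4).
Qed.

(** The time reversal of [fwd_step]. The two terms of [star] exchange their roles, which is why lam
    p and lam p.+1 change places. *)
Lemma bwd_step p : (p.+1 < d)%N -> forall e dl : R, 0 < e -> 0 < dl ->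
  exists n0, forall n m, (n0 <= n)%N -> (2 * n <= m <= 4 * n)%N ->
  forall v : 'cV[R]_d,
    expR (n%:R * (- lam p + e)) * `|v| <= `|invmx (X n (iter n fi x)) *m v| ->
    expR ((m - n)%:R * - lam p.+1 - dl * m%:R) * `|invmx (X n (iter n fi x)) *m v|
      <= `|invmx (X m (iter m fi x)) *m v|.
Proof.
move=> pd e dl e0 dl0; have [C C0 HC] := star R d p.
have [eta [n0 [eta0 etae etad H]]] := step_setup pd C e0 dl0; exists n0 => n m n0n nm v vn.
have [H2 H3 n_gt0 mn_gt0 [Hn0 Hn1 Hn2 Hm1]] := H n m n0n nm.
have [->|v0] := eqVneq v 0; first by rewrite !mulmx0 normr0 mulr0.
have nm' : (n <= m)%N by rewrite ltnW // -subn_gt0.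
have n_4 : (n <= n <= 4 * n)%N by rewrite leqnn leq_pmull.
have mn_4 : (m - n <= m <= 4 * n)%N by rewrite leq_subr (andP nm).2.
set Y := X n (iter n fi x) in vn *.
have uY : Y \in unitmx by exact: cocycle_nat_unit.
have Zv0 : 0 < `|invmx Y *m v|.
  by apply: lt_le_trans vn; rewrite mulr_gt0 ?expR_gt0 ?normr_gt0.
set z := `|invmx Y *m v| in vn Zv0 *.
pose u := z^-1 *: (invmx Y *m v).
have u1 : `|u| = 1 by rewrite /u normrZ gtr0_norm ?invr_gt0 // mulVf ?gt_eqF.
pose T := X (m - n) (iter m fi x).
have uT : T \in unitmx by exact: cocycle_nat_unit.
have XT : X m (iter m fi x) = Y *m T.
  have := cocycle_natD n (m - n) (iter m fi x).
  by rewrite subnKC // iter_homeo_sub ?leq_subr // subKn.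
set Y' := X m _ in XT *.
have uY' : Y' \in unitmx by exact: cocycle_nat_unit.
have YT : invmx Y' *m v = invmx T *m (invmx Y *m v).
  by apply: (can_inj (mulKmx uY')); rewrite mulKVmx // XT -mulmxA mulKVmx // mulKVmx.
have Tu : `|invmx T *m u| = `|invmx Y' *m v| / z.
  by rewrite /u -scalemxAr -YT normrZ gtr0_norm ?invr_gt0 // mulrC.
have iu : `|Y *m u| <= expR (- (n%:R * (- lam p + e))).
  rewrite /u -scalemxAr mulKVmx // normrZ gtr0_norm ?invr_gt0 //.
  by rewrite expRN ler_pdivrMl // ler_pdivlMr ?expR_gt0 // mulrC.
have sw (a b c : R) : a * b * c = c * b * a by rewrite mulrC mulrA mulrAC.
have S := HC Y T u u1 uT; rewrite -XT Tu addrC (sw (w p.+1 Y)) (sw `|Y *m u|) in S.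
rewrite opprB in iu; rewrite opprB; have lo := bnd_lob Hm1; rewrite -/Y' in lo.
apply: (step_bound C0 Zv0 eta0 etae etad nm H2 H3 lo S) => //.
  by split; rewrite ?minor_sum_ge0.
split; first exact: (bnd_upb Hn1).
- exact: (bnd_upb Hn0 n_gt0 n_4).
- exact: iu.
- exact: (bnd_upb Hn2).
- exact: (bnd_upb Hn1 n_gt0 n_4).
Qed.

Lemma quotient_bound p q (W : R) (s t Cc dl : R) n : (0 < n)%N -> 0 < Cc ->
  expR (n%:R * (Lam p - dl / 4)) <= W -> W * s <= Cc * (expR (n%:R * Lam q + dl / 4 * n%:R) * t) ->
  Cc <= expR (dl / 2 * n%:R) -> 0 <= s -> 0 <= t ->
  s <= expR (n%:R * (Lam q - Lam p + dl)) * t.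
Proof.
move=> n0 C0 HW H HC s0 t0.
have E0 : 0 < expR (n%:R * (Lam p - dl / 4)) by exact: expR_gt0.
rewrite -(ler_pM2l E0); apply: le_trans (ler_wpM2r s0 HW) _; apply: le_trans H _.
rewrite !mulrA; apply: ler_wpM2r => //.
apply: le_trans (ler_wpM2r (expR_ge0 _) HC) _.
by rewrite -!expRD ler_expR; lra.
Qed.

Lemma fwd_proj p : (p.+1 < d)%N -> exists C, forall dl : R, 0 < dl ->
  exists n0, forall n, (n0 <= n)%N ->
  exists P : 'M[R]_d, [/\ P *m P = P, `|P| <= C, \tr P = p.+1%:R &
    forall v : 'cV[R]_d, P *m v = 0 ->
      `|X n x *m v| <= expR (n%:R * (lam p.+1 + dl)) * `|v|].
Proof.
move=> pd; have [C C0 HC] := contracted_kernel R d p.+1; exists C => dl dl0.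
have [n1 H1] := reg_bounds3 pd (divr_gt0 dl0 (ltr0n R 4)).
have [n2 H2] := const_expR C (divr_gt0 dl0 (ltr0n R 2)).
exists (maxn n1 n2) => n; rewrite geq_max => /andP[n1n n2n].
have [n_gt0 [Hn0 Hn1 Hn2]] := H1 n n1n.
have [P [PP PC trP HP]] := HC (X n x) (cocycle_nat_unit n x) (ltnW pd).
exists P; split=> // v Pv; have := HP v Pv; rewrite mulrC => H.
have lo := bnd_lo Hn1.
apply: (quotient_bound n_gt0 C0 lo (s := `|X n x *m v|) (t := `|v|)) => //; last exact: H2.
apply: le_trans H _; rewrite ler_wpM2l ?(ltW C0) // ler_wpM2r //.
by apply: (bnd_up Hn2 (a := 0%N)) => //; rewrite add0n leq_pmull.
Qed.

Lemma bwd_proj p : (p.+1 < d)%N -> exists C, forall dl : R, 0 < dl ->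
  exists n0, forall n, (n0 <= n)%N ->
  exists P : 'M[R]_d, [/\ P *m P = P, `|P| <= C, \tr P = (d - p.+1)%:R &
    forall v : 'cV[R]_d, P *m v = 0 ->
      `|invmx (X n (iter n fi x)) *m v| <= expR (n%:R * (- lam p + dl)) * `|v|].
Proof.
move=> pd; have [C C0 HC] := expanded_image R d p; exists C => dl dl0.
have [n1 H1] := reg_bounds3 pd (divr_gt0 dl0 (ltr0n R 4)).
have [n2 H2] := const_expR C (divr_gt0 dl0 (ltr0n R 2)).
exists (maxn n1 n2) => n; rewrite geq_max => /andP[n1n n2n].
have [n_gt0 [Hn0 Hn1 Hn2]] := H1 n n1n.
have [P [PP PC trP HP]] := HC _ (cocycle_nat_unit n (iter n fi x)) (ltnW pd).
exists P; split=> // v Pv; have := HP v Pv; rewrite mulrC => H.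
have lo := bnd_lob Hn1.
have -> : - lam p = Lam p - Lam p.+1 by rewrite /exponent opprB.
apply: (quotient_bound n_gt0 C0 lo (t := `|v|)) => //; last exact: H2.
apply: le_trans H _; rewrite ler_wpM2l ?(ltW C0) // ler_wpM2r //.
by apply: (bnd_upb Hn0) => //; rewrite leqnn leq_pmull.
Qed.

Definition slow_fwd (a : R) (v : 'cV[R]_d) := slowv (fun n => X n x) a v.
Definition slow_bwd (a : R) (v : 'cV[R]_d) := slowv (fun n => invmx (X n (iter n fi x))) a v.

(** [star] at the midpoint of a segment of length 2 n: for a vector slow in both directions, both
    terms fall short of the known growth by a factor exponential in n times the gap, against
    [reg_mid]. *)
Lemma transversal p v : (p.+1 < d)%N -> lam p.+1 < lam p ->
  slow_fwd (lam p.+1) v -> slow_bwd (- lam p) v -> v = 0.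
Proof.
move=> pd gap sf sb; apply/eqP/negPn/negP => v0.
have [C C0 HC] := star R d p.
pose g := lam p - lam p.+1; have g0 : 0 < g by rewrite subr_gt0.
have g16 : 0 < g / 16 by rewrite divr_gt0.
have [n1 H1] := reg_bounds3 pd g16.
have [n2 H2] := sf _ g16; have [n3 H3] := sb _ g16.
have [n4 H4] := const_expR (2 * C + 1) (divr_gt0 g0 (ltr0n R 2)).
have [n nn lo] := reg_mid reg (ltnW pd) g16 (maxn n1 (maxn n2 (maxn n3 n4))).
move: nn; rewrite !geq_max => /and4P[n1n n2n n3n n4n].
have [n_gt0 [Hn0 Hn1 Hn2]] := H1 n n1n.
have n_4 : (0 + n <= 4 * n)%N by lia.
have n_4' : (n <= n <= 4 * n)%N by lia.
have nv : 0 < `|v| by rewrite normr_gt0.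
pose u := `|v|^-1 *: v.
have u1 : `|u| = 1 by rewrite /u normrZ gtr0_norm ?invr_gt0 // mulVf ?gt_eqF.
set Y := X n (iter n fi x).
have uY : Y \in unitmx by exact: cocycle_nat_unit.
have XY : X (2 * n) (iter n fi x) = X n x *m Y.
  by rewrite mul2n -addnn cocycle_natD iter_homeo_invK.
have S := HC (X n x) Y u u1 uY; rewrite -XY in S.
have Xu : `|X n x *m u| <= expR (n%:R * (lam p.+1 + g / 16)).
  rewrite /u -scalemxAr normrZ gtr0_norm ?invr_gt0 // ler_pdivrMl // mulrC.
  exact: H2.
have Yu : `|invmx Y *m u| <= expR (n%:R * (- lam p + g / 16)).
  rewrite /u -scalemxAr normrZ gtr0_norm ?invr_gt0 // ler_pdivrMl // mulrC.
  exact: H3.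
have t1 := bnd_up Hn1 n_gt0 n_4.
have t2 := bnd_upb Hn2 n_gt0 n_4'.
have t3 := bnd_up Hn0 n_gt0 n_4.
have t4 := bnd_upb Hn1 n_gt0 n_4'.
pose E := expR (2 * n%:R * Lam p.+1 - n%:R * g + 3 * (g / 16 * n%:R)).
have : expR ((2 * n)%:R * (Lam p.+1 - g / 16)) <= C * (E + E).
  apply: le_trans lo _; apply: le_trans S _; rewrite ler_wpM2l ?(ltW C0) //.
  apply: lerD.
    apply: (@le_trans _ _ (expR (n%:R * Lam p.+1 + g / 16 * n%:R)
      * expR (n%:R * Lam p.+2 + g / 16 * n%:R) * expR (n%:R * (- lam p + g / 16)))).
      by rewrite !ler_pM ?mulr_ge0 ?minor_sum_ge0 ?normr_ge0.
    by rewrite -!expRD ler_expR /g /exponent; move: (Lam p) (Lam p.+1) (Lam p.+2) => a b c; lra.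
  apply: (@le_trans _ _ (expR (n%:R * (lam p.+1 + g / 16))
    * expR (n%:R * Lam p + g / 16 * n%:R) * expR (n%:R * Lam p.+1 + g / 16 * n%:R))).
    by rewrite !ler_pM ?mulr_ge0 ?minor_sum_ge0 ?normr_ge0.
  by rewrite -!expRD ler_expR /g /exponent; move: (Lam p) (Lam p.+1) (Lam p.+2) => a b c; lra.
rewrite -mulr2n mulrnAr -mulrnAl -[C *+ 2]mulr_natl leNgt => /negP; apply.
have E0 : 0 < E by exact: expR_gt0.
apply: (@lt_le_trans _ _ (expR (g / 2 * n%:R) * E)).
  by rewrite ltr_pM2r //; have := H4 n n4n; lra.
have gn : 0 <= g * n%:R by rewrite mulr_ge0 // ltW.
by rewrite -expRD ler_expR natrM; lra.
Qed.

Lemma exponent_decr p : (p.+1 < d)%N -> lam p.+1 <= lam p.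
Proof.
move=> pd; apply/ler_addgt0Pr => e e0.
have e8 : 0 < e / 8 by rewrite divr_gt0.
have [C C1 HC] := gain_decreasing R d.
have [n1 H1] := reg_bounds3 pd e8.
have [n2 H2] := const_expR C (divr_gt0 e0 (ltr0n R 4)).
pose n := maxn n1 n2; have [n_gt0 [Hn0 Hn1 Hn2]] := H1 n (leq_maxl _ _).
have n_4 : (0 + n <= 4 * n)%N by lia.
have t1 := bnd_up Hn1 n_gt0 n_4.
have lo2 := bnd_lo Hn2; have lo0 := bnd_lo Hn0.
have uX : X n x \in unitmx by exact: cocycle_nat_unit.
have w1 : 0 < w p.+1 (X n x) by apply: minor_sum_gt0 => //; exact: ltnW.
have w0 : 0 < w p (X n x) by apply: minor_sum_gt0 => //; exact/ltnW/ltnW.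
have := HC p pd _ uX; rewrite /gain ler_pdivrMr //.
rewrite mulrA mulrAC ler_pdivlMr // => H.
have : expR (n%:R * (Lam p.+2 - e / 8)) * expR (n%:R * (Lam p - e / 8)) <=
  expR (e / 4 * n%:R) * expR (n%:R * Lam p.+1 + e / 8 * n%:R) * expR (n%:R * Lam p.+1 + e / 8 * n%:R).
  apply: le_trans (_ : w p.+2 (X n x) * w p (X n x) <= _).
    by rewrite ler_pM ?expR_ge0.
  apply: le_trans H _.
  rewrite !ler_pM ?mulr_ge0 ?minor_sum_ge0 ?(le_trans ler01 C1) //.
  by apply: H2; exact: leq_maxr.
rewrite -!expRD ler_expR => {}H.
have nR : 0 < n%:R :> R by rewrite ltr0n.
have en : 0 <= e * n%:R by rewrite mulr_ge0 // ltW.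
rewrite -(ler_pM2l nR) /exponent; move: H.
by move: (Lam p) (Lam p.+1) (Lam p.+2) => a b c; lra.
Qed.

(** The two slow spaces have complementary dimensions, and [transversal] makes their sum direct. A
    vector slow in one direction then has no component in the other space, so slowness characterises
    each space and its complement consists of fast vectors. *)
Lemma regular_gap p : (p.+1 < d)%N -> lam p.+1 < lam p ->
  exists F B : {vspace 'cV[R]_d},
  [/\ \dim F = (d - p.+1)%N, \dim B = p.+1, (F :&: B = 0)%VS,
      (forall v, (v \in F) <-> slow_fwd (lam p.+1) v) /\
      (forall v, (v \in B) <-> slow_bwd (- lam p) v) &
      (forall v, v \notin F -> fastv (fun n => X n x) (lam p) v) /\
      (forall v, v \notin B -> fastv (fun n => invmx (X n (iter n fi x))) (- lam p.+1) v)].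
Proof.
move=> pd gap.
have gap' : - lam p < - lam p.+1 by rewrite ltrN2.
have [Cf Pf] := fwd_proj pd; have [Cb Pb] := bwd_proj pd.
have [F [dF HF]] := slow_space gap (fwd_step pd) Pf.
have [B [dB HB]] := slow_space gap' (bwd_step pd) Pb.
have {}dB : \dim B = p.+1 by rewrite dB; lia.
have Fs v : v \in F -> slow_fwd (lam p.+1) v.
  by move=> vF dl dl0; have [n0 H] := HF dl dl0; exists n0 => n /H; apply.
have Bs v : v \in B -> slow_bwd (- lam p) v.
  by move=> vB dl dl0; have [n0 H] := HB dl dl0; exists n0 => n /H; apply.
have FB0 : (F :&: B = 0)%VS.
  apply/eqP; rewrite -subv0; apply/subvP => v /memv_capP[vF vB].
  by rewrite memv0; apply/eqP; apply: (transversal pd gap); [exact: Fs|exact: Bs].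
have dFB : \dim (F + B) = d.
  have := dimv_sum_cap F B; rewrite FB0 dimv0 addn0 dF dB => ->.
  by rewrite subnK // ltnW.
have full v : v \in (F + B)%VS.
  have /eqP -> : (F + B)%VS == fullv.
    by rewrite -dimv_leqif_eq ?subvf // dFB dimvf /dim /= muln1.
  exact: memvf.
have nF v : slow_fwd (lam p.+1) v -> v \in F.
  move=> sv; have /memv_addP[u uF [b bB vE]] := full v.
  have : slow_fwd (lam p.+1) b.
    have -> : b = v + (-1) *: u by rewrite vE scaleN1r addrAC subrr add0r.
    exact: slowvD sv (slowvZ _ (Fs _ uF)).
  by move=> /(transversal pd gap) /(_ (Bs _ bB)) b0; rewrite vE b0 addr0.
have nB v : slow_bwd (- lam p) v -> v \in B.
  move=> sv; have /memv_addP[u uF [b bB vE]] := full v.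
  have : slow_bwd (- lam p) u.
    have -> : u = v + (-1) *: b by rewrite vE scaleN1r addrK.
    exact: slowvD sv (slowvZ _ (Bs _ bB)).
  by move=> /(transversal pd gap (Fs _ uF)) u0; rewrite vE u0 add0r.
exists F, B; split=> //; first by split=> v; split; [exact: Fs|exact: nF|exact: Bs|exact: nB].
split=> v vn.
  have [/nF|//] := slow_or_fast gap (fwd_step pd) v; by rewrite (negbTE vn).
have [/nB|//] := slow_or_fast gap' (bwd_step pd) v; by rewrite (negbTE vn).
Qed.
End RegularPoint.

(** * Continuity and measurability of minors; regular points have full measure *)

Section AlmostEverywhere.
Context (dd : measure_display) (T : measurableType dd) (R : realType).
Variable mu : probability T R.

Lemma ae_imp (P Q : T -> Prop) : (forall x, P x -> Q x) ->
  {ae mu, forall x, P x} -> {ae mu, forall x, Q x}.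
Proof. by move=> PQ; apply: filterS. Qed.

Lemma ae_imp2 (P Q S : T -> Prop) : (forall x, P x -> Q x -> S x) ->
  {ae mu, forall x, P x} -> {ae mu, forall x, Q x} -> {ae mu, forall x, S x}.
Proof. by move=> PQ; apply: filterS2. Qed.

Lemma ae_all_nat (P : nat -> T -> Prop) : (forall n, {ae mu, forall x, P n x}) ->
  {ae mu, forall x, forall n, P n x}.
Proof. exact: ae_foralln. Qed.
End AlmostEverywhere.

Section ContinuousMatrices.
Variables (R : realType) (T : topologicalType).
Local Notation cont_at F x := {for x, continuous F}.

Lemma cont_at_sum (I : Type) (r : seq I) (P : pred I) (F : I -> T -> R) x :
  (forall i, P i -> cont_at (F i) x) -> cont_at (fun x => \sum_(i <- r | P i) F i x) x.
Proof.
move=> cF; apply: cvg_big => //.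
by move=> -[a b]; apply: cvgD; [exact: cvg_fst|exact: cvg_snd].
Qed.

Lemma cont_at_prod (I : Type) (r : seq I) (P : pred I) (F : I -> T -> R) x :
  (forall i, P i -> cont_at (F i) x) -> cont_at (fun x => \prod_(i <- r | P i) F i x) x.
Proof.
move=> cF; apply: cvg_big => //.
by move=> -[a b]; apply: cvgM; [exact: cvg_fst|exact: cvg_snd].
Qed.

Lemma cont_at_mul (F G : T -> R) x :
  cont_at F x -> cont_at G x -> cont_at (fun x => F x * G x) x.
Proof. by move=> cF cG; apply: cvgM; [exact: cF|exact: cG]. Qed.

Lemma cont_at_inv (F : T -> R) x : F x != 0 -> cont_at F x -> cont_at (fun x => (F x)^-1) x.
Proof. by move=> F0 cF; apply: cvgV => //; exact: cF. Qed.

Lemma cont_at_mx m n (F : T -> 'M[R]_(m, n)) x :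
  (forall i j, cont_at (fun x => F x i j) x) -> cont_at F x.
Proof.
move=> cF; apply/cvgrPdist_le => e e0.
have H (ij : 'I_m * 'I_n) : \forall y \near x, `|F x ij.1 ij.2 - F y ij.1 ij.2| <= e.
  by have /cvgrPdist_le := cF ij.1 ij.2; apply.
have := filter_forall (nbhs_filter x) H; apply: filterS => y Hy.
apply: mx_norm_le; first exact: ltW.
by move=> i j; have := Hy (i, j); rewrite !mxE.
Qed.

Lemma cont_at_entry m n (F : T -> 'M[R]_(m, n)) i j x :
  cont_at F x -> cont_at (fun x => F x i j) x.
Proof.
move=> cF; apply: (@continuous_comp _ _ _ F (fun B : 'M[R]_(m, n) => B i j)) => //.
exact: coord_continuous.
Qed.

Lemma cont_at_mulmx m n p (F : T -> 'M[R]_(m, n)) (G : T -> 'M[R]_(n, p)) x :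
  cont_at F x -> cont_at G x -> cont_at (fun x => F x *m G x) x.
Proof.
move=> cF cG; apply: cont_at_mx => i j.
rewrite (_ : (fun _ => _) = fun x => \sum_k F x i k * G x k j); last first.
  by apply/funext => y; rewrite mxE.
by apply: cont_at_sum => k _; apply: cont_at_mul; exact: cont_at_entry.
Qed.

Lemma cont_at_scale m n (h : T -> R) (F : T -> 'M[R]_(m, n)) x :
  cont_at h x -> cont_at F x -> cont_at (fun x => h x *: F x) x.
Proof.
move=> ch cF; apply: cont_at_mx => i j.
rewrite (_ : (fun _ => _) = fun x => h x * F x i j); last by apply/funext => y; rewrite mxE.
by apply: cont_at_mul => //; exact: cont_at_entry.
Qed.

Lemma cont_at_det n (F : T -> 'M[R]_n) x : cont_at F x -> cont_at (fun x => \det (F x)) x.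
Proof.
move=> cF; apply: cont_at_sum => s _; apply: cont_at_mul; first exact: cst_continuous.
by apply: cont_at_prod => i _; exact: cont_at_entry.
Qed.

Lemma cont_at_mxsub m n m' n' (s : 'I_m' -> 'I_m) (t : 'I_n' -> 'I_n) (F : T -> 'M[R]_(m, n)) x :
  cont_at F x -> cont_at (fun x => mxsub s t (F x)) x.
Proof.
move=> cF; apply: cont_at_mx => i j.
rewrite (_ : (fun _ => _) = fun x => F x (s i) (t j)); last by apply/funext => y; rewrite mxE.
exact: cont_at_entry.
Qed.

Lemma cont_at_minor_sum d p (F : T -> 'M[R]_d) x :
  cont_at F x -> cont_at (fun x => minor_sum p (F x)) x.
Proof.
move=> cF; apply: cont_at_sum => s _; apply: cont_at_sum => t _.
by apply: cvg_norm; apply: cont_at_det; exact: cont_at_mxsub.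
Qed.

Lemma cont_at_gain d p (F : T -> 'M[R]_d) x : (p <= d)%N -> F x \in unitmx ->
  cont_at F x -> cont_at (fun x => gain p (F x)) x.
Proof.
move=> pd uF cF; apply: cont_at_mul; first exact: cont_at_minor_sum.
by apply: cont_at_inv; [exact/lt0r_neq0/minor_sum_gt0|exact: cont_at_minor_sum].
Qed.

Lemma cont_at_ln (F : T -> R) x : 0 < F x -> cont_at F x -> cont_at (fun x => ln (F x)) x.
Proof.
by move=> F0 cF; apply: (@continuous_comp _ _ _ F (@ln R)) => //; exact: continuous_ln.
Qed.

Lemma cont_at_unit d (F : T -> 'M[R]_d) x : F x \in unitmx -> cont_at F x ->
  \forall y \near x, F y \in unitmx.
Proof.
move=> uF cF; have D0 : \det (F x) != 0 by rewrite -unitfE -unitmxE.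
have := cvgr_neq0 (FF := nbhs_filter x) _ (cont_at_det cF) D0.
apply: filterS => y.
by rewrite unitmxE unitfE.
Qed.

Lemma cont_at_invmx d (F : T -> 'M[R]_d) x :
  F x \in unitmx -> cont_at F x -> cont_at (fun x => invmx (F x)) x.
Proof.
move=> uF cF.
have c : cont_at (fun x => (\det (F x))^-1 *: \adj (F x)) x.
  apply: cont_at_scale; first by apply: cont_at_inv; [rewrite -unitfE -unitmxE|exact: cont_at_det].
  apply: cont_at_mx => i j.
  rewrite (_ : (fun _ => _) = fun x => cofactor (F x) j i); last by apply/funext => y; rewrite mxE.
  apply: cont_at_mul; first exact: cst_continuous.
  apply: cont_at_det.
  rewrite (_ : (fun _ => _) = fun x => mxsub (lift j) (lift i) (F x)); first exact: cont_at_mxsub.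
  by apply/funext => y; apply/matrixP => a b; rewrite !mxE.
have E y : F y \in unitmx -> invmx (F y) = (\det (F y))^-1 *: \adj (F y) by rewrite /invmx => ->.
suff : (fun y => invmx (F y)) @ x --> invmx (F x) by [].
rewrite E //; apply: cvg_trans c; apply: near_eq_cvg.
by have := cont_at_unit uF cF; apply: filterS => y /E ->.
Qed.

Lemma continuous_minor_sum d p (F : T -> 'M[R]_d) :
  continuous F -> continuous (fun x => minor_sum p (F x)).
Proof. by move=> cF x; apply: cont_at_minor_sum; exact: cF. Qed.

Lemma continuous_invmx d (F : T -> 'M[R]_d) :
  (forall x, F x \in unitmx) -> continuous F -> continuous (fun x => invmx (F x)).
Proof. by move=> uF cF x; apply: cont_at_invmx => //; exact: cF. Qed.

Lemma continuous_iter (h : T -> T) n : continuous h -> continuous (iter n h).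
Proof.
move=> ch; elim: n => [|n IH]; first by move=> x; exact: cvg_id.
by move=> x; apply: (@continuous_comp _ _ _ (iter n h) h); [exact: IH|exact: ch].
Qed.

Lemma continuous_cocycle_nat d (f : homeomorphism T) (A : T -> 'M[R]_d) n :
  continuous A -> continuous (cocycle_nat f A n).
Proof.
move=> cA; elim: n => [|n IH]; first exact: cst_continuous.
move=> x; apply: cont_at_mulmx; last exact: IH.
apply: (@continuous_comp _ _ _ (iter n f) A); last exact: cA.
by apply: continuous_iter; exact: homeo_fun_continuous.
Qed.

Lemma continuous_bounded (F : T -> R) : compact [set: T] -> continuous F ->
  exists2 K : R, 1 <= K & forall x, `|F x| <= K.
Proof.
move=> cT cF; have cFT : compact (F @` [set: T]).
  by apply: continuous_compact => //; apply: continuous_subspaceT.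
have [K [_ HK]] := compact_bounded cFT.
exists (`|K| + 1); first by rewrite lerDr.
move=> x; apply: (HK (`|K| + 1)); last by exists x.
by apply: le_lt_trans (ler_norm K) _; rewrite ltrDl.
Qed.
End ContinuousMatrices.

Section Measurability.
Variables (R : realType) (M : ptopologicalType).

Lemma continuous_measurable_real (F : M -> R) : continuous F ->
  measurable_fun [set: borel M] F.
Proof.
move=> cF; apply: (measurability _ (RGenOpens.measurableE R)).
move=> _ [_ [a [b ->]] <-]; rewrite setTI; apply: sub_sigma_algebra.
apply: open_comp => //; exact: interval_open.
Qed.

Lemma continuous_measurable_self (F : M -> M) : continuous F ->
  measurable_fun [set: borel M] (F : _ -> borel M).
Proof.
move=> cF; apply: (@measurability _ _ (borel M) (borel M) _ _ (@open M)) => //.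
move=> _ [U oU <-]; rewrite setTI; apply: sub_sigma_algebra.
exact: open_comp.
Qed.
End Measurability.

Lemma minor_sum1_ge1 (R : realType) d p : (p <= d)%N -> 1 <= minor_sum p (1%:M : 'M[R]_d).
Proof.
move=> pd; pose s (i : 'I_p) := widen_ord pd i.
have := le_minor_sum (1%:M : 'M[R]_d) s s.
suff -> : mxsub s s 1%:M = 1%:M :> 'M[R]_p by rewrite det1 normr1.
by apply/matrixP => i j; rewrite !mxE.
Qed.

Section LogMinors.
Variables (R : realType) (d : nat) (M : ptopologicalType) (mu : probability (borel M) R) (f : homeomorphism M).
Hypotheses (M_compact : compact [set: M]) (mu_invariant : preserves mu f).
Variable A : M -> 'M[R]_d.
Hypotheses (cA : continuous A) (uA : forall x, A x \in unitmx).
Local Notation fi := (homeo_inv f).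
Local Notation X := (cocycle_nat f A).
Local Notation w := minor_sum.

(** The value at n = 0 is set to 0 because the bound [C * n%:R] demands it, whereas [w p 1%:M]
    exceeds 1 in general. *)
Definition log_minor p n x : R := if n is 0 then 0 else ln (w p (X n x)).

(** Almost everywhere the sum of the p largest exponents. Being a lower limit it is defined at every
    point, and for p <= d it is measurable, bounded and invariant without exceptional set. *)
Definition exponent_sum p : M -> R :=
  linf (T := borel M) (log_minor p).

Lemma minor_cocycle_gt0 p n x : (p <= d)%N -> 0 < w p (X n x).
Proof. by move=> pd; apply: minor_sum_gt0 => //; exact: cocycle_nat_unit. Qed.

Lemma log_minor_bound p : (p <= d)%N -> exists2 C : R, 0 <= C &
  forall x, (ln (w p (A x)) <= C /\ ln (w p (invmx (A x))) <= C).
Proof.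
move=> pd.
have [K1 K1_ge HK1] := continuous_bounded M_compact (continuous_minor_sum (p := p) cA).
have [K2 K2_ge HK2] := continuous_bounded M_compact
  (continuous_minor_sum (p := p) (continuous_invmx uA cA)).
exists (ln (Num.max K1 K2)) => [|x]; first by rewrite ln_ge0 // le_max K1_ge.
have m0 : 0 < Num.max K1 K2 by rewrite lt_max (lt_le_trans ltr01 K1_ge).
split; rewrite ler_ln ?posrE ?minor_sum_gt0 ?unitmx_inv // le_max.
  by rewrite (le_trans (ler_norm _) (HK1 x)).
by rewrite (le_trans (ler_norm _) (HK2 x)) orbT.
Qed.

Lemma ln_minorM p (B D : 'M[R]_d) : (p <= d)%N -> B \in unitmx -> D \in unitmx ->
  ln (w p (B *m D)) <= ln (w p B) + ln (w p D).
Proof.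
move=> pd uB uD; have uBD : B *m D \in unitmx by rewrite unitmx_mul uB uD.
rewrite -lnM ?posrE ?minor_sum_gt0 // ler_ln ?posrE ?mulr_gt0 ?minor_sum_gt0 //.
exact: minor_sumM.
Qed.

Lemma ln_minorM_lower p (B D : 'M[R]_d) : (p <= d)%N -> B \in unitmx -> D \in unitmx ->
  ln (w p D) <= ln (w p (invmx B)) + ln (w p (B *m D)) /\
  ln (w p B) <= ln (w p (B *m D)) + ln (w p (invmx D)).
Proof.
move=> pd uB uD; have uBD : B *m D \in unitmx by rewrite unitmx_mul uB uD.
by split; [rewrite -{1}(mulKmx uB D)|rewrite -{1}(mulmxK uD B)]; apply: ln_minorM;
  rewrite ?unitmx_inv.
Qed.

Lemma log_minorD p m n x : (p <= d)%N ->
  log_minor p (m + n) x <= log_minor p n x + log_minor p m (iter n f x).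
Proof.
move=> pd; case: n m => [|n] [|m] //=; rewrite ?addr0 ?add0r ?addn0 //.
rewrite addnS -addSn -[X in ln (w p X)]/(X (m.+1 + n).+1 x) -addnS cocycle_natD addrC.
by apply: ln_minorM => //; exact: cocycle_nat_unit.
Qed.

Lemma log_minor_step_of p (C : R) : (p <= d)%N -> 0 <= C ->
  (forall x, ln (w p (A x)) <= C /\ ln (w p (invmx (A x))) <= C) ->
  [/\ (forall n x, `|log_minor p n x| <= C * n%:R),
      (forall n x, `|log_minor p n.+1 x - log_minor p n (f x)| <= C) &
      (forall n x, `|log_minor p n.+1 x - log_minor p n x| <= C)].
Proof.
move=> pd C0 HC.
have one x : `|ln (w p (A x))| <= C.
  have [H1 H2] := HC x; rewrite ler_norml H1 andbT lerNl.
  apply: le_trans H2; rewrite -subr_ge0 opprK.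
  have := ln_minorM pd (uA x) (eq_ind_r is_true (uA x) (unitmx_inv (A x))).
  rewrite mulmxV // addrC; apply: le_trans.
  by rewrite ln_ge0 // minor_sum1_ge1.
have S1 n x : `|log_minor p n.+1 x - log_minor p n x| <= C.
  case: n => [|n]; first by rewrite /= subr0 mulmx1.
  have uX := cocycle_nat_unit f uA n.+1 x.
  have [H1 H2] := HC (iter n.+1 f x).
  have [H3 _] := ln_minorM_lower pd (uA (iter n.+1 f x)) uX.
  have H4 := ln_minorM pd (uA (iter n.+1 f x)) uX.
  rewrite /log_minor -[X n.+2 x]/(A (iter n.+1 f x) *m X n.+1 x).
  by rewrite ler_norml; apply/andP; split; lra.
split => //.
  elim=> [|n IH] x; first by rewrite normr0 mulr0.
  have -> : log_minor p n.+1 x = (log_minor p n.+1 x - log_minor p n x) + log_minor p n x.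
    by rewrite subrK.
  apply: le_trans (ler_normD _ _) _.
  by have := S1 n x; have := IH x; rewrite -natr1; lra.
case=> [|n] x; first by rewrite /= subr0 mulmx1.
have uX := cocycle_nat_unit f uA n.+1 (f x).
have [H1 H2] := HC x.
have [_ H3] := ln_minorM_lower pd uX (uA x).
have H4 := ln_minorM pd uX (uA x).
have XE : X n.+2 x = X n.+1 (f x) *m A x.
  by have := cocycle_natD f A n.+1 1 x; rewrite addn1 /= mulmx1.
rewrite /log_minor XE.
by rewrite ler_norml; apply/andP; split; lra.
Qed.

Lemma log_minor_step p : (p <= d)%N -> exists2 C : R, 0 <= C &
  [/\ (forall n x, `|log_minor p n x| <= C * n%:R),
      (forall n x, `|log_minor p n.+1 x - log_minor p n (f x)| <= C) &
      (forall n x, `|log_minor p n.+1 x - log_minor p n x| <= C)].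
Proof.
move=> pd; have [C C0 HC] := log_minor_bound pd; exists C => //.
exact: log_minor_step_of.
Qed.

Lemma exponent_sum_norm p (C : R) x : (p <= d)%N -> 0 <= C ->
  (forall x, ln (w p (A x)) <= C /\ ln (w p (invmx (A x))) <= C) -> `|exponent_sum p x| <= C.
Proof.
move=> pd C0 HC; have [gC _ _] := log_minor_step_of pd C0 HC.
exact: (linf_norm (T := borel M) gC).
Qed.

Lemma measurable_log_minor p n : (p <= d)%N ->
  measurable_fun [set: borel M] (log_minor p n).
Proof.
move=> pd; case: n => [|n]; first exact: measurable_cst.
apply: (measurableT_comp (@measurable_ln R)).
apply: continuous_measurable_real; apply: continuous_minor_sum.
exact: continuous_cocycle_nat.
Qed.

Local Notation mf := (continuous_measurable_self (@homeo_fun_continuous M f)).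
Local Notation mfi := (continuous_measurable_self (@homeo_inv_continuous M f)).

Lemma bmf_exponent_sum p : (p <= d)%N ->
  bmf (T := borel M) (exponent_sum p).
Proof.
move=> pd; have [C C0 [gC gS gS']] := log_minor_step pd.
exact: (bmf_linf (C := C) (fun n => measurable_log_minor n pd) gC).
Qed.

Lemma exponent_sum_inv p x : (p <= d)%N -> exponent_sum p (f x) = exponent_sum p x.
Proof.
move=> pd; have [C C0 [gC gS gS']] := log_minor_step pd.
exact: (linf_inv (T := borel M) (C := C) gC gS).
Qed.

Lemma mean_log_minor_ge p n : (p <= d)%N ->
  n%:R * mean mu (exponent_sum p) <= mean mu (log_minor p n).
Proof.
move=> pd; have [C C0 [gC gS gS']] := log_minor_step pd.
exact: (mean_g_ge mf mu_invariant (fun k => measurable_log_minor k pd) gC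
  (fun m k x => log_minorD m k x pd)).
Qed.

Lemma mean_log_minor_le p (e : R) : (p <= d)%N -> 0 < e -> exists n0, forall n, (n0 <= n)%N ->
  mean mu (log_minor p n) <= n%:R * (mean mu (exponent_sum p) + e).
Proof.
move=> pd e0; have [C C0 [gC gS gS']] := log_minor_step pd.
exact: (mean_g_le mf mu_invariant (fun k => measurable_log_minor k pd) gC
  (fun m k x => log_minorD m k x pd) gS e0).
Qed.

Lemma ae_regular : {ae mu, forall x, regular f A (exponent_sum ^~ x) x}.
Proof.
pose P p x := (p <= d)%N -> [/\
  (forall dl : R, 0 < dl ->
    exists n0, forall n, (n0 <= n)%N ->
    (forall a k, (0 < k)%N -> (a + k <= 4 * n)%N ->
       w p (X k (iter a f x)) <= expR (k%:R * exponent_sum p x + dl * n%:R)) /\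
    (forall a k, (0 < k)%N -> (k <= a <= 4 * n)%N ->
       w p (X k (iter a fi x)) <= expR (k%:R * exponent_sum p x + dl * n%:R))),
  (forall dl : R, 0 < dl ->
    exists n0, forall n, (n0 <= n)%N -> expR (n%:R * (exponent_sum p x - dl)) <= w p (X n x)),
  (forall dl : R, 0 < dl ->
    exists n0, forall n, (n0 <= n)%N ->
    expR (n%:R * (exponent_sum p x - dl)) <= w p (X n (iter n fi x))) &
  (forall dl : R, 0 < dl -> forall n0,
    exists2 n, (n0 <= n)%N &
    expR ((2 * n)%:R * (exponent_sum p x - dl)) <= w p (X (2 * n) (iter n fi x)))].
suff : {ae mu, forall x, forall p, P p x}.
  apply: ae_imp => x H; split=> p pd; [have [h _ _ _] := H p pd|have [_ h _ _] := H p pd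
    |have [_ _ h _] := H p pd|have [_ _ _ h] := H p pd]; exact: h.
apply: ae_all_nat => p.
have [pd|pd] := leqP p d; last by apply: aeW => x; rewrite /P leqNgt pd.
have [C C0 [gC gS gS']] := log_minor_step pd.
have gD m n x : log_minor p (m + n) x <= log_minor p n x + log_minor p m (iter n f x).
  exact: log_minorD.
have mg n := measurable_log_minor n pd.
have U := upper_ae (T := borel M) (@homeo_funK M f) (@homeo_invK M f) mf mfi mu_invariant mg gC gD gS.
have B := lower_bwd_ae (T := borel M) (@homeo_funK M f) (@homeo_invK M f) mf mfi mu_invariant mg gC gD gS gS'.
have D := lower_mid_ae (T := borel M) (@homeo_funK M f) (@homeo_invK M f) mf mfi mu_invariant mg gC gD gS.
have lnE (a : R) k y : (0 < k)%N -> log_minor p k y <= a -> w p (X k y) <= expR a.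
  case: k => // k _ H; rewrite -[leLHS]lnK ?posrE ?minor_cocycle_gt0 //.
  by rewrite ler_expR.
have lnE' (a : R) k y : (0 < k)%N -> a <= log_minor p k y -> expR a <= w p (X k y).
  case: k => // k _ H; rewrite -[leRHS]lnK ?posrE ?minor_cocycle_gt0 //.
  by rewrite ler_expR.
have nE0 (a : R) y : expR (0 * a) <= w p (X 0 y).
  by rewrite mul0r expR0 /=; exact: minor_sum1_ge1.
move: U B D; apply: filterS3 => x HU HB HD _; split=> dl dl0.
- have [n0 H] := HU dl dl0; exists n0 => n /H[Ha Hb]; split=> a k k0 ak.
    by apply: lnE => //; exact: Ha.
  by apply: lnE => //; exact: Hb.
- have [n0 H] := linf_lb (T := borel M) gC x dl0; exists n0 => -[|n] nn; first exact: nE0.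
  apply: lnE' => //; have := H n.+1 nn.
  by rewrite /avg ler_pdivlMr ?ltr0n // mulrC.
- have [n0 H] := HB dl dl0; exists n0 => -[|n] nn; first exact: nE0.
  by apply: lnE' => //; exact: H.
- move=> n0; have [n nn H] := HD dl n0 dl0; exists n => //.
  case: n H {nn} => [|n] H; first exact: nE0.
  by apply: lnE'.
Qed.
End LogMinors.

(** * Oseledets' theorem: existence, uniqueness and equivariance of the splitting *)

Section Enorm.
Variables (R : realType) (d : nat).
Implicit Type v : 'cV[R]_d.

Lemma norm_le_enorm v : `|v| <= enorm v.
Proof.
apply: mx_norm_le => [|i j]; first exact: sqrtr_ge0.
rewrite ord1 -sqrtr_sqr ler_wsqrtr // (bigD1 i) //= lerDl.
by apply: sumr_ge0 => k _; exact: sqr_ge0.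
Qed.

Lemma enorm_le_norm v : enorm v <= d%:R * `|v|.
Proof.
rewrite -[leRHS]ger0_norm // -sqrtr_sqr ler_wsqrtr // exprMn.
apply: (@le_trans _ _ (\sum_(i < d) `|v| ^+ 2)).
  apply: ler_sum => i _; rewrite -(real_normK (num_real (v i 0))).
  by rewrite lerXn2r ?nnegrE // le_mx_entry.
rewrite sumr_const card_ord -[leLHS]mulr_natl ler_wpM2r ?sqr_ge0 // -natrX ler_nat.
by case: (d) => // m; rewrite expnS expn1 leq_pmulr.
Qed.

Lemma enormZ a v : enorm (a *: v) = `|a| * enorm v.
Proof.
rewrite -sqrtr_sqr -sqrtrM ?sqr_ge0 //; congr Num.sqrt.
by rewrite mulr_sumr; apply: eq_bigr => i _; rewrite mxE exprMn.
Qed.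

Lemma enorm_ge0 v : 0 <= enorm v.
Proof. exact: sqrtr_ge0. Qed.

Lemma enorm_gt0 v : v != 0 -> 0 < enorm v.
Proof. by move=> v0; apply: lt_le_trans (norm_le_enorm v); rewrite normr_gt0. Qed.
End Enorm.

Section Rates.
Variables (R : realType) (d : nat) (Z : nat -> 'M[R]_d).
Hypothesis uZ : forall n, Z n \in unitmx.
Implicit Types (v : 'cV[R]_d) (a l : R).

Definition has_rate v l : Prop :=
  (fun n : nat => (n%:R)^-1 * ln (enorm (Z n *m v))) @ \oo --> l.

Lemma unit_mul_neq0 (B : 'M[R]_d) v : B \in unitmx -> v != 0 -> B *m v != 0.
Proof.
move=> uB; apply: contra => /eqP E; apply/eqP.
by rewrite -(mulKmx uB v) E mulmx0.
Qed.

Lemma has_rateP v l (e : R) : 0 < e -> has_rate v l ->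
  exists n0, forall n, (n0 <= n)%N ->
    n%:R * (l - e) <= ln (enorm (Z n *m v)) <= n%:R * (l + e) /\ (0 < n)%N.
Proof.
move=> e0 /cvgrPdist_le /(_ e e0) [n0 _ H]; exists n0.+1 => n nn.
have n_gt0 : (0 < n)%N by apply: leq_trans nn.
have nR : 0 < n%:R :> R by rewrite ltr0n.
split=> //.
have := H n (ltnW nn); rewrite /= ler_norml => /andP[H1 H2].
by apply/andP; split; [rewrite -ler_pdivlMl //|rewrite -ler_pdivrMl //]; lra.
Qed.

Lemma rate_slow v l a : v != 0 -> has_rate v l -> slowv Z a v <-> l <= a.
Proof.
move=> v0 rv; have nv : 0 < `|v| by rewrite normr_gt0.
split=> [sv|la].
  apply/ler_addgt0Pr => e e0; have e4 : 0 < e / 4 by rewrite divr_gt0.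
  have [n1 H1] := has_rateP e4 rv; have [n2 H2] := sv _ e4.
  have [n3 H3] := const_expR (d%:R * `|v|) e4.
  pose n := maxn n1 (maxn n2 n3).
  have [/andP[lo _] n_gt0] := H1 n (leq_maxl _ _).
  have n2n : (n2 <= n)%N by rewrite /n; lia.
  have n3n : (n3 <= n)%N by rewrite /n; lia.
  have nR : 0 < n%:R :> R by rewrite ltr0n.
  have Zv : 0 < enorm (Z n *m v) by apply: enorm_gt0; exact: unit_mul_neq0.
  have : expR (n%:R * (l - e / 4)) <= expR (e / 4 * n%:R + n%:R * (a + e / 4)).
    apply: (@le_trans _ _ (enorm (Z n *m v))); first by rewrite -[leRHS]lnK ?ler_expR // posrE.
    apply: le_trans (enorm_le_norm _) _.
    apply: le_trans (ler_wpM2l (ler0n _ _) (H2 n n2n)) _.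
    rewrite mulrCA mulrC expRD ler_wpM2r ?expR_ge0 //; exact: H3.
  rewrite ler_expR => H; have en : 0 <= e * n%:R by rewrite mulr_ge0 // ltW.
  rewrite -(ler_pM2l nR); move: (n%:R : R) en H => N en H; lra.
move=> dl dl0; have dl2 : 0 < dl / 2 by rewrite divr_gt0.
have [n1 H1] := has_rateP dl2 rv; have [n2 H2] := const_expR (`|v|^-1) dl2.
exists (maxn n1 n2) => n; rewrite geq_max => /andP[/H1 [/andP[_ hi] n_gt0] /H2 c].
have Zv : 0 < enorm (Z n *m v) by apply: enorm_gt0; exact: unit_mul_neq0.
apply: le_trans (norm_le_enorm _) _.
rewrite -ler_pdivrMr //.
have E : enorm (Z n *m v) <= expR (n%:R * (l + dl / 2)).
  by rewrite -[leLHS]lnK ?ler_expR // posrE.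
apply: le_trans (ler_pM (enorm_ge0 _) _ E c) _; first by rewrite invr_ge0 ltW.
rewrite -expRD ler_expR -[dl / 2 * _]mulrC -mulrDr ler_wpM2l //; lra.
Qed.

Lemma slow_fast_rate v a : v != 0 -> slowv Z a v -> fastv Z a v -> has_rate v a.
Proof.
move=> v0 sv fv; apply/cvgrPdist_le => e e0.
have nv : 0 < `|v| by rewrite normr_gt0.
have e4 : 0 < e / 4 by rewrite divr_gt0.
have [n1 H1] := sv _ e4; have [n2 H2] := fv _ e4.
have [n3 H3] := const_expR (d%:R * `|v|) e4.
have [n4 H4] := const_expR (`|v|^-1) e4.
exists (maxn 1 (maxn n1 (maxn n2 (maxn n3 n4)))) => // n /=.
rewrite !geq_max => /and5P[n_gt0 /H1 h1 /H2 h2 /H3 h3 /H4 h4].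
have nR : 0 < n%:R :> R by rewrite ltr0n.
have Zv : 0 < enorm (Z n *m v) by apply: enorm_gt0; exact: unit_mul_neq0.
have up : enorm (Z n *m v) <= expR (e / 4 * n%:R + n%:R * (a + e / 4)).
  apply: le_trans (enorm_le_norm _) _.
  apply: le_trans (ler_wpM2l (ler0n _ _) h1) _.
  by rewrite mulrCA mulrC expRD ler_wpM2r ?expR_ge0.
have lo : expR (n%:R * (a - e / 4) - e / 4 * n%:R) <= enorm (Z n *m v).
  apply: le_trans (norm_le_enorm _); apply: le_trans h2.
  rewrite expRD ler_wpM2l ?expR_ge0 // expRN -[leRHS]invrK lef_pV2 ?posrE ?invr_gt0 ?expR_gt0 //.
have := up; rewrite -[leLHS]lnK ?posrE // ler_expR => {}up.
have := lo; rewrite -[leRHS]lnK ?posrE // ler_expR => {}lo.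
rewrite ler_distlC mulrC ler_pdivlMr // ler_pdivrMr //.
have en : 0 <= e * n%:R by rewrite mulr_ge0 // ltW.
by move: (ln _) (n%:R : R) up lo en => h N up lo en; apply/andP; split; lra.
Qed.
End Rates.

Section MaxComponent.
Variables (R : realType) (V : zmodType) (I : finType) (S : R -> V -> Prop) (r : I -> R) (u : I -> V).
Hypotheses (SD : forall a x y, S a x -> S a y -> S a (x + y))
  (SN : forall a x, S a x -> S a (- x)) (S0 : forall a, S a 0)
  (Sw : forall a b x, a <= b -> S a x -> S b x)
  (r_inj : injective r)
  (Su : forall i a, u i != 0 -> S a (u i) <-> r i <= a).

Lemma max_component_sum a (P : pred I) : (forall i, P i -> u i != 0 -> r i <= a) ->
  S a (\sum_(i | P i) u i).
Proof.
move=> H; elim/big_ind: _ => [||i Pi]; [exact: S0|exact: SD|].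
by have [->|ui] := eqVneq (u i) 0; [exact: S0|apply/Su => //; exact: H].
Qed.

(** Let j be the nonzero component of largest rate. If r j exceeded a, then u j, as the sum minus
    the other components, would be slow at a rate below r j. *)
Lemma max_component a i : S a (\sum_i u i) -> u i != 0 -> r i <= a.
Proof.
move=> Sa ui0.
case: (arg_maxP r (P := fun j => u j != 0) ui0) => j uj jmax.
suff : r j <= a by apply: le_trans; exact: jmax.
rewrite leNgt; apply/negP => aj.
pose b := \big[Num.max/a]_(i | (u i != 0) && (i != j)) r i.
have bj : b < r j.
  apply/bigmax_ltP; split=> // k /andP[uk kj].
  by rewrite lt_neqAle (inj_eq r_inj) kj; exact: jmax.
have ab : a <= b by exact: bigmax_ge_id.
suff : S b (u j) by move/(Su b uj); rewrite leNgt bj.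
have -> : u j = (\sum_i u i) - \sum_(i | i != j) u i.
  by rewrite [in X in X - _](bigD1 j) //= addrK.
apply: SD; first exact: Sw Sa.
apply: SN; apply: max_component_sum => k kj uk.
by apply: le_bigmax_cond; rewrite uk.
Qed.
End MaxComponent.

Section VspaceSums.
Variables (R : realType) (V : vectType R).
Implicit Types E : nat -> {vspace V}.

Lemma sumv_ind (Q : V -> Prop) (I : eqType) (r : seq I) (E : I -> {vspace V}) :
  Q 0 -> (forall x y, Q x -> Q y -> Q (x + y)) ->
  (forall i v, i \in r -> v \in E i -> Q v) ->
  forall v, v \in (\sum_(i <- r) E i)%VS -> Q v.
Proof.
move=> Q0 QD; elim: r => [|i r IH] H v; first by rewrite big_nil memv0 => /eqP ->.
rewrite big_cons => /memv_addP[x xi [y yr ->]]; apply: QD.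
  by apply: (H i) => //; rewrite mem_head.
by apply: IH => // j w jr; apply: H; rewrite in_cons jr orbT.
Qed.

Lemma dim_sumv_le (I : Type) (r : seq I) (E : I -> {vspace V}) :
  (\dim (\sum_(i <- r) E i)%VS <= \sum_(i <- r) \dim (E i))%N.
Proof.
elim: r => [|i r IH]; first by rewrite !big_nil dimv0.
rewrite !big_cons; have := dimv_sum_cap (E i) (\sum_(j <- r) E j)%VS; lia.
Qed.

Lemma split_sum_cut k j E : (j <= k)%N ->
  directv (\sum_(i < k) E i) -> (\sum_(i < k) E i)%VS = fullv ->
  let lo := (\sum_(0 <= i < j) E i)%VS in let hi := (\sum_(j <= i < k) E i)%VS in
  [/\ (lo :&: hi = 0)%VS, (lo + hi = fullv)%VS,
      \dim lo = (\sum_(0 <= i < j) \dim (E i))%N &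
      \dim hi = (\sum_(j <= i < k) \dim (E i))%N].
Proof.
move=> jk dE full lo hi; have /directvP /= D := dE.
have lohi : (lo + hi = fullv)%VS by rewrite -full -(big_mkord xpredT E) (big_cat_nat (leq0n j) jk).
have Dn : (\dim (fullv : {vspace V}) = \sum_(0 <= i < j) \dim (E i) + \sum_(j <= i < k) \dim (E i))%N.
  by rewrite -full D -(big_mkord xpredT (fun i => \dim (E i))) (big_cat_nat (leq0n j) jk).
have dl := dim_sumv_le (index_iota 0 j) E.
have dh := dim_sumv_le (index_iota j k) E.
have := dimv_sum_cap lo hi; rewrite lohi Dn.
rewrite -/lo in dl; rewrite -/hi in dh.
move: dl dh; set a := (\sum_(0 <= i < j) _)%N; set b := (\sum_(j <= i < k) _)%N => dl dh S.
have cap0 : \dim (lo :&: hi) = 0%N by lia.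
split=> //; try lia.
by apply/eqP; rewrite -dimv_eq0 cap0.
Qed.
End VspaceSums.

Section OseledetsTheory.
Variables (R : realType) (d : nat) (M : topologicalType) (f : homeomorphism M) (A : M -> 'M[R]_d).
Hypothesis uA : forall x, A x \in unitmx.
Local Notation fi := (homeo_inv f).
Local Notation X := (cocycle_nat f A).

Definition back_cocycle x n : 'M[R]_d := invmx (X n (iter n fi x)).

Lemma back_cocycle_unit x n : back_cocycle x n \in unitmx.
Proof. by rewrite unitmx_inv cocycle_nat_unit. Qed.

Lemma two_sidedE x v l : two_sided_exponent f A x v l <->
  has_rate (X ^~ x) v l /\ has_rate (back_cocycle x) v (- l).
Proof.
rewrite /two_sided_exponent /has_rate.
have -> : (fun n : nat => (- n%:R)^-1 * ln (enorm (cocycle f A (- n%:Z) x *m v))) =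
   (fun n : nat => - (n%:R^-1 * ln (enorm (back_cocycle x n *m v)))).
  by apply/funext => n; rewrite cocycle_back invrN mulNr.
split=> -[H1 H2]; split=> //; last by rewrite -[l]opprK; exact: cvgN.
rewrite (_ : (fun _ => _) = (fun n : nat => - - (n%:R^-1 * ln (enorm (back_cocycle x n *m v))))).
  exact: cvgN.
by apply/funext => n; rewrite opprK.
Qed.

Section AtPoint.
Variables (x : M) (s : seq (R * {vspace 'cV[R]_d})).
Hypothesis os : is_oseledets f A x s.
Local Notation k := (size s).
Local Notation E i := (nth 0%VS (unzip2 s) i).
Local Notation l i := (nth 0 (unzip1 s) i).

Lemma osel_lt i j : (i < j < k)%N -> l j < l i.
Proof.
move=> /andP[ij jk]; have [S _ _] := os.
have tr : transitive (fun a b : R => b < a) by move=> a b c h1 h2; exact: lt_trans h2 h1.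
by apply: (sorted_ltn_nth tr 0 S) => //; rewrite inE size_map // (ltn_trans ij).
Qed.

Lemma osel_le i j : (i <= j < k)%N -> l j <= l i.
Proof.
rewrite leq_eqVlt => /andP[/orP[/eqP -> //|ij] jk].
by apply: ltW; apply: osel_lt; rewrite ij.
Qed.

Lemma osel_exp i v : (i < k)%N -> v \in E i -> v != 0 ->
  has_rate (X ^~ x) v (l i) /\ has_rate (back_cocycle x) v (- l i).
Proof.
move=> ik vE v0; have [_ _ H] := os; apply/two_sidedE.
have := H (nth (0, 0%VS) s i) (mem_nth _ ik) v.
by rewrite /unzip1 /unzip2 !(nth_map (0, 0%VS)) //; apply; rewrite // -(nth_map _ 0%VS).
Qed.

Lemma osel_fwd i v a : (i < k)%N -> v \in E i -> v != 0 ->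
  slow_fwd f A x a v <-> l i <= a.
Proof.
move=> ik vE v0; apply: rate_slow => //; first by move=> n; exact: cocycle_nat_unit.
exact: (osel_exp ik vE v0).1.
Qed.

Lemma osel_bwd i v a : (i < k)%N -> v \in E i -> v != 0 ->
  slow_bwd f A x a v <-> - l i <= a.
Proof.
move=> ik vE v0; apply: rate_slow => //; first by move=> n; exact: back_cocycle_unit.
exact: (osel_exp ik vE v0).2.
Qed.

Lemma slowv0 (Z : nat -> 'M[R]_d) a : slowv Z a 0.
Proof. by move=> dl _; exists 0%N => n _; rewrite mulmx0 !normr0 mulr0. Qed.

Lemma slowvW (Z : nat -> 'M[R]_d) a b v : a <= b -> slowv Z a v -> slowv Z b v.
Proof.
move=> ab sv dl dl0; have [n0 H] := sv dl dl0; exists n0 => n /H; move=> h.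
by apply: le_trans h _; rewrite ler_wpM2r // ler_expR ler_wpM2l // lerD2r.
Qed.

Lemma slowvN (Z : nat -> 'M[R]_d) a v : slowv Z a v -> slowv Z a (- v).
Proof. by rewrite -scaleN1r; exact: slowvZ. Qed.

Lemma osel_l_inj (i j : 'I_k) : l i = l j -> i = j.
Proof.
move=> E; apply/val_inj; have [ij|ji|//] := ltngtP i j.
  by have := @osel_lt i j; rewrite ij ltn_ord E ltxx => /(_ isT).
by have := @osel_lt j i; rewrite ji ltn_ord E ltxx => /(_ isT).
Qed.

Lemma osel_component (u : 'I_k -> 'cV[R]_d) (i : 'I_k) a : (forall i, u i \in E i) ->
  u i != 0 ->
  (slow_fwd f A x a (\sum_i u i) -> l i <= a) /\
  (slow_bwd f A x a (\sum_i u i) -> - l i <= a).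
Proof.
move=> uE ui; split=> S.
  apply: (@max_component R _ _ (slow_fwd f A x) (fun i : 'I_k => l i) u) S ui => //.
  - by move=> *; exact: slowvD.
  - by move=> *; exact: slowvN.
  - by move=> *; exact: slowv0.
  - by move=> ? ? ? ab; exact: slowvW.
  - by move=> *; exact: osel_l_inj.
  - by move=> j b uj; exact: osel_fwd.
apply: (@max_component R _ _ (slow_bwd f A x) (fun i : 'I_k => - l i) u) S ui => //.
- by move=> *; exact: slowvD.
- by move=> *; exact: slowvN.
- by move=> *; exact: slowv0.
- by move=> ? ? ? ab; exact: slowvW.
- by move=> i1 i2 /oppr_inj; exact: osel_l_inj.
- by move=> j b uj; exact: osel_bwd.
Qed.

Lemma osel_decomp v : exists2 u : 'I_k -> 'cV[R]_d, forall i, u i \in E i & v = \sum_i u i.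
Proof.
have [_ [_ _ full] _] := os.
have : v \in (\sum_(i < k) E i)%VS by rewrite full memvf.
by move=> /memv_sumP[u uE vE]; exists u => // i; exact: uE.
Qed.

(** Slowness in both directions pins the exponents of all components of v to l i. The space is thus
    described by the cocycle alone, which is the source of uniqueness. *)
Lemma osel_space_mem v i : (i < k)%N ->
  (slow_fwd f A x (l i) v /\ slow_bwd f A x (- l i) v) <-> v \in E i.
Proof.
move=> ik; split=> [[sf sb]|vE]; last first.
  have [->|v0] := eqVneq v 0; first by split; exact: slowv0.
  by split; [apply/(osel_fwd _ ik vE v0)|apply/(osel_bwd _ ik vE v0)].
have [u uE vE] := osel_decomp v; rewrite vE.
apply: rpred_sum => j _; have [->|uj] := eqVneq (u j) 0; first exact: mem0v.
rewrite vE in sf sb.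
have l1 := (osel_component _ uE uj).1 sf.
have l2 := (osel_component _ uE uj).2 sb.
suff /(congr1 val) /= -> : Ordinal ik = j by exact: uE.
by apply: osel_l_inj => /=; apply/le_anti; rewrite l1 -lerN2 l2.
Qed.

Lemma osel_hi_slow j v : (j < k)%N -> v \in (\sum_(j <= i < k) E i)%VS -> slow_fwd f A x (l j) v.
Proof.
move=> jk; move: v; apply: sumv_ind; [exact: slowv0|by move=> *; exact: slowvD|].
move=> i v; rewrite mem_index_iota => /andP[ji ik] vE.
have [->|v0] := eqVneq v 0; first exact: slowv0.
by apply/(osel_fwd _ ik vE v0); apply: osel_le; rewrite ji.
Qed.

Lemma osel_lo_slow j v : (j < k)%N -> v \in (\sum_(0 <= i < j.+1) E i)%VS ->
  slow_bwd f A x (- l j) v.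
Proof.
move=> jk; move: v; apply: sumv_ind; [exact: slowv0|by move=> *; exact: slowvD|].
move=> i v; rewrite mem_index_iota => /andP[_ ij] vE.
have ik : (i < k)%N by apply: leq_ltn_trans jk.
have [->|v0] := eqVneq v 0; first exact: slowv0.
by apply/(osel_bwd _ ik vE v0); rewrite lerN2; apply: osel_le; rewrite jk andbT.
Qed.
End AtPoint.

(** A nonzero vector of a space of s has a nonzero component in some space of s'. Its two slowness
    bounds force equal exponents, and then [osel_space_mem] identifies the spaces. *)
Lemma oseledets_sub x s s' : is_oseledets f A x s -> is_oseledets f A x s' ->
  {subset s <= s'}.
Proof.
move=> os os' p ps.
have E1 (i : nat) t : nth (0 : R) (unzip1 t) i = (nth (0, 0%VS : {vspace 'cV[R]_d}) t i).1.
  have [it|it] := ltnP i (size t); first by rewrite (nth_map (0, 0%VS)).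
  by rewrite !nth_default // size_map.
have E2 (i : nat) t : nth (0%VS : {vspace 'cV[R]_d}) (unzip2 t) i = (nth (0 : R, 0%VS) t i).2.
  have [it|it] := ltnP i (size t); first by rewrite (nth_map (0, 0%VS)).
  by rewrite !nth_default // size_map.
have ex t t' i v : is_oseledets f A x t -> is_oseledets f A x t' -> (i < size t)%N ->
    v \in (nth (0 : R, 0%VS) t i).2 -> v != 0 ->
    exists j, [/\ (j < size t')%N, (nth (0 : R, 0%VS) t' j).1 = (nth (0 : R, 0%VS) t i).1 &
      v \in (nth (0 : R, 0%VS) t' j).2].
  move=> ot ot' it vi v0.
  have [sf sb] : slow_fwd f A x (nth (0 : R, 0%VS) t i).1 v /\
      slow_bwd f A x (- (nth (0 : R, 0%VS) t i).1) v.
    by rewrite -E1; apply/(osel_space_mem ot) => //; rewrite E2.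
  have [u uE vE] := osel_decomp ot' v.
  have [j uj] : exists j, u j != 0.
    apply: contrapT => nu; move/eqP: v0; apply; rewrite vE big1 // => j _.
    by apply: contrapT => /eqP uj; apply: nu; exists j.
  rewrite vE in sf sb.
  have l1 := (osel_component ot' _ uE uj).1 sf.
  have l2 := (osel_component ot' _ uE uj).2 sb.
  have lj : (nth (0 : R, 0%VS) t' j).1 = (nth (0 : R, 0%VS) t i).1.
    by apply/le_anti; rewrite -E1 l1 -lerN2 l2.
  exists j; split=> //.
  rewrite -E2; apply/(osel_space_mem ot') => //; rewrite E1 lj vE; split=> //.
have pE : p = nth (0, 0%VS) s (index p s) by rewrite nth_index.
have ik : (index p s < size s)%N by rewrite index_mem.
have [_ [nz _ _] _] := os.
have := nz _ ik; rewrite E2 -pE => p0.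
have [v vp v0] : exists2 v, v \in p.2 & v != 0 by exists (vpick p.2); rewrite ?memv_pick ?vpick0.
have [j [jk lj vj]] := ex s s' _ v os os' ik (etrans (congr1 (fun q : R * {vspace 'cV[R]_d} => v \in q.2) (esym pE)) vp) v0.
rewrite -pE in lj.
suff -> : p = nth (0, 0%VS) s' j by exact: mem_nth.
apply: injective_projections; first by [].
apply/vspaceP => z.
have H1 := osel_space_mem os z ik; rewrite E1 E2 -pE in H1.
have H2 := osel_space_mem os' z jk; rewrite E1 E2 lj in H2.
by apply/idP/idP => h; [apply/H2/H1|apply/H1/H2].
Qed.

Lemma oseledets_uniq x s s' : is_oseledets f A x s -> is_oseledets f A x s' -> s = s'.
Proof.
move=> os os'; have [S _ _] := os; have [S' _ _] := os'.
apply: (@irr_sorted_eq _ (relpre fst (fun a b : R => b < a))).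
- by move=> a b c /= h1 h2; exact: lt_trans h2 h1.
- by move=> a /=; exact: ltxx.
- by move: S; rewrite sorted_map.
- by move: S'; rewrite sorted_map.
- by move=> p; apply/idP/idP => ps; [apply: (oseledets_sub os os')|apply: (oseledets_sub os' os)].
Qed.

Lemma oseledetsE x s : is_oseledets f A x s -> oseledets f A x = s.
Proof.
move=> os; apply: (oseledets_uniq _ os).
by rewrite /oseledets; apply: xgetPex; exists s.
Qed.

Section Assembly.
Local Notation w := minor_sum.
Variables (Lam : nat -> R) (x : M).
Hypothesis reg : regular f A Lam x.
Local Notation lam := (exponent Lam).
Local Notation Y n := (X n (iter n fi x)).

Lemma ratio_bounds (a b : R) (l l' dl : R) n :
  expR (n%:R * (l - dl / 4)) <= a -> a <= expR (n%:R * l + dl / 4 * n%:R) ->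
  expR (n%:R * (l' - dl / 4)) <= b -> b <= expR (n%:R * l' + dl / 4 * n%:R) ->
  0 <= dl ->
  expR (n%:R * (l' - l - dl)) <= b / a <= expR (n%:R * (l' - l + dl)).
Proof.
move=> a1 a2 b1 b2 dl0.
have a0 : 0 < a by apply: lt_le_trans a1; exact: expR_gt0.
have dn : 0 <= dl * n%:R by rewrite mulr_ge0.
apply/andP; split.
  rewrite ler_pdivlMr //; apply: le_trans b1.
  apply: le_trans (ler_wpM2l (expR_ge0 _) a2) _.
  by rewrite -expRD ler_expR; lra.
rewrite ler_pdivrMr //; apply: le_trans b2 _.
apply: le_trans (ler_wpM2l (expR_ge0 _) a1).
by rewrite -expRD ler_expR; lra.
Qed.

Lemma gain_rate p (dl : R) : (p < d)%N -> 0 < dl -> exists n0, forall n, (n0 <= n)%N ->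
  expR (n%:R * (lam p - dl)) <= gain p (X n x) <= expR (n%:R * (lam p + dl)) /\
  expR (n%:R * (lam p - dl)) <= gain p (Y n) <= expR (n%:R * (lam p + dl)).
Proof.
move=> pd dl0; have dl4 : 0 < dl / 4 by rewrite divr_gt0.
have [n1 H1] := reg_bounds reg (ltnW pd) dl4.
have [n2 H2] := reg_bounds reg pd dl4.
exists (maxn 1 (maxn n1 n2)) => n; rewrite !geq_max => /and3P[n0 /H1 b1 /H2 b2].
have n_4 : (0 + n <= 4 * n)%N by lia.
have n_4' : (n <= n <= 4 * n)%N by lia.
split; apply: ratio_bounds; rewrite ?(ltW dl0) //.
- exact: bnd_lo b1.
- exact: (bnd_up b1 n0 n_4).
- exact: bnd_lo b2.
- exact: (bnd_up b2 n0 n_4).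
- exact: bnd_lob b1.
- exact: (bnd_upb b1 n0 n_4').
- exact: bnd_lob b2.
- exact: (bnd_upb b2 n0 n_4').
Qed.

Lemma full_dim (U : {vspace 'cV[R]_d}) v : \dim U = d -> v \in U.
Proof.
move=> dU; have /eqP -> : U == fullv by rewrite -dimv_leqif_eq ?subvf // dU dimvf /dim /= muln1.
exact: memvf.
Qed.

(** Bounds valid for all vectors, from the extreme gains; they take the place of [regular_gap] at
    the ends p = 0 and p = d. *)
Lemma all_rates (dl : R) : (0 < d)%N -> 0 < dl -> exists n0, forall n, (n0 <= n)%N ->
  forall Z, Z = X n x \/ Z = Y n -> forall v : 'cV[R]_d,
    expR (n%:R * (lam d.-1 - dl)) * `|v| <= `|Z *m v| <= expR (n%:R * (lam 0 + dl)) * `|v|.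
Proof.
move=> d0 dl0; have [C C1 HC] := gain_spaces R d.
have dl2 : 0 < dl / 2 by rewrite divr_gt0.
have d1 : (d.-1 < d)%N by rewrite prednK.
have [n1 H1] := gain_rate d0 dl2; have [n2 H2] := gain_rate d1 dl2.
have [n3 H3] := const_expR C dl2.
exists (maxn n1 (maxn n2 n3)) => n; rewrite !geq_max => /and3P[/H1 g1 /H2 g2 /H3 c] Z ZE v.
have uZ : Z \in unitmx by case: ZE => ->; exact: cocycle_nat_unit.
have [gZ1 gZ2] : gain 0 Z <= expR (n%:R * (lam 0 + dl / 2)) /\
    expR (n%:R * (lam d.-1 - dl / 2)) <= gain d.-1 Z.
  by case: g1 g2 ZE => /andP[_ ?] /andP[_ ?] [/andP[? _] /andP[? _]] [->|->].
have [[U [dU HU]] _] := HC 0%N (leq0n d) Z uZ.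
have [_ /(_ d1)[V [dV HV]]] := HC d.-1 (ltnW d1) Z uZ.
have C0 : 0 < C by apply: lt_le_trans C1.
apply/andP; split.
  rewrite -(ler_pM2l C0); apply: le_trans (HV v _); last by apply: full_dim; rewrite dV prednK.
  rewrite mulrA ler_wpM2r //; apply: le_trans gZ2.
  by apply: le_trans (ler_wpM2r (expR_ge0 _) c) _; rewrite -expRD ler_expR; lra.
apply: le_trans (HU v _) _; first by apply: full_dim; rewrite dU subn0.
rewrite mulrA ler_wpM2r //; apply: le_trans (ler_pM (ltW C0) (gain_ge0 _ _) c gZ1) _.
by rewrite -expRD ler_expR; lra.
Qed.

Lemma all_fwd v : (0 < d)%N -> slow_fwd f A x (lam 0) v /\ fastv (fun n => X n x) (lam d.-1) v.
Proof.
move=> d0; split=> dl /(all_rates d0)[n0 H];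
  by exists n0 => n /H/(_ _ (or_introl erefl) v)/andP[].
Qed.

Lemma all_bwd v : (0 < d)%N -> slow_bwd f A x (- lam d.-1) v /\ fastv (back_cocycle x) (- lam 0) v.
Proof.
move=> d0; have uY n : Y n \in unitmx by exact: cocycle_nat_unit.
split=> dl /(all_rates d0)[n0 H]; exists n0 => n /H/(_ _ (or_intror erefl) (invmx (Y n) *m v));
  rewrite mulKVmx // => /andP[h1 h2].
  have -> : n%:R * (- lam d.-1 + dl) = - (n%:R * (lam d.-1 - dl)) by ring.
  by rewrite expRN ler_pdivlMl ?expR_gt0.
by rewrite -opprD mulrN expRN ler_pdivrMl ?expR_gt0.
Qed.

(** The ends 0 and d count as gaps, so that every block of equal exponents lies between two
    consecutive gaps. *)
Definition is_gap p := [|| p == 0%N, p == d | lam p < lam p.-1].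

Record gap_spaces p (F B : {vspace 'cV[R]_d}) : Prop := GapSpaces {
  gap_dimF : \dim F = (d - p)%N;
  gap_dimB : \dim B = p;
  gap_cap : (F :&: B = 0)%VS;
  gap_slowF : (p < d)%N -> forall v, v \in F <-> slow_fwd f A x (lam p) v;
  gap_slowB : (0 < p)%N -> forall v, v \in B <-> slow_bwd f A x (- lam p.-1) v;
  gap_fastF : (0 < p)%N -> forall v, v \notin F -> fastv (fun n => X n x) (lam p.-1) v;
  gap_fastB : (p < d)%N -> forall v, v \notin B -> fastv (back_cocycle x) (- lam p) v }.

Lemma gap_exists p : (p <= d)%N -> is_gap p -> exists F B, gap_spaces p F B.
Proof.
move=> pd; rewrite /is_gap => gp.
have dfull : \dim (fullv : {vspace 'cV[R]_d}) = d by rewrite dimvf /dim /= muln1.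
have [p0|p0] := posnP p.
  exists fullv, 0%VS; split; rewrite ?p0 // ?dfull ?subn0 ?dimv0 ?capv0 //.
    by move=> d0 v; rewrite memvf; split=> // _; exact: (all_fwd v d0).1.
  by move=> d0 v _; exact: (all_bwd v d0).2.
have [pE|pnd] := eqVneq p d.
  have d0 : (0 < d)%N by rewrite -pE.
  exists 0%VS, fullv; rewrite pE; split; rewrite ?ltnn ?dfull ?subnn ?dimv0 ?cap0v //.
    by move=> _ v; rewrite memvf; split=> // _; exact: (all_bwd v d0).1.
  by move=> _ v _; exact: (all_fwd v d0).2.
have {}pd : (p < d)%N by rewrite ltn_neqAle pnd.
move: gp; rewrite (negbTE pnd) (gtn_eqF p0) /= => gap.
case: p p0 pd gap {pnd} => // p _ pd gap.
have [F [B [dF dB FB [H1 H2] [H3 H4]]]] := regular_gap uA reg pd gap.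
by exists F, B; split.
Qed.

Lemma exponent_le p q : (p <= q < d)%N -> lam q <= lam p.
Proof.
move=> /andP[pq qd]; have [n qE] : exists n, q = (p + n)%N by exists (q - p)%N; lia.
move: qd; rewrite {}qE {pq}; elim: n => [|n IH] nd; first by rewrite addn0.
rewrite addnS; apply: le_trans (IH _); last by lia.
by apply: (exponent_decr uA reg); lia.
Qed.

Lemma next_gap p : (p < d)%N -> exists p', [/\ (p < p' <= d)%N, is_gap p' &
  forall i, (p <= i < p')%N -> lam i = lam p].
Proof.
move=> pd; have ex : exists q, (p < q)%N && is_gap q by exists d; rewrite pd /is_gap eqxx orbT.
case: (ex_minnP ex) => p' /andP[pp' gp'] pmin.
have p'd : (p' <= d)%N by apply: pmin; rewrite pd /is_gap eqxx orbT.
exists p'; rewrite pp' p'd; split=> // i /andP[p_i ip'].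
have [n iE] : exists n, i = (p + n)%N by exists (i - p)%N; lia.
move: ip'; rewrite {}iE {p_i}; elim: n => [|n IH] np'; first by rewrite addn0.
rewrite -IH ?addnS; last by lia.
apply/le_anti; apply/andP; split; first by apply: (exponent_decr uA reg); lia.
rewrite leNgt; apply/negP => gap.
suff : (p' <= (p + n).+1)%N by rewrite leqNgt -addnS np'.
by apply: pmin; apply/andP; split; [lia|rewrite /is_gap gap !orbT].
Qed.

(** Induction on d - p. Between consecutive gaps p < p' the Oseledets space is the intersection of
    the forward slow space at p with the backward slow space at p': each of them bounds the rates
    from one side, and not lying in the other space of each pair bounds them from the other side. *)
Lemma filtration p (F B : {vspace 'cV[R]_d}) : (p <= d)%N -> is_gap p -> gap_spaces p F B ->
  exists s : seq (R * {vspace 'cV[R]_d}),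
  [/\ sorted (fun a b : R => b < a) (unzip1 s),
      (forall q, q \in s -> (p < d)%N /\ q.1 <= lam p),
      (forall q, q \in s -> q.2 != 0%VS /\
         forall v, v \in q.2 -> v != 0 -> two_sided_exponent f A x v q.1),
      (\sum_(q <- s) q.2)%VS = F /\ \dim F = (\sum_(q <- s) \dim q.2)%N &
      flatten [seq nseq (\dim q.2) q.1 | q <- s] = [seq lam i | i <- iota p (d - p)]].
Proof.
move=> pd; move En : (d - p)%N => n; elim: n {-2}n (leqnn n) p pd En F B => [|m IH] n nm p pd En F B gp GS.
  have n0 : n = 0%N by lia.
  have F0 : F = 0%VS by apply/eqP; rewrite -dimv_eq0 (gap_dimF GS) En n0.
  by exists [::]; split=> //; rewrite ?n0 // !big_nil F0 dimv0.
have [n0|n_gt0] := posnP n.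
  have nm0 : (n <= m)%N by rewrite n0.
  exact: (IH n nm0 p pd En F B gp GS).
have p_lt : (p < d)%N by lia.
have [p' [/andP[pp' p'd] gp' lamE]] := next_gap p_lt.
have [F' [B' GS']] := gap_exists p'd gp'.
have nm' : (d - p' <= m)%N by lia.
have [s [s1 s2 s3 [s4 s4'] s5]] := IH (d - p')%N nm' p' p'd erefl F' B' gp' GS'.
have p'0 : (0 < p')%N by lia.
have lamp' : lam p'.-1 = lam p by apply: lamE; lia.
pose E := (F :&: B')%VS.
have EF' : (E :&: F' = 0)%VS.
  apply/eqP; rewrite -subv0 -(gap_cap GS') subv_cap capvSr andTb.
  by apply: subv_trans (capvSl _ _) _; exact: capvSr.
have FF' : (F' <= F)%VS.
  apply/subvP => v vF'; apply/(gap_slowF GS) => //.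
  have [p'lt|p'ge] := ltnP p' d.
    apply: slowvW ((gap_slowF GS' p'lt v).1 vF').
    by apply: exponent_le; rewrite p'lt andbT ltnW.
  have -> : v = 0; last exact: slowv0.
  apply/eqP; rewrite -memv0; suff -> : 0%VS = F' by [].
  by apply/esym/eqP; rewrite -dimv_eq0 (gap_dimF GS'); lia.
(* Counting dimensions in the sum gives this bound; the opposite one follows because E meets F'
   trivially inside F. *)
have dE_ge : (p' - p <= \dim E)%N.
  have := dimv_sum_cap F B'; rewrite (gap_dimF GS) (gap_dimB GS') -/E.
  have : (\dim (F + B') <= d)%N.
    by have := dimvS (subvf (F + B')%VS); rewrite dimvf /dim /= muln1.
  lia.
have EFF' : (E + F' <= F)%VS by rewrite subv_add capvSl.
have dEF' : \dim (E + F') = (\dim E + (d - p'))%N.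
  by have := dimv_sum_cap E F'; rewrite EF' dimv0 addn0 (gap_dimF GS').
have dE : \dim E = (p' - p)%N.
  by have := dimvS EFF'; rewrite dEF' (gap_dimF GS); lia.
have EFE : (E + F' = F)%VS.
  by apply/eqP; rewrite -dimv_leqif_eq // dEF' (gap_dimF GS) dE; apply/eqP; lia.
have E0 : E != 0%VS by rewrite -dimv_eq0 dE; lia.
exists ((lam p, E) :: s); split.
- case: s s1 s2 {s3 s4 s4' s5} => //= q s s1 s2; rewrite s1 andbT.
  have [p'lt ql] := s2 q (mem_head _ _); apply: le_lt_trans ql _.
  by move: gp'; rewrite /is_gap (gtn_eqF p'0) (ltn_eqF p'lt) /= lamp'.
- move=> q; rewrite in_cons => /orP[/eqP ->|/s2[p'lt ql]]; split=> //.
  by apply: le_trans ql _; apply: exponent_le; rewrite p'lt andbT ltnW.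
- move=> q; rewrite in_cons => /orP[/eqP ->|/s3 //]; split=> // v /= vE v0.
  have [vF vB] := memv_capP vE.
  apply/two_sidedE; split; apply: slow_fast_rate => //.
  + by move=> k; exact: cocycle_nat_unit.
  + exact/(gap_slowF GS).
  + rewrite -lamp'; apply: (gap_fastF GS') => //.
    apply: contra v0 => vF'; rewrite -memv0 -(gap_cap GS') memv_cap vF'; exact: vB.
  + by move=> k; exact: back_cocycle_unit.
  + by rewrite -lamp'; exact/(gap_slowB GS').
  + apply: (gap_fastB GS) => //.
    by apply: contra v0 => vB'; rewrite -memv0 -(gap_cap GS) memv_cap vF.
- rewrite !big_cons /= s4; split; first exact: EFE.
  by rewrite -EFE dEF' -s4' (gap_dimF GS').
rewrite /= s5 dE -En.
have -> : (d - p = (p' - p) + (d - p'))%N by lia.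
rewrite iotaD map_cat subnKC ?(ltnW pp') //; congr (_ ++ _).
apply: (@eq_from_nth _ 0); rewrite size_nseq ?size_map ?size_iota // => i ip.
rewrite nth_nseq ip (nth_map 0%N) ?size_iota // nth_iota // lamE //.
by rewrite leq_addr /= -ltn_subRL.
Qed.

Lemma regular_oseledets : exists s, is_oseledets f A x s /\
  flatten [seq nseq (\dim q.2) q.1 | q <- s] = [seq lam i | i <- iota 0 d].
Proof.
have g0 : is_gap 0 by rewrite /is_gap eqxx.
have [F [B GS]] := gap_exists (leq0n d) g0.
have [s [s1 s2 s3 [s4 s4'] s5]] := filtration (leq0n d) g0 GS.
rewrite subn0 in s5; exists s; split=> //.
have sumE : (\sum_(i < size s) nth 0 (unzip2 s) i)%VS = F.
  by rewrite -s4 -(big_map snd xpredT id) (big_nth 0%VS) big_mkord size_map.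
have Ffull : F = fullv.
  apply/eqP; rewrite -dimv_leqif_eq ?subvf // (gap_dimF GS) subn0.
  by rewrite dimvf /dim /= muln1.
split=> //; last by move=> q /s3[].
split; last by rewrite sumE.
  move=> i ik; rewrite /unzip2 (nth_map (0, 0%VS)) //.
  by have [] := s3 _ (mem_nth (0, 0%VS) ik).
rewrite directvE /= sumE s4' -(big_map snd xpredT (fun U : {vspace _} => \dim U)).
by rewrite (big_nth 0%VS) big_mkord size_map.
Qed.

Lemma lyapunov_regular i : (i < d)%N -> lyapunov f A i x = lam i.
Proof.
move=> id_; have [s [os fl]] := regular_oseledets.
rewrite /lyapunov (oseledetsE os) fl (nth_map 0%N) ?size_iota //.
by rewrite nth_iota.
Qed.
End Assembly.

Lemma img_unitE (B : 'M[R]_d) (E : {vspace 'cV[R]_d}) v : B \in unitmx ->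
  (v \in img B E) = (invmx B *m v \in E).
Proof.
move=> uB; apply/memv_imgP/idP => [[u uE ->]|vE]; first by rewrite lfunE mulKmx.
by exists (invmx B *m v) => //; rewrite lfunE /= mulKVmx.
Qed.

Lemma lker_unit (B : 'M[R]_d) : B \in unitmx -> lker (linfun (mulmx B : 'cV[R]_d -> _)) = 0%VS.
Proof.
move=> uB; apply/eqP; rewrite -subv0; apply/subvP => v.
by rewrite memv_ker lfunE memv0 => /eqP E; rewrite -(mulKmx uB v) /= E mulmx0.
Qed.

Lemma dim_img (B : 'M[R]_d) (E : {vspace 'cV[R]_d}) : B \in unitmx -> \dim (img B E) = \dim E.
Proof. by move=> uB; apply: limg_dim_eq; rewrite lker_unit // capv0. Qed.

Lemma img_sum (B : 'M[R]_d) I (r : seq I) (E : I -> {vspace 'cV[R]_d}) :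
  img B (\sum_(i <- r) E i)%VS = (\sum_(i <- r) img B (E i))%VS.
Proof. exact: limg_sum. Qed.

Lemma splitting_img (B : 'M[R]_d) k (E E' : nat -> {vspace 'cV[R]_d}) : B \in unitmx ->
  (forall i, (i < k)%N -> E' i = img B (E i)) -> is_splitting k E -> is_splitting k E'.
Proof.
move=> uB E'E [nz /directvP /= D full].
have S : (\sum_(i < k) E' i)%VS = fullv.
  transitivity (\sum_(i < k) img B (E i))%VS; first by apply: eq_bigr => i _; exact: E'E.
  rewrite -img_sum full; apply/vspaceP => v; rewrite img_unitE // !memvf; done.
split=> //; first by move=> i ik; rewrite E'E // -dimv_eq0 dim_img // dimv_eq0 nz.
rewrite directvE /= S -full D; apply/eqP.
by apply: eq_bigr => i _; rewrite E'E // dim_img.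
Qed.

Lemma ratio_cvg1 : (fun n : nat => (n.+1%:R : R)^-1 * n%:R) @ \oo --> (1 : R).
Proof.
rewrite (_ : (fun _ => _) = fun n : nat => 1 - harmonic n); last first.
  apply/funext => n; rewrite /harmonic /= -[X in X - _](mulVf (lt0r_neq0 (ltr0Sn R n))).
  by rewrite -[X in _ - X]mulr1 -mulrBr -natr1 addrK.
by rewrite -[X in _ --> X]subr0; apply: cvgB; [exact: cvg_cst|exact: cvg_harmonic].
Qed.

Lemma rate_shift (h : nat -> R) (l : R) :
  (fun n : nat => n%:R^-1 * h n) @ \oo --> l <->
  (fun n : nat => n.+1%:R^-1 * h n) @ \oo --> l.
Proof.
split=> H.
  rewrite -[l]mul1r; apply: cvg_trans (cvgM ratio_cvg1 H).
  apply: near_eq_cvg; exists 1%N => // n /= n0.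
  by rewrite mulrA mulfK // pnatr_eq0 -lt0n.
have iv : (fun n : nat => (n.+1%:R^-1 * n%:R : R)^-1) @ \oo --> (1 : R).
  by rewrite -[X in _ --> X]invr1; apply: cvgV; [exact: oner_neq0|exact: ratio_cvg1].
rewrite -[l]mul1r; apply: cvg_trans (cvgM iv H).
apply: near_eq_cvg; exists 1%N => // n /= n0.
by rewrite invfM invrK mulrACA mulfV // mul1r.
Qed.

(** Passing from x to f x shifts the time index by one, and n / (n + 1) tends to 1. *)
Lemma exponent_equivariant x v l : two_sided_exponent f A x v l <->
  two_sided_exponent f A (f x) (A x *m v) l.
Proof.
rewrite !two_sidedE /has_rate.
have XS n : X n (f x) *m (A x *m v) = X n.+1 x *m v.
  by have := cocycle_natD f A n 1 x; rewrite addn1 /= mulmx1 => ->; rewrite mulmxA.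
have YS n : back_cocycle (f x) n.+1 *m (A x *m v) = back_cocycle x n *m v.
  rewrite /back_cocycle iterSr homeo_funK -[X n.+1 _]/(A (iter n f (iter n fi x)) *m X n _).
  rewrite iter_homeo_invK.
  have uX := cocycle_nat_unit f uA n (iter n fi x).
  apply: (can_inj (mulKmx uX)); rewrite mulKVmx //.
  apply: (can_inj (mulKmx (uA x))); rewrite !mulmxA mulmxV ?mul1mx ?unitmx_mul ?uA ?uX //.
split=> -[H1 H2]; split.
- apply/rate_shift.
  rewrite (_ : (fun _ => _) = fun n : nat => n.+1%:R^-1 * ln (enorm (X n.+1 x *m v))); last first.
    by apply/funext => n; rewrite XS.
  by move: H1; rewrite -cvg_shiftS.
- rewrite -cvg_shiftS /=.
  rewrite (_ : (fun _ => _) = fun n : nat => n.+1%:R^-1 * ln (enorm (back_cocycle x n *m v))).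
    exact/rate_shift.
  by apply/funext => n; rewrite YS.
- rewrite -cvg_shiftS /=.
  rewrite (_ : (fun _ => _) = fun n : nat => n.+1%:R^-1 * ln (enorm (X n (f x) *m (A x *m v)))).
    exact/rate_shift.
  by apply/funext => n; rewrite XS.
- apply/rate_shift.
  rewrite (_ : (fun _ => _) = fun n : nat => n.+1%:R^-1 *
      ln (enorm (back_cocycle (f x) n.+1 *m (A x *m v)))); last first.
    by apply/funext => n; rewrite YS.
  by move: H2; rewrite -cvg_shiftS.
Qed.

Lemma oseledets_equivariant x s : is_oseledets f A x s ->
  is_oseledets f A (f x) [seq (q.1, img (A x) q.2) | q <- s].
Proof.
move=> [s1 s2 s3]; split.
- by rewrite /unzip1 -map_comp (@eq_map _ _ _ fst).
- rewrite size_map; apply: splitting_img s2; first exact: (uA x).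
  move=> i ik; rewrite /unzip2 -map_comp.
  by rewrite !(nth_map (0, 0%VS)).
- move=> _ /mapP[q qs ->] v /=; rewrite img_unitE // => vE v0.
  have v1 : invmx (A x) *m v != 0 by apply: unit_mul_neq0; rewrite ?unitmx_inv.
  have := (exponent_equivariant x (invmx (A x) *m v) q.1).1 (s3 q qs _ vE v1).
  by rewrite mulKVmx.
Qed.

Section OnOrbit.
Variable x : M.
Hypothesis ox : forall y, orbitz f x y -> exists s, is_oseledets f A y s.
Local Notation os := (oseledets f A).

Lemma iterz_step n : f (iterz f n x) = iterz f (n + 1) x.
Proof.
case: n => n; first by rewrite -[(_ + 1)%R]/(Posz (n + 1)) addn1.
rewrite /= homeo_invK; case: n => [//|n].
by rewrite (_ : Negz n.+1 + 1 = Negz n) // !NegzE; lia.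
Qed.

Lemma orbit_step y : orbitz f x y -> orbitz f x (f y).
Proof. by move=> [n ->]; exists (n + 1); rewrite iterz_step. Qed.

Lemma orbit_step_inv y : orbitz f x y -> orbitz f x (fi y).
Proof.
move=> [n ->]; exists (n - 1).
by rewrite -[n in LHS](subrK 1) -iterz_step homeo_funK.
Qed.

Lemma orbit_iter n y : orbitz f x y -> orbitz f x (iter n f y).
Proof. by elim: n => //= n IH /IH; exact: orbit_step. Qed.

Lemma orbit_iter_inv n y : orbitz f x y -> orbitz f x (iter n fi y).
Proof. by elim: n => //= n IH /IH; exact: orbit_step_inv. Qed.

Lemma orbit_self : orbitz f x x.
Proof. by exists 0. Qed.

Lemma orbit_ind (T : Type) (h : M -> T) : (forall y, orbitz f x y -> h (f y) = h y) ->
  forall y, orbitz f x y -> h y = h x.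
Proof.
move=> H y [[n|n] ->] /=.
  by elim: n => //= n IH; rewrite H //; apply: orbit_iter; exact: orbit_self.
elim: n => [|n IH] /=.
  by rewrite -[in RHS](homeo_invK f x) H //; apply: orbit_step_inv; exact: orbit_self.
rewrite -IH -[in RHS](homeo_invK f (fi (iter n fi x))) H //.
by apply: (orbit_iter_inv n.+2); exact: orbit_self.
Qed.

Lemma oseledets_orbit y : orbitz f x y -> is_oseledets f A y (os y).
Proof. by move=> /ox[s o]; rewrite (oseledetsE o). Qed.

Lemma oseledets_step y : orbitz f x y ->
  os (f y) = [seq (q.1, img (A y) q.2) | q <- os y].
Proof. by move=> oy; apply: (oseledetsE); apply: oseledets_equivariant; exact: oseledets_orbit. Qed.

Lemma oseledets_unzip1 y : orbitz f x y -> unzip1 (os y) = unzip1 (os x).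
Proof.
apply: (orbit_ind (h := fun y => unzip1 (os y))) => z oz; rewrite oseledets_step //.
by rewrite /unzip1 -map_comp (@eq_map _ _ _ fst).
Qed.

Lemma oseledets_number_orbit y : orbitz f x y -> size (os y) = size (os x).
Proof. move=> oy; rewrite -[LHS](size_map fst) -[RHS](size_map fst).
exact: congr1 (oseledets_unzip1 oy). Qed.

Lemma oseledets_space_step i y : (i < size (os x))%N -> orbitz f x y ->
  img (A y) (oseledets_space f A i y) = oseledets_space f A i (f y).
Proof.
move=> ik oy; rewrite /oseledets_space oseledets_step // /unzip2 -map_comp.
by rewrite !(nth_map (0, 0%VS)) ?oseledets_number_orbit.
Qed.

Lemma oseledets_dim_orbit i y : (i < size (os x))%N -> orbitz f x y ->
  \dim (oseledets_space f A i y) = \dim (oseledets_space f A i x).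
Proof.
move=> ik; apply: (orbit_ind (h := fun y => \dim (oseledets_space f A i y))) => z oz.
by rewrite -oseledets_space_step // dim_img.
Qed.

Lemma oseledets_invariant_splitting :
  invariant_splitting f A (orbitz f x) (oseledets_number f A x) (oseledets_space f A).
Proof.
split.
- move=> y oy; have [_ s2 _] := oseledets_orbit oy.
  by rewrite /oseledets_number -(oseledets_number_orbit oy).
- by move=> i y ik oy; exact: oseledets_space_step.
- move=> i y z ik oy oz.
  exact: (etrans (oseledets_dim_orbit ik oy) (esym (oseledets_dim_orbit ik oz))).
Qed.
End OnOrbit.
End OseledetsTheory.

(** * Integrated exponents as means of exponents of minors *)

Section NullModification.
Context (dd : measure_display) (T : measurableType dd) (R : realType).
Variable mu : probability T R.
Implicit Types (F G : T -> \bar R) (N : set T).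
Local Open Scope ereal_scope.
Import HBNNSimple.

(* The integral of a non-measurable function is still a supremum over simple
   functions, hence does not see null sets. *)
Lemma ge0_integral_off_null F G N : measurable N -> mu N = 0 ->
  (forall x, 0 <= F x) -> (forall x, 0 <= G x) -> (forall x, ~ N x -> F x = G x) ->
  \int[mu]_x F x <= \int[mu]_x G x.
Proof.
move=> mN N0 F0 G0 FG; have mN' : measurable (~` N) by exact: measurableC.
rewrite ge0_integralTE // [leRHS]ge0_integralTE //.
apply/ge_ereal_sup => /= _ [h hF <-].
have -> : sintegral mu h = sintegral mu (proj_nnsfun h mN').
  rewrite -!integralT_nnsfun; apply: ge0_ae_eq_integral => //.
  - by apply/measurable_EFinP; exact: measurable_funPT.
  - by apply/measurable_EFinP; exact: measurable_funPT.
  - by move=> x _; rewrite lee_fin.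
  - by move=> x _; rewrite lee_fin; exact: (@fun_ge0 _ _ (proj_nnsfun h mN')).
  - exists N; split=> // x /= nE; apply: contrapT => nx; apply: nE => _.
    by rewrite mindicE mem_set // mulr1.
apply: ereal_sup_ubound; exists (proj_nnsfun h mN') => //= x.
rewrite mindicE; case: (boolP (x \in ~` N)) => [|_]; last by rewrite mulr0 G0.
by move=> /set_mem nx; rewrite mulr1 -FG //; exact: hF.
Qed.

Lemma integral_eq_off_null F G N : measurable N -> mu N = 0 ->
  (forall x, ~ N x -> F x = G x) -> \int[mu]_x F x = \int[mu]_x G x.
Proof.
move=> mN N0 FG; rewrite integralE [RHS]integralE.
have P x : ~ N x -> F^\+ x = G^\+ x by move=> nx; rewrite !funeposE FG.
have Q x : ~ N x -> F^\- x = G^\- x by move=> nx; rewrite !funenegE FG.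
have sym H K : (forall x, ~ N x -> H x = K x) -> (forall x, 0 <= H x) -> (forall x, 0 <= K x) ->
    \int[mu]_x H x = \int[mu]_x K x.
  move=> HK H0 K0; apply/eqP; rewrite eq_le; apply/andP; split.
    exact: (ge0_integral_off_null mN N0).
  by apply: (ge0_integral_off_null mN N0) => // x nx; rewrite HK.
by rewrite (sym _ _ P) // (sym _ _ Q).
Qed.
End NullModification.

Section LyapunovMean.
Variables (R : realType) (d : nat) (M : ptopologicalType) (mu : probability (borel M) R) (f : homeomorphism M).
Hypotheses (M_compact : compact [set: M]) (mu_invariant : preserves mu f).
Variable A : M -> 'M[R]_d.
Hypotheses (cA : continuous A) (uA : forall x, A x \in unitmx).

Lemma ae_comp (P : M -> Prop) (h : M -> M) : continuous h -> preserves mu h ->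
  {ae mu, forall x, P x} -> {ae mu, forall x, P (h x)}.
Proof.
move=> ch ph [N [mN N0 NP]]; exists (h @^-1` N); split.
- by rewrite -[_ @^-1` _]setTI; exact: (continuous_measurable_self ch).
- by rewrite ph.
- by move=> x /= nP; apply: NP.
Qed.

Lemma preserves_inv : preserves mu (homeo_inv f).
Proof.
exact: (pres_inv (T := borel M) (@homeo_funK M f)
  (continuous_measurable_self (@homeo_inv_continuous M f)) mu_invariant).
Qed.

Lemma ae_orbit (P : M -> Prop) : {ae mu, forall x, P x} ->
  {ae mu, forall x, forall y, orbitz f x y -> P y}.
Proof.
move=> aeP.
have fwd n : {ae mu, forall x, P (iter n f x)}.
  elim: n => // n IH; have := ae_comp (@homeo_fun_continuous M f) mu_invariant IH.
  by apply: ae_imp => x; rewrite -iterSr.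
have bwd n : {ae mu, forall x, P (iter n (homeo_inv f) x)}.
  elim: n => // n IH; have := ae_comp (@homeo_inv_continuous M f) preserves_inv IH.
  by apply: ae_imp => x; rewrite -iterSr.
have := ae_imp2 _ (ae_all_nat fwd) (ae_all_nat bwd); apply=> x Hf Hb y [[n|n] ->] /=.
  exact: Hf.
exact: (Hb n.+1).
Qed.

Lemma ae_orbit_regular : {ae mu, forall x, forall y, orbitz f x y ->
  regular f A (exponent_sum f A ^~ y) y}.
Proof. by apply: ae_orbit; exact: ae_regular. Qed.

Lemma sum_exponents p x :
  \sum_(i < p) exponent (exponent_sum f A ^~ x) i = exponent_sum f A p x.
Proof.
have E0 : exponent_sum f A 0 x = 0.
  have z n y : log_minor f A 0 n y = 0 by case: n => //= n; rewrite minor_sum0 ln1.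
  rewrite /exponent_sum (_ : log_minor f A 0 = fun _ _ => 0); last by do 2 apply/funext => ?.
  have g0 n (y : M) : `|(0 : R)| <= 0 * n%:R by rewrite normr0 mul0r.
  apply/le_anti; have := linf_norm (T := borel M) g0 x.
  by rewrite normr_le0 => /eqP ->; rewrite lexx.
rewrite -(big_mkord xpredT (fun i => exponent _ i)) /exponent telescope_sumr //.
by rewrite E0 subr0.
Qed.

(** [lyapunov] agrees with the differences of [exponent_sum] at regular points only and need not be
    measurable, whence [integral_eq_off_null]. *)
Lemma LE_mean j : (j <= d)%N -> LE mu f A j = mean mu (exponent_sum f A j).
Proof.
move=> jd.
rewrite /LE /mean /Rintegral; congr fine.
have [N [mN N0 NP]] := ae_regular M_compact mu_invariant cA uA.
apply: (integral_eq_off_null mN N0) => x nx; congr EFin.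
have reg : regular f A (exponent_sum f A ^~ x) x.
  by apply: contrapT => nr; apply: nx; exact: NP.
rewrite -sum_exponents; apply: eq_bigr => i _.
by apply: (lyapunov_regular uA reg); exact: leq_trans jd.
Qed.
End LyapunovMean.

(** * Domination in terms of vectors; uniform perturbations of cocycles *)

Section OperatorNorm.
Variables (R : realType) (d : nat).
Implicit Types (B : 'M[R]_d) (E : {vspace 'cV[R]_d}) (v w : 'cV[R]_d).

Lemma enorm0 : enorm (0 : 'cV[R]_d) = 0.
Proof. by rewrite -(scale0r 0) enormZ normr0 mul0r. Qed.

Lemma enorm_bounded B : exists2 K : R, 0 < K & forall v, enorm (B *m v) <= K * enorm v.
Proof.
exists (d%:R * mnorm B + 1) => [|v]; first by rewrite ltr_pwDr // mulr_ge0 // mnorm_ge0.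
apply: le_trans (enorm_le_norm _) _.
apply: (@le_trans _ _ (d%:R * (mnorm B * enorm v))).
  rewrite ler_wpM2l //; apply: le_trans (normrM_mx _ _) _.
  by rewrite ler_wpM2l ?mnorm_ge0 // norm_le_enorm.
by rewrite mulrA mulrDl mul1r lerDl enorm_ge0.
Qed.

Lemma opnorm_ub B E v : v \in E -> enorm (B *m v) <= opnorm_on B E * enorm v.
Proof.
move=> vE; have [->|v0] := eqVneq v 0; first by rewrite mulmx0 enorm0 mulr0.
have n0 := enorm_gt0 v0; rewrite -ler_pdivrMr //.
apply: ub_le_sup.
  have [K K0 HK] := enorm_bounded B; exists K => _ [u [_ u1] <-].
  by have := HK u; rewrite u1 mulr1.
exists ((enorm v)^-1 *: v).
  by split; [exact: memvZ|rewrite enormZ gtr0_norm ?invr_gt0 // mulVf ?gt_eqF].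
by rewrite -scalemxAr enormZ gtr0_norm ?invr_gt0 // mulrC.
Qed.

Lemma opnorm_le B E (c : R) : E != 0%VS ->
  (forall v, v \in E -> enorm (B *m v) <= c * enorm v) -> opnorm_on B E <= c.
Proof.
move=> E0 H; apply: ge_sup.
  have v0 : vpick E != 0 by rewrite vpick0.
  have n0 := enorm_gt0 v0; set v := vpick E in v0 n0.
  exists (enorm (B *m ((enorm v)^-1 *: v))), ((enorm v)^-1 *: v) => //.
  by split; [apply: memvZ; exact: memv_pick|rewrite enormZ gtr0_norm ?invr_gt0 // mulVf ?gt_eqF].
by move=> _ [v [vE v1] <-]; have := H v vE; rewrite v1 mulr1.
Qed.

(** Turns the definition of domination into an inequality between single vectors, the form in which
    it is used and refuted. *)
Lemma opnorm_ratio B E1 E2 (c : R) : B \in unitmx -> E1 != 0%VS -> E2 != 0%VS -> 0 <= c ->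
  opnorm_on B E2 * opnorm_on (invmx B) (img B E1) <= c <->
  forall v w, v \in E1 -> w \in E2 ->
    enorm (B *m w) * enorm v <= c * (enorm (B *m v) * enorm w).
Proof.
move=> uB E10 E20 c0.
have memimg v : v \in E1 -> B *m v \in img B E1 by move=> vE; rewrite img_unitE // mulKmx.
split=> [H v w vE wE|H].
  have H1 := opnorm_ub B wE.
  have := opnorm_ub (invmx B) (memimg _ vE); rewrite mulKmx // => H2.
  apply: le_trans (ler_pM (enorm_ge0 _) (enorm_ge0 _) H1 H2) _.
  by rewrite mulrACA [X in _ * X]mulrC ler_wpM2r // mulr_ge0 // enorm_ge0.
have w0 : vpick E2 != 0 by rewrite vpick0.
have op0 : 0 < opnorm_on B E2.
  have := opnorm_ub B (memv_pick E2).
  rewrite -ler_pdivrMr ?enorm_gt0 //; apply: lt_le_trans.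
  by rewrite divr_gt0 ?enorm_gt0 // unit_mul_neq0.
have img0 : img B E1 != 0%VS by rewrite -dimv_eq0 dim_img // dimv_eq0.
rewrite -ler_pdivlMl //; apply: opnorm_le => // u; rewrite img_unitE // => uE.
have [->|u0] := eqVneq u 0; first by rewrite mulmx0 enorm0 mulr0.
have v0 : invmx B *m u != 0 by apply: unit_mul_neq0; rewrite ?unitmx_inv.
rewrite -mulrA ler_pdivlMl // -ler_pdivlMr ?enorm_gt0 //.
apply: opnorm_le => // w wE.
have := H _ w uE wE; rewrite mulKVmx // => {}H.
by rewrite mulrAC ler_pdivlMr ?enorm_gt0 // -mulrA.
Qed.
End OperatorNorm.

Lemma dominates_ratio (R : realType) (d : nat) (M : topologicalType) (f : homeomorphism M)
  (A : M -> 'M[R]_d) (Gam : set M) (E1 E2 : M -> {vspace 'cV[R]_d}) : (forall x, A x \in unitmx) ->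
  (forall y, Gam y -> E1 y != 0%VS) -> (forall y, Gam y -> E2 y != 0%VS) ->
  dominates f A Gam E1 E2 <-> exists m, forall y, Gam y ->
    forall v w, v \in E1 y -> w \in E2 y ->
      enorm (cocycle_nat f A m y *m w) * enorm v <= 2^-1 * (enorm (cocycle_nat f A m y *m v) * enorm w).
Proof.
move=> uA E10 E20; have h0 : 0 <= 2^-1 :> R by rewrite invr_ge0.
split=> -[m H]; exists m => y Gy.
  have := H y Gy; rewrite /= opnorm_ratio //; [exact: cocycle_nat_unit|exact: E10|exact: E20].
by rewrite /= opnorm_ratio //; [exact: H|exact: cocycle_nat_unit|exact: E10|exact: E20].
Qed.

Section UniformPerturbation.
Variables (R : realType) (d : nat) (M : topologicalType).
Hypothesis M_compact : compact [set: M].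
Implicit Types (A B : M -> 'M[R]_d).

Definition close A B (dl : R) := forall x, `|B x - A x| <= dl.

(** M carries no metric: compactness, through near coverings, is what yields a radius independent of
    x. *)
Lemma uniform_continuity (V : normedModType R) (Phi : 'M[R]_d -> V) A (e : R) :
  continuous A -> (forall x, {for A x, continuous Phi}) -> 0 < e ->
  exists2 dl : R, 0 < dl & forall x Z, `|Z - A x| <= dl -> `|Phi Z - Phi (A x)| <= e.
Proof.
move=> cA cPhi e0.
pose P (n : nat) x := forall Z, `|Z - A x| <= n.+1%:R^-1 -> `|Phi Z - Phi (A x)| <= e.
have cov : \forall n \near \oo, [set: M] `<=` P n.
  have /compact_near_coveringP := M_compact; apply=> x _.
  have /cvgrPdist_le /(_ (e / 2)) := cPhi x; rewrite divr_gt0 // => /(_ isT).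
  move=> /nbhs_ballP[r /= r0 Hr].
  have r2 : 0 < r / 2 by rewrite divr_gt0.
  have [n0 Hn0] := archi_le 1 r2.
  have /cvgrPdist_lt /(_ _ r2) Hx := cA x.
  exists ([set y | `|A x - A y| < r / 2], [set n : nat | (n0 <= n)%N]).
    by split=> //; exists n0.
  move=> [y n] /= [Hy n0n] Z HZ.
  have inv : n.+1%:R^-1 <= r / 2.
    rewrite -[leLHS]mul1r ler_pdivrMr ?ltr0n //; apply: le_trans (Hn0 n n0n) _.
    by rewrite ler_wpM2l ?(ltW r2) // ler_nat.
  have h1 : `|Phi (A x) - Phi Z| <= e / 2.
    apply: Hr; rewrite -ball_normE /= (_ : A x - Z = (A x - A y) - (Z - A y)); last first.
      by rewrite opprB addrA subrK.
    by apply: le_lt_trans (ler_normB _ _) _; have := le_trans HZ inv; move: Hy; lra.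
  have h2 : `|Phi (A x) - Phi (A y)| <= e / 2.
    by apply: Hr; rewrite -ball_normE /=; lra.
  rewrite (_ : Phi Z - _ = (Phi (A x) - Phi (A y)) - (Phi (A x) - Phi Z)); last first.
    by apply/esym; rewrite opprB addrC subrKA.
  by apply: le_trans (ler_normB _ _) _; lra.
have [n _ Hn] := cov; exists n.+1%:R^-1; first by rewrite invr_gt0 ltr0n.
by move=> x; exact: (Hn n (leqnn n)).
Qed.

Lemma continuous_mx_bounded A : continuous A -> exists2 K : R, 1 <= K & forall x, `|A x| <= K.
Proof.
move=> cA; have cn : continuous (fun x => `|A x|) by move=> x; apply: cvg_norm; exact: cA.
have [K K1 HK] := continuous_bounded M_compact cn.
by exists K => // x; have := HK x; rewrite normr_id.
Qed.

Variable f : homeomorphism M.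

Lemma cocycle_close A n (e : R) : continuous A -> 0 < e ->
  exists2 dl : R, 0 < dl & forall B, close A B dl ->
    forall x, `|cocycle_nat f B n x - cocycle_nat f A n x| <= e.
Proof.
move=> cA; elim: n e => [|n IH] e e0.
  by exists 1 => // B _ x; rewrite subrr normr0 ltW.
have [K1 K1_ge HK1] := continuous_mx_bounded cA.
have [K2 K2_ge HK2] := continuous_mx_bounded (continuous_cocycle_nat (f := f) (n := n) cA).
pose D : R := d%:R + 1; have D0 : 0 < D by rewrite ltr_wpDl.
have K10 : 0 < K1 by apply: lt_le_trans K1_ge.
have K20 : 0 < K2 by apply: lt_le_trans K2_ge.
pose e1 := Num.min 1 (e / 2 / (D * (K1 + 1))).
have e10 : 0 < e1 by rewrite lt_min ltr01 !divr_gt0 // mulr_gt0 // addr_gt0.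
have [dl dl0 H] := IH e1 e10.
pose dl1 := Num.min 1 (Num.min dl (e / 2 / (D * K2))).
exists dl1; first by rewrite !lt_min ltr01 dl0 !divr_gt0 // mulr_gt0.
move=> B HB x /=.
have HB1 y : `|B y - A y| <= 1 by apply: le_trans (HB y) _; rewrite ge_min lexx.
have HBd : close A B dl by move=> y; apply: le_trans (HB y) _; rewrite !ge_min lexx orbT.
have HBe y : `|B y - A y| <= e / 2 / (D * K2).
  by apply: le_trans (HB y) _; rewrite !ge_min lexx !orbT.
set y := iter n f x; set Q := cocycle_nat f A n x; set Q' := cocycle_nat f B n x.
have -> : B y *m Q' - A y *m Q = (B y - A y) *m Q + B y *m (Q' - Q).
  by apply/esym; rewrite mulmxBl mulmxBr addrC subrKA.
apply: le_trans (ler_normD _ _) _.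
have By : `|B y| <= K1 + 1.
  by rewrite -[B y](subrK (A y)); apply: le_trans (ler_normD _ _) _; have := HB1 y; have := HK1 y; lra.
have dD : d%:R <= D by rewrite lerDl.
have t1 : `|(B y - A y) *m Q| <= e / 2.
  apply: le_trans (normrM_mx _ _) _; rewrite /mnorm.
  have := HBe y; rewrite ler_pdivlMr ?mulr_gt0 //; apply: le_trans.
  rewrite mulrAC mulrC ler_wpM2l // ler_pM //; exact: HK2.
have t2 : `|B y *m (Q' - Q)| <= e / 2.
  apply: le_trans (normrM_mx _ _) _; rewrite /mnorm.
  have h : `|Q' - Q| <= e / 2 / (D * (K1 + 1)).
    by apply: le_trans (H B HBd x) _; rewrite ge_min lexx orbT.
  have K11 : 0 < K1 + 1 by rewrite addr_gt0.
  have := h; rewrite ler_pdivlMr; last exact: mulr_gt0.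
  apply: le_trans.
  by rewrite mulrC ler_wpM2l // ler_pM.
by lra.
Qed.

Lemma cocycle_fun_close (V : normedModType R) (Phi : 'M[R]_d -> V) A n (e : R) :
  continuous A -> (forall x, A x \in unitmx) ->
  (forall Z, Z \in unitmx -> {for Z, continuous Phi}) -> 0 < e ->
  exists2 dl : R, 0 < dl & forall B, close A B dl ->
    forall x, `|Phi (cocycle_nat f B n x) - Phi (cocycle_nat f A n x)| <= e.
Proof.
move=> cA uA cPhi e0.
have [e1 e10 He] := uniform_continuity (continuous_cocycle_nat (f := f) (n := n) cA)
  (fun x => cPhi _ (cocycle_nat_unit f uA n x)) e0.
have [dl dl0 H] := cocycle_close n cA e10.
by exists dl => // B HB x; apply: He; exact: H.
Qed.
End UniformPerturbation.

(** * Cone fields and the uniform consequences of domination *)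

Section ConeChain.
Variables (R : realType) (d p : nat).
Hypothesis pd : (p < d)%N.
Implicit Types (Z : 'M[R]_d) (v : 'cV[R]_d).

(** When the quotient of consecutive gains is small, this matrix is small on the image of the p + 1
    strongest directions of Z, while [fwd_weight] is small on the d - p - 1 weakest directions. A
    lower bound on the sum of both norms, for Z and the next factor, says that these spaces form an
    angle. *)
Definition back_weight Z : 'M[R]_d := gain p.+1 Z *: invmx Z.
Definition fwd_weight Z : 'M[R]_d := (gain p Z)^-1 *: Z.
Definition gain_quot Z : R := gain p.+1 Z / gain p Z.

Lemma cont_weights Z : Z \in unitmx ->
  [/\ {for Z, continuous back_weight}, {for Z, continuous fwd_weight} &
      {for Z, continuous gain_quot}].
Proof.
move=> uZ; have cid : {for Z, continuous (fun Y : 'M[R]_d => Y)} by exact: cvg_id.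
have g0 := lt0r_neq0 (gain_gt0 uZ pd).
have cg : {for Z, continuous (fun Y : 'M[R]_d => gain p Y)} by apply: cont_at_gain => //; exact: ltnW.
have cg1 : {for Z, continuous (fun Y : 'M[R]_d => gain p.+1 Y)} by exact: cont_at_gain.
split.
- by apply: cont_at_scale => //; exact: cont_at_invmx.
- by apply: cont_at_scale => //; exact: cont_at_inv.
- by apply: cont_at_mul => //; exact: cont_at_inv.
Qed.

Fixpoint chain_prod (Z : nat -> 'M[R]_d) n : 'M[R]_d :=
  if n is m.+1 then Z m *m chain_prod Z m else 1%:M.

Lemma chain_prod_unit (Z : nat -> 'M[R]_d) n :
  (forall k, Z k \in unitmx) -> chain_prod Z n \in unitmx.
Proof. by move=> uZ; elim: n => [|n IH] /=; [exact: unitmx1|rewrite unitmx_mul uZ]. Qed.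

(* The cone |Z_k v| >= c * gain p (Z_k) |v| is mapped into the next one. *)
Lemma cone_step (b e : R) Z Z' v : 0 < b -> Z \in unitmx -> Z' \in unitmx ->
  gain_quot Z <= e -> e <= (b / 2) * (b / 2) ->
  (forall u : 'cV[R]_d, `|u| = 1 -> b <= `|back_weight Z *m u| + `|fwd_weight Z' *m u|) ->
  (b / 2) * gain p Z * `|v| <= `|Z *m v| ->
  (b / 2) * gain p Z' * `|Z *m v| <= `|Z' *m (Z *m v)|.
Proof.
move=> b0 uZ uZ' q e_le H cone.
have [->|v0] := eqVneq v 0; first by rewrite !mulmx0 normr0 mulr0.
have z0 : 0 < `|Z *m v| by rewrite normr_gt0 unit_mul_neq0.
have g0 := gain_gt0 uZ pd; have g0' := gain_gt0 uZ' pd.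
pose u := `|Z *m v|^-1 *: (Z *m v).
have u1 : `|u| = 1 by rewrite /u normrZ gtr0_norm ?invr_gt0 // mulVf ?gt_eqF.
have := H u u1.
have -> : `|fwd_weight Z' *m u| = (gain p Z')^-1 * (`|Z *m v|^-1 * `|Z' *m (Z *m v)|).
  by rewrite /u /fwd_weight -scalemxAl -scalemxAr !normrZ !gtr0_norm ?invr_gt0.
have : `|back_weight Z *m u| <= b / 2.
  rewrite /u /back_weight -scalemxAl -scalemxAr mulKmx // normrZ (ger0_norm (gain_ge0 _ _)).
  rewrite normrZ gtr0_norm ?invr_gt0 //.
  rewrite mulrCA -ler_pdivlMl ?invr_gt0 // invrK.
  move: q; rewrite /gain_quot ler_pdivrMr // => q.
  have b2 : 0 < b / 2 by rewrite divr_gt0.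
  apply: le_trans (ler_wpM2r (normr_ge0 _) q) _.
  apply: (@le_trans _ _ (b / 2 * (b / 2) * gain p Z * `|v|)).
    by rewrite ler_wpM2r // ler_wpM2r // ltW.
  by rewrite -mulrA -mulrA mulrC -[leRHS]mulrC [leRHS]mulrC ler_wpM2r ?(ltW b2) // mulrA.
set t := (X in _ + X) => h1 h2; have : b / 2 <= t by lra.
rewrite ler_pdivlMl // ler_pdivlMl // => h.
by rewrite mulrC [b / 2 * _]mulrC; exact: h.
Qed.

(** A space of dimension p + 1 well expanded by the first factor remains in the cones, hence is
    expanded at each step by b / 2 times the gain; [gain_extremal] reads off the gain of the whole
    product. *)
Lemma cone_chain : exists2 C : R, 1 <= C & forall (b e : R) (Z : nat -> 'M[R]_d),
  0 < b -> b <= C^-1 -> (forall k, Z k \in unitmx) ->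
  (forall k, gain_quot (Z k) <= e) -> e <= (b / 2) * (b / 2) ->
  (forall k (u : 'cV[R]_d), `|u| = 1 -> b <= `|back_weight (Z k) *m u| + `|fwd_weight (Z k.+1) *m u|) ->
  forall n, \prod_(k < n) (b / 2 * gain p (Z k)) <= C * gain p (chain_prod Z n).
Proof.
have [C1 C1_ge H1] := gain_spaces R d; have [C2 C2_ge H2] := gain_extremal R d.
pose C := Num.max C1 C2.
have C1C : C1 <= C by rewrite le_max lexx.
have C2C : C2 <= C by rewrite le_max lexx orbT.
have C1_0 : 0 < C1 by apply: lt_le_trans C1_ge.
have C0 : 0 < C by apply: lt_le_trans C1C.
exists C; first exact: le_trans C1C.
move=> b e Z b0 bC uZ q e_le H n.
have [_ /(_ pd)[V [dV HV]]] := H1 p (ltnW pd) (Z 0%N) (uZ 0%N).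
have cone v k : v \in V ->
    (b / 2) * gain p (Z k) * `|chain_prod Z k *m v| <= `|Z k *m (chain_prod Z k *m v)|.
  move=> vV; elim: k => [|k IH] /=; last by rewrite -mulmxA; exact: (cone_step b0 (uZ k) (uZ k.+1) (q k) e_le (H k) IH).
  rewrite mul1mx; have := HV v vV.
  rewrite -ler_pdivrMl //; apply: le_trans.
  rewrite -mulrA ler_wpM2r //; first by apply: mulr_ge0 => //; exact: gain_ge0.
  have : C^-1 <= C1^-1 by rewrite lef_pV2 ?posrE.
  by move: bC; lra.
have grow v : v \in V -> (\prod_(k < n) (b / 2 * gain p (Z k))) * `|v| <= `|chain_prod Z n *m v|.
  move=> vV; elim: n => [|n IH] /=; first by rewrite big_ord0 mul1r mul1mx.
  rewrite big_ord_recr /= -mulmxA; apply: le_trans (cone v n vV).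
  rewrite mulrAC mulrC ler_wpM2l // mulr_ge0 ?gain_ge0 //; lra.
have [H3 _] := H2 p pd _ (chain_prod_unit n uZ).
apply: le_trans (H3 V _ _ grow) _; first by rewrite dV.
by rewrite ler_wpM2r ?gain_ge0.
Qed.
End ConeChain.

Section Good.
Variables (R : realType) (d p : nat) (M : topologicalType) (f : homeomorphism M).
Hypothesis pd : (p < d)%N.

Section Set_.
Variables (A : M -> 'M[R]_d) (k : R).

(* A closed condition implied by domination at index p.+1 along the orbit. *)
Definition good (y : M) : Prop := forall N, (0 < N)%N ->
  gain_quot p (cocycle_nat f A N y) <= k * expR (- (N%:R / k)) /\
  forall v : 'cV[R]_d, `|v| = 1 -> k^-1 <=
    `|back_weight p (cocycle_nat f A N y) *m v| +
    `|fwd_weight p (cocycle_nat f A N (iter N f y)) *m v|.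

Definition good_orbit : set M := [set x | forall y, orbitz f x y -> good y].

Lemma closed_le_fun (h1 h2 : M -> R) : continuous h1 -> continuous h2 ->
  closed [set x | h1 x <= h2 x].
Proof.
move=> c1 c2; rewrite (_ : [set x | _] = (fun x => h2 x - h1 x) @^-1` [set t | 0 <= t]).
  apply: closed_comp; last exact: closed_ge.
  by move=> x _; apply: cvgB; [exact: c2|exact: c1].
by apply/seteqP; split=> x /=; rewrite subr_ge0.
Qed.

Lemma closed_good : continuous A -> (forall x, A x \in unitmx) -> closed good.
Proof.
move=> cA uA.
have cX N := continuous_cocycle_nat (f := f) (n := N) cA.
have uX N y := cocycle_nat_unit f uA N y.
have w_cont N (Phi : 'M[R]_d -> 'M[R]_d) : (forall Z, Z \in unitmx -> {for Z, continuous Phi}) ->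
    continuous (fun y => Phi (cocycle_nat f A N y)).
  by move=> cPhi y; apply: continuous_comp; [exact: cX|exact: cPhi].
have nv_cont (F : M -> 'M[R]_d) (v : 'cV[R]_d) : continuous F -> continuous (fun y => `|F y *m v|).
  by move=> cF y; apply: cvg_norm; apply: cont_at_mulmx; [exact: cF|exact: cst_continuous].
rewrite (_ : good = \bigcap_(N in [set N | (0 < N)%N])
   ([set y | gain_quot p (cocycle_nat f A N y) <= k * expR (- (N%:R / k))] `&`
    \bigcap_(v in [set v : 'cV[R]_d | `|v| = 1]) [set y | k^-1 <=
    `|back_weight p (cocycle_nat f A N y) *m v| +
    `|fwd_weight p (cocycle_nat f A N (iter N f y)) *m v|])); last first.
  apply/seteqP; split=> y H N N0 /=; have := H N N0.
    by move=> [h1 h2]; split=> // v; exact: h2.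
  by move=> [h1 h2]; split=> // v; exact: h2.
apply: closed_bigI => N N0; apply: closedI.
  apply: closed_le_fun; last exact: cst_continuous.
  by move=> y; apply: continuous_comp; [exact: cX|have [_ _ h] := cont_weights pd (uX N y); exact: h].
apply: closed_bigI => v _; apply: closed_le_fun; first exact: cst_continuous.
have cb : continuous (fun y => `|back_weight p (cocycle_nat f A N y) *m v|).
  apply: (nv_cont (fun y => back_weight p (cocycle_nat f A N y))).
  by apply: (w_cont N (back_weight p)) => Z uZ; have [h _ _] := cont_weights pd uZ; exact: h.
have cf : continuous (fun y => `|fwd_weight p (cocycle_nat f A N y) *m v|).
  apply: (nv_cont (fun y => fwd_weight p (cocycle_nat f A N y))).
  by apply: (w_cont N (fwd_weight p)) => Z uZ; have [_ h _] := cont_weights pd uZ; exact: h.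
move=> y; apply: cvgD; first exact: cb.
apply: (@continuous_comp _ _ _ (iter N f) (fun y => `|fwd_weight p (cocycle_nat f A N y) *m v|)).
  by apply: continuous_iter; exact: homeo_fun_continuous.
exact: cf.
Qed.
End Set_.

Lemma chain_cocycle (A : M -> 'M[R]_d) N n x :
  chain_prod (fun k => cocycle_nat f A N (iter (k * N) f x)) n = cocycle_nat f A (n * N) x.
Proof. by elim: n => //= n ->; rewrite mulSn cocycle_natD. Qed.

Lemma good_mono (A : M -> 'M[R]_d) (k k' : R) y : 0 < k -> k <= k' -> good A k y -> good A k' y.
Proof.
move=> k0 kk' H N N0; have k0' : 0 < k' by apply: lt_le_trans kk'.
have ii : k'^-1 <= k^-1 by rewrite lef_pV2 ?posrE.
have [h1 h2] := H N N0; split; last by move=> v v1; apply: le_trans (h2 v v1).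
apply: le_trans h1 _; rewrite ler_pM ?expR_ge0 ?(ltW k0) // ler_expR lerN2.
by rewrite ler_wpM2l.
Qed.
End Good.

Lemma eq_ler (R : realType) (x y : R) : x = y -> x <= y.
Proof. by move=> ->. Qed.

Lemma dim_add_line (R : realType) (d k : nat) (U : {vspace 'cV[R]_d}) (v : 'cV[R]_d) :
  \dim U = k -> v \notin U -> \dim (U + <[v]>)%VS = k.+1.
Proof.
move=> dU vU; have v0 : v != 0 by apply: contraNneq vU => ->; exact: mem0v.
have cap0 : (U :&: <[v]> = 0)%VS.
  apply/eqP; rewrite -subv0; apply/subvP => z /memv_capP[zU /vlineP[a za]].
  rewrite memv0 za; have [->|a0] := eqVneq a 0; first by rewrite scale0r.
  case/negP: vU; rewrite -(scalerK a0 v) -za; exact: memvZ.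
by have := dimv_sum_cap U <[v]>; rewrite cap0 dimv0 addn0 dU dim_vline v0 addn1.
Qed.

Section DominatedOrbit.
Variables (R : realType) (d : nat) (M : topologicalType) (f : homeomorphism M).
Hypothesis M_compact : compact [set: M].
Variable A : M -> 'M[R]_d.
Hypotheses (cA : continuous A) (uA : forall x, A x \in unitmx).
Local Notation X := (cocycle_nat f A).

Lemma cocycle_lipschitz : exists2 L : R, 1 <= L & forall n x (v : 'cV[R]_d),
  `|X n x *m v| <= L ^+ n * `|v| /\ `|v| <= L ^+ n * `|X n x *m v|.
Proof.
have [K1 K1_ge HK1] := continuous_mx_bounded M_compact cA.
have [K2 K2_ge HK2] := continuous_mx_bounded M_compact (continuous_invmx uA cA).
pose L := (d%:R + 1) * Num.max K1 K2.
have K1L : d%:R * K1 <= L.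
  by rewrite ler_pM ?(le_trans ler01 K1_ge) ?lerDl // le_max lexx.
have K2L : d%:R * K2 <= L.
  by rewrite ler_pM ?(le_trans ler01 K2_ge) ?lerDl // le_max lexx orbT.
have L1 : 1 <= L.
  rewrite /L -[leLHS]mulr1 ler_pM // ?lerDr // le_max K1_ge //.
have L0 : 0 <= L by apply: le_trans L1.
have one x (v : 'cV[R]_d) : `|A x *m v| <= L * `|v| /\ `|v| <= L * `|A x *m v|.
  split.
    apply: le_trans (normrM_mx _ _) _; rewrite ler_wpM2r //.
    by apply: le_trans K1L; rewrite ler_wpM2l.
  rewrite -{1}(mulKmx (uA x) v); apply: le_trans (normrM_mx _ _) _; rewrite ler_wpM2r //.
  by apply: le_trans K2L; rewrite ler_wpM2l.
exists L => //; elim=> [|n IH] x v /=; first by rewrite mul1mx expr0 mul1r lexx.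
rewrite -mulmxA; have [h1 h2] := IH x v; have [h3 h4] := one (iter n f x) (X n x *m v).
split.
  by apply: le_trans h3 _; rewrite exprS -mulrA ler_wpM2l.
by apply: le_trans h2 _; rewrite exprSr -mulrA ler_wpM2l // exprn_ge0.
Qed.
Variable p : nat.
Hypothesis pd : (p.+1 < d)%N.
Variables (Gam : set M) (V F : M -> {vspace 'cV[R]_d}) (x0 : M).
Hypotheses (Gx0 : Gam x0) (Gf : forall y, Gam y -> Gam (f y))
  (dV : forall y, Gam y -> \dim (V y) = p.+1)
  (dF : forall y, Gam y -> \dim (F y) = (d - p.+1)%N)
  (VF : forall y, Gam y -> (V y :&: F y = 0)%VS)
  (iV : forall y, Gam y -> img (A y) (V y) = V (f y))
  (iF : forall y, Gam y -> img (A y) (F y) = F (f y)).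

Lemma Gam_iter n y : Gam y -> Gam (iter n f y).
Proof. by elim: n => //= n IH /IH; exact: Gf. Qed.

Lemma mem_inv (E : M -> {vspace 'cV[R]_d}) n y v :
  (forall y, Gam y -> img (A y) (E y) = E (f y)) -> Gam y ->
  (X n y *m v \in E (iter n f y)) = (v \in E y).
Proof.
move=> iE Gy; elim: n v => [|n IH] v /=; first by rewrite mul1mx.
by rewrite -iE; [rewrite img_unitE // -mulmxA mulKmx|exact: Gam_iter].
Qed.

Lemma split_mem y u : Gam y -> exists v w, [/\ v \in V y, w \in F y & u = v + w].
Proof.
move=> Gy; have : u \in (V y + F y)%VS.
  apply: full_dim; have := dimv_sum_cap (V y) (F y).
  by rewrite VF // dimv0 addn0 dV // dF // subnKC // ltnW.
by move=> /memv_addP[v vV [w wF ->]]; exists v, w.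
Qed.

Hypothesis dom : exists m, forall y, Gam y -> forall v w, v \in V y -> w \in F y ->
  enorm (X m y *m w) * enorm v <= 2^-1 * (enorm (X m y *m v) * enorm w).

(** Blocks of m steps multiply their factors 1/2 into an exponential rate; Q absorbs the incomplete
    block and the change from the Euclidean to the sup norm. *)
Lemma domination_rate : exists2 Q : R, 1 <= Q & exists2 tau : R, 0 < tau &
  forall N y v w, Gam y -> v \in V y -> w \in F y ->
    `|X N y *m w| * `|v| <= Q * expR (- (tau * N%:R)) * (`|X N y *m v| * `|w|).
Proof.
have [m H] := dom; have [L L1 HL] := cocycle_lipschitz.
(* For m = 0 the inequality would compare two nonzero vectors with themselves and give 1 <= 1/2. *)
have m0 : (0 < m)%N.
  case: m H => // H; exfalso.
  have V0 : V x0 != 0%VS by rewrite -dimv_eq0 dV.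
  have F0 : F x0 != 0%VS by rewrite -dimv_eq0 dF // subn_eq0 -ltnNge.
  have v0 : vpick (V x0) != 0 by rewrite vpick0.
  have w0 : vpick (F x0) != 0 by rewrite vpick0.
  have := H x0 Gx0 _ _ (memv_pick _) (memv_pick _); rewrite /= !mul1mx.
  rewrite [X in _ <= _ * X]mulrC; set t := _ * _; have : 0 < t by rewrite mulr_gt0 ?enorm_gt0.
  by lra.
have blocks q y v w : Gam y -> v \in V y -> w \in F y ->
    enorm (X (q * m) y *m w) * enorm v <= 2^-1 ^+ q * (enorm (X (q * m) y *m v) * enorm w).
  move=> Gy vV wF; elim: q => [|q IH].
    by rewrite mul0n /= !mul1mx expr0 mul1r mulrC.
  have [->|v0] := eqVneq v 0; first by rewrite !mulmx0 enorm0 !(mulr0, mul0r).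
  have [->|w0] := eqVneq w 0; first by rewrite !mulmx0 enorm0 !(mulr0, mul0r).
  set y' := iter (q * m) f y; set v' := X (q * m) y *m v in IH *; set w' := X (q * m) y *m w in IH *.
  have Gy' : Gam y' by exact: Gam_iter.
  have uX := cocycle_nat_unit f uA (q * m) y.
  have v'0 : 0 < enorm v' by apply: enorm_gt0; exact: unit_mul_neq0.
  have w'0 : 0 < enorm w' by apply: enorm_gt0; exact: unit_mul_neq0.
  have := H y' Gy' v' w'; rewrite (mem_inv _ _ iV Gy) (mem_inv _ _ iF Gy) => /(_ vV wF) H'.
  rewrite mulSn cocycle_natD -!mulmxA -/v' -/w' -/y'.
  have vw0 : 0 < enorm v' * enorm w' by rewrite mulr_gt0.
  rewrite -(ler_pM2r vw0).
  have E1 : enorm (X m y' *m w') * enorm v * (enorm v' * enorm w') =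
     (enorm (X m y' *m w') * enorm v') * (enorm w' * enorm v) by ring.
  rewrite E1; apply: le_trans (ler_pM _ _ H' IH) _; rewrite ?mulr_ge0 ?enorm_ge0 //.
  by rewrite exprS; lra.
have L0 : 0 < L by apply: lt_le_trans L1.
have dR : 1 <= d%:R :> R by rewrite ler1n; lia.
pose Q : R := 2 * (L ^+ m * L ^+ m) * (d%:R * d%:R).
have Lm : 1 <= L ^+ m by rewrite exprn_ege1.
exists Q.
  have LL : 1 <= L ^+ m * L ^+ m by rewrite mulr_ege1.
  have dd : 1 <= d%:R * d%:R :> R by rewrite mulr_ege1.
  by rewrite /Q mulr_ege1 // mulr_ege1 // ler1n.
have m0R : 0 < m%:R :> R by rewrite ltr0n.
exists (ln 2 / m%:R); first by rewrite divr_gt0 // ln_gt0 // ltr1n.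
move=> N y v w Gy vV wF.
pose q := (N %/ m)%N; pose r := (N %% m)%N.
have NE : N = (r + q * m)%N by rewrite addnC -divn_eq.
have rm : (r <= m)%N by rewrite ltnW // ltn_mod.
have := blocks q y v w Gy vV wF.
set v' := X (q * m) y *m v; set w' := X (q * m) y *m w => B.
pose y' := iter (q * m) f y.
have XE u : X N y *m u = X r y' *m (X (q * m) y *m u) by rewrite mulmxA -cocycle_natD -NE.
rewrite !XE -/v' -/w'.
have [h1 _] := HL r y' w'; have [_ h2] := HL r y' v'.
have Lr : L ^+ r <= L ^+ m by rewrite ler_weXn2l.
have h1' : `|X r y' *m w'| <= L ^+ m * `|w'| by apply: le_trans h1 _; rewrite ler_wpM2r.
have h2' : `|v'| <= L ^+ m * `|X r y' *m v'| by apply: le_trans h2 _; rewrite ler_wpM2r.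
have Lm0 : 0 <= L ^+ m by rewrite exprn_ge0 // ltW.
have t1 : `|w'| * `|v| <= 2^-1 ^+ q * (d%:R * `|v'| * (d%:R * `|w|)).
  apply: (@le_trans _ _ (enorm w' * enorm v)); first by rewrite ler_pM ?norm_le_enorm.
  apply: le_trans B _; rewrite ler_wpM2l ?exprn_ge0 ?invr_ge0 //.
  by rewrite ler_pM ?enorm_ge0 ?enorm_le_norm.
have t2 : 2^-1 ^+ q <= 2 * expR (- (ln 2 / m%:R * N%:R)) :> R.
  have -> : 2^-1 ^+ q = 2 * 2^-1 ^+ q.+1 :> R by rewrite exprS mulrA mulfV ?mul1r.
  rewrite ler_wpM2l // -[2^-1 in leLHS]lnK ?posrE ?invr_gt0 // -expRM_natl ler_expR.
  rewrite lnV ?posrE // mulrN lerN2 mulrAC ler_pdivrMr // [q.+1%:R * _]mulrC -mulrA.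
  rewrite ler_wpM2l ?ln_ge0 ?ler1n // -natrM ler_nat.
  by rewrite [leqLHS]NE mulSn leq_add2r.
apply: (@le_trans _ _ (L ^+ m * (`|w'| * `|v|))); first by rewrite mulrA ler_wpM2r.
apply: (@le_trans _ _ (L ^+ m * (2 * expR (- (ln 2 / m%:R * N%:R)) * (d%:R * (L ^+ m * `|X r y' *m v'|) * (d%:R * `|w|))))).
  rewrite ler_wpM2l //; apply: le_trans t1 _.
  rewrite ler_pM ?exprn_ge0 ?invr_ge0 ?mulr_ge0 // ler_wpM2r ?mulr_ge0 // ler_wpM2l //.
by rewrite /Q; lra.
Qed.

(** If v + w were very short, v and w would have comparable lengths and nearly cancel. After the
    fixed time N domination has shrunk w relative to v, so v + w would have been stretched more than
    the Lipschitz bound allows. *)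
Lemma domination_angle : exists2 c : R, 1 <= c & forall y v w, Gam y -> v \in V y -> w \in F y ->
  `|v| <= c * `|v + w| /\ `|w| <= c * `|v + w|.
Proof.
have [Q Q1 [tau tau0 HQ]] := domination_rate.
have [L L1 HL] := cocycle_lipschitz.
have Q0 : 0 < Q by apply: lt_le_trans Q1.
have [N HN] := const_expR (2 * Q) tau0.
have {}HN : Q * expR (- (tau * N%:R)) <= 2^-1.
  by rewrite expRN ler_pdivrMr ?expR_gt0 //; have := HN N (leqnn N); lra.
have L0 : 0 < L by apply: lt_le_trans L1.
have LN : 1 <= L ^+ N by rewrite exprn_ege1.
pose c := 4 * (L ^+ N * L ^+ N).
have c4 : 4 <= c.
  by rewrite /c -[leLHS]mulr1 ler_wpM2l // -[leLHS]mulr1 ler_pM.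
exists (c + 1) => [|y v w Gy vV wF]; first by lra.
suff vc : `|v| <= c * `|v + w|.
  have := normr_ge0 (v + w); have wn : `|w| <= `|v| + `|v + w|.
    by have := ler_normB (v + w) v; rewrite [v + w - v]addrAC subrr add0r; lra.
  by split; lra.
set u := v + w.
have u0 := normr_ge0 u.
have [uv|vu] := leP (`|v| / 2) `|u|.
  have : 4 * `|u| <= c * `|u| by rewrite ler_wpM2r.
  by lra.
have v0 : 0 < `|v| by lra.
have wn : `|w| <= `|v| + `|u|.
  by have := ler_normB (v + w) v; rewrite [v + w - v]addrAC subrr add0r; lra.
have R1 := HQ N y v w Gy vV wF.
have Xw : `|X N y *m w| <= 3 / 4 * `|X N y *m v|.
  rewrite -(ler_pM2r v0); apply: le_trans R1 _.
  apply: le_trans (ler_wpM2r _ HN) _; first by rewrite mulr_ge0.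
  have : `|X N y *m v| * `|w| <= `|X N y *m v| * (3 / 2 * `|v|) by rewrite ler_wpM2l //; lra.
  by lra.
have [h1 _] := HL N y u; have [_ h2] := HL N y v.
have h3 : `|X N y *m v| <= `|X N y *m u| + `|X N y *m w|.
  have -> : X N y *m v = X N y *m u - X N y *m w by rewrite -mulmxBr addrK.
  exact: ler_normB.
have h4 : `|X N y *m v| <= 4 * (L ^+ N * `|u|) by lra.
apply: le_trans h2 _; rewrite /c; apply: le_trans (ler_wpM2l _ h4) _.
  by rewrite exprn_ge0 // ltW.
by lra.
Qed.

(** The min-max property is tested on V and F and on these spaces enlarged by one line: this
    compares the gains of index p and p + 1 with the growth on V and on F. The angle bound carries
    the comparison over to a unit vector, one of whose two components has length at least 1/2. *)
Lemma dominated_good : exists2 k : R, 0 < k & forall y, Gam y -> good p f A k y.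
Proof.
have dp1 : (d <= d - p.+1 + p.+1)%N by lia.
have dp2 : (d <= (d - p.+1).+1 + p)%N by lia.
have [Q Q1 [tau tau0 HQ]] := domination_rate.
have [c c1 Hc] := domination_angle.
have [C C1 HC] := gain_extremal R d.
have Q0 : 0 < Q by apply: lt_le_trans Q1.
have c0 : 0 < c by apply: lt_le_trans c1.
have C0 : 0 < C by apply: lt_le_trans C1.
pose E N := expR (- (tau * N%:R)).
have HQE N y v w : Gam y -> v \in V y -> w \in F y ->
    `|X N y *m w| * `|v| <= Q * E N * (`|X N y *m v| * `|w|) by exact: HQ.
have E0 N : 0 < E N by exact: expR_gt0.
have E1 N : E N <= 1 by rewrite -expR0 ler_expR oppr_le0 mulr_ge0 // ltW.
have uX N y := cocycle_nat_unit f uA N y.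
have g1 N y v : Gam y -> v \in V y -> gain p.+1 (X N y) * `|v| <= C * (Q * E N) * `|X N y *m v|.
  move=> Gy vV; have [->|v0] := eqVneq v 0; first by rewrite mulmx0 normr0 !mulr0.
  have nv : 0 < `|v| by rewrite normr_gt0.
  have [_ /(_ (F y) (Q * E N * `|X N y *m v| / `|v|)) h] := HC _ pd _ (uX N y).
  rewrite -ler_pdivlMr //; apply: le_trans (_ : _ <= C * (Q * E N * `|X N y *m v| / `|v|)) _.
    apply: h; first by rewrite dF.
    move=> w wF; have := HQE N y v w Gy vV wF.
    by rewrite -ler_pdivlMr // mulrAC => h; apply: le_trans h _; lra.
  by lra.
have g1' N y : Gam y -> gain p.+1 (X N y) <= C * (C * Q) * E N * gain p (X N y).
  move=> Gy; have CQE : 0 < C * (Q * E N) by rewrite !mulr_gt0.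
  have [/(_ (V y) (gain p.+1 (X N y) / (C * (Q * E N)))) h _] := HC _ (ltnW pd) _ (uX N y).
  move: h; rewrite dV // => /(_ (leqnn _)) h.
  have {}h : gain p.+1 (X N y) / (C * (Q * E N)) <= C * gain p (X N y).
    apply: h => v vV; rewrite mulrAC ler_pdivrMr // mulrC.
    by have := g1 N y v Gy vV; rewrite [leLHS]mulrC [leRHS]mulrC.
  move: h; rewrite ler_pdivrMr // => h; apply: le_trans h _; lra.
pose K2 := c * (Q + 1).
have K20 : 0 < K2 by rewrite mulr_gt0 // addr_gt0.
have notin y v w : Gam y -> v \in V y -> w \in F y -> v != 0 -> v \notin F y.
  move=> Gy vV wF; apply: contra => vF.
  by rewrite -memv0 -(VF Gy) memv_cap vV.
have notin' y w : Gam y -> w \in F y -> w != 0 -> w \notin V y.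
  move=> Gy wF; apply: contra => wV.
  by rewrite -memv0 -(VF Gy) memv_cap wF andbT.
have g2 N y v : Gam y -> v \in V y -> gain p (X N y) * `|v| <= C * K2 * `|X N y *m v|.
  move=> Gy vV; have [->|v0] := eqVneq v 0; first by rewrite mulmx0 normr0 !mulr0.
  have nv : 0 < `|v| by rewrite normr_gt0.
  have vF : v \notin F y by exact: (notin y v 0 Gy vV (mem0v _) v0).
  have [_ /(_ (F y + <[v]>)%VS (K2 * `|X N y *m v| / `|v|)) h] := HC _ (ltnW pd) _ (uX N y).
  rewrite -ler_pdivlMr //; apply: le_trans (_ : _ <= C * (K2 * `|X N y *m v| / `|v|)) _; last first.
    by lra.
  apply: h.
    by rewrite (dim_add_line (dF Gy) vF).
  move=> _ /memv_addP[w wF [_ /vlineP[t ->] ->]].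
  have tvV : t *: v \in V y by exact: memvZ.
  have [a1 a2] := Hc y _ _ Gy tvV wF; rewrite addrC in a1 a2.
  rewrite mulmxDr; apply: le_trans (ler_normD _ _) _.
  set n := `|w + _| in a1 a2 *.
  have b1 : `|X N y *m w| <= Q * c * `|X N y *m v| / `|v| * n.
    have := HQE N y v w Gy vV wF; rewrite -ler_pdivlMr // => h; apply: le_trans h _.
    apply: (@le_trans _ _ (Q * (`|X N y *m v| / `|v|) * (E N * `|w|))).
      by lra.
    apply: (@le_trans _ _ (Q * (`|X N y *m v| / `|v|) * (1 * (c * n)))); last first.
      by lra.
    rewrite ler_wpM2l ?mulr_ge0 ?invr_ge0 ?(ltW Q0) //.
    by rewrite ler_pM ?(ltW (E0 _)).
  have b2 : `|X N y *m (t *: v)| <= c * `|X N y *m v| / `|v| * n.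
    rewrite -scalemxAr normrZ; move: a1; rewrite normrZ -ler_pdivlMr // => h.
    by apply: le_trans (ler_wpM2r (normr_ge0 _) h) _; lra.
  apply: le_trans (lerD b1 b2) _; rewrite /K2; lra.
pose K3 := C * (2 * c * Q).
have K30 : 0 < K3 by rewrite !mulr_gt0.
have g3 N y w : Gam y -> w \in F y -> `|X N y *m w| <= K3 * gain p.+1 (X N y) * `|w|.
  move=> Gy wF; have [->|w0] := eqVneq w 0; first by rewrite mulmx0 normr0 !mulr0.
  have nw : 0 < `|w| by rewrite normr_gt0.
  have wV := notin' y w Gy wF w0.
  pose s := 2 * c * Q.
  have s0 : 0 < s by rewrite !mulr_gt0.
  have [/(_ (V y + <[w]>)%VS (`|X N y *m w| / `|w| / s)) h _] := HC _ pd _ (uX N y).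
  rewrite -ler_pdivrMr // /K3 -/s mulrAC -ler_pdivrMr //; apply: h.
    by rewrite (dim_add_line (dV Gy) wV).
  move=> _ /memv_addP[v vV [_ /vlineP[t ->] ->]].
  have twF : t *: w \in F y by exact: memvZ.
  have XvV : X N y *m v \in V (iter N f y) by rewrite mem_inv.
  have XwF : X N y *m (t *: w) \in F (iter N f y) by rewrite mem_inv.
  have [a1 a2] := Hc _ _ _ (Gam_iter N Gy) XvV XwF.
  rewrite mulmxDr; set n := `|X N y *m v + _| in a1 a2 *.
  rewrite mulrAC ler_pdivrMr //.
  have b1 : `|X N y *m w| / `|w| * `|v| <= Q * c * n.
    have := HQE N y v w Gy vV wF => h.
    rewrite mulrAC ler_pdivrMr //; apply: le_trans h _.
    apply: (@le_trans _ _ (Q * 1 * (`|X N y *m v| * `|w|))).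
      by rewrite ler_wpM2r ?mulr_ge0 // ler_wpM2l // ltW.
    by rewrite mulr1 mulrA ler_wpM2r // -mulrA ler_wpM2l // ltW.
  have b2 : `|X N y *m w| / `|w| * `|t *: w| <= c * n.
    apply: le_trans a2; rewrite -scalemxAr !normrZ.
    by rewrite mulrCA -mulrA mulVf ?mulr1 // gt_eqF.
  apply: (@le_trans _ _ (`|X N y *m w| / `|w| * (`|v| + `|t *: w|))).
    by rewrite ler_wpM2l ?ler_normD // divr_ge0.
  rewrite mulrDr; apply: le_trans (lerD b1 b2) _; rewrite /s.
  have cn : 0 <= c * n by apply: mulr_ge0; [exact: ltW|exact: normr_ge0].
  have hz := ler_peMl cn Q1.
  apply: (@le_trans _ _ (Q * (c * n) + Q * (c * n))); last by lra.
  by rewrite -[Q * c * n]mulrA lerD2l.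
(* The first two entries serve the quotient of gains and its rate, the last two the forward and the
   backward weight. *)
pose k := Num.max (C * (C * Q)) (Num.max tau^-1 (Num.max (2 * c * (C * K2)) (2 * c * K3))).
have k1 : C * (C * Q) <= k by rewrite le_max lexx.
have k2 : tau^-1 <= k by rewrite !le_max lexx !orbT.
have k3 : 2 * c * (C * K2) <= k by rewrite !le_max lexx !orbT.
have k4 : 2 * c * K3 <= k by rewrite !le_max lexx !orbT.
have c20 : 0 < 2 * c by exact: mulr_gt0.
have s3 : 0 < 2 * c * (C * K2) by apply: mulr_gt0 => //; exact: mulr_gt0.
have s4 : 0 < 2 * c * K3 by exact: mulr_gt0.
have k0 : 0 < k by apply: lt_le_trans k1; rewrite !mulr_gt0.
exists k => // y Gy N N0; split.
  rewrite /gain_quot ler_pdivrMr ?gain_gt0 // ?(ltnW pd) //.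
  apply: le_trans (g1' N y Gy) _; rewrite ler_wpM2r ?gain_ge0 // ler_pM ?mulr_ge0 ?expR_ge0 ?(ltW C0) ?(ltW Q0) //.
  rewrite ler_expR lerN2 mulrC ler_wpM2r //.
  by rewrite -[leRHS]invrK lef_pV2 ?posrE ?invr_gt0.
move=> u u1.
set z := iter N f y; have Gz : Gam z by exact: Gam_iter.
have [v [w [vV wF uE]]] := split_mem u Gz.
have kinv (s : R) : 0 < s -> s <= k -> k^-1 <= s^-1 by move=> s0 sk; rewrite lef_pV2 ?posrE.
have vw : 1 <= `|v| + `|w| by rewrite -u1 uE; exact: ler_normD.
have [v2|v2] := leP (1 / 2) `|v|.
  apply: (@le_trans _ _ `|fwd_weight p (X N z) *m u|); last by rewrite lerDr.
  apply: le_trans (kinv _ s3 k3) _.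
  have gz : 0 < gain p (X N z) by apply: gain_gt0; [exact: uX|exact: ltnW].
  rewrite /fwd_weight -scalemxAl normrZ gtr0_norm ?invr_gt0 //.
  rewrite [leRHS]mulrC ler_pdivlMr // [leLHS]mulrC ler_pdivrMr //.
  have XvV : X N z *m v \in V (iter N f z) by rewrite mem_inv.
  have XwF : X N z *m w \in F (iter N f z) by rewrite mem_inv.
  have [a1 _] := Hc _ _ _ (Gam_iter N Gz) XvV XwF; rewrite -mulmxDr -uE in a1.
  have a3 := g2 N z v Gz vV.
  have a4 : gain p (X N z) <= 2 * (gain p (X N z) * `|v|).
    by rewrite mulrCA ler_peMr ?gain_ge0 //; lra.
  apply: le_trans a4 _; apply: (@le_trans _ _ (2 * (C * K2 * (c * `|X N z *m u|)))).
    rewrite ler_wpM2l //; apply: le_trans a3 _; rewrite ler_wpM2l // mulr_ge0 //; exact: ltW.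
  by lra.
have w2 : 1 / 2 <= `|w| by lra.
apply: (@le_trans _ _ `|back_weight p (X N y) *m u|); last by rewrite lerDl.
apply: le_trans (kinv _ s4 k4) _.
set Y := X N y; have uY : Y \in unitmx by exact: uX.
rewrite /back_weight -scalemxAl normrZ (ger0_norm (gain_ge0 _ _)).
pose v' := invmx Y *m v; pose w' := invmx Y *m w.
have v'V : v' \in V y by rewrite -(mem_inv N _ iV Gy) /v' mulKVmx.
have w'F : w' \in F y by rewrite -(mem_inv N _ iF Gy) /w' mulKVmx.
have [_ a1] := Hc _ _ _ Gy v'V w'F; rewrite -mulmxDr -uE in a1.
have := g3 N y w' Gy w'F; rewrite -/Y {1}/w' mulKVmx // => a3.
rewrite -[leLHS]mul1r ler_pdivrMr //.
have a4 : K3 * gain p.+1 Y * `|w'| <= K3 * gain p.+1 Y * (c * `|invmx Y *m u|).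
  by rewrite ler_wpM2l // mulr_ge0 ?gain_ge0 // ltW.
rewrite (_ : _ * (2 * c * K3) = 2 * (K3 * gain p.+1 Y * (c * `|invmx Y *m u|))); last by ring.
by lra.
Qed.
End DominatedOrbit.

(** At the last index the gain d vanishes: there is no slow side, and the condition holds with a
    constant that depends on the dimension only. *)
Lemma good_last (R : realType) (p : nat) (M : topologicalType) (f : homeomorphism M) :
  exists2 k : R, 0 < k & forall A : M -> 'M[R]_p.+1, (forall x, A x \in unitmx) ->
  forall y, good p f A k y.
Proof.
have [C C1 HC] := gain_spaces R p.+1.
have C0 : 0 < C by apply: lt_le_trans C1.
exists C => // A uA y N N0.
have uX n z := cocycle_nat_unit f uA n z.
split; first by rewrite /gain_quot gain_full mul0r mulr_ge0 ?expR_ge0 // ltW.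
move=> v v1; apply: (@le_trans _ _ `|fwd_weight p (cocycle_nat f A N (iter N f y)) *m v|);
  last by rewrite lerDr.
set Z := cocycle_nat _ _ _ _.
have uZ : Z \in unitmx by exact: uX.
have g0 : 0 < gain p Z by exact: gain_gt0.
have [_ /(_ (ltnSn p))[V [dV HV]]] := HC p (leqnSn p) Z uZ.
have := HV v (full_dim _ dV); rewrite v1 mulr1 => h.
rewrite /fwd_weight -scalemxAl normrZ gtr0_norm ?invr_gt0 // mulrC ler_pdivlMr //.
by rewrite ler_pdivrMl.
Qed.

(** * Semicontinuity of the integrated exponents *)

Section MeanOffNull.
Context (dd : measure_display) (T : measurableType dd) (R : realType).
Variable mu : probability T R.
Implicit Types (h k : T -> R).

Lemma mean_eq_ae h k : {ae mu, forall x, h x = k x} -> mean mu h = mean mu k.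
Proof.
move=> [N [mN N0 NP]]; rewrite /mean /Rintegral; congr fine.
apply: (integral_eq_off_null mN N0) => x nx; congr EFin.
by apply: contrapT => nhk; apply: nx; apply: NP.
Qed.

Lemma mean_le_ae h k : bmf h -> bmf k -> {ae mu, forall x, h x <= k x} ->
  mean mu h <= mean mu k.
Proof.
move=> bh bk hk; pose m x := Num.min (h x) (k x).
have bm : bmf m.
  have [mh [C hC]] := bh; have [mk [D kD]] := bk; split; first exact: measurable_minr.
  exists (Num.max C D) => x; rewrite /m le_max.
  by case: (leP (h x) (k x)) => _; [rewrite hC|rewrite kD orbT].
rewrite (_ : mean mu h = mean mu m); last first.
  by apply: mean_eq_ae; apply: ae_imp hk => x hkx; rewrite /m min_l.
by apply: mean_le => // x; rewrite /m ge_min lexx orbT.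
Qed.

Lemma mean_small_ae (u : nat -> T -> R) (C e : R) : (forall n, measurable_fun setT (u n)) ->
  (forall n x, `|u n x| <= C) ->
  {ae mu, forall x, forall a : R, 0 < a -> exists n0, forall n, (n0 <= n)%N -> `|u n x| <= a} ->
  0 < e -> exists n0, forall n, (n0 <= n)%N -> mean mu (fun x => `|u n x|) <= e.
Proof.
move=> mu_ uC ae0 e0; have mn n : measurable_fun setT (fun x => `|u n x|) by exact: measurableT_comp.
have nC n x : `| (`|u n x|) | <= C by rewrite normr_id.
have := mean_cvg (mu := mu) mn (@measurable_cst _ _ _ _ setT (0 : R)) nC.
rewrite mean_cst => /(_ _)/cvgrPdist_le/(_ e e0)[|n0 _ Hn0].
  apply: ae_imp ae0 => x H; apply/cvgrPdist_le => a /H[n0 Hn0]; exists n0 => // n /= /Hn0.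
  by rewrite sub0r normrN normr_id.
exists n0 => n /Hn0; rewrite /= sub0r normrN; apply: le_trans; exact: ler_norm.
Qed.

Lemma bmf_norm h : bmf h -> bmf (fun x => `|h x|).
Proof.
case=> mh [C hC]; split; first exact: measurableT_comp.
by exists C => x; rewrite normr_id.
Qed.

Lemma mean_norm_le h : bmf h -> `|mean mu h| <= mean mu (fun x => `|h x|).
Proof.
move=> bh; have bn := bmf_norm bh; rewrite ler_norml -meanN //; apply/andP; split; apply: mean_le => //; first exact: bmfN.
  by move=> x; rewrite lerNl; apply: le_trans (ler_norm _) _; rewrite normrN.
by move=> x; exact: ler_norm.
Qed.

End MeanOffNull.

Lemma loss_arith1 (R : realType) (a b q l t : R) : a - q <= b -> - t <= l -> a - (q + t) <= b + l.
Proof. lra. Qed.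

Lemma loss_arith2 (R : realType) (n m e a t : R) : n * m - n * (e / 4) <= a ->
  t <= e / 4 * n -> 0 < e -> 1 <= n -> n * m - n * e <= a - (e / 4 + t).
Proof. by move=> h1 h2 e0 n1; have := ler_peMr (ltW e0) n1; lra. Qed.

Lemma common_radius (R : realType) (n : nat) (P : nat -> R -> Prop) :
  (forall i a b, a <= b -> P i b -> P i a) ->
  (forall i, (i < n)%N -> exists2 dl : R, 0 < dl & P i dl) ->
  exists2 dl : R, 0 < dl & forall i, (i < n)%N -> P i dl.
Proof.
move=> mono; elim: n => [|n IH] H; first by exists 1.
have [d1 d10 H1] := IH (fun i h => H i (ltnW h)); have [d2 d20 H2] := H n (ltnSn n).
exists (Num.min d1 d2); first by rewrite lt_min d10.
move=> i; rewrite ltnS leq_eqVlt => /orP[/eqP -> |/H1].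
  by apply: mono H2; rewrite ge_min lexx orbT.
by apply: mono; rewrite ge_min lexx.
Qed.

Section OrbitShift.
Variables (M : topologicalType) (f : homeomorphism M).

Lemma iterz_comm n x : iterz f n (f x) = f (iterz f n x).
Proof.
case: n => n /=; first by rewrite -iterSr.
by rewrite homeo_invK -[LHS]/(iter n.+1 (homeo_inv f) (f x)) iterSr homeo_funK.
Qed.

Lemma orbitz_shift x y : orbitz f (f x) y <-> orbitz f x y.
Proof.
split=> -[n ->]; first by exists (n + 1); rewrite iterz_comm iterz_step.
by exists (n - 1); rewrite iterz_comm iterz_step subrK.
Qed.
End OrbitShift.

Section LogGain.
Variables (R : realType) (d : nat) (M : ptopologicalType) (mu : probability (borel M) R) (f : homeomorphism M).
Hypotheses (M_compact : compact [set: M]) (mu_invariant : preserves mu f).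
Local Notation S := (borel M).
Local Notation bmS := (@bmf _ S R).

Section One.
Variable A : M -> 'M[R]_d.
Hypotheses (cA : continuous A) (uA : forall x, A x \in unitmx).
Local Notation X := (cocycle_nat f A).

Definition lam p (x : M) : R := exponent (exponent_sum f A ^~ x) p.
Definition log_gain p n (x : M) : R := log_minor f A p.+1 n x - log_minor f A p n x.

Lemma bmf_lam p : (p < d)%N -> bmS (lam p).
Proof. by move=> pd; apply: bmfB; apply: bmf_exponent_sum => //; exact: ltnW. Qed.

Lemma bmf_log_minor p n : (p <= d)%N -> bmS (log_minor f A p n).
Proof.
move=> pd; split; first exact: measurable_log_minor.
have [C C0 [gC _ _]] := log_minor_step f M_compact cA uA pd.
by exists (C * n%:R) => x; exact: gC.
Qed.

Lemma bmf_log_gain p n : (p < d)%N -> bmS (log_gain p n).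
Proof. by move=> pd; apply: bmfB; apply: bmf_log_minor => //; exact: ltnW. Qed.

Lemma lam_inv p x : (p < d)%N -> lam p (f x) = lam p x.
Proof.
move=> pd; rewrite /lam /exponent !exponent_sum_inv //; exact: ltnW.
Qed.

Lemma log_gainE p n x : (p < d)%N -> (0 < n)%N -> log_gain p n x = ln (gain p (X n x)).
Proof.
move=> pd; case: n => // n _; rewrite /log_gain /gain ln_div // posrE minor_sum_gt0 //;
  by [exact: cocycle_nat_unit|exact: ltnW].
Qed.

Lemma log_gain_mean p (e : R) : (p < d)%N -> 0 < e -> exists n0, forall n, (n0 <= n)%N ->
  (0 < n)%N /\ mean mu (fun x => `|log_gain p n x / n%:R - lam p x|) <= e.
Proof.
move=> pd e0.
have [C1 C10 [g1 _ _]] := log_minor_step f M_compact cA uA pd.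
have [C2 C20 [g2 _ _]] := log_minor_step f M_compact cA uA (ltnW pd).
have l1 x : `|exponent_sum f A p.+1 x| <= C1 by exact: (linf_norm (T := S) g1).
have l2 x : `|exponent_sum f A p x| <= C2 by exact: (linf_norm (T := S) g2).
pose u n x : R := log_gain p n x / n%:R - lam p x.
have bu n : bmS (u n).
  apply: bmfB; last exact: bmf_lam.
  rewrite (_ : (fun _ => _) = fun x => n%:R^-1 * log_gain p n x); last by apply/funext => x; rewrite mulrC.
  by apply: bmfZ; exact: bmf_log_gain.
have uC n x : `|u n x| <= 2 * (C1 + C2).
  have lamC : `|lam p x| <= C1 + C2.
    by apply: le_trans (ler_normB _ _) _; rewrite lerD.
  apply: le_trans (ler_normB _ _) _.
  have : `|log_gain p n x / n%:R| <= C1 + C2.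
    case: n => [|n]; first by rewrite invr0 mulr0 normr0 addr_ge0.
    rewrite normrM normfV [X in _ / X]ger0_norm // ler_pdivrMr ?ltr0n //.
    apply: le_trans (ler_normB _ _) _; rewrite mulrDl; exact: lerD.
  by lra.
have aeu : {ae mu, forall x, forall a : R, 0 < a -> exists n0, forall n, (n0 <= n)%N -> `|u n x| <= a}.
  apply: ae_imp (ae_regular M_compact mu_invariant cA uA) => x reg a a0.
  have [n0 H] := gain_rate reg pd a0; exists (maxn 1 n0) => n.
  rewrite geq_max => /andP[n1 /H [/andP[lo hi] _]].
  have nR : 0 < n%:R :> R by rewrite ltr0n.
  have g0 : 0 < gain p (X n x) by apply: gain_gt0 => //; exact: cocycle_nat_unit.
  rewrite /u log_gainE // ler_distl ler_pdivlMr // ler_pdivrMr //.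
  move: lo hi; rewrite -{1 2}[gain p (X n x)]lnK ?posrE // !ler_expR.
  by rewrite /lam ![_ * n%:R]mulrC => -> ->.
have [n0 H] := mean_small_ae (fun n => (bu n).1) uC aeu e0.
by exists (maxn 1 n0) => n; rewrite geq_max => /andP[n1 n0n]; split=> //; exact: H.
Qed.

Lemma log_gain_mean_on p (e : R) (D : set S) n : (p < d)%N -> measurable D -> (0 < n)%N ->
  mean mu (fun x => `|log_gain p n x / n%:R - lam p x|) <= e ->
  `|mean mu (fun x => \1_D x * log_gain p n x) - n%:R * mean mu (fun x => \1_D x * lam p x)|
    <= n%:R * e.
Proof.
move=> pd mD n0 H.
have nR : 0 < n%:R :> R by rewrite ltr0n.
have bD : bmS (\1_D : S -> R) by exact: bmf_indic.
have b1 : bmS (fun x => \1_D x * log_gain p n x) by apply: bmfM => //; exact: bmf_log_gain.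
have b2 : bmS (fun x => \1_D x * lam p x) by apply: bmfM => //; exact: bmf_lam.
rewrite -meanZ // -meanB //; last exact: bmfZ.
have bu : bmS (fun x => log_gain p n x / n%:R - lam p x).
  apply: bmfB; last exact: bmf_lam.
  rewrite (_ : (fun _ => _) = fun x => n%:R^-1 * log_gain p n x); last by apply/funext => x; rewrite mulrC.
  by apply: bmfZ; exact: bmf_log_gain.
apply: le_trans (mean_norm_le _ _) _; first by apply: bmfB => //; exact: bmfZ.
apply: (@le_trans _ _ (mean mu (fun x => n%:R * `|log_gain p n x / n%:R - lam p x|))); last first.
  by rewrite meanZ ?ler_pM2l //; exact: bmf_norm.
apply: mean_le; [by apply: bmf_norm; apply: bmfB => //; exact: bmfZ|by apply: bmfZ; exact: bmf_norm|].
move=> x; rewrite indicE; case: (x \in D); last by rewrite !mul0r mulr0 subrr normr0 mulr_ge0.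
rewrite !mul1r -[X in _ <= X * _]gtr0_norm // -normrM; move: (lam p x) (log_gain p n x) => l g.
rewrite mulrBr; by rewrite [n%:R * (_ / _)]mulrC divfK // gt_eqF.
Qed.
End One.

(** Fix N so large that [good] at time N implies the hypotheses of [cone_chain] with room for a
    perturbation. For B close to A the log gain over n blocks of N steps is then at least the sum of
    the block log gains minus n |ln c|, up to a constant. Integration over the invariant set D
    bounds the exponent of B through a quantity depending on N steps only. *)
Lemma core_lower (A : M -> 'M[R]_d) p (k e : R) : continuous A -> (forall x, A x \in unitmx) -> (p < d)%N ->
  0 < k -> 0 < e -> exists2 dl : R, 0 < dl & forall B : M -> 'M[R]_d, continuous B -> (forall x, B x \in unitmx) ->
    close A B dl -> forall D : set S, measurable D -> (forall x, D (f x) <-> D x) ->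
    (forall x, D x -> good_orbit p f A k x) ->
    mean mu (fun x => \1_D x * lam A p x) - e <= mean mu (fun x => \1_D x * lam B p x).
Proof.
move=> cA uA pd k0 e0.
have [C C1 HC] := cone_chain R pd.
have C0 : 0 < C by apply: lt_le_trans C1.
pose k' := Num.max k C.
have kk' : k <= k' by rewrite le_max lexx.
have Ck' : C <= k' by rewrite le_max lexx orbT.
have k'0 : 0 < k' by apply: lt_le_trans kk'.
have ik' : 0 < k'^-1 by rewrite invr_gt0.
(* Each of the two weights may lose a quarter of [k'^-1] under the perturbation, which leaves one
   half. *)
pose b := k'^-1 / 2; have b0 : 0 < b by rewrite divr_gt0.
have bC : b <= C^-1.
  have : k'^-1 <= C^-1 by rewrite lef_pV2 ?posrE.
  by rewrite /b; lra.
pose c := b / 2; have c0 : 0 < c by rewrite divr_gt0.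
have c2 : 0 < c * c / 2 by rewrite divr_gt0 // mulr_gt0.
have e4 : 0 < e / 4 by rewrite divr_gt0.
have [n1 Hn1] := log_gain_mean cA uA pd e4.
have [n2 Hn2] := const_expR (k' / (c * c / 2)) ik'.
have [n3 Hn3] := archi_le `|ln c| e4.
pose N := maxn n1 (maxn n2 n3).
have [N0 {Hn1}HN1] := Hn1 N (leq_maxl _ _).
have NR : 0 < N%:R :> R by rewrite ltr0n.
have HN2 : k' * expR (- (N%:R / k')) <= c * c / 2.
  have := Hn2 N _; rewrite leq_max leq_max leqnn orbT => /(_ isT).
  rewrite ler_pdivrMr // mulrC => h.
  by rewrite expRN ler_pdivrMr ?expR_gt0 // [N%:R / k']mulrC; exact: h.
have HN3 : `|ln c| <= e / 4 * N%:R by apply: Hn3; rewrite /N !leq_max leqnn !orbT.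
pose eta := k'^-1 / (4 * (d%:R + 1)).
have d10 : 0 < 4 * (d%:R + 1) :> R by rewrite mulr_gt0 // ltr_wpDl.
have eta0 : 0 < eta by rewrite divr_gt0.
have eta_d : d%:R * eta <= k'^-1 / 4.
  rewrite /eta mulrA ler_pdivrMr // mulrC -mulrA ler_wpM2l ?(ltW ik') //.
  by rewrite mulrA mulVf // mul1r lerDl.
have [d1 d1_0 H1] := cocycle_fun_close M_compact f (Phi := back_weight p) N cA uA
  (fun Z uZ => let: And3 h _ _ := cont_weights pd uZ in h) eta0.
have [d2 d2_0 H2] := cocycle_fun_close M_compact f (Phi := fwd_weight p) N cA uA
  (fun Z uZ => let: And3 _ h _ := cont_weights pd uZ in h) eta0.
have [d3 d3_0 H3] := cocycle_fun_close M_compact f (Phi := gain_quot p : _ -> R) N cA uA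
  (fun Z uZ => let: And3 _ _ h := cont_weights pd uZ in h) c2.
have clng Z : Z \in unitmx -> {for Z, continuous (fun Y : 'M[R]_d => ln (gain p Y))}.
  move=> uZ; apply: cont_at_ln; first exact: gain_gt0.
  apply: (cont_at_gain (F := fun Y : 'M[R]_d => Y)) => //; exact: ltnW.
have [d4 d4_0 H4] := cocycle_fun_close M_compact f (Phi := (fun Y => ln (gain p Y)) : _ -> R)
  N cA uA clng e4.
pose dl := Num.min (Num.min d1 d2) (Num.min d3 d4).
exists dl; first by rewrite !lt_min d1_0 d2_0 d3_0 d4_0.
move=> B cB uB clB D mD Dinv Dgood.
have cl1 : close A B d1 by move=> x; apply: le_trans (clB x) _; rewrite !ge_min lexx.
have cl2 : close A B d2 by move=> x; apply: le_trans (clB x) _; rewrite !ge_min lexx orbT.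
have cl3 : close A B d3 by move=> x; apply: le_trans (clB x) _; rewrite !ge_min lexx !orbT.
have cl4 : close A B d4 by move=> x; apply: le_trans (clB x) _; rewrite !ge_min lexx !orbT.
have Diter n x : D (iter n f x) <-> D x.
  by elim: n => //= n [IH1 IH2]; split=> [/Dinv/IH1|/IH2/Dinv].
have uBN n x := cocycle_nat_unit f uB n x.
pose phi y := log_gain B p N y + ln c.
have chain n x : D x -> \sum_(i < n) phi (iter (i * N) f x) <= ln C + log_gain B p (n.+1 * N) x - phi (iter (n * N) f x).
  move=> Dx.
  pose Z i := cocycle_nat f B N (iter (i * N) f x).
  have Zgood i : good p f A k' (iter (i * N) f x).
    by apply: good_mono kk' _ => //; apply: (Dgood x Dx); exists (i * N)%N.
  have q i : gain_quot p (Z i) <= c * c.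
    have [h _] := Zgood i N N0; have := H3 B cl3 (iter (i * N) f x).
    by rewrite ler_distl => /andP[_ h']; apply: le_trans h' _; lra.
  have cone i (v : 'cV[R]_d) : `|v| = 1 ->
      b <= `|back_weight p (Z i) *m v| + `|fwd_weight p (Z i.+1) *m v|.
    move=> v1; have [_ /(_ v v1) h] := Zgood i N N0.
    have pert (P Q : 'M[R]_d) : `|P - Q| <= eta -> `|Q *m v| <= `|P *m v| + k'^-1 / 4.
      move=> PQ; have -> : Q *m v = P *m v - (P - Q) *m v by rewrite mulmxBl opprB addrC subrK.
      apply: le_trans (ler_normB _ _) _; rewrite lerD2l.
      apply: le_trans (normrM_mx _ _) _; rewrite v1 mulr1 /mnorm.
      by apply: le_trans eta_d; rewrite ler_wpM2l.
    have p1 := pert _ _ (H1 B cl1 (iter (i * N) f x)).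
    have p2 := pert _ _ (H2 B cl2 (iter N f (iter (i * N) f x))).
    have -> : Z i.+1 = cocycle_nat f B N (iter N f (iter (i * N) f x)) by rewrite /Z mulSn iterD.
    by rewrite /b; move: h p1 p2; rewrite -/(Z i); lra.
  have := HC b (c * c) Z b0 bC (fun i => uBN _ _) q (lexx _) cone n.+1.
  rewrite chain_cocycle => h.
  have g0 i : 0 < gain p (Z i) by apply: gain_gt0; [exact: uBN|exact: pd].
  have cg0 i : 0 < b / 2 * gain p (Z i) by rewrite mulr_gt0.
  have nN0 : (0 < n.+1 * N)%N by rewrite muln_gt0.
  have lnh : ln (\prod_(i < n.+1) (b / 2 * gain p (Z i))) <= ln (C * gain p (cocycle_nat f B (n.+1 * N) x)).
    by rewrite ler_ln // posrE ?prodr_gt0 // mulr_gt0 // gain_gt0.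
  have E m : ln (\prod_(i < m) (b / 2 * gain p (Z i))) = \sum_(i < m) phi (iter (i * N) f x).
    elim: m => [|m IH]; first by rewrite !big_ord0 ln1.
    rewrite !big_ord_recr /= lnM ?posrE ?prodr_gt0 // IH; congr (_ + _).
    by rewrite lnM ?posrE // addrC /phi log_gainE.
  rewrite E big_ord_recr /= lnM ?posrE // ?gain_gt0 // in lnh.
  by rewrite log_gainE //; move: lnh; set s := \sum_(i < n) _; lra.
have bD : bmS (\1_D : S -> R) by exact: bmf_indic.
have bphi : bmS phi by apply: bmfD; [exact: bmf_log_gain|exact: (bmf_cst _ (ln c))].
have bDphi : bmS (fun x => \1_D x * phi x) by exact: bmfM.
have DI n x : \1_D (iter n f x) = \1_D x :> R.
  rewrite !indicE; congr (_%:R); congr nat_of_bool.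
  by apply/idP/idP => /set_mem h; apply/mem_set; apply/(Diter n x).
have mf := continuous_measurable_self (@homeo_fun_continuous M f).
have step n : n.+1%:R * mean mu (fun x => \1_D x * phi x) <=
    ln C + mean mu (fun x => \1_D x * log_gain B p (n.+1 * N) x).
  have bDg : bmS (fun x => \1_D x * log_gain B p (n.+1 * N) x).
    by apply: bmfM => //; exact: bmf_log_gain.
  have bi i : bmS (fun x => \1_D (iter (i * N) f x) * phi (iter (i * N) f x)).
    exact: (bmf_iter mf (i * N) bDphi).
  have -> : n.+1%:R * mean mu (fun x => \1_D x * phi x) =
      \sum_(i < n.+1) mean mu (fun x => \1_D (iter (i * N) f x) * phi (iter (i * N) f x)).
    rewrite (eq_bigr (fun=> mean mu (fun x => \1_D x * phi x))).
      by rewrite sumr_const card_ord mulr_natl.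
    by move=> i _; exact: (mean_iter mf mu_invariant (i * N) bDphi).
  rewrite -(mean_sum mu (index_enum 'I_n.+1) (fun i : 'I_n.+1 => bi i)).
  rewrite -[ln C](mean_cst mu) -meanD //; last exact: (bmf_cst _ (ln C)).
  apply: mean_le; [exact: bmf_sum|by apply: bmfD => //; exact: (bmf_cst _ (ln C))|].
  move=> x; under eq_bigr do rewrite DI; rewrite -mulr_sumr.
  have lnC0 : 0 <= ln C by rewrite ln_ge0.
  rewrite indicE; case: (boolP (x \in D)) => [/set_mem Dx|_]; last by rewrite !mul0r addr0.
   rewrite !mul1r big_ord_recr /=; have := chain n x Dx.
  by set s := \sum_(i < n) _; lra.
have main : mean mu (fun x => \1_D x * phi x) <= N%:R * mean mu (fun x => \1_D x * lam B p x).
  apply/ler_addgt0Pr => a a0.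
  have aN : 0 < a / (2 * N%:R) by rewrite divr_gt0 // mulr_gt0.
  have [m1 Hm1] := log_gain_mean cB uB pd aN.
  have a2 : 0 < a / 2 by rewrite divr_gt0.
  have [m2 Hm2] := archi_le (ln C) a2.
  pose n := maxn m1 m2.
  have nN : (m1 <= n.+1 * N)%N by apply: leq_trans (leq_maxl m1 m2) _; rewrite -/n -[leqLHS]muln1 leq_mul // ltnW.
  have [nN0 Hm] := Hm1 _ nN.
  have := log_gain_mean_on cB uB pd mD nN0 Hm; rewrite ler_distl => /andP[_ up].
  have lnC : ln C <= a / 2 * n.+1%:R by apply: Hm2; apply: leq_trans (leq_maxr m1 m2) _.
  have nR : 0 < n.+1%:R :> R by rewrite ltr0n.
  rewrite -(ler_pM2l nR); apply: le_trans (step n) _.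
  apply: le_trans (lerD lnC up) _.
  rewrite natrM (_ : n.+1%:R * N%:R * (a / (2 * N%:R)) = n.+1%:R * (a / 2)); last first.
    by rewrite invfM -!mulrA; congr (_ * _); rewrite mulrCA [N%:R * _]mulrCA mulfV ?mulr1 // gt_eqF.
  by apply: eq_ler; field.
have low : N%:R * mean mu (fun x => \1_D x * lam A p x) - N%:R * (e / 4) <=
    mean mu (fun x => \1_D x * log_gain A p N x).
  by have := log_gain_mean_on cA uA pd mD N0 HN1; rewrite ler_distl => /andP[].
have comp : mean mu (fun x => \1_D x * log_gain A p N x) - (e / 4 + `|ln c|) <=
    mean mu (fun x => \1_D x * phi x).
  have bDg : bmS (fun x => \1_D x * log_gain A p N x) by apply: bmfM => //; exact: bmf_log_gain.
  rewrite -[X in _ - X](mean_cst mu) -meanB //; last exact: (bmf_cst _ (e / 4 + `|ln c|)).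
  apply: mean_le => //; first by apply: bmfB => //; exact: (bmf_cst _ (e / 4 + `|ln c|)).
  move=> x; have ce : 0 <= e / 4 + `|ln c| by rewrite addr_ge0 // ltW.
  rewrite indicE; case: (x \in D); last by rewrite !mul0r sub0r oppr_le0.
  have := H4 B cl4 x; rewrite !mul1r /phi !log_gainE // ler_distl => /andP[h _].
  have h' : - `|ln c| <= ln c by rewrite lerNl; apply: le_trans (ler_norm _) _; rewrite normrN.
  exact: loss_arith1 h h'.
have N1 : 1 <= N%:R :> R by rewrite ler1n.
rewrite -(ler_pM2l NR) mulrBr; apply: le_trans main; apply: le_trans comp.
exact: loss_arith2 low HN3 e0 N1.
Qed.
#[local] Opaque mean exponent_sum.
Variable A : M -> 'M[R]_d.
Hypotheses (cA : continuous A) (uA : forall x, A x \in unitmx).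
Local Notation L := (exponent_sum f).

Lemma closeW (B : M -> 'M[R]_d) a b : a <= b -> close A B a -> close A B b.
Proof. by move=> ab H x; apply: le_trans (H x) ab. Qed.

Lemma lam_uniform_bound p : (p < d)%N -> exists2 C : R, 0 <= C & exists2 dl : R, 0 < dl &
  forall B : M -> 'M[R]_d, continuous B -> (forall x, B x \in unitmx) -> close A B dl ->
  forall x, `|lam B p x| <= C.
Proof.
move=> pd.
have one q : (q <= d)%N -> exists2 C : R, 0 <= C & exists2 dl : R, 0 < dl &
    forall B : M -> 'M[R]_d, continuous B -> (forall x, B x \in unitmx) -> close A B dl ->
    forall x, `|L B q x| <= C.
  move=> qd; have [C C0 HC] := log_minor_bound M_compact cA uA qd.
  have c1 x : {for A x, continuous (fun Z : 'M[R]_d => ln (minor_sum q Z))}.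
    apply: cont_at_ln; first exact: minor_sum_gt0.
    exact: (cont_at_minor_sum (F := fun Y : 'M[R]_d => Y)).
  have c2 x : {for A x, continuous (fun Z : 'M[R]_d => ln (minor_sum q (invmx Z)))}.
    apply: cont_at_ln; first by apply: minor_sum_gt0; rewrite ?unitmx_inv.
    apply: cont_at_minor_sum; exact: (cont_at_invmx (F := fun Y : 'M[R]_d => Y)).
  have [d1 d10 H1] := uniform_continuity (V := R^o) M_compact cA c1 ltr01.
  have [d2 d20 H2] := uniform_continuity (V := R^o) M_compact cA c2 ltr01.
  exists (C + 1); first by rewrite addr_ge0.
  exists (Num.min d1 d2); first by rewrite lt_min d10.
  move=> B cB uB clB x; apply: exponent_sum_norm => //; first by rewrite addr_ge0.
  move=> y; have [h1 h2] := HC y.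
  have := H1 y (B y); have := H2 y (B y); have := clB y; rewrite le_min => /andP[-> ->].
  move=> /(_ isT); rewrite ler_distl => /andP[_ k2] /(_ isT); rewrite ler_distl => /andP[_ k1].
  by split; lra.
have [C1 C10 [d1 d10 H1]] := one p (ltnW pd); have [C2 C20 [d2 d20 H2]] := one p.+1 pd.
exists (C1 + C2); first by rewrite addr_ge0.
exists (Num.min d1 d2); first by rewrite lt_min d10.
move=> B cB uB clB x.
have cl1 : close A B d1 by apply: closeW clB; rewrite ge_min lexx.
have cl2 : close A B d2 by apply: closeW clB; rewrite ge_min lexx orbT.
apply: le_trans (ler_normB _ _) _; rewrite [C1 + C2]addrC.
by apply: lerD; [exact: (H2 B cB uB cl2 x)|exact: (H1 B cB uB cl1 x)].
Qed.

(** At a regular point, p is the last index of a block of equal exponents of A. *)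
Definition class_end p x : Prop := p.+1 = d \/ lam A p.+1 x < lam A p x.

Lemma class_end_inv p x : (p < d)%N -> class_end p (f x) <-> class_end p x.
Proof.
move=> pd; rewrite /class_end (lam_inv cA uA x pd).
have [->|pnd] := eqVneq p.+1 d; first by split=> _; left.
have p1d : (p.+1 < d)%N by rewrite ltn_neqAle pnd.
by rewrite (lam_inv cA uA x p1d).
Qed.

Lemma measurable_class_end p : (p < d)%N -> measurable (class_end p : set S).
Proof.
move=> pd; have [E|pnd] := eqVneq p.+1 d.
  by rewrite (_ : class_end p = setT) //; apply/seteqP; split=> x // _; left.
have p1d : (p.+1 < d)%N by rewrite ltn_neqAle pnd.
have [m _] := bmfB (bmf_lam cA uA pd) (bmf_lam cA uA p1d).
rewrite (_ : class_end p = setT `&` (fun x => lam A p x - lam A p.+1 x) @^-1` [set` `]0, +oo[]).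
  exact: m.
apply/seteqP; split=> x /=; rewrite in_itv /= andbT subr_gt0.
  by move=> [/eqP|]; [rewrite (negbTE pnd)|].
by move=> [_ h]; right.
Qed.

Lemma measurable_good_orbit p k : (p < d)%N -> measurable (good_orbit p f A k : set S).
Proof.
move=> pd.
have mg : measurable (good p f A k : set S).
  rewrite -[X in measurable X]setCK; apply: measurableC; apply: sub_sigma_algebra.
  by apply: closed_openC; exact: closed_good.
have mi (h : M -> M) n : continuous h -> measurable (iter n h @^-1` good p f A k : set S).
  move=> ch; rewrite -[X in measurable X]setTI.
  by apply: (continuous_measurable_self (continuous_iter (n := n) ch)).
rewrite (_ : good_orbit p f A k = (\bigcap_n (iter n f @^-1` good p f A k)) `&`
   (\bigcap_n (iter n (homeo_inv f) @^-1` good p f A k))).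
  apply: measurableI; apply: bigcapT_measurable => n; apply: mi.
    exact: homeo_fun_continuous.
  exact: homeo_inv_continuous.
apply/seteqP; split=> x.
  move=> H; split=> n _; apply: H; first by exists n%:Z.
  by apply: orbit_iter_inv; exact: orbit_self.
move=> [Hf Hb] y [[n|n] ->]; first exact: Hf.
exact: (Hb n.+1).
Qed.

(** By [mean_log_minor_ge] the exponent of B is at most its mean log minor at a single time n,
    chosen for A, and that mean is continuous in B. *)
Lemma exponent_sum_upper p (e : R) : (p <= d)%N -> 0 < e -> exists2 dl : R, 0 < dl &
  forall B : M -> 'M[R]_d, continuous B -> (forall x, B x \in unitmx) -> close A B dl ->
    mean mu (L B p) <= mean mu (L A p) + e.
Proof.
move=> pd e0; have e2 : 0 < e / 2 by rewrite divr_gt0.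
have [n0 Hn0] := mean_log_minor_le M_compact mu_invariant cA uA pd e2.
have {Hn0} := Hn0 n0.+1 (leqnSn n0); set n := n0.+1 => Hn.
have nR : 0 < n%:R :> R by rewrite ltr0n.
have cl Z : Z \in unitmx -> {for Z, continuous (fun Z : 'M[R]_d => ln (minor_sum p Z))}.
  move=> uZ; apply: cont_at_ln; first exact: minor_sum_gt0.
  exact: (cont_at_minor_sum (F := fun Y : 'M[R]_d => Y)).
have [dl dl0 H] := cocycle_fun_close (V := R^o) M_compact f n cA uA cl e2.
exists dl => // B cB uB clB.
rewrite -(ler_pM2l nR); apply: le_trans (mean_log_minor_ge M_compact mu_invariant cB uB n pd) _.
apply: (@le_trans _ _ (mean mu (fun x => log_minor f A p n x + e / 2))).
  apply: mean_le; [exact: bmf_log_minor|by apply: bmfD; [exact: bmf_log_minor|exact: (bmf_cst _ (e / 2))]|].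
  by move=> x; have := H B clB x; rewrite ler_distl => /andP[].
rewrite meanD; [|exact: bmf_log_minor|exact: (bmf_cst _ (e / 2))].
rewrite (mean_cst mu (e / 2)); apply: le_trans (lerD Hn (lexx _)) _.
have : e / 2 <= e / 2 * n%:R by rewrite ler_peMr ?(ltW e2) // ler1n.
by lra.
Qed.

Hypothesis Hgood : {ae mu, forall x, forall q, (q < d)%N -> class_end q x ->
  exists2 k : R, 0 < k & good_orbit q f A k x}.

Section Index.
Variable j : nat.
Hypothesis jd : (j < d)%N.

(** Sorts the points by the end q of the block of exponents containing j. There lam j = lam q for A
    at regular points, while lam q <= lam j for any B, so a lower bound at q gives one at j.
    Domination is thus used only where the splitting of A is cut, and a trivial splitting needs
    none. *)
Definition first_end q : set S :=
  [set x | (j <= q)%N /\ class_end q x /\ forall i, (j <= i < q)%N -> ~ class_end i x].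

Lemma measurable_first_end q : (q < d)%N -> measurable (first_end q).
Proof.
move=> qd; have [jq|qj] := leqP j q; last first.
  rewrite (_ : first_end q = set0) //; apply/seteqP; split=> x // -[].
  by rewrite leqNgt qj.
rewrite (_ : first_end q = class_end q `&`
    \bigcap_i (if (j <= i < q)%N then ~` (class_end i) else setT)).
  apply: measurableI; first exact: measurable_class_end.
  apply: bigcapT_measurable => i; case: ifP => // /andP[_ iq].
  by apply: measurableC; apply: measurable_class_end; exact: ltn_trans qd.
apply/seteqP; split=> x.
  by move=> [_ [h1 h2]]; split=> // i _; case: ifP => // /h2.
move=> [h1 h2]; split=> //; split=> // i ij.
by have := h2 i I; rewrite ij.
Qed.

Lemma first_end_inv q x : (q < d)%N -> first_end q (f x) <-> first_end q x.
Proof.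
move=> qd; have E i : (i <= q)%N -> class_end i (f x) <-> class_end i x.
  by move=> iq; apply: class_end_inv; exact: leq_ltn_trans qd.
split=> -[h0 [h1 h2]]; split.
- exact: h0.
- split; first exact: (E q (leqnn q)).1 h1.
  by move=> i iq ci; apply: (h2 i iq); exact: (E i (ltnW (andP iq).2)).2 ci.
- exact: h0.
- split; first exact: (E q (leqnn q)).2 h1.
  by move=> i iq ci; apply: (h2 i iq); exact: (E i (ltnW (andP iq).2)).1 ci.
Qed.

Lemma first_end_sum x : \sum_(q < d) \1_(first_end q) x = 1 :> R.
Proof.
have ex : exists q, (j <= q)%N && `[< class_end q x >].
  exists d.-1; apply/andP; split; first by lia.
  by apply/asboolP; left; rewrite prednK //; apply: leq_ltn_trans jd.
case: (ex_minnP ex) => q /andP[jq /asboolP cq] qmin.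
have qd : (q < d)%N.
  have : (q <= d.-1)%N.
    apply: qmin; apply/andP; split; first by lia.
    by apply/asboolP; left; rewrite prednK //; apply: leq_ltn_trans jd.
  by move: jd; lia.
rewrite (bigD1 (Ordinal qd)) //= big1 ?addr0 => [|i iq].
  rewrite indicE mem_set //; split=> //; split=> // i /andP[ji iq] ci.
  have := qmin i; rewrite ji /= asboolT // => /(_ isT).
  by rewrite leqNgt iq.
rewrite indicE memNset // => -[ji [ci hi]].
have qi : (q <= i)%N by apply: qmin; rewrite ji asboolT.
apply: (hi q) => //; rewrite jq /= ltn_neqAle qi andbT.
by apply: contra iq => /eqP E; apply/eqP/val_inj.
Qed.

Lemma class_constant x q : regular f A (L A ^~ x) x -> (j <= q)%N -> (q < d)%N ->
  (forall i, (j <= i < q)%N -> ~ class_end i x) -> lam A j x = lam A q x.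
Proof.
move=> reg jq qd; have [m qE] : exists m, q = (j + m)%N by exists (q - j)%N; rewrite subnKC.
rewrite {}qE {jq} in qd *; elim: m qd => [|m IH] md noend; first by rewrite addn0.
have md' : (j + m < d)%N by apply: leq_ltn_trans md; rewrite addnS.
rewrite IH //; last by move=> i /andP[ji im]; apply: noend; rewrite ji addnS ltnW.
have nc : ~ class_end (j + m) x by apply: noend; rewrite leq_addr addnS ltnSn.
rewrite addnS in md *.
apply/le_anti/andP; split; last exact: (exponent_decr uA reg).
by rewrite leNgt; apply/negP => h; apply: nc; right.
Qed.

Lemma split_arith (tA tB dA dB qA qB a m b e : R) :
  `|tA - dA| <= a * m -> `|tB - dB| <= a * m -> dA = qA -> qB <= dB -> qA - e / 2 <= qB ->
  0 <= m -> m <= b -> 0 <= a -> b * (4 * a + 4) <= e -> tA - e <= tB.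
Proof.
rewrite !ler_distl => /andP[_ h1] /andP[h2 _] E h3 h4 m0 mb a0 h5.
have := ler_wpM2l a0 mb; move: (a * m) h1 h2 => am h1 h2 h6; rewrite E in h1.
by have b0 := le_trans m0 mb; lra.
Qed.

Lemma lower_on_class q (e : R) : (q < d)%N -> 0 < e -> exists2 dl : R, 0 < dl &
  forall B : M -> 'M[R]_d, continuous B -> (forall x, B x \in unitmx) -> close A B dl ->
    mean mu (fun x => \1_(first_end q) x * lam A j x) - e
      <= mean mu (fun x => \1_(first_end q) x * lam B j x).
Proof.
move=> qd e0.
have [jq|qj] := leqP j q; last first.
  exists 1 => // B cB uB _; rewrite (_ : first_end q = set0); last first.
    by apply/seteqP; split=> x // -[]; rewrite leqNgt qj.
  have M0 (l : M -> R) : mean mu (fun x : S => \1_(set0 : set S) x * l x) = 0.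
    transitivity (mean mu (fun=> 0)); last exact: mean_cst.
    by congr (mean mu _); apply/funext => x; rewrite indicE in_set0 mul0r.
  by rewrite [leRHS](M0 (lam B j)) [X in X - _](M0 (lam A j)) sub0r oppr_le0 ltW.
have [C C0 [d1 d10 HC]] := lam_uniform_bound jd.
pose D := first_end q.
have mD : measurable D by exact: measurable_first_end.
pose K n : set S := good_orbit q f A n.+1%:R.
have mK n : measurable (K n) by exact: measurable_good_orbit.
have mDK n : measurable (D `\` K n) by exact: measurableD.
(* Discarding the points whose constant in [good] exceeds the chosen level costs at most C b for A
   and for B; the remaining half of e goes to [core_lower]. *)
pose b : R := e / (4 * C + 4).
have C4 : 0 < 4 * C + 4 by rewrite ltr_wpDl // mulr_ge0.
have b0 : 0 < b by rewrite divr_gt0.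
have bE : b * (4 * C + 4) <= e by rewrite /b divfK // gt_eqF.
have aeK : {ae mu, forall x, forall a : R, 0 < a -> exists n0, forall n, (n0 <= n)%N ->
    `|\1_(D `\` K n) x : R| <= a}.
  apply: ae_imp Hgood => x H a a0.
  have [Dx|nDx] := pselect (D x); last first.
    by exists 0%N => n _; rewrite indicE memNset ?normr0 ?ltW // => -[].
  have [_ [cx _]] := Dx; have [k k0 gk] := H q qd cx.
  have [n0 Hn0] := archi_le k (ltr01 : 0 < (1 : R)).
  exists n0 => n n0n; rewrite indicE memNset ?normr0 ?ltW // => -[_]; apply.
  move=> y oy; apply: good_mono (gk y oy) => //.
  by have := Hn0 n n0n; rewrite mul1r => /le_trans; apply; rewrite ler_nat.
pose u n : S -> R := \1_(D `\` K n).
have mu_ n : measurable_fun setT (u n) by apply: measurable_indic.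
have u1 n x : `|u n x| <= 1.
  by rewrite /u indicE; case: (x \in _); rewrite ?normr1 ?normr0.
have [n0 Hn0] := mean_small_ae mu_ u1 aeK b0.
pose D' := D `&` K n0.
have mD' : measurable D' by exact: measurableI.
have D'inv x : D' (f x) <-> D' x.
  have gi : K n0 (f x) <-> K n0 x.
    by split=> H y oy; apply: H; apply/orbitz_shift.
  have fe := first_end_inv x qd.
  split=> -[h1 h2].
    exact: (conj (fe.1 h1) (gi.1 h2)).
  exact: (conj (fe.2 h1) (gi.2 h2)).
have D'good x : D' x -> good_orbit q f A n0.+1%:R x by case.
have k0 : 0 < n0.+1%:R :> R by rewrite ltr0n.
have e2 : 0 < e / 2 by rewrite divr_gt0.
have [d2 d20 Hcore] := core_lower cA uA qd k0 e2.
exists (Num.min d1 d2); first by rewrite lt_min d10.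
move=> B cB uB clB.
have cl1 : close A B d1 by apply: closeW clB; rewrite ge_min lexx.
have cl2 : close A B d2 by apply: closeW clB; rewrite ge_min lexx orbT.
have clA : close A A d1 by move=> x; rewrite subrr normr0 ltW.
have bD : bmS (\1_D : S -> R) by exact: bmf_indic.
have bD' : bmS (\1_D' : S -> R) by exact: bmf_indic.
have bDK : bmS (\1_(D `\` K n0) : S -> R) by exact: bmf_indic.
have bnd0 : 0 <= mean mu (\1_(D `\` K n0)).
  rewrite -[leLHS](mean_cst mu 0); apply: mean_le => //; first exact: (bmf_cst _ (0 : R)).
have small : mean mu (\1_(D `\` K n0)) <= b.
  have := Hn0 n0 (leqnn _); congr (mean mu _ <= _); apply/funext => x.
  by rewrite ger0_norm.
have ptw (l : M -> R) x : (forall x, `|l x| <= C) ->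
    `|\1_D x * l x - \1_D' x * l x| <= C * \1_(D `\` K n0) x.
  move=> lC; rewrite -mulrBl.
  have [Dx|nDx] := pselect (D x); last first.
    rewrite !indicE !memNset //; [|by case..].
    by rewrite subrr mul0r normr0 mulr0.
  have [Kx|nKx] := pselect (K n0 x).
    rewrite !indicE (mem_set Dx) (mem_set (conj Dx Kx : D' x)) memNset; last by case.
    by rewrite subrr mul0r normr0 mulr0.
  rewrite !indicE (mem_set Dx) (mem_set (conj Dx nKx : (D `\` K n0) x)) memNset; last by case.
  by rewrite subr0 mul1r mulr1.
have meanD (B' : M -> 'M[R]_d) : continuous B' -> (forall x, B' x \in unitmx) -> close A B' d1 ->
    `|mean mu (fun x => \1_D x * lam B' j x) - mean mu (fun x => \1_D' x * lam B' j x)|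
      <= C * mean mu (\1_(D `\` K n0)).
  move=> cB' uB' clB'; have bl : bmS (lam B' j) by exact: bmf_lam.
  have b1 : bmS (fun x => \1_D x * lam B' j x) by exact: bmfM.
  have b2 : bmS (fun x => \1_D' x * lam B' j x) by exact: bmfM.
  rewrite -meanB // -meanZ //; apply: le_trans (mean_norm_le _ _) _; first exact: bmfB.
  apply: mean_le; [by apply: bmf_norm; exact: bmfB|exact: bmfZ|].
  by move=> x; apply: ptw => y; exact: HC.
have hA := meanD A cA uA clA; have hB := meanD B cB uB cl1.
have eqA : mean mu (fun x => \1_D' x * lam A j x) = mean mu (fun x => \1_D' x * lam A q x).
  apply: mean_eq_ae; apply: ae_imp (ae_regular M_compact mu_invariant cA uA) => x reg.
  rewrite indicE; case: (boolP (x \in D')) => [/set_mem [[_ [_ noend]] _]|_]; last by rewrite !mul0r.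
  by congr (_ * _); exact: (class_constant reg jq qd noend).
have leB : mean mu (fun x => \1_D' x * lam B q x) <= mean mu (fun x => \1_D' x * lam B j x).
  apply: mean_le_ae.
  - exact: (bmfM bD' (bmf_lam cB uB qd)).
  - exact: (bmfM bD' (bmf_lam cB uB jd)).
  apply: ae_imp (ae_regular M_compact mu_invariant cB uB) => x reg.
  rewrite indicE; case: (x \in D'); last by rewrite !mul0r.
  by rewrite !mul1r; apply: (exponent_le uB reg); rewrite jq.
have core := Hcore B cB uB cl2 D' mD' D'inv D'good.
exact: (split_arith hA hB eqA leB core bnd0 small C0 bE).
Qed.

Lemma lam_lower (e : R) : 0 < e -> exists2 dl : R, 0 < dl &
  forall B : M -> 'M[R]_d, continuous B -> (forall x, B x \in unitmx) -> close A B dl ->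
    mean mu (lam A j) - e <= mean mu (lam B j).
Proof.
move=> e0; have d0 : 0 < d%:R :> R by rewrite ltr0n; apply: leq_ltn_trans jd.
have ed : 0 < e / d%:R by rewrite divr_gt0.
have [|q qd|dl dl0 H] := @common_radius R d (fun q dl => forall B : M -> 'M[R]_d,
  continuous B -> (forall x, B x \in unitmx) -> close A B dl ->
    mean mu (fun x => \1_(first_end q) x * lam A j x) - e / d%:R
      <= mean mu (fun x => \1_(first_end q) x * lam B j x)).
- by move=> i a b ab H B cB uB clB; apply: H => //; exact: closeW clB.
- exact: lower_on_class.
exists dl => // B cB uB clB.
have dec (B' : M -> 'M[R]_d) : continuous B' -> (forall x, B' x \in unitmx) ->
    mean mu (lam B' j) = \sum_(q < d) mean mu (fun x => \1_(first_end q) x * lam B' j x).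
  move=> cB' uB'; have bq (q : 'I_d) : bmS (fun x => \1_(first_end q) x * lam B' j x).
    apply: bmfM; last exact: bmf_lam.
    by apply: bmf_indic; exact: measurable_first_end.
  rewrite -(mean_sum mu (index_enum 'I_d) bq); congr mean; apply/funext => x.
  by rewrite -mulr_suml first_end_sum mul1r.
rewrite [leRHS](dec B cB uB) [X in X - _](dec A cA uA) lerBlDr.
have -> : e = \sum_(q < d) (e / d%:R).
  by rewrite sumr_const card_ord -[RHS]mulr_natr divfK // gt_eqF.
rewrite -big_split /=; apply: ler_sum => q _.
by rewrite -lerBlDr; apply: H.
Qed.
End Index.

Lemma exponent_sum_lower p (e : R) : (p <= d)%N -> 0 < e -> exists2 dl : R, 0 < dl &
  forall B : M -> 'M[R]_d, continuous B -> (forall x, B x \in unitmx) -> close A B dl ->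
    mean mu (L A p) - e <= mean mu (L B p).
Proof.
move=> pd e0; have ed : 0 < e / p.+1%:R by rewrite divr_gt0.
have [|j jp|dl dl0 H] := @common_radius R p (fun j dl => forall B : M -> 'M[R]_d,
  continuous B -> (forall x, B x \in unitmx) -> close A B dl ->
    mean mu (lam A j) - e / p.+1%:R <= mean mu (lam B j)).
- by move=> i a b ab H B cB uB clB; apply: H => //; exact: closeW clB.
- by apply: lam_lower => //; exact: leq_trans pd.
exists dl => // B cB uB clB.
have dec (B' : M -> 'M[R]_d) : continuous B' -> (forall x, B' x \in unitmx) ->
    mean mu (L B' p) = \sum_(j < p) mean mu (lam B' j).
  move=> cB' uB'; rewrite -(mean_sum mu (index_enum 'I_p) (h := fun (j : 'I_p) x => lam B' j x)).
    by congr mean; apply/funext => x; rewrite -sum_exponents.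
  by move=> j; apply: bmf_lam => //; exact: leq_trans pd.
rewrite [leRHS](dec B cB uB) [X in X - _](dec A cA uA) lerBlDr.
apply: (@le_trans _ _ (\sum_(j < p) mean mu (lam B j) + \sum_(j < p) (e / p.+1%:R))).
  by rewrite -big_split /=; apply: ler_sum => j _; rewrite -lerBlDr; apply: H.
rewrite lerD2l sumr_const card_ord -[leLHS]mulr_natr mulrAC ler_pdivrMr ?ltr0n //.
by rewrite ler_wpM2l ?(ltW e0) // ler_nat.
Qed.
End LogGain.

(** * Baire's theorem and small elements of a transitive closed group *)

Lemma mnorm_col (R : realType) d (v : 'cV[R]_d) : mnorm v = `|v|.
Proof. by rewrite /mnorm mul1r. Qed.

(** [D x y r] stands for a distance at most r. The relational form serves for vectors and also for
    maps into G, where the distance controls the inverses too. *)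
Lemma baire_category (R : realType) (T : Type) (D : T -> T -> R -> Prop) (F : nat -> set T) :
  (forall x, D x x 0) -> (forall x y a b, a <= b -> D x y a -> D x y b) ->
  (forall x y z a b, D x y a -> D y z b -> D x z (a + b)) ->
  (forall (u : nat -> T) (e : nat -> R), (forall n k, D (u n) (u (n + k)%N) (e n)) ->
    (forall eta : R, 0 < eta -> exists n, e n <= eta) -> exists l, forall n, D (u n) l (e n)) ->
  (forall i x, F i x -> exists2 r : R, 0 < r & forall y, D x y r -> F i y) ->
  (forall i x (r : R), 0 < r -> exists2 y, F i y & D x y r) ->
  forall x (r : R), 0 < r -> exists2 y, D x y r & forall i, F i y.
Proof.
move=> refl mono tri complete opn dns x0 r0 r00.
have ex i (s : T * R) : {t : T * R | 0 < s.2 ->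
    [/\ D s.1 t.1 (s.2 / 2), 0 < t.2, t.2 <= s.2 / 2 & forall y, D t.1 y t.2 -> F i y]}.
  apply: cid; have [s0|s0] := ltP 0 s.2; last by exists s.
  have s20 : 0 < s.2 / 2 by rewrite divr_gt0.
  have [y Fy Dy] := dns i s.1 _ s20; have [r rp Hr] := opn i y Fy.
  exists (y, Num.min r (s.2 / 2)) => _ /=; split=> //.
  - by rewrite lt_min rp.
  - by rewrite ge_min lexx orbT.
  - by move=> z Dz; apply: Hr; apply: mono Dz; rewrite ge_min lexx.
pose fix s n := if n is m.+1 then sval (ex m (s m)) else (x0, r0).
have pos n : 0 < (s n).2.
  by elim: n => [|n IH] //=; have [] := svalP (ex n (s n)) IH.
have st n := svalP (ex n (s n)) (pos n).
have cauchy k : forall n, D (s n).1 (s (n + k)%N).1 (s n).2.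
  elim: k => [|k IH] n; first by rewrite addn0; apply: mono (refl _); exact: ltW.
  have [h1 _ h2 _] := st n; rewrite -addSnnS [(s n).2]splitr.
  by apply: tri h1 _; apply: mono (IH n.+1).
have small (eta : R) : 0 < eta -> exists n, (s n).2 <= eta.
  move=> eta0; have [n Hn] := archi_le r0 eta0; exists n.
  have h m : (s m).2 * m.+1%:R <= r0.
    elim: m => [|m IH]; first by rewrite mulr1.
    have [_ _ h2 _] := st m; apply: le_trans IH.
    apply: (@le_trans _ _ ((s m).2 / 2 * m.+2%:R)); first by rewrite ler_wpM2r.
    rewrite -mulrA; apply: ler_wpM2l; first exact: ltW.
    by rewrite ler_pdivrMl // -natrM ler_nat mul2n -addnn addnS ltnS leq_addr.
  rewrite leNgt; apply/negP => lt; have := h n; rewrite leNgt => /negP; apply.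
  apply: le_lt_trans (Hn n (leqnn n)) _; apply: (@le_lt_trans _ _ (eta * n.+1%:R)).
    by rewrite ler_wpM2l ?(ltW eta0) // ler_nat.
  by rewrite ltr_pM2r // ltr0n.
have [l Hl] := complete _ _ (fun n k => cauchy k n) small.
exists l; first exact: Hl 0%N.
by move=> i; have [_ _ _ h] := st i; apply: h; exact: (Hl i.+1).
Qed.

Lemma mx_complete (R : realType) m n (u : nat -> 'M[R]_(m, n)) (e : nat -> R) :
  (forall i k, `|u i - u (i + k)%N| <= e i) -> (forall eta : R, 0 < eta -> exists i, e i <= eta) ->
  exists l, forall i, `|u i - l| <= e i.
Proof.
move=> H _; have [|l Hl] := @mx_cluster R m n u (`|u 0%N| + e 0%N).
  move=> k; rewrite -[u k](subrK (u 0%N)); apply: le_trans (ler_normD _ _) _.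
  by rewrite addrC lerD2l distrC; exact: H.
exists l => i; apply/ler_addgt0Pr => eta eta0; have [k ik Hk] := Hl eta i eta0.
have := H i (k - i)%N; rewrite subnKC // => h.
by rewrite -[X in `|X|](subrKA (u k)); apply: le_trans (ler_normD _ _) _; exact: lerD.
Qed.

Section NearIdentity.
Variables (R : realType) (d : nat).
Implicit Types (g h X Y : 'M[R]_d).

Lemma mnorm0 m n : mnorm (0 : 'M[R]_(m, n)) = 0.
Proof. by rewrite /mnorm normr0 mulr0. Qed.

Lemma mnormZ m n (c : R) (X : 'M[R]_(m, n)) : mnorm (c *: X) = `|c| * mnorm X.
Proof. by rewrite /mnorm normrZ mulrCA. Qed.

Lemma mnormMl m (X : 'M[R]_d) (Z : 'M[R]_(d, m)) : `|X *m Z| <= mnorm X * `|Z|.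
Proof. exact: normrM_mx. Qed.

Lemma unit_near1 g : mnorm (g - 1%:M) < 1 -> g \in unitmx.
Proof.
move=> g1; rewrite -row_free_unit -kermx_eq0; apply/eqP/row_matrixP => i; rewrite row0.
set v := row i _; have vg : v *m g = 0 by apply: (sub_kermxP (row_sub _ _)).
have E : v = - (v *m (g - 1%:M)) by rewrite mulmxBr vg mulmx1 sub0r opprK.
have le : mnorm v <= mnorm v * mnorm (g - 1%:M) by rewrite {1}E mnormN mnormM.
have v0 : mnorm v <= 0.
  rewrite leNgt; apply/negP => v0.
  by move: le; rewrite -{1}[mnorm v]mulr1 ler_pM2l // leNgt g1.
by apply/eqP; rewrite -normr_le0; apply: le_trans (norm_le_mnorm _) v0.
Qed.

Lemma invmx_near1 m g (Z : 'M[R]_(d, m)) : mnorm (g - 1%:M) <= 2^-1 ->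
  mnorm (invmx g *m Z) <= 2 * mnorm Z.
Proof.
move=> g1; have ug : g \in unitmx by apply: unit_near1; lra.
set W := invmx g *m Z; have E : W = Z - (g - 1%:M) *m W.
  by rewrite mulmxBl mul1mx /W mulKVmx // opprB addrC subrK.
have h1 : mnorm W <= mnorm Z + mnorm (g - 1%:M) * mnorm W.
  by rewrite {1}E; apply: le_trans (mnormD _ _) _; rewrite mnormN lerD2l mnormM.
have h2 : mnorm (g - 1%:M) * mnorm W <= 2^-1 * mnorm W by rewrite ler_wpM2r ?mnorm_ge0.
by lra.
Qed.

Lemma mnormB_ratio g h : mnorm (g - 1%:M) <= 2^-1 ->
  mnorm (invmx g *m h - 1%:M) <= 2 * (mnorm (g - 1%:M) + mnorm (h - 1%:M)).
Proof.
move=> g1; have ug : g \in unitmx by apply: unit_near1; lra.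
have -> : invmx g *m h - 1%:M = invmx g *m ((h - 1%:M) - (g - 1%:M)).
  by rewrite opprB addrA subrK mulmxBr mulVmx.
apply: le_trans (invmx_near1 _ g1) _; rewrite ler_wpM2l // addrC.
by apply: le_trans (mnormD _ _) _; rewrite mnormN.
Qed.

Definition mx_pow g n : 'M[R]_d := iter n (mulmx g) 1%:M.

(** Powers of an element near 1 follow a straight line up to a quadratic error, so they pass close
    to the half-way point of a larger element with almost the same direction. *)
Lemma mx_pow_linear Y n : n%:R * mnorm Y <= 1 ->
  mnorm (mx_pow (1%:M + Y) n - 1%:M - n%:R *: Y) <= (n%:R * mnorm Y) ^+ 2.
Proof.
elim: n => [|n IH] nY; first by rewrite /= subrr scale0r subrr mnorm0 mul0r expr0n.
have y0 := mnorm_ge0 Y; set y := mnorm Y in y0 nY IH *.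
have nY' : n%:R * y <= 1 by apply: le_trans nY; rewrite ler_wpM2r // ler_nat.
have {}IH := IH nY'; set E := (X in mnorm X) in IH.
have PE : mx_pow (1%:M + Y) n = 1%:M + n%:R *: Y + E.
  by rewrite /E; apply/matrixP => i j; rewrite !mxE; ring.
have -> : mx_pow (1%:M + Y) n.+1 - 1%:M - n.+1%:R *: Y = E + Y *m (n%:R *: Y + E).
  rewrite /mx_pow iterS -/(mx_pow _ n) mulmxDl mul1mx {2}PE.
  rewrite -[1%:M + _ + E]addrA mulmxDr mulmx1 -natr1 scalerDl scale1r PE.
  apply/matrixP => i j; rewrite !mxE; ring.
have h1 : mnorm (n%:R *: Y + E) <= n%:R * y + (n%:R * y) ^+ 2.
  by apply: le_trans (mnormD _ _) _; rewrite mnormZ normr_nat lerD2l.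
have h2 : mnorm (E + Y *m (n%:R *: Y + E)) <= (n%:R * y) ^+ 2 + y * (n%:R * y + (n%:R * y) ^+ 2).
  apply: le_trans (mnormD _ _) _; rewrite lerD //.
  by apply: le_trans (mnormM _ _) _; rewrite ler_wpM2l.
apply: le_trans h2 _; rewrite -natr1.
have h3 : (n%:R * y) ^+ 2 <= n%:R * y.
  by rewrite expr2 -[leRHS]mul1r ler_wpM2r // mulr_ge0.
have h4 : y * (n%:R * y + (n%:R * y) ^+ 2) <= y * (n%:R * y + n%:R * y).
  by rewrite ler_wpM2l // lerD2l.
have h5 : 0 <= y ^+ 2 by exact: sqr_ge0.
apply: le_trans (lerD (lexx _) h4) _.
by rewrite -subr_ge0 (_ : _ - _ = y ^+ 2) //; ring.
Qed.
End NearIdentity.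

Section SmallElements.
Variables (R : realType) (d : nat) (G : set 'M[R]_d).
Hypothesis HG : closed_subgroup_GL G.
Implicit Types (g h q : 'M[R]_d).

Lemma subgroup1 : G 1%:M. Proof. by case: HG. Qed.
Lemma subgroupM g h : G g -> G h -> G (g *m h). Proof. by case: HG => _ _ H _; exact: H. Qed.
Lemma subgroupV g : G g -> G (invmx g). Proof. by case: HG => _ _ _; exact. Qed.
Lemma subgroup_unit g : G g -> g \in unitmx.
Proof. by case: HG => -[C _ ->] _ _ _ []. Qed.

Lemma subgroup_pow g n : G g -> G (mx_pow g n).
Proof. by move=> Gg; elim: n => [|n IH]; [exact: subgroup1|exact: subgroupM]. Qed.

Let half_arith (t a : R) : 0 < t -> t <= 1 / 100 -> 0 <= a -> a <= t / 2 ->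
  a + a ^+ 2 <= 3 / 5 * t.
Proof.
move=> t0 t1 a0 a1; have h : a ^+ 2 <= 1 / 100 * a by rewrite expr2 ler_wpM2r //; lra.
by lra.
Qed.

(* An approximate square root of g is a power of a much smaller element of G having almost the
   same direction as g, which exists by compactness of the set of directions. *)
Lemma small_halving : exists2 r : R, 0 < r & forall g, G g -> mnorm (g - 1%:M) < r ->
  exists q, [/\ G q, mnorm (q - 1%:M) <= 3 / 5 * mnorm (g - 1%:M) &
    mnorm (invmx q *m g - 1%:M) <= 3 / 5 * mnorm (g - 1%:M)].
Proof.
apply: contrapT => H.
have ex k : {g | G g /\ mnorm (g - 1%:M) < k.+1%:R^-1 /\
    forall q, ~ [/\ G q, mnorm (q - 1%:M) <= 3 / 5 * mnorm (g - 1%:M) &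
    mnorm (invmx q *m g - 1%:M) <= 3 / 5 * mnorm (g - 1%:M)]}.
  apply: cid; apply: contrapT => Hk; apply: H; exists k.+1%:R^-1; first by rewrite invr_gt0.
  move=> g Gg gk; apply: contrapT => nq; apply: Hk; exists g; split=> //; split=> // q Hq.
  by apply: nq; exists q.
pose g k := sval (ex k); pose t k := mnorm (g k - 1%:M).
have Gg k : G (g k) by have [] := svalP (ex k).
have tk k : t k < k.+1%:R^-1 by have [_ []] := svalP (ex k).
have nq k q : ~ [/\ G q, mnorm (q - 1%:M) <= 3 / 5 * t k & mnorm (invmx q *m g k - 1%:M) <= 3 / 5 * t k].
  by have [_ [_]] := svalP (ex k); exact.
have t0 k : 0 < t k.
  rewrite lt_neqAle mnorm_ge0 andbT; apply/eqP => /esym tk0; apply: (nq k (g k)).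
  by rewrite -/(t k) tk0 mulVmx ?subgroup_unit // subrr mnorm0 mulr0; split.
pose D k := (t k)^-1 *: (g k - 1%:M).
have D1 k : mnorm (D k) = 1.
  by rewrite mnormZ gtr0_norm ?invr_gt0 // -/(t k) mulVf ?gt_eqF.
have gD k : g k = 1%:M + t k *: D k.
  by rewrite /D scalerA divff ?gt_eqF // scale1r addrC subrK.
have [|l Hl] := @mx_cluster R d d D 1.
  by move=> k; apply: le_trans (norm_le_mnorm _) _; rewrite D1.
have e0 : 0 < (100 * (d%:R + 1))^-1 :> R by rewrite invr_gt0 mulr_gt0 // ltr_wpDl.
have small (X : 'M[R]_d) : `|X| <= (100 * (d%:R + 1))^-1 -> mnorm X <= 1 / 100.
  move=> hX; rewrite /mnorm; apply: (@le_trans _ _ ((d%:R + 1) * (100 * (d%:R + 1))^-1)).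
    by apply: ler_pM => //; rewrite lerDl.
  by rewrite invfM mulrCA divff ?mulr1 ?gt_eqF ?ltr_wpDl // mul1r.
have tsmall (e : R) : 0 < e -> exists k0, forall k, (k0 <= k)%N -> t k <= e.
  move=> ep; have [n0 Hn0] := archi_le 1 ep; exists n0 => k kn.
  apply: le_trans (ltW (tk k)) _; rewrite -[leLHS]mul1r ler_pdivrMr ?ltr0n //.
  exact: (Hn0 k.+1 (leqW kn)).
have [j0 Hj0] := tsmall _ (divr_gt0 (@ltr01 R) (ltr0n R 100)).
have [j j0j /small Dj] := Hl _ j0 e0; have {Hj0 j0j} tj := Hj0 j j0j.
have [k0 Hk0] := tsmall _ (divr_gt0 (t0 j) (ltr0n R 100)).
have [k k0k /small Dk] := Hl _ k0 e0; have {Hk0 k0k} ttk := Hk0 k k0k.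
have Djk : mnorm (D j - D k) <= 1 / 50.
  have -> : D j - D k = (D j - l) - (D k - l) by rewrite opprB addrA subrK.
  by apply: le_trans (mnormD _ _) _; rewrite mnormN; lra.
(* The index j is fixed first, then k with t k far below t j; about t j / (2 t k) powers of g k
   cover half of the way to g j. *)
pose n := Num.truncn (t j / 2 / t k).
have /andP[n1 n2] : n%:R <= t j / 2 / t k < n.+1%:R.
  by apply: truncn_itv; rewrite !divr_ge0 // ltW.
rewrite ler_pdivlMr // in n1; rewrite ltr_pdivrMr // -[n.+1%:R]natr1 mulrDl mul1r in n2.
pose E := mx_pow (g k) n - 1%:M - n%:R *: (t k *: D k).
have mY : mnorm (t k *: D k) = t k by rewrite mnormZ D1 mulr1 gtr0_norm.
have tj0 := t0 j; have tk0 := t0 k; set a := n%:R * t k in n1 n2.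
have a0 : 0 <= a by rewrite /a mulr_ge0 // ltW.
have EE : mnorm E <= a ^+ 2.
  by have := @mx_pow_linear R d (t k *: D k) n; rewrite mY -gD; apply; rewrite -/a; lra.
have qE : mx_pow (g k) n - 1%:M = a *: D k + E by rewrite /E scalerA [RHS]addrC subrK.
have q1 : mnorm (mx_pow (g k) n - 1%:M) <= 3 / 5 * t j.
  rewrite qE; apply: le_trans (half_arith tj0 tj a0 n1).
  by apply: le_trans (mnormD _ _) _; rewrite mnormZ D1 mulr1 ger0_norm // lerD2l.
apply: (nq j (mx_pow (g k) n)); split=> //; first exact: subgroup_pow.
set q := mx_pow _ _ in q1 qE *.
have uq : q \in unitmx by apply: subgroup_unit; exact: subgroup_pow.
set W := invmx q *m g j - 1%:M.
have WE : W = (g j - q) - (q - 1%:M) *m W.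
  have qW : q *m W = g j - q by rewrite mulmxBr mulmx1 mulKVmx.
  by rewrite mulmxBl mul1mx qW opprB addrC subrK.
have gq : g j - q = t j *: (D j - D k) + (t j - a) *: D k - E.
  rewrite (_ : q = 1%:M + a *: D k + E); last by rewrite -addrA -qE addrC subrK.
  rewrite gD scalerBr scalerBl; apply/matrixP => i i'; rewrite !mxE; ring.
have h1 : mnorm (g j - q) <= t j / 50 + (t j - a) + a ^+ 2.
  rewrite gq; apply: le_trans (mnormD _ _) _; rewrite mnormN lerD //.
  apply: le_trans (mnormD _ _) _; rewrite [mnorm (t j *: _)]mnormZ [mnorm ((t j - a) *: _)]mnormZ D1 mulr1 gtr0_norm // ger0_norm; last by lra.
  by rewrite lerD2r; apply: le_trans (ler_wpM2l (ltW tj0) Djk) _; lra.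
have h2 : mnorm W <= mnorm (g j - q) + mnorm (q - 1%:M) * mnorm W.
  by rewrite {1}WE; apply: le_trans (mnormD _ _) _; rewrite mnormN lerD2l mnormM.
have W0 := mnorm_ge0 W.
have h3 : mnorm (q - 1%:M) * mnorm W <= 3 / 500 * mnorm W by rewrite ler_wpM2r //; lra.
have h4 : a ^+ 2 <= 1 / 200 * (t j / 2).
  by rewrite expr2 ler_pM //; lra.
by lra.
Qed.

Lemma closed_limit_mx (C : set 'M[R]_d) l : closed C ->
  (forall e : R, 0 < e -> exists2 X, C X & `|X - l| <= e) -> C l.
Proof.
move=> cC H; apply: cC => B /nbhs_ballP[e /= e0 He].
have [X CX Xl] := H _ (divr_gt0 e0 (ltr0n R 2)); exists X; split=> //; apply: He.
rewrite -ball_normE /= distrC; apply: le_lt_trans Xl _.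
by rewrite ltr_pdivrMr // ltr_pMr // ltr1n.
Qed.

Lemma subgroup_limit l : l \in unitmx ->
  (forall e : R, 0 < e -> exists2 X, G X & `|X - l| <= e) -> G l.
Proof.
case: HG => -[C cC ->] _ _ _ ul H; split=> //; apply: closed_limit_mx cC _ => e /H[X [CX _] h].
by exists X.
Qed.

Section Path.
Variables (mid : 'M[R]_d -> 'M[R]_d) (r : R) (g : 'M[R]_d).
Hypothesis midP : forall h, G h -> mnorm (h - 1%:M) < r ->
  [/\ G (mid h), mnorm (mid h - 1%:M) <= 3 / 5 * mnorm (h - 1%:M) &
    mnorm (invmx (mid h) *m h - 1%:M) <= 3 / 5 * mnorm (h - 1%:M)].
Local Notation D := (d%:R + 1 : R).
Local Notation rho := (mnorm (g - 1%:M)).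
Hypotheses (Gg : G g) (gr : rho < r) (g_small : 4 * D * rho <= 2^-1).

(** The approximate value of the path at i / 2^n, with odd points inserted as approximate midpoints
    in the group. Past the parameter 1 it stays at g. *)
Fixpoint dyadic n i : 'M[R]_d :=
  if n is m.+1 then
    if odd i then dyadic m i./2 *m mid (invmx (dyadic m i./2) *m dyadic m i./2.+1)
    else dyadic m i./2
  else if i == 0%N then 1%:M else g.

Let rho0 : 0 <= rho := mnorm_ge0 _.
Let D1 : 1 <= D. Proof. by rewrite lerDr. Qed.
Let fifth n : 0 < (3 / 5 : R) ^+ n. Proof. by rewrite exprn_gt0. Qed.
Let fifth1 n : (3 / 5 : R) ^+ n <= 1. Proof. by apply: exprn_ile1; lra. Qed.

Lemma mnorm1_le : mnorm (1%:M : 'M[R]_d) <= d%:R.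
Proof.
rewrite /mnorm -[leRHS]mulr1 ler_wpM2l //; apply: mx_norm_le => // i j.
by rewrite mxE; case: eqP => _; rewrite ?normr1 ?normr0.
Qed.

Lemma mnorm_near1 h : mnorm (h - 1%:M) <= 1 -> mnorm h <= D.
Proof.
move=> h1; rewrite -[h](subrK 1%:M); apply: le_trans (mnormD _ _) _.
by have := mnorm1_le; lra.
Qed.

(** Each refinement shortens the steps by 3/5 rather than 1/2, which still decays geometrically. The
    distances to 1 grow by D rho (3/5)^n at level n, and these increments sum to 3/2 D rho. *)
Lemma dyadicP n i : [/\ G (dyadic n i),
  mnorm (dyadic n i - 1%:M) <= rho + 3 / 2 * (D * rho) * (1 - (3 / 5) ^+ n) &
  mnorm (invmx (dyadic n i) *m dyadic n i.+1 - 1%:M) <= (3 / 5) ^+ n * rho].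
Proof.
elim: n i => [|n IH] i.
  rewrite expr0 subrr mulr0 addr0 mul1r /=.
  case: eqP => _; first by rewrite subrr mnorm0 invmx1 mul1mx; split=> //; exact: subgroup1.
  by rewrite mulVmx ?(subgroup_unit) // subrr mnorm0; split.
set a := i./2; have [Ga na da] := IH a; have [Ga' na' _] := IH a.+1.
set P := dyadic n a in Ga na da *; set P' := dyadic n a.+1 in Ga' na' da *.
have Dr : 0 <= D * rho by rewrite mulr_ge0 //; lra.
have f0 := fifth n; have f1 := fifth1 n.
have Gh : G (invmx P *m P') by apply: subgroupM => //; exact: subgroupV.
have hr : mnorm (invmx P *m P' - 1%:M) < r.
  by apply: le_lt_trans da (le_lt_trans _ gr); rewrite ler_piMl.
have [Gq q1 q2] := midP Gh hr; set q := mid _ in Gq q1 q2.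
have uP := subgroup_unit Ga; have uq := subgroup_unit Gq.
have bnd x : x <= 1 -> 3 / 2 * (D * rho) * x <= 3 / 2 * (D * rho).
  by move=> x1; rewrite ler_piMr // mulr_ge0.
have P1 : mnorm (P - 1%:M) <= 1.
  apply: le_trans na _; have := bnd (1 - (3 / 5) ^+ n); move: g_small.
  have : rho <= D * rho by rewrite ler_peMl.
  rewrite -mulrA; set z := D * rho; set w := 3 / 2 * z * _; move: rho0 => r0 h1 h2 h3.
  by have := h3 (ltac:(lra)); lra.
have PD : mnorm P <= D by exact: mnorm_near1.
have q1' : mnorm (q - 1%:M) <= (3 / 5) ^+ n.+1 * rho.
  by apply: le_trans q1 _; rewrite exprS -[leRHS]mulrA ler_wpM2l //; lra.
have q2' : mnorm (invmx q *m (invmx P *m P') - 1%:M) <= (3 / 5) ^+ n.+1 * rho.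
  by apply: le_trans q2 _; rewrite exprS -[leRHS]mulrA ler_wpM2l //; lra.
have nPq : mnorm (P *m q - 1%:M) <= rho + 3 / 2 * (D * rho) * (1 - (3 / 5) ^+ n.+1).
  have -> : P *m q - 1%:M = (P - 1%:M) + P *m (q - 1%:M) by rewrite mulmxBr mulmx1 [RHS]addrC subrKA.
  apply: le_trans (mnormD _ _) _.
  have h : mnorm (P *m (q - 1%:M)) <= D * ((3 / 5) ^+ n.+1 * rho).
    by apply: le_trans (mnormM _ _) _; rewrite ler_pM ?mnorm_ge0.
  apply: le_trans (lerD na h) _; rewrite exprS; set f := _ ^+ n.
  by apply: eq_ler; field.
have nP : mnorm (P - 1%:M) <= rho + 3 / 2 * (D * rho) * (1 - (3 / 5) ^+ n.+1).
  apply: le_trans na _; rewrite lerD2l ler_wpM2l ?mulr_ge0 // lerD2l lerN2 exprS ler_piMl ?ltW //; lra.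
have E1 : dyadic n.+1 i = if odd i then P *m q else P by [].
have E2 : dyadic n.+1 i.+1 = if odd i then P' else P *m q.
  by rewrite /= uphalf_half; case: (odd i).
rewrite E1 E2; case: (odd i); last first.
  by split=> //; rewrite mulKmx.
split=> //; first exact: subgroupM.
have -> : invmx (P *m q) = invmx q *m invmx P.
  have uPq : P *m q \in unitmx by rewrite unitmx_mul uP.
  by rewrite -[RHS](mulmxK uPq) -!mulmxA (mulKmx uP) (mulKmx uq).
by rewrite -mulmxA.
Qed.

Lemma dyadic_small n i : mnorm (dyadic n i - 1%:M) <= 4 * D * rho.
Proof.
have [_ h _] := dyadicP n i; apply: le_trans h _.
have Dr : 0 <= D * rho by rewrite mulr_ge0 //; lra.
have : rho <= D * rho by rewrite ler_peMl.
have : 3 / 2 * (D * rho) * (1 - (3 / 5) ^+ n) <= 3 / 2 * (D * rho).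
  by rewrite ler_piMr ?mulr_ge0 //; have := fifth n; lra.
by rewrite -mulrA; lra.
Qed.

Lemma dyadic_next n i : `|dyadic n i.+1 - dyadic n i| <= (3 / 5) ^+ n * (D * rho).
Proof.
have [Ga _ da] := dyadicP n i; have ua := subgroup_unit Ga.
apply: le_trans (norm_le_mnorm _) _.
have -> : dyadic n i.+1 - dyadic n i = dyadic n i *m (invmx (dyadic n i) *m dyadic n i.+1 - 1%:M).
  by rewrite mulmxBr mulmx1 mulKVmx.
apply: le_trans (mnormM _ _) _; rewrite [leRHS]mulrCA; apply: ler_pM; rewrite ?mnorm_ge0 //.
by apply: mnorm_near1; apply: le_trans (dyadic_small n i) (le_trans g_small _); lra.
Qed.

Lemma dyadic_near n i j : (i <= j.+1)%N -> (j <= i.+1)%N ->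
  `|dyadic n i - dyadic n j| <= (3 / 5) ^+ n * (D * rho).
Proof.
move=> ij ji; have Dr : 0 <= D * rho by rewrite mulr_ge0 //; lra.
have [->|->|->] : [\/ i = j, i = j.+1 | j = i.+1].
- case: (ltngtP i j) => [h|h|h]; first by apply: Or33; lia.
    by apply: Or32; lia.
  exact: Or31.
- by rewrite subrr normr0 mulr_ge0 // ltW.
- exact: dyadic_next.
- by rewrite distrC; exact: dyadic_next.
Qed.

Definition dyadic_approx n (s : R) := dyadic n (Num.truncn (2 ^+ n * s)).

Lemma dyadic_refine n s : `|dyadic_approx n.+1 s - dyadic_approx n s| <= (3 / 5) ^+ n * (D * rho).
Proof.
have Dr : 0 <= D * rho by rewrite mulr_ge0 //; lra.
rewrite /dyadic_approx; set x := 2 ^+ n * s; have -> : 2 ^+ n.+1 * s = 2 * x by rewrite exprS mulrA.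
set i := Num.truncn (2 * x); have -> : Num.truncn x = i./2.
  have [x0|x0] := ltP x 0.
    by rewrite /i !truncn_floor !leNgt x0 (_ : 2 * x < 0) //; lra.
  have /andP[h1 h2] := truncn_itv x0; have x20 : 0 <= 2 * x by lra.
  have /andP[h3 h4] := truncn_itv x20; rewrite -/i in h3 h4.
  set k := Num.truncn x in h1 h2 *.
  have h5 : (2 * k < i.+1)%N by rewrite -(ltr_nat R) natrM; apply: le_lt_trans h4; lra.
  have h6 : (i < 2 * k.+1)%N by rewrite -(ltr_nat R) natrM; apply: le_lt_trans h3 _; lra.
  by clearbody i k; clear -h5 h6; lia.
have <- : dyadic n.+1 (i./2).*2 = dyadic n i./2 by rewrite /= odd_double doubleK.
have h := @dyadic_near n.+1 i (i./2).*2.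
apply: le_trans (h _ _) _; [by clearbody i; clear; lia|by clearbody i; clear; lia|].
by rewrite ler_wpM2r // exprS ler_piMl ?ltW ?fifth //; lra.
Qed.

Lemma dyadic_cauchy n k s :
  `|dyadic_approx (n + k) s - dyadic_approx n s| <= (3 / 5) ^+ n * (3 * (D * rho)).
Proof.
have Dr : 0 <= D * rho by rewrite mulr_ge0 //; lra.
suff H : `|dyadic_approx (n + k) s - dyadic_approx n s| <=
    (3 / 5) ^+ n * (5 / 2 * (D * rho)) * (1 - (3 / 5) ^+ k).
  apply: le_trans H _; have f0 := fifth n; have fk := fifth k; have fk1 := fifth1 k.
  apply: (@le_trans _ _ ((3 / 5) ^+ n * (5 / 2 * (D * rho)))).
    by apply: ler_piMr; [apply: mulr_ge0; [exact: ltW|lra]|lra].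
  by apply: ler_wpM2l; [exact: ltW|lra].
elim: k => [|k IH]; first by rewrite addn0 subrr normr0 expr0 subrr mulr0.
rewrite addnS -[X in `|X|](subrKA (dyadic_approx (n + k) s)).
apply: le_trans (ler_normD _ _) (le_trans (lerD (dyadic_refine _ _) IH) _).
by rewrite exprS exprD; set a := _ ^+ n; set b := _ ^+ k; apply: eq_ler; field.
Qed.

Lemma dyadic_limit s : exists l : 'M[R]_d, forall n, `|dyadic_approx n s - l| <= (3 / 5) ^+ n * (3 * (D * rho)).
Proof.
have [|l Hl] := @mx_cluster R d d (dyadic_approx ^~ s) D.
  move=> k; apply: le_trans (norm_le_mnorm _) _; apply: mnorm_near1.
  by apply: le_trans (dyadic_small _ _) (le_trans g_small _); lra.
exists l => n; apply/ler_addgt0Pr => e e0; have [k nk kl] := Hl e n e0.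
have := dyadic_cauchy n (k - n) s; rewrite subnKC // => h.
rewrite -[X in `|X|](subrKA (dyadic_approx k s)); apply: le_trans (ler_normD _ _) _.
by rewrite distrC lerD.
Qed.

Lemma geometric_small (c e : R) : 0 < e -> exists n, (3 / 5) ^+ n * c <= e.
Proof.
move=> e0; have [n0 Hn0] := archi_le (`|c| * 2) e0; exists n0.
have cn : c <= `|c| by exact: ler_norm.
have h n : (3 / 5 : R) ^+ n * n%:R <= 2.
  suff : (3 / 5 : R) ^+ n * (n%:R + 2) <= 2.
    by apply: le_trans; rewrite (ler_wpM2l (ltW (fifth n))) // lerDl.
  elim: n => [|n IH]; first by rewrite expr0 mul1r add0r.
  apply: le_trans IH; rewrite exprS -[leLHS]mulrA mulrCA (ler_wpM2l (ltW (fifth n))) //.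
  by rewrite -natr1; have : (0 : R) <= n%:R by []; lra.
have [n00|n0p] := leqP n0 0.
  have := Hn0 n0 (leqnn _); move: n00; rewrite leqn0 => /eqP ->; rewrite mulr0 => c2.
  have -> : c = 0.
    apply/eqP; rewrite -normr_le0; lra.
  by rewrite mulr0 ltW.
have n0R : (0 : R) < n0%:R by rewrite ltr0n.
rewrite -(ler_pM2r n0R); apply: le_trans (Hn0 n0 (leqnn _)).
rewrite mulrAC; apply: le_trans (_ : 2 * `|c| <= _); last by rewrite mulrC.
apply: (@le_trans _ _ ((3 / 5) ^+ n0 * n0%:R * `|c|)).
  by rewrite ler_wpM2l // mulr_ge0 // ltW.
by rewrite ler_wpM2r.
Qed.

(** The dyadic approximations converge geometrically, and nearby parameters have equal or adjacent
    approximations at level n, whence continuity. Limits stay in G because they are invertible and G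
    is closed in GL. *)
Lemma path_exists : exists gam : R -> 'M[R]_d, [/\ continuous gam, gam 0 = 1%:M, gam 1 = g &
  forall s, G (gam s) /\ mnorm (gam s - 1%:M) <= 4 * D * rho].
Proof.
pose gam s := sval (cid (dyadic_limit s)).
have gamP s n : `|dyadic_approx n s - gam s| <= (3 / 5) ^+ n * (3 * (D * rho)) by exact: svalP (cid (dyadic_limit s)) n.
have Dr : 0 <= D * rho by rewrite mulr_ge0 //; lra.
have approx s (e : R) : 0 < e -> exists n, `|dyadic_approx n s - gam s| <= e.
  move=> e0; have [n Hn] := geometric_small (3 * (D * rho)) e0; exists n.
  exact: le_trans (gamP s n) Hn.
have const s X : (forall n, dyadic_approx n s = X) -> gam s = X.
  move=> HX; apply/eqP; rewrite eq_sym -subr_eq0 -normr_le0; apply/ler_addgt0Pr => e e0.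
  by have [n] := approx s e e0; rewrite HX distrC add0r.
have small s : mnorm (gam s - 1%:M) <= 4 * D * rho.
  apply/ler_addgt0Pr => e e0; have d0 : 0 < D := lt_le_trans ltr01 D1.
  have [n Hn] := approx s _ (divr_gt0 e0 d0).
  rewrite -[X in mnorm X](subrKA (dyadic_approx n s)); apply: le_trans (mnormD _ _) _.
  rewrite addrC lerD ?dyadic_small // /mnorm distrC.
  apply: (@le_trans _ _ (D * (e / D))); last by rewrite mulrCA divff ?mulr1 // gt_eqF.
  by rewrite ler_pM // lerDl.
exists gam; split.
- move=> s; apply/cvgrPdist_le => e e0.
  have e3 : 0 < e / 2 by rewrite divr_gt0.
  have [n Hn] := geometric_small (7 * (D * rho)) e0.
  have p0 : 0 < (2 ^+ n : R) by rewrite exprn_gt0.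
  near=> u.
  have us : `|s - u| < (2 ^+ n)^-1.
    by near: u; exists (2 ^- n) => //=; rewrite invr_gt0.
  have us2 : `|2 ^+ n * s - 2 ^+ n * u| <= 1.
    by rewrite -mulrBr normrM gtr0_norm // mulrC -ler_pdivlMr // mul1r ltW.
  have mono (x y : R) : `|x - y| <= 1 -> (Num.truncn x <= (Num.truncn y).+1)%N.
    move=> xy; rewrite truncn_le_nat -natr1; have := truncnS_gt y.
    by move: xy; rewrite ler_distl => /andP[_]; lra.
  have us3 : `|2 ^+ n * u - 2 ^+ n * s| <= 1 by rewrite distrC.
  have near := dyadic_near n (mono _ _ us2) (mono _ _ us3).
  have -> : gam s - gam u = (gam s - dyadic_approx n s) + (dyadic_approx n s - dyadic_approx n u)
    + (dyadic_approx n u - gam u) by rewrite !subrKA.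
  apply: le_trans (ler_normD _ _) _; apply: le_trans (lerD (ler_normD _ _) (lexx _)) _.
  rewrite [`|gam s - _|]distrC; apply: le_trans Hn.
  apply: le_trans (lerD (lerD (gamP s n) near) (gamP u n)) _.
  by set f := _ ^+ n; apply: eq_ler; ring.
- apply: const => n; rewrite /dyadic_approx mulr0 truncn0.
  by elim: n.
- apply: const => n; rewrite /dyadic_approx mulr1 -natrX natrK.
  by elim: n => [|n IH] //=; rewrite expnS mul2n odd_double doubleK.
- move=> s; split; last exact: small.
  apply: subgroup_limit; first by apply: unit_near1; apply: le_lt_trans (le_trans (small s) g_small) _; lra.
  by move=> e e0; have [n Hn] := approx s e e0; exists (dyadic_approx n s) => //; have [] := dyadicP n (Num.truncn (2 ^+ n * s)).
Unshelve. all: by end_near.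
Qed.
End Path.

(** The path is what allows g to be inserted continuously in space: [multiplier] composes it with a
    Urysohn function. *)
Definition reachable (e : R) g := exists gam : R -> 'M[R]_d, [/\ continuous gam, gam 0 = 1%:M, gam 1 = g &
  forall s, G (gam s) /\ mnorm (gam s - 1%:M) <= e].

Lemma small_reachable (e : R) : 0 < e -> exists2 r : R, 0 < r &
  forall g, G g -> mnorm (g - 1%:M) <= r -> reachable e g.
Proof.
move=> e0; have [r r0 Hr] := small_halving.
have ex h : exists q, G h -> mnorm (h - 1%:M) < r ->
  [/\ G q, mnorm (q - 1%:M) <= 3 / 5 * mnorm (h - 1%:M) &
    mnorm (invmx q *m h - 1%:M) <= 3 / 5 * mnorm (h - 1%:M)].
  have [[Gh hr]|nh] := pselect (G h /\ mnorm (h - 1%:M) < r).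
    by have [q Hq] := Hr h Gh hr; exists q.
  by exists 1%:M => Gh hr; case: nh.
pose mid h := sval (cid (ex h)).
have D0 : 0 < 4 * (d%:R + 1) :> R by rewrite mulr_gt0 // ltr_wpDl.
pose r' := Num.min (r / 2) (Num.min e 2^-1 / (4 * (d%:R + 1))).
exists r'; first by rewrite lt_min !divr_gt0 // lt_min e0 invr_gt0 ltr0n.
move=> g Gg; rewrite /r' le_min (ler_pdivlMr _ _ D0) [_ * (4 * _)]mulrC le_min => /and3P[g1 g2 g3].
have gr : mnorm (g - 1%:M) < r by lra.
have [gam [c1 c2 c3 c4]] := @path_exists mid r g (fun h => svalP (cid (ex h))) Gg gr g3.
exists gam; split=> // s; have [h1 h2] := c4 s; split=> //; exact: le_trans h2 g2.
Qed.
Hypotheses (d_gt0 : (0 < d)%N) (G_transitive : projectively_transitive G).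
Implicit Types (u v x y : 'cV[R]_d).

Lemma move_line u v : u != 0 -> v != 0 -> exists2 g, G g & exists2 c : R, c != 0 & v = c *: (g *m u).
Proof.
move=> u0 v0; have := @G_transitive <[u]>%VS <[v]>%VS.
rewrite !dim_vline u0 v0 => /(_ erefl erefl)[g Gg]; rewrite /img limg_line lfunE /= => E.
exists g => //; have : v \in <[g *m u]>%VS by rewrite E memv_line.
move=> /vlineP[c vE]; exists c => //.
by apply: contraNneq v0 => c0; rewrite vE c0 scale0r.
Qed.

Lemma rat_approx (x e : R) : 0 < e -> exists q : rat, `|ratr q - x| <= e.
Proof.
move=> e0; have lt : x - e < x + e by lra.
have [q] := rat_in_itvoo lt; rewrite in_itv /= => /andP[h1 h2]; exists q.
by rewrite ler_distl; apply/andP; split; lra.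
Qed.

Lemma rat_mx_approx (X : 'M[R]_d) (e : R) : 0 < e -> exists q : 'M[rat]_d, `|map_mx ratr q - X| <= e.
Proof.
move=> e0; pose q i j := sval (cid (rat_approx (X i j) e0)).
exists (\matrix_(i, j) q i j); apply: mx_norm_le => [|i j]; first exact: ltW.
by rewrite !mxE; exact: svalP (cid (rat_approx (X i j) e0)).
Qed.

(** Separability of G: for each rational matrix q that is nearly inverse to some element of G, one
    such element is selected. *)
Lemma countable_cover (r : R) : 0 < r -> exists2 h : nat -> 'M[R]_d, forall i, G (h i) &
  forall g, G g -> exists i, mnorm (invmx (h i) *m g - 1%:M) <= r.
Proof.
move=> r0; pose r' := Num.min 2^-1 (r / 4).
have r'0 : 0 < r' by rewrite lt_min invr_gt0 ltr0n divr_gt0.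
have [r'1 r'2] : r' <= 2^-1 /\ r' <= r / 4 by split; rewrite /r' ge_min lexx ?orbT.
pose near (q : 'M[rat]_d) h := G h /\ mnorm (map_mx (ratr : rat -> R) q *m h - 1%:M) <= r'.
have ex i : exists h, G h /\ forall q : 'M[rat]_d, unpickle i = Some q -> (exists g, near q g) -> near q h.
  case E : (unpickle i : option 'M[rat]_d) => [q|]; last first.
    by exists 1%:M; split=> //; exact: subgroup1.
  have [[h Hh]|nh] := pselect (exists g, near q g).
    by exists h; split; [by case: Hh|move=> _ [<-]].
  by exists 1%:M; split; [exact: subgroup1|move=> _ [<-] /nh].
exists (fun i => sval (cid (ex i))) => [i|g Gg]; first by have [] := svalP (cid (ex i)).
have D0 : 0 < d%:R * (mnorm g + 1) :> R by rewrite mulr_gt0 ?ltr0n // ltr_wpDl // mnorm_ge0.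
have [q Hq] := rat_mx_approx (invmx g) (divr_gt0 r'0 D0).
have ug := subgroup_unit Gg.
have ng : near q g.
  split=> //; have -> : map_mx ratr q *m g - 1%:M = (map_mx ratr q - invmx g) *m g.
    by rewrite mulmxBl mulVmx.
  apply: le_trans (mnormM _ _) _; rewrite {1}/mnorm.
  rewrite ler_pdivlMr // in Hq; apply: le_trans Hq.
  rewrite mulrC mulrA [_ * d%:R]mulrC -mulrA [leRHS]mulrCA ler_wpM2l //.
  by rewrite [leRHS]mulrC ler_wpM2r ?normr_ge0 // lerDl.
exists (pickle q); have [Gh] := svalP (cid (ex (pickle q))).
set h := sval _ in Gh * => /(_ q (pickleK q) (ex_intro _ g ng))[_ hq].
have uh := subgroup_unit Gh.
have [_ gq] := ng; set Q := map_mx ratr q in hq gq.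
have uQh : Q *m h \in unitmx by apply: unit_near1; lra.
have -> : invmx h *m g = invmx (Q *m h) *m (Q *m g).
  by rewrite -[LHS](mulKmx uQh) -mulmxA mulKVmx.
by apply: le_trans (mnormB_ratio _ _) _; lra.
Qed.

Lemma closed_of_limits (S : set 'cV[R]_d) :
  (forall l, (forall e : R, 0 < e -> exists2 x, S x & `|x - l| <= e) -> S l) -> closed S.
Proof.
move=> H l cl; apply: H => e e0; have [x [Sx]] := cl _ (nbhsx_ballx l e e0).
by rewrite -ball_normE /= distrC => /ltW h; exists x.
Qed.

Lemma closed_line x l : x != 0 -> (forall e : R, 0 < e -> exists c : R, `|c *: x - l| <= e) ->
  exists c : R, l = c *: x.
Proof.
move=> x0 H; have [i xi] : exists i, x i 0 != 0.
  apply: contrapT => nx; move/eqP: x0; apply; apply/matrixP => i j; rewrite mxE ord1.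
  by apply/eqP/negPn/negP => h; apply: nx; exists i.
exists (l i 0 / x i 0); apply/eqP; rewrite -subr_eq0 -normr_le0; apply/ler_addgt0Pr => e e0; rewrite add0r.
pose K := 1 + `|x| / `|x i 0|; have K0 : 0 < K by rewrite ltr_wpDr // divr_ge0.
have [c Hc] := H _ (divr_gt0 e0 K0).
have ci : `|c * x i 0 - l i 0| <= e / K.
  by apply: le_trans Hc; have := le_mx_entry (c *: x - l) i 0; rewrite !mxE.
have -> : l - (l i 0 / x i 0) *: x = (c - l i 0 / x i 0) *: x - (c *: x - l).
  by rewrite scalerBl; apply/matrixP => a b; rewrite !mxE; ring.
apply: le_trans (ler_normB _ _) _; rewrite normrZ.
have -> : c - l i 0 / x i 0 = (c * x i 0 - l i 0) / x i 0 by rewrite mulrBl mulfK.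
rewrite normrM normfV; apply: (@le_trans _ _ (e / K * (`|x| / `|x i 0|) + e / K)); last first.
  by rewrite -[X in _ + X]mulr1 -mulrDr addrC divfK ?gt_eqF.
by apply: lerD => //; rewrite -[leLHS]mulrA [_^-1 * _]mulrC ler_wpM2r // divr_ge0.
Qed.

(** By transitivity every nonzero vector is a multiple of some h_i g u with g near 1 and h_i from a
    countable family. For each i these multiples form a closed set, so by Baire one of them has an
    interior point. *)
Lemma open_cone u : u != 0 -> forall r : R, 0 < r -> exists h, G h /\ exists x0 (dl : R), [/\ x0 != 0, 0 < dl &
  forall x, `|x - x0| < dl -> exists g c, [/\ G g, mnorm (g - 1%:M) <= r & x = c *: (h *m (g *m u))]].
Proof.
move=> u0 r0' r00; pose r := Num.min r0' 2^-1.
have [r0 [r1 r2]] : 0 < r /\ r <= r0' /\ r <= 2^-1.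
  by rewrite /r lt_min r00 invr_gt0 ltr0n; split=> //; split; rewrite ge_min lexx ?orbT.
have [h Gh Hh] := countable_cover r0.
pose S i : set 'cV[R]_d := [set x | exists g c, [/\ G g, mnorm (g - 1%:M) <= r & x = c *: (h i *m (g *m u))]].
have cS i : closed (S i).
  apply: closed_of_limits => l H.
  have ex k : {g : 'M[R]_d | exists c : R, [/\ G g, mnorm (g - 1%:M) <= r &
      `|c *: (h i *m (g *m u)) - l| <= k.+1%:R^-1]}.
    apply: cid; have [|x [g [c [Gg gr ->]]] xl] := H k.+1%:R^-1; first by rewrite invr_gt0.
    by exists g, c.
  pose g k := sval (ex k).
  have gP k : exists c : R, [/\ G (g k), mnorm (g k - 1%:M) <= r &
      `|c *: (h i *m (g k *m u)) - l| <= k.+1%:R^-1] := svalP (ex k).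
  have [|lg Hlg] := @mx_cluster R d d g (d%:R + 1).
    move=> k; have [c [_ gr _]] := gP k; apply: le_trans (norm_le_mnorm _) _.
    by apply: mnorm_near1; lra.
  have lg1 : mnorm (lg - 1%:M) <= r.
    apply/ler_addgt0Pr => e e0; have D0 : 0 < d%:R + 1 :> R by rewrite ltr_wpDl.
    have [k _ Hk] := Hlg _ 0%N (divr_gt0 e0 D0); have [c [_ gr _]] := gP k.
    rewrite -[X in mnorm X](subrKA (g k)); apply: le_trans (mnormD _ _) _.
    rewrite addrC lerD // /mnorm distrC.
    apply: (@le_trans _ _ ((d%:R + 1) * (e / (d%:R + 1)))); last by rewrite mulrCA divff ?mulr1 // gt_eqF.
    by rewrite ler_pM // lerDl.
  have ulg : lg \in unitmx by apply: unit_near1; lra.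
  have Glg : G lg.
    apply: subgroup_limit ulg _ => // e e0; have [k _ Hk] := Hlg _ 0%N e0.
    by exists (g k) => //; have [c []] := gP k.
  have uh := subgroup_unit (Gh i).
  have nz : h i *m (lg *m u) != 0 by rewrite !unit_mul_neq0.
  suff [c lE] : exists c : R, l = c *: (h i *m (lg *m u)) by exists lg, c.
  apply: closed_line nz _ => e e0.
  (* The coefficients c_k are bounded because g_k u stays away from 0. *)
  pose B := 2 * (mnorm (invmx (h i)) * (`|l| + 1)) / `|u|.
  have nu : 0 < `|u| by rewrite normr_gt0.
  pose K := B * (mnorm (h i) * (d%:R * `|u|)) + 1.
  have K0 : 0 < K by rewrite ltr_wpDl // !mulr_ge0 ?mnorm_ge0.
  have [n0 Hn0] := archi_le 1 (divr_gt0 e0 (ltr0n R 2)).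
  have [k n0k Hk] := Hlg _ n0 (divr_gt0 (divr_gt0 e0 (ltr0n R 2)) K0).
  have [c [Gg gr gl]] := gP k; exists c.
  have k1 : k.+1%:R^-1 <= e / 2.
    by rewrite -[leLHS]mul1r ler_pdivrMr ?ltr0n //; apply: Hn0; exact: leqW.
  have k2 : k.+1%:R^-1 <= 1 :> R by rewrite invf_le1 ?ltr0n // ler1n.
  have ug := subgroup_unit Gg.
  have cB : `|c| <= B.
    rewrite /B ler_pdivlMr //; set z := c *: _ in gl.
    have zl : `|z| <= `|l| + 1.
      by rewrite -[z](subrK l); apply: le_trans (ler_normD _ _) _; rewrite addrC lerD2l (le_trans gl).
    have cu : c *: u = invmx (g k) *m (invmx (h i) *m z).
      by rewrite /z -!scalemxAr !mulKmx.
    rewrite -normrZ cu; apply: le_trans (norm_le_mnorm _) _.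
    apply: le_trans (invmx_near1 _ _) _; first by lra.
    rewrite ler_wpM2l // mnorm_col; apply: le_trans (mnormMl _ _) _.
    by rewrite ler_wpM2l ?mnorm_ge0.
  have -> : c *: (h i *m (lg *m u)) - l = (c *: (h i *m (g k *m u)) - l) - c *: (h i *m ((g k - lg) *m u)).
    by rewrite mulmxBl mulmxBr scalerBr opprB [RHS]addrC subrKA.
  apply: le_trans (ler_normB _ _) _; rewrite [leRHS]splitr addrC.
  have h1 : `|c *: (h i *m ((g k - lg) *m u))| <= B * (mnorm (h i) * (d%:R * (e / 2 / K) * `|u|)).
    rewrite normrZ ler_pM //; apply: le_trans (mnormMl _ _) _; rewrite ler_wpM2l ?mnorm_ge0 //.
    by apply: le_trans (mnormMl _ _) _; rewrite ler_wpM2r // /mnorm ler_wpM2l.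
  have h2 : B * (mnorm (h i) * (d%:R * (e / 2 / K) * `|u|)) <= e / 2.
    apply: (@le_trans _ _ (K * (e / 2 / K))); last by rewrite mulrCA divff ?mulr1 // gt_eqF.
    rewrite (_ : B * _ = B * (mnorm (h i) * (d%:R * `|u|)) * (e / 2 / K)); last by ring.
    by rewrite ler_wpM2r ?lerDl // !divr_ge0 // ltW.
  exact: lerD (le_trans h1 h2) (le_trans gl k1).
have D i : open (~` S i) by exact: closed_openC.
have [i [x0 [r3 [r30 nd]]]] : exists i x0 (r3 : R), 0 < r3 /\ forall x, `|x - x0| <= r3 -> S i x.
  apply: contrapT => H.
  have opn j (v : 'cV[R]_d) : (~` S j) v -> exists2 e : R, 0 < e & forall y, `|v - y| <= e -> (~` S j) y.
    move=> Fv; have /nbhs_ballP[e /= e0 He] := open_nbhs_nbhs (conj (D j) Fv).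
    exists (e / 2); first by rewrite divr_gt0.
    by move=> y vy; apply: He; rewrite -ball_normE /=; lra.
  have dns j (v : 'cV[R]_d) (e : R) : 0 < e -> exists2 y, (~` S j) y & `|v - y| <= e.
    move=> e0; apply: contrapT => ny; apply: H; exists j, v, e; split=> // y yv.
    by apply: contrapT => nS; apply: ny; exists y => //; rewrite distrC.
  have nu : 0 < `|u| by rewrite normr_gt0.
  have [||||v uv Hv] := @baire_category R 'cV[R]_d (fun x y r => `|x - y| <= r) (fun j => ~` S j)
    _ _ _ _ opn dns u _ (divr_gt0 nu (ltr0n R 2)).
  - by move=> v; rewrite subrr normr0.
  - by move=> v y a b ab vy; exact: le_trans vy ab.
  - move=> v y z a b h1 h2; rewrite -[X in `|X|](subrKA y).
    by apply: le_trans (ler_normD _ _) _; exact: lerD.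
  - by move=> w e; exact: mx_complete.
  have v0 : v != 0 by apply/eqP => vE; move: uv; rewrite vE subr0; lra.
  have [g Gg [c c0 vE]] := move_line u0 v0; have [j Hj] := Hh g Gg.
  apply: (Hv j); exists (invmx (h j) *m g), c; split=> //.
    by apply: subgroupM => //; exact: subgroupV.
  by rewrite -mulmxA mulKVmx // (subgroup_unit).
exists (h i); split=> //.
(* The interior point found may be 0; it is then replaced by a small multiple of u inside the same
   ball. *)
have [x [x00 [dl dl0 Hdl]]] : exists x, x != 0 /\ exists2 dl : R, 0 < dl & forall y, `|y - x| < dl -> S i y.
  have nu : 0 < `|u| by rewrite normr_gt0.
  have [E|nz] := eqVneq x0 0; last first.
    by exists x0; split=> //; exists r3 => // y yx; apply: nd; exact: ltW.
  exists ((r3 / 2 / `|u|) *: u); split; first by rewrite scaler_eq0 negb_or u0 gt_eqF // !divr_gt0.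
  exists (r3 / 2); first by rewrite divr_gt0.
  move=> y yx; apply: nd; rewrite E subr0 -[y](subrK ((r3 / 2 / `|u|) *: u)).
  apply: le_trans (ler_normD _ _) _; rewrite normrZ gtr0_norm ?divr_gt0 // divfK ?gt_eqF //.
  by rewrite [leRHS]splitr lerD2r ltW.
exists x, dl; split=> // y /Hdl[g [c [Gg gr ->]]].
by exists g, c; split=> //; exact: le_trans gr r1.
Qed.

(** Pulling the interior point back by h and g0 shows that the action on directions is open at the
    identity: [invmx g0 *m g] is near 1 because both factors are. *)
Lemma move_at_base u (e : R) : u != 0 -> 0 < e -> exists2 rho : R, 0 < rho &
  forall y, `|y - u| <= rho -> exists g c, [/\ G g, mnorm (g - 1%:M) <= e, c != 0 & y = c *: (g *m u)].
Proof.
move=> u0 e0; pose r := Num.min 2^-1 (e / 4).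
have r0 : 0 < r by rewrite lt_min invr_gt0 ltr0n divr_gt0.
have [r1 r2] : r <= 2^-1 /\ r <= e / 4 by split; rewrite /r ge_min lexx ?orbT.
have [h [Gh [x0 [dl [x00 dl0 H]]]]] := open_cone u0 r0.
have uh := subgroup_unit Gh.
have [|g0 [c0 [Gg0 g0r x0E]]] := H x0; first by rewrite subrr normr0.
have ug0 := subgroup_unit Gg0.
have c00 : c0 != 0 by apply: contraNneq x00 => c0E; rewrite x0E c0E scale0r.
pose K := `|c0| * (mnorm h * mnorm g0) + 1.
have K0 : 0 < K by rewrite ltr_wpDl // !mulr_ge0 ?mnorm_ge0.
have nu : 0 < `|u| by rewrite normr_gt0.
exists (Num.min (`|u| / 2) (dl / 2 / K)); first by rewrite lt_min !divr_gt0.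
move=> y; rewrite le_min => /andP[y1 y2].
have y0 : y != 0.
  apply/eqP => y0; move: y1; rewrite y0 sub0r normrN; lra.
have [|g [c [Gg gr yE]]] := H (c0 *: (h *m (g0 *m y))).
  rewrite x0E -scalerBr -!mulmxBr normrZ.
  apply: (@le_lt_trans _ _ (K * (dl / 2 / K))); last by rewrite mulrCA divff ?gt_eqF // mulr1; lra.
  apply: (@le_trans _ _ (`|c0| * (mnorm h * (mnorm g0 * `|y - u|)))).
    rewrite ler_wpM2l //; apply: le_trans (mnormMl _ _) _; rewrite ler_wpM2l ?mnorm_ge0 //.
    exact: mnormMl.
  rewrite [mnorm h * _]mulrA mulrA ler_pM ?mulr_ge0 ?mnorm_ge0 //.
  by rewrite lerDl.
have E : g0 *m y = (c0^-1 * c) *: (g *m u).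
  rewrite -scalerA -[g *m u](mulKmx uh) scalemxAr -yE scalemxAr -!scalemxAr scalerA.
  by rewrite mulVf // scale1r mulKmx.
have yE' : y = (c0^-1 * c) *: ((invmx g0 *m g) *m u).
  by rewrite -mulmxA scalemxAr -E mulKmx.
exists (invmx g0 *m g), (c0^-1 * c); split=> //.
- by apply: subgroupM => //; exact: subgroupV.
- by apply: le_trans (mnormB_ratio _ _) _; lra.
- by apply: contraNneq y0 => c_0; rewrite yE' c_0 scale0r.
Qed.

(* The transitive action makes every direction movable, through the conjugate g of an element
   near the identity; compactness of the sphere yields a uniform radius. *)
Lemma move_directions (e : R) : 0 < e -> exists2 al : R, 0 < al &
  forall x x', x != 0 -> `|x' - x| <= al * `|x| ->
  exists g c, [/\ G g, mnorm (g - 1%:M) <= e, c != 0 & g *m x = c *: x'].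
Proof.
move=> e0; apply: contrapT => H.
have ex k : {p : 'cV[R]_d * 'cV[R]_d | [/\ p.1 != 0, `|p.2 - p.1| <= k.+1%:R^-1 * `|p.1| &
   ~ exists g c, [/\ G g, mnorm (g - 1%:M) <= e, c != 0 & g *m p.1 = c *: p.2]]}.
  apply: cid; apply: contrapT => nk; apply: H; exists k.+1%:R^-1; first by rewrite invr_gt0.
  by move=> x x' x0 xx'; apply: contrapT => ng; apply: nk; exists (x, x').
pose x k := (sval (ex k)).1; pose x' k := (sval (ex k)).2.
have xP k : [/\ x k != 0, `|x' k - x k| <= k.+1%:R^-1 * `|x k| &
   ~ exists g c, [/\ G g, mnorm (g - 1%:M) <= e, c != 0 & g *m x k = c *: x' k]] := svalP (ex k).
pose u k := `|x k|^-1 *: x k.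
have nx k : 0 < `|x k| by have [h _ _] := xP k; rewrite normr_gt0.
have u1 k : `|u k| = 1 by rewrite normrZ gtr0_norm ?invr_gt0 // mulVf ?gt_eqF.
have [|l Hl] := @mx_cluster R d 1 u 1; first by move=> k; rewrite u1.
have l0 : l != 0.
  apply/eqP => l0; have [k _] := Hl 2^-1 0%N (ltac:(by rewrite invr_gt0)).
  by rewrite l0 subr0 u1; lra.
pose e1 := Num.min 2^-1 (e / (4 * (d%:R + 1))).
have e10 : 0 < e1 by rewrite lt_min invr_gt0 ltr0n divr_gt0.
have [e11 e12] : e1 <= 2^-1 /\ e1 * (4 * (d%:R + 1)) <= e.
  by rewrite -ler_pdivlMr // /e1; split; rewrite ge_min lexx ?orbT.
have [rho rho0 Hrho] := move_at_base l0 e10.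
have [n0 Hn0] := archi_le 1 (divr_gt0 rho0 (ltr0n R 2)).
have [k n0k Hk] := Hl _ n0 (divr_gt0 rho0 (ltr0n R 2)).
have k1 : k.+1%:R^-1 <= rho / 2.
  by rewrite -[leLHS]mul1r ler_pdivrMr ?ltr0n //; apply: Hn0; exact: leqW.
have [xk0 xx' ng] := xP k; apply: ng.
have [|g [a [Gg gr a0 uE]]] := Hrho (u k); first by lra.
pose u' := `|x k|^-1 *: x' k.
have uu' : `|u' - u k| <= k.+1%:R^-1.
  by rewrite -scalerBr normrZ gtr0_norm ?invr_gt0 // mulrC ler_pdivrMr.
have [|g' [b [Gg' gr' b0 uE']]] := Hrho u'.
  rewrite -[X in `|X|](subrKA (u k)); apply: le_trans (ler_normD _ _) _.
  by apply: le_trans (lerD uu' Hk) _; rewrite [leRHS]splitr lerD2r.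
have ug := subgroup_unit Gg.
exists (g' *m invmx g), (a / b); split.
- by apply: subgroupM => //; exact: subgroupV.
- have -> : g' *m invmx g - 1%:M = ((g' - 1%:M) - (g - 1%:M)) *m (invmx g *m 1%:M).
    by rewrite opprB addrA subrK mulmx1 mulmxBl mulmxV.
  apply: le_trans (mnormM _ _) _.
  apply: (@le_trans _ _ ((e1 + e1) * (2 * d%:R))).
    apply: ler_pM; rewrite ?mnorm_ge0 //.
      by apply: le_trans (mnormD _ _) _; rewrite mnormN lerD.
    by apply: le_trans (invmx_near1 _ _) _; rewrite ?ler_wpM2l ?mnorm1_le //; lra.
  apply: le_trans e12; rewrite (_ : (e1 + e1) * (2 * d%:R) = e1 * (4 * d%:R)); last by ring.
  by apply: ler_wpM2l; [exact: ltW|rewrite ler_wpM2l // lerDl].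
- by rewrite mulf_neq0 // invr_neq0.
- have xE : x k = `|x k| *: u k by rewrite /u scalerA divff ?scale1r // gt_eqF.
  have xE' : x' k = `|x k| *: u' by rewrite /u' scalerA divff ?scale1r // gt_eqF.
  rewrite xE xE' uE uE' -!scalemxAr -mulmxA mulKmx // !scalerA; congr (_ *: _).
  by rewrite mulrC mulrAC divfK.
Qed.
End SmallElements.

(** * Rotating one vector into another along an orbit segment *)

Lemma slow_arith (R : realFieldType) (al m C1 a x S N : R) : 0 <= x -> 0 < al -> 0 < m -> 0 <= C1 ->
  4 * C1 <= al ^+ 2 * m -> 2^-1 <= a -> al * (a * x) <= 2 * N -> S <= C1 * x -> S <= al * m * N.
Proof.
move=> x0 al0 m0 C0 H ha h hS.
have h1 : al * m * (al * (a * x)) <= al * m * (2 * N) by rewrite ler_wpM2l // mulr_ge0 // ltW.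
have h2 : 4 * C1 * (2^-1 * x) <= al ^+ 2 * m * (a * x).
  by rewrite ler_pM ?mulr_ge0 ?ler_wpM2r.
have h3 : al * m * (al * (a * x)) = al ^+ 2 * m * (a * x) by ring.
have h4 : al * m * (2 * N) = 2 * (al * m * N) by ring.
by rewrite h3 h4 in h1; set Z := al * m * N in h1 *; lra.
Qed.

Section Rotation.
Variables (R : realType) (V : normedModType R).

(** When v and w are not nearly opposite, combinations with nonnegative coefficients cannot cancel
    by more than a factor 2 / al. *)
Let scaled_lower (v w : V) (al a b : R) : 0 < al -> v != 0 -> w != 0 -> 0 <= a -> 0 <= b ->
  al * `|v| <= `|v + (`|v| / `|w|) *: w| ->
  al * (a * `|v|) <= 2 * `|a *: v + b *: w| /\ al * (b * `|w|) <= 2 * `|a *: v + b *: w|.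
Proof.
move=> al0 v0 w0 a0 b0 H; set N := `|a *: v + b *: w|.
have nv : 0 < `|v| by rewrite normr_gt0. have nw : 0 < `|w| by rewrite normr_gt0.
have diff : `|a * `|v| - b * `|w| | <= N.
  have -> : a * `|v| - b * `|w| = `|a *: v| - `|b *: w| by rewrite !normrZ !ger0_norm.
  by have := ler_dist_dist (a *: v) (- (b *: w)); rewrite normrN opprK.
split.
  have -> : al * (a * `|v|) = a * (al * `|v|) by ring.
  apply: (@le_trans _ _ (a * `|v + (`|v| / `|w|) *: w|)); first by rewrite ler_wpM2l.
  rewrite -{1}[a]ger0_norm // -normrZ scalerDr.
  have -> : a *: v + a *: ((`|v| / `|w|) *: w) = (a *: v + b *: w) + ((a * `|v| - b * `|w|) / `|w|) *: w.
    rewrite -addrA; congr (_ + _); rewrite scalerA -scalerDl; congr (_ *: _).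
    by field; rewrite gt_eqF.
  apply: le_trans (ler_normD _ _) _; rewrite normrZ normrM normfV normr_id divfK ?gt_eqF //.
  by have := diff; rewrite -/N; lra.
have -> : al * (b * `|w|) = b * `|w| / `|v| * (al * `|v|) by field; rewrite gt_eqF.
have c0 : 0 <= b * `|w| / `|v| by rewrite divr_ge0 // mulr_ge0.
apply: (@le_trans _ _ (b * `|w| / `|v| * `|v + (`|v| / `|w|) *: w|)); first by rewrite ler_wpM2l.
rewrite -{1}[b * `|w| / `|v|]ger0_norm // -normrZ scalerDr.
have -> : (b * `|w| / `|v|) *: v + (b * `|w| / `|v|) *: ((`|v| / `|w|) *: w) =
   (a *: v + b *: w) - ((a * `|v| - b * `|w|) / `|v|) *: v.
  rewrite addrAC -scalerBl scalerA; congr (_ *: _ + _ *: _); field.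
    by rewrite gt_eqF.
  by rewrite !gt_eqF.
apply: le_trans (ler_normB _ _) _; rewrite normrZ normrM normfV normr_id divfK ?gt_eqF //.
by have := diff; rewrite -/N; lra.
Qed.

(* Either v_j and -w_j have nearly the same direction for some j, or v_i + t w_i turns towards w_j
   between two times i < j, or all quotients |w_j| / |v_j| are comparable and the direction
   is turned uniformly slowly. *)
Lemma rotate_sequence (al K c0 : R) : 0 < al -> al <= 1 -> 1 <= K -> 0 < c0 ->
  exists2 m, (0 < m)%N & forall v w : nat -> V, (forall j, v j != 0) -> (forall j, w j != 0) ->
  `|v 0%N| = `|w 0%N| -> (forall j, `|v j| <= K * `|v j.+1|) -> (forall j, `|w j.+1| <= K * `|w j|) ->
  c0 * `|v m| <= `|w m| ->
  exists a b : nat -> R, [/\ a 0%N = 1, b 0%N = 0, a m = 0, b m != 0 &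
    forall j, (j < m)%N -> `|(a j.+1 - a j) *: v j + (b j.+1 - b j) *: w j| <= al * `|a j *: v j + b j *: w j|].
Proof.
move=> al0 al1 K1 c00.
pose C : R := 2 / al ^+ 2.
have C2 : 2 <= C by rewrite /C ler_pdivlMr ?exprn_gt0 // ler_piMr // exprn_ile1 // ltW.
pose C1 := 1 + C + K ^+ 2 * C / c0.
have KC0 : 0 < K ^+ 2 * C / c0 by rewrite divr_gt0 // mulr_gt0 ?exprn_gt0 //; lra.
have [m Hm] := archi_le (4 * C1 / al ^+ 2) (@ltr01 R).
have {Hm} Hm : 4 * C1 <= al ^+ 2 * m%:R.
  have := Hm m (leqnn m); rewrite mul1r ler_pdivrMr ?exprn_gt0 //; lra.
have m_gt0 : (0 < m)%N.
  rewrite lt0n; apply/eqP => m0; move: Hm; rewrite m0 mulr0 /C1; lra.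
exists m => // v w v0 w0 vw0 vK wK ratio.
have nv j : 0 < `|v j| by rewrite normr_gt0.
have nw j : 0 < `|w j| by rewrite normr_gt0.
have [[j jm Hj]|case1] := pselect (exists2 j, (j < m)%N & `|v j + (`|v j| / `|w j|) *: w j| <= al * `|v j|).
  exists (fun i => if (i <= j)%N then 1 else 0), (fun i => if (i <= j)%N then 0 else - (`|v j| / `|w j|)).
  have mj : (m <= j)%N = false by rewrite leqNgt jm.
  rewrite mj leq0n; split; [by []|by []|by []| |].
    by rewrite oppr_eq0 mulf_neq0 ?invr_neq0 ?gt_eqF.
  move=> i im; case: (ltngtP i j) => ij.
  - by rewrite !subrr !scale0r addr0 normr0 mulr_ge0 // ltW.
  - by rewrite !subrr !scale0r addr0 normr0 mulr_ge0 // ltW.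
  - by rewrite ij sub0r subr0 scaleN1r scaleNr -opprD normrN scale1r scale0r addr0.
have [[i [j [ij jm Hij]]]|case2] := pselect (exists i j, [/\ (i < j)%N, (j < m)%N &
    C * (`|w i| * `|v j|) <= `|w j| * `|v i|]).
  (* The largest multiple of w i whose addition to v i is a turn of size al. By time j the ratio C
     has made the w-part so dominant that dropping v j is again a turn of size at most al. *)
  pose tau := al * (`|v i| / `|w i|).
  have tau0 : 0 < tau by rewrite !mulr_gt0 // invr_gt0.
  exists (fun k => if (k <= j)%N then 1 else 0), (fun k => if (k <= i)%N then 0 else tau).
  have im := ltn_trans ij jm.
  have mj : (m <= j)%N = false by rewrite leqNgt jm.
  have mi : (m <= i)%N = false by rewrite leqNgt im.
  rewrite mj mi !leq0n; split; [by []|by []|by []|by rewrite gt_eqF|].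
  move=> k km; have [ki|ki] := eqVneq k i.
    rewrite ki ij (ltnW ij) ltnn leqnn subrr subr0 !scale0r add0r addr0 scale1r.
    by rewrite normrZ gtr0_norm // /tau -mulrA divfK ?gt_eqF.
  have [kj|kj] := eqVneq k j.
    have ji : (j <= i)%N = false by rewrite leqNgt ij.
    have ji' : (j < i)%N = false by rewrite ltnNge (ltnW ij).
    rewrite kj ltnn leqnn ji ji' subrr scale0r addr0 sub0r scaleN1r normrN scale1r.
    have h1 : 2 * `|v j| <= al * (tau * `|w j|).
      have -> : al * (tau * `|w j|) = al ^+ 2 * (`|w j| * `|v i|) / `|w i| by rewrite /tau; field; rewrite gt_eqF.
      rewrite ler_pdivlMr //; apply: le_trans (ler_wpM2l (sqr_ge0 al) Hij).
      by apply: eq_ler; rewrite /C; field; rewrite gt_eqF.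
    have h2 : tau * `|w j| - `|v j| <= `|v j + tau *: w j|.
      rewrite -{1}[tau]gtr0_norm // -normrZ addrC.
      by have := lerB_dist (tau *: w j) (- v j); rewrite normrN opprK addrC [_ + v j]addrC.
    apply: le_trans (ler_wpM2l (ltW al0) h2); rewrite mulrBr.
    have : al * `|v j| <= `|v j| by rewrite ler_piMl // ltW.
    lra.
  have E1 : (k < j)%N = (k <= j)%N by rewrite [RHS]leq_eqVlt (negbTE kj).
  have E2 : (k < i)%N = (k <= i)%N by rewrite [RHS]leq_eqVlt (negbTE ki).
  by rewrite E1 E2 !subrr !scale0r addr0 normr0 mulr_ge0 // ltW.
have {}case1 j : (j < m)%N -> al * `|v j| <= `|v j + (`|v j| / `|w j|) *: w j|.
  by move=> jm; rewrite leNgt; apply/negP => h; apply: case1; exists j => //; exact: ltW.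
have {}case2 i j : (i < j)%N -> (j < m)%N -> `|w j| * `|v i| <= C * (`|w i| * `|v j|).
  by move=> ij jm; rewrite leNgt; apply/negP => h; apply: case2; exists i, j; split=> //; exact: ltW.
have m0 : 0 < m%:R :> R by rewrite ltr0n.
have up j : (j < m)%N -> `|w j| <= C * `|v j|.
  move=> jm; case: j jm => [|j] jm; first by rewrite -vw0 ler_peMl //; lra.
  have := case2 0%N j.+1 isT jm; rewrite vw0 [X in _ <= X](_ : _ = C * `|v j.+1| * `|w 0%N|); last by ring.
  by rewrite ler_pM2r.
have low j : (j < m)%N -> `|v j| <= K ^+ 2 * C / c0 * `|w j|.
  move=> jm; set q := m.-1; have qm : q.+1 = m by rewrite prednK.
  have h1 : c0 * `|v q| <= K ^+ 2 * `|w q|.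
    have h := vK q; have h' := wK q; rewrite qm in h h'.
    apply: (@le_trans _ _ (c0 * (K * `|v m|))); first by rewrite ler_wpM2l // ltW.
    rewrite mulrCA; apply: (@le_trans _ _ (K * `|w m|)); first by rewrite ler_wpM2l //; lra.
    by rewrite expr2 -mulrA ler_wpM2l //; lra.
  suff h2 : c0 * `|v j| <= K ^+ 2 * C * `|w j|.
    by rewrite mulrAC ler_pdivlMr // mulrC.
  have [->|jq] := eqVneq j q.
    apply: le_trans h1 _; rewrite ler_wpM2r // ler_peMr ?exprn_ge0 //; lra.
  have jq' : (j < q)%N by rewrite ltn_neqAle jq -ltnS qm.
  have h3 := case2 j q jq' (ltac:(by rewrite -qm)).
  rewrite -(ler_pM2r (nw q)); apply: (@le_trans _ _ (C * `|w j| * (c0 * `|v q|))).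
    have := ler_wpM2l (ltW c00) h3; move: (`|w j|) (`|v q|) (`|w q|) (`|v j|) => *; lra.
  apply: (@le_trans _ _ (C * `|w j| * (K ^+ 2 * `|w q|))).
    by rewrite ler_wpM2l // mulr_ge0 //; lra.
  by apply: eq_ler; ring.
(* All lengths being comparable, the coefficients may move linearly; m was chosen so that steps of
   size 1 / m stay below al. *)
exists (fun k => 1 - k%:R / m%:R), (fun k => k%:R / m%:R).
split; [by rewrite mul0r subr0|by rewrite mul0r|by rewrite divff ?gt_eqF // subrr|by rewrite divff ?gt_eqF // oner_neq0|].
move=> j jm.
have jR : j%:R / m%:R <= 1 :> R by rewrite ler_pdivrMr // mul1r ler_nat ltnW.
have j0 : 0 <= j%:R / m%:R :> R by rewrite divr_ge0.
have a0 : 0 <= 1 - j%:R / m%:R :> R by rewrite subr_ge0.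
have [L1 L2] := scaled_lower al0 (v0 j) (w0 j) a0 j0 (case1 j jm).
set N := `|_ + _| in L1 L2 *.
have dE : j.+1%:R / m%:R - j%:R / m%:R = m%:R^-1 :> R by rewrite -mulrBl -natr1 addrAC subrr add0r mul1r.
have -> : 1 - j.+1%:R / m%:R - (1 - j%:R / m%:R) = - m%:R^-1 :> R by rewrite opprB addrC addrA subrK -opprB dE.
rewrite dE scaleNr addrC -scalerBr normrZ gtr0_norm ?invr_gt0 //.
rewrite mulrC ler_pdivrMr // -mulrA [N * _]mulrC mulrA.
apply: (@le_trans _ _ (`|v j| + `|w j|)); first by rewrite [leRHS]addrC ler_normB.
have u1 := up j jm; have l1 := low j jm; have [nvj nwj] := (nv j, nw j).
have C10 : 0 <= C1 by rewrite /C1; lra.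
have S1 : `|v j| + `|w j| <= C1 * `|v j|.
  have : 0 <= K ^+ 2 * C / c0 * `|v j| by rewrite mulr_ge0 // ltW.
  by rewrite /C1 !mulrDl mul1r; lra.
have S2 : `|v j| + `|w j| <= C1 * `|w j|.
  have : 0 <= C * `|w j| by rewrite mulr_ge0 //; lra.
  by rewrite /C1 !mulrDl mul1r; lra.
have [h|h] := leP (2^-1) (j%:R / m%:R : R).
  exact: slow_arith (ltW nwj) al0 m0 C10 Hm h L2 S2.
apply: slow_arith (ltW nvj) al0 m0 C10 Hm _ L1 S1; lra.
Qed.
End Rotation.

Section Chain.
Variables (R : realType) (d : nat) (M : topologicalType) (f : homeomorphism M) (A : M -> 'M[R]_d).
Local Notation X := (cocycle_nat f A).

(** The cocycle along a single orbit segment, with the factor P k acting before the k-th step. *)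
Fixpoint pert (P : nat -> 'M[R]_d) n x : 'M[R]_d :=
  if n is k.+1 then A (iter k f x) *m P k *m pert P k x else 1%:M.

Lemma pert_chain P (x x' : nat -> 'cV[R]_d) (c : nat -> R) m y :
  (forall j, (j < m)%N -> c j != 0 /\ P j *m x j = c j *: x' j) ->
  (forall j, (j < m)%N -> x j.+1 = A (iter j f y) *m x' j) ->
  exists2 c' : R, c' != 0 & pert P m y *m x 0%N = c' *: x m.
Proof.
move=> H1 H2; elim: m H1 H2 => [|m IH] H1 H2; first by exists 1; rewrite ?oner_neq0 // scale1r mul1mx.
have [||c' c'0 E] := IH; first by move=> j jm; apply: H1; exact: ltnW.
  by move=> j jm; apply: H2; exact: ltnW.
have [cm0 Em] := H1 m (ltnSn m).
exists (c' * c m); first by rewrite mulf_neq0.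
by rewrite /= -mulmxA E -scalemxAr -mulmxA Em -scalemxAr -H2 // scalerA.
Qed.

Hypothesis uA : forall x, A x \in unitmx.

Lemma pert_unit P n x : (forall j, P j \in unitmx) -> pert P n x \in unitmx.
Proof.
move=> uP; elim: n => [|n IH] /=; first exact: unitmx1.
by rewrite !unitmx_mul uA uP.
Qed.

Hypotheses (M_compact : compact [set: M]) (cA : continuous A).
Variable G : set 'M[R]_d.
Hypotheses (d_gt0 : (0 < d)%N) (HG : closed_subgroup_GL G) (G_transitive : projectively_transitive G).

(** Failure of the 1/2-domination on m steps gives, after rescaling w to the length of v, the ratio
    required by [rotate_sequence]. The vectors x j then turn slowly, and [move_directions] realises
    each turn by a reachable element. The length m is independent of the point and of the
    vectors. *)
Lemma local_perturbation (e : R) : 0 < e -> exists2 m, (0 < m)%N & forall y v w, v != 0 -> w != 0 ->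
  2^-1 * (enorm (X m y *m v) * enorm w) < enorm (X m y *m w) * enorm v ->
  exists P, (forall j, reachable G e (P j)) /\
    exists2 c : R, c != 0 & pert P m y *m v = c *: (X m y *m w).
Proof.
move=> e0; have [r r0 Hr] := small_reachable HG e0.
have [al' al'0 Hal] := move_directions HG d_gt0 G_transitive r0.
pose al := Num.min al' 1.
have [al0 [al1 al2]] : 0 < al /\ al <= 1 /\ al <= al'.
  by rewrite /al lt_min al'0 ltr01; split=> //; split; rewrite ge_min lexx ?orbT.
have [K1 K1_ge HK1] := continuous_mx_bounded M_compact cA.
have [K2 K2_ge HK2] := continuous_mx_bounded M_compact (continuous_invmx uA cA).
pose K := d%:R * (K1 + K2).
have d1 : 1 <= d%:R :> R by rewrite ler1n.
have K_ge : 1 <= K by rewrite /K mulr_ege1 //; lra.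
have K1K x : mnorm (A x) <= K by rewrite /mnorm ler_wpM2l //; apply: le_trans (HK1 x) _; lra.
have K2K x : mnorm (invmx (A x)) <= K by rewrite /mnorm ler_wpM2l //; apply: le_trans (HK2 x) _; lra.
pose c0 : R := 2^-1 / (d%:R * d%:R).
have c00 : 0 < c0 by rewrite divr_gt0 // mulr_gt0 //; lra.
have [m m_gt0 Hm] := @rotate_sequence R 'cV[R]_d al K c0 al0 al1 K_ge c00.
exists m => // y v w v0 w0 lt.
have nv : 0 < `|v| by rewrite normr_gt0. have nw : 0 < `|w| by rewrite normr_gt0.
pose t := `|v| / `|w|; have t0 : 0 < t by rewrite divr_gt0.
pose vs j := X j y *m v; pose ws j := t *: (X j y *m w).
have uX j : X j y \in unitmx by exact: cocycle_nat_unit.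
have vs0 j : vs j != 0 by rewrite unit_mul_neq0.
have ws0 j : ws j != 0 by rewrite scaler_eq0 negb_or gt_eqF //= unit_mul_neq0.
have eq0 : `|vs 0%N| = `|ws 0%N|.
  by rewrite /vs /ws /= !mul1mx normrZ gtr0_norm // divfK ?gt_eqF.
have vsS j : vs j.+1 = A (iter j f y) *m vs j by rewrite /vs /= mulmxA.
have wsS j : ws j.+1 = A (iter j f y) *m ws j by rewrite /ws /= -scalemxAr mulmxA.
have vK j : `|vs j| <= K * `|vs j.+1|.
  have -> : vs j = invmx (A (iter j f y)) *m vs j.+1 by rewrite vsS mulKmx.
  by apply: le_trans (mnormMl _ _) _; rewrite ler_wpM2r.
have wK j : `|ws j.+1| <= K * `|ws j|.
  by rewrite wsS; apply: le_trans (mnormMl _ _) _; rewrite ler_wpM2r.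
have ratio : c0 * `|vs m| <= `|ws m|.
  rewrite /ws normrZ gtr0_norm // /t [leRHS]mulrAC ler_pdivlMr //.
  have d0 : 0 < d%:R * d%:R :> R by rewrite mulr_gt0 //; lra.
  have h1 : `|vs m| * `|w| <= enorm (vs m) * enorm w by rewrite ler_pM ?norm_le_enorm.
  have h2 : enorm (X m y *m w) * enorm v <= (d%:R * `|X m y *m w|) * (d%:R * `|v|).
    by rewrite ler_pM ?enorm_ge0 ?enorm_le_norm.
  rewrite /c0 -mulrA mulrAC ler_pdivrMr // mulrAC -mulrA.
  apply: le_trans (ler_wpM2l _ h1) _ => //.
  apply: le_trans (ltW lt) (le_trans h2 _); apply: eq_ler; ring.
have [a [b [a0 b0 am bm step]]] := Hm vs ws vs0 ws0 eq0 vK wK ratio.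
pose x j := a j *: vs j + b j *: ws j; pose x' j := a j.+1 *: vs j + b j.+1 *: ws j.
have xS j : x j.+1 = A (iter j f y) *m x' j.
  by rewrite /x /x' vsS wsS mulmxDr -!scalemxAr.
have near j : (j < m)%N -> `|x' j - x j| <= al' * `|x j|.
  move=> jm; rewrite /x' opprD addrACA -!scalerBl.
  by apply: le_trans (step j jm) _; rewrite ler_wpM2r.
have xm : x m = (b m * t) *: (X m y *m w) by rewrite /x am scale0r add0r /ws scalerA.
(* Descending induction from time m: a turn is bounded by the length of x j, so a vanishing x j
   would vanish at the next time as well. *)
have x0 j : (j <= m)%N -> x j != 0.
  move=> jm; have [k ->] : exists k, (j = m - k)%N by exists (m - j)%N; rewrite subKn.
  elim: k => [|k IH].
    by rewrite subn0 xm scaler_eq0 negb_or mulf_neq0 ?(gt_eqF t0) //= unit_mul_neq0.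
  have [mk|km] := leqP m k.
    by rewrite (_ : (m - k.+1)%N = (m - k)%N) //; move: mk; clear; lia.
  set i := (m - k.+1)%N; have iS : (m - k)%N = i.+1 by rewrite /i subnSK.
  rewrite iS xS in IH; apply: contraNneq IH => xi0.
  have := near i (ltac:(by rewrite -subn_gt0 /i subKn)).
  by rewrite xi0 normr0 mulr0 subr0 normr_le0 => /eqP ->; rewrite mulmx0.
have ex j : {p : 'M[R]_d * R | reachable G e p.1 /\ ((j < m)%N -> p.2 != 0 /\ p.1 *m x j = p.2 *: x' j)}.
  apply: cid; have [jm|mj] := ltnP j m; last first.
    exists (1%:M, 1); split=> //; apply: Hr; first exact: subgroup1.
    by rewrite subrr mnorm0 ltW.
  have [g [c [Gg gr cn E]]] := Hal _ _ (x0 j (ltnW jm)) (near j jm).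
  by exists (g, c); split=> //; exact: Hr.
exists (fun j => (sval (ex j)).1); split; first by move=> j; have [] := svalP (ex j).
have [|//|c cn E] := @pert_chain (fun j => (sval (ex j)).1) x x' (fun j => (sval (ex j)).2) m y.
  by move=> j jm; have [_ /(_ jm)] := svalP (ex j).
exists (c * (b m * t)); first by apply: mulf_neq0 => //; apply: mulf_neq0 => //; rewrite gt_eqF.
have -> : v = x 0%N by rewrite /x a0 b0 scale1r scale0r addr0 /vs /= mul1mx.
by rewrite E xm scalerA.
Qed.
End Chain.

(** * Loss of volume growth where domination fails *)

(** The exponents of the two terms of [star]. As k lies between n/4 and 3n/4, the gap g is lost on
    at least a quarter of the window, twice the g / 8 claimed; the surplus pays for the errors g /
    64 and for the m modified steps. *)
Lemma drop_arith (R : realFieldType) (n k m N Lo L1 L2 l l' g : R) :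
  l = L1 - Lo -> l' = L2 - L1 -> g = l - l' -> 0 <= g -> 0 <= m -> n = N + k + m -> n <= 4 * k -> 4 * k <= 3 * n ->
  N * L1 + g / 64 * n + (k * L2 + g / 64 * n) + k * (- l + g / 64) <=
    n * (L1 - g / 8) + (`|m * L1| + m * g + `|m * l'|) - 5 / 64 * g * n /\
  (n - k) * (l' + g / 64) + (N * Lo + g / 64 * n) + (k * L1 + g / 64 * n) <=
    n * (L1 - g / 8) + (`|m * L1| + m * g + `|m * l'|) - 5 / 64 * g * n.
Proof.
move=> lE l'E gE g0 m0 nE n4k k4n.
have h1 := ler_norm (- (m * L1)); rewrite normrN in h1.
have h2 := ler_norm (m * l').
have h3 : 0 <= `|m * l'| by [].
have h4 : 0 <= m * g by rewrite mulr_ge0.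
have h5 : n * g <= 4 * k * g by rewrite ler_wpM2r.
have h6 : 4 * k * g <= 3 * n * g by rewrite ler_wpM2r.
have -> : L2 = L1 + l' by lra. have -> : Lo = L1 - l by lra.
have lE' : l = g + l' by lra.
have NE : N = n - k - m by lra.
rewrite {}lE' {}NE; move: h1 h2 h3 h4 h5 h6; set a := `|m * L1|; set b := `|m * l'|.
clear lE l'E gE nE => h1 h2 h3 h4 h5 h6; split; lra.
Qed.

Lemma drop_combine (R : realType) (C S a1 b2 yv xv a0 b1 D1 D2 D3 e1 e2 e3 e4 e5 e6 Z : R) :
  0 <= C -> 0 <= a1 -> 0 <= b2 -> 0 <= yv -> 0 <= xv -> 0 <= a0 -> 0 <= b1 -> 0 <= D1 -> 0 <= D2 -> 0 <= D3 ->
  S <= C * (a1 * b2 * yv + xv * a0 * b1) ->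
  a1 <= expR e1 * D1 -> b2 <= expR e2 -> yv <= expR e3 -> xv <= D2 * expR e4 -> a0 <= expR e5 * D3 ->
  b1 <= expR e6 -> e1 + e2 + e3 <= Z -> e4 + e5 + e6 <= Z -> S <= C * ((D1 + D2 * D3) * expR Z).
Proof.
move=> C0 a10 b20 y0 x0 a00 b10 D10 D20 D30 HS h1 h2 h3 h4 h5 h6 Z1 Z2.
apply: le_trans HS _; apply: ler_wpM2l => //; rewrite mulrDl; apply: lerD.
  apply: (@le_trans _ _ (expR e1 * D1 * expR e2 * expR e3)).
    by apply: ler_pM => //; [exact: mulr_ge0|exact: ler_pM].
  rewrite (_ : _ * _ = D1 * (expR e1 * expR e2 * expR e3)); last by ring.
  by apply: ler_wpM2l => //; rewrite -!expRD ler_expR.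
apply: (@le_trans _ _ (D2 * expR e4 * (expR e5 * D3) * expR e6)).
  by apply: ler_pM => //; [exact: mulr_ge0|exact: ler_pM].
rewrite (_ : _ * _ = D2 * D3 * (expR e4 * expR e5 * expR e6)); last by ring.
by apply: ler_wpM2l; [exact: mulr_ge0|rewrite -!expRD ler_expR].
Qed.

Lemma drop_end (R : realType) (C D B c e : R) : C * D * expR c + 1 <= expR e ->
  C * (D * expR (B + c - e)) < expR B.
Proof.
move=> H; rewrite mulrA -addrA expRD [expR B * _]mulrC mulrA expRD mulrA expRN.
rewrite -[X in _ < X]mul1r ltr_pM2r ?expR_gt0 // ltr_pdivrMr ?expR_gt0 // mul1r.
by apply: lt_le_trans H; rewrite ltrDl.
Qed.

(** Slowness is a pointwise notion; on a subspace it becomes uniform through the projections of the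
    finitely many unit vectors. *)
Lemma slow_uniform (R : realType) d (Z : nat -> 'M[R]_d) (a : R) (E : {vspace 'cV[R]_d}) :
  (forall v, v \in E -> slowv Z a v) -> forall dl : R, 0 < dl ->
  exists n0, forall n, (n0 <= n)%N -> forall v, v \in E -> `|Z n *m v| <= expR (n%:R * (a + dl)) * `|v|.
Proof.
move=> sl dl dl0; have dl2 : 0 < dl / 2 by rewrite divr_gt0.
pose b j : 'cV[R]_d := projv E (delta_mx j 0).
have bE j : b j \in E by exact: memv_proj.
pose n1 j := sval (cid (sl _ (bE j) _ dl2)).
have Hn1 j := svalP (cid (sl _ (bE j) _ dl2)).
have [n2 H2] := const_expR (\sum_j `|b j|) dl2.
exists (maxn (\max_j n1 j) n2) => n; rewrite geq_max => /andP[n1n n2n] v vE.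
have vS : v = \sum_j v j 0 *: b j.
  rewrite -{1}(projv_id vE) {1}[v]matrix_sum_delta linear_sum; apply: eq_bigr => j _.
  by rewrite big_ord1 linearZ.
rewrite {1}vS mulmx_sumr; apply: le_trans (ler_norm_sum _ _ _) _.
apply: (@le_trans _ _ (\sum_j `|v| * (expR (n%:R * (a + dl / 2)) * `|b j|))).
  apply: ler_sum => j _; rewrite -scalemxAr normrZ ler_pM ?le_mx_entry //.
  by apply: Hn1; apply: leq_trans n1n; exact: (leq_bigmax j).
rewrite -mulr_sumr -mulr_sumr mulrC; apply: ler_wpM2r => //.
apply: (@le_trans _ _ (expR (n%:R * (a + dl / 2)) * expR (dl / 2 * n%:R))).
  by apply: ler_wpM2l (H2 n n2n); exact: expR_ge0.
by rewrite -expRD ler_expR; apply: eq_ler; field.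
Qed.

Lemma uniform_nat (P : nat -> nat -> Prop) r :
  (forall i, exists n0, forall n, (n0 <= n)%N -> P i n) ->
  exists n0, forall i, (i < r)%N -> forall n, (n0 <= n)%N -> P i n.
Proof.
move=> H; elim: r => [|r [n1 H1]]; first by exists 0%N.
have [n2 H2] := H r; exists (maxn n1 n2) => i; rewrite ltnS leq_eqVlt => /predU1P[->|ir] n.
  by rewrite geq_max => /andP[_]; exact: H2.
by rewrite geq_max => /andP[h _]; exact: H1.
Qed.

Lemma periodic_orbit (M : topologicalType) (f : homeomorphism M) r x y :
  (0 < r)%N -> iter r f x = x -> orbitz f x y -> exists2 i, (i < r)%N & y = iter i f x.
Proof.
move=> r0 per; have perM k : iter (k * r) f x = x by elim: k => [|k IH] //; rewrite mulSn iterD IH.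
have pos n : iter n f x = iter (n %% r) f x.
  by rewrite {1}(divn_eq n r) addnC iterD perM.
have H n : exists2 i, (i < r)%N & iter n f x = iter i f x.
  by exists (n %% r)%N => //; exact: ltn_pmod.
case=> -[n|n] ->; first exact: H.
have E : ((n.+1 * r - n.+1) + n.+1 = n.+1 * r)%N by rewrite subnK // leq_pmulr.
have -> : iterz f (Negz n) x = iter (n.+1 * r - n.+1) f x; last exact: H.
by rewrite -[RHS](@iter_homeoK _ f n.+1) -iterD addnC E perM.
Qed.

Section Blocks.
Variable R : realType.
Implicit Type s : seq (nat * R).
Local Notation blocks s := (flatten [seq nseq q.1 q.2 | q <- s]).
Local Notation nb s i := (nth (0%N, 0 : R) s i).

Lemma nth_blocks s j r : (j < size s)%N -> (r < (nb s j).1)%N ->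
  nth 0 (blocks s) (\sum_(0 <= i < j) (nb s i).1 + r) = (nb s j).2.
Proof.
elim: s j => // q s IH [|j] /= js rq.
  by rewrite big_geq // add0n nth_cat size_nseq rq nth_nseq rq.
rewrite big_nat_recl //= -addnA nth_cat size_nseq ltnNge leq_addr /= addKn.
exact: IH.
Qed.

(** Matches the two indexings: a jump in the exponents repeated with multiplicity occurs at a sum of
    multiplicities, hence at a cut of the splitting. *)
Lemma blocks_cut s q : (q.+1 < size (blocks s))%N ->
  nth 0 (blocks s) q.+1 != nth 0 (blocks s) q ->
  exists2 j, (0 < j < size s)%N & (\sum_(0 <= i < j) (nb s i).1)%N = q.+1.
Proof.
elim: s q => // b s IH q /=; rewrite size_cat size_nseq !nth_cat size_nseq.
case: (ltngtP q.+1 b.1) => [qb _|qb qs|qb qs _].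
- by rewrite !nth_nseq qb (ltn_trans (ltnSn q) qb) eqxx.
- have [c cE] : exists c, q = (b.1 + c)%N by exists (q - b.1)%N; lia.
  rewrite {}cE in qb qs *; rewrite -addnS !addKn => ne.
  have [|j /andP[j0 js] jE] := IH c _ ne; first by lia.
  by exists j.+1; rewrite ?ltnS ?js // big_nat_recl //= jE.
- exists 1%N; last by rewrite big_nat1 -qb.
  by case: s {IH} qs => //=; rewrite qb addn0 ltnn.
Qed.
End Blocks.

Section Cuts.
Variables (R : realType) (d : nat) (M : ptopologicalType) (f : homeomorphism M).
Hypothesis M_compact : compact [set: M].
Variable A : M -> 'M[R]_d.
Hypotheses (cA : continuous A) (uA : forall x, A x \in unitmx).
Local Notation X := (cocycle_nat f A).
Local Notation os := (oseledets f A).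
Local Notation E i y := (oseledets_space f A i y).
Local Notation L := (exponent_sum f A).

Definition regular_orbit x := forall y, orbitz f x y -> regular f A (L ^~ y) y.

Definition upper_space j y : {vspace 'cV[R]_d} := (\sum_(0 <= i < j) E i y)%VS.
Definition lower_space x j y : {vspace 'cV[R]_d} :=
  (\sum_(j <= i < oseledets_number f A x) E i y)%VS.

Section Point.
Variable x : M.
Hypothesis reg : regular_orbit x.

Lemma regular_orbit_oseledets y : orbitz f x y -> exists s, is_oseledets f A y s.
Proof. by move=> oy; have [s [os _]] := regular_oseledets uA (reg oy); exists s. Qed.
Local Notation ox := regular_orbit_oseledets.

Lemma lam_orbit p y : (p < d)%N -> orbitz f x y -> lam f A p y = lam f A p x.
Proof.
by move=> pd; apply: (orbit_ind (h := lam f A p)) => z _; exact: lam_inv.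
Qed.

Lemma oseledets_flatten y : orbitz f x y ->
  flatten [seq nseq (\dim q.2) q.1 | q <- os y] = [seq lam f A i y | i <- iota 0 d].
Proof.
move=> oy; have [t [ot ft]] := regular_oseledets uA (reg oy).
by rewrite (oseledetsE uA ot).
Qed.

Definition cut j := (\sum_(0 <= i < j) \dim (E i x))%N.

Let bl := [seq (\dim q.2, q.1) | q <- os x].

Let blE : flatten [seq nseq q.1 q.2 | q <- bl] = [seq lam f A i x | i <- iota 0 d].
Proof. by rewrite -oseledets_flatten ?/bl -?map_comp //; exact: orbit_self. Qed.

Let nbl i : (i < size (os x))%N ->
  nth (0%N, 0 : R) bl i = (\dim (E i x), nth 0 (unzip1 (os x)) i).
Proof.
move=> ik; rewrite /bl (nth_map (0, 0%VS)) // /oseledets_space /unzip2 /unzip1.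
by rewrite !(nth_map (0, 0%VS)).
Qed.

Lemma cut_exists q : (q.+1 < d)%N -> lam f A q.+1 x < lam f A q x ->
  exists2 j, (0 < j < oseledets_number f A x)%N & cut j = q.+1.
Proof.
move=> qd lt; have := @blocks_cut R bl q; rewrite blE size_map size_iota => /(_ qd).
rewrite !(nth_map 0%N) ?size_iota ?nth_iota //; try exact: ltnW.
rewrite !add0n lt_eqF // => /(_ isT) [j jk jE]; rewrite size_map in jk.
exists j => //; rewrite -jE /cut; apply: eq_big_nat => i /andP[_ ij]; rewrite nbl //.
by apply: ltn_trans ij _; case/andP: jk.
Qed.

Section OneCut.
Variable j : nat.
Hypothesis jk : (0 < j < oseledets_number f A x)%N.

Lemma space_dim_gt0 i y : (i < oseledets_number f A x)%N -> orbitz f x y -> (0 < \dim (E i y))%N.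
Proof.
move=> ik oy; have [H _ _] := oseledets_invariant_splitting uA ox.
have [nz _ _] := H y oy.
by rewrite lt0n dimv_eq0; exact: nz.
Qed.

Lemma cut_facts y : orbitz f x y ->
  [/\ (upper_space j y :&: lower_space x j y = 0)%VS,
      \dim (upper_space j y) = cut j & \dim (lower_space x j y) = (d - cut j)%N].
Proof.
move=> oy; have [H _ Hd] := oseledets_invariant_splitting uA ox.
have [_ dE full] := H y oy.
have jk' : (j <= oseledets_number f A x)%N by case/andP: jk => _ /ltnW.
have [c1 c2 c3 c4] := split_sum_cut jk' dE full.
have cE : (\sum_(0 <= i < j) \dim (E i y))%N = cut j.
  apply: eq_big_nat => i /andP[_ ij].
  exact: (Hd i y x (leq_trans ij jk') oy (orbit_self f x)).
split; [exact: c1|by rewrite c3|].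
have := dimv_sum_cap (upper_space j y) (lower_space x j y).
rewrite c1 c2 dimv0 addn0 dimvf /dim /= muln1 {1}/upper_space c3 cE.
by set l := \dim _; move: (cut j) l => a b ->; rewrite addKn.
Qed.

Lemma upper_step y : orbitz f x y -> img (A y) (upper_space j y) = upper_space j (f y).
Proof.
move=> oy; have [_ H _] := oseledets_invariant_splitting uA ox.
rewrite /upper_space img_sum; apply: eq_big_nat => i /andP[_ ij].
by apply: (H i y _ oy); apply: ltn_trans ij _; case/andP: jk.
Qed.

Lemma lower_step y : orbitz f x y -> img (A y) (lower_space x j y) = lower_space x j (f y).
Proof.
move=> oy; have [_ H _] := oseledets_invariant_splitting uA ox.
rewrite /lower_space img_sum; apply: eq_big_nat => i /andP[_ ik].
exact: (H i y ik oy).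
Qed.

Lemma cut_gt0 : (0 < cut j)%N.
Proof.
rewrite /cut big_ltn; last by case/andP: jk.
rewrite addn_gt0 space_dim_gt0 //; first by apply: ltn_trans (ltnSn 0) _; case/andP: jk => /leq_ltn_trans h /h.
exact: orbit_self.
Qed.

Lemma cut_exponents : lam f A (cut j) x = nth 0 (unzip1 (os x)) j /\
  lam f A (cut j).-1 x = nth 0 (unzip1 (os x)) j.-1 /\ (cut j < d)%N.
Proof.
have [_ k_gt] := andP jk; have j1k : (j.-1 < oseledets_number f A x)%N by apply: leq_ltn_trans k_gt; exact: leq_pred.
have sums i : (i <= oseledets_number f A x)%N -> (\sum_(0 <= a < i) (nth (0%N, 0%R : R) bl a).1)%N = cut i.
  move=> ik; apply: eq_big_nat => a /andP[_ ai].
  by rewrite nbl // (leq_trans ai).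
have d1 := space_dim_gt0 k_gt (orbit_self f x); have d2 := space_dim_gt0 j1k (orbit_self f x).
have S : size bl = oseledets_number f A x by rewrite size_map.
have cd : (cut j < d)%N.
  have := dimv_sum_cap (upper_space j x) (E j x).
  have [_ dl dh] := cut_facts (orbit_self f x).
  have : (E j x <= lower_space x j x)%VS.
    by rewrite /lower_space big_ltn // addvSl.
  move/dimvS; rewrite dh; lia.
have h1 := @nth_blocks R bl j 0; rewrite S sums ?(ltnW k_gt) // addn0 nbl // blE in h1.
have h2 := @nth_blocks R bl j.-1 (\dim (E j.-1 x)).-1.
rewrite S sums ?(ltnW j1k) // nbl // blE in h2.
have cj : cut j = (cut j.-1 + \dim (E j.-1 x))%N.
  by case/andP: jk => j0 _; rewrite -{1}(prednK j0) /cut big_nat_recr.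
have cj1 : (cut j).-1 = (cut j.-1 + (\dim (E j.-1 x)).-1)%N by rewrite cj; lia.
split; last split; last exact: cd.
  by have := h1 k_gt d1; rewrite (nth_map 0%N) ?size_iota // nth_iota.
rewrite cj1; have := h2 j1k; rewrite prednK // leqnn => /(_ isT).
rewrite -cj1 (nth_map 0%N) ?size_iota ?nth_iota //; apply: leq_ltn_trans cd; exact: leq_pred.
Qed.

Lemma cut_gap : lam f A (cut j) x < lam f A (cut j).-1 x.
Proof.
have [-> [-> _]] := cut_exponents.
apply: (osel_lt (oseledets_orbit uA ox (orbit_self f x))); case/andP: jk => j0 jk'.
by rewrite prednK // leqnn.
Qed.

Lemma lower_slow y v : orbitz f x y -> v \in lower_space x j y -> slow_fwd f A y (lam f A (cut j) x) v.
Proof.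
move=> oy vF; have [-> _] := cut_exponents; rewrite -(oseledets_unzip1 uA ox oy).
have kE := oseledets_number_orbit uA ox oy.
apply: (osel_hi_slow uA (oseledets_orbit uA ox oy)).
  by rewrite kE; case/andP: jk.
by rewrite kE.
Qed.

Lemma upper_slow y v : orbitz f x y -> v \in upper_space j y ->
  slow_bwd f A y (- lam f A (cut j).-1 x) v.
Proof.
move=> oy vF; have [_ [-> _]] := cut_exponents; rewrite -(oseledets_unzip1 uA ox oy).
have kE := oseledets_number_orbit uA ox oy; have [j0 jk'] := andP jk.
apply: (osel_lo_slow uA (oseledets_orbit uA ox oy)).
  by rewrite kE; apply: leq_ltn_trans jk'; exact: leq_pred.
by rewrite prednK.
Qed.
End OneCut.

Lemma dominated_at_cut j : oseledets_dominated_at f A x -> (0 < j < oseledets_number f A x)%N ->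
  exists m, forall y, orbitz f x y -> forall v w, v \in upper_space j y -> w \in lower_space x j y ->
    enorm (X m y *m w) * enorm v <= 2^-1 * (enorm (X m y *m v) * enorm w).
Proof.
move=> [_ dom] jk; have cd := (cut_exponents jk).2.2; have c0 := cut_gt0 jk.
have h1 y : orbitz f x y -> upper_space j y != 0%VS.
  by move=> oy; have [_ h _] := cut_facts jk oy; rewrite -dimv_eq0 h -lt0n.
have h2 y : orbitz f x y -> lower_space x j y != 0%VS.
  by move=> oy; have [_ _ h] := cut_facts jk oy; rewrite -dimv_eq0 h -lt0n subn_gt0.
exact: (@dominates_ratio R d M f A (orbitz f x) (upper_space j) (lower_space x j) uA h1 h2).1 (dom j jk).
Qed.

Lemma not_dominated_cut : ~ oseledets_dominated_at f A x -> exists2 j,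
  (0 < j < oseledets_number f A x)%N &
  forall m, exists y, orbitz f x y /\ exists v w, [/\ v \in upper_space j y, w \in lower_space x j y &
    2^-1 * (enorm (X m y *m v) * enorm w) < enorm (X m y *m w) * enorm v].
Proof.
move=> nd; apply: contrapT => H; apply: nd; split; first exact: (oseledets_invariant_splitting uA ox).
move=> j jk; have cd := (cut_exponents jk).2.2; have c0 := cut_gt0 jk.
have h1 y : orbitz f x y -> upper_space j y != 0%VS.
  by move=> oy; have [_ h _] := cut_facts jk oy; rewrite -dimv_eq0 h -lt0n.
have h2 y : orbitz f x y -> lower_space x j y != 0%VS.
  by move=> oy; have [_ _ h] := cut_facts jk oy; rewrite -dimv_eq0 h -lt0n subn_gt0.
apply: (@dominates_ratio R d M f A (orbitz f x) (upper_space j) (lower_space x j) uA h1 h2).2.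
apply: contrapT => nm; apply: H; exists j => // m.
apply: contrapT => ny; apply: nm; exists m => y oy v w vV wF.
rewrite leNgt; apply/negP => lt; apply: ny; exists y; split=> //.
by exists v, w; split.
Qed.

(** A block of exponents ending before the last index produces a cut of the splitting. This excludes
    a trivial splitting, and domination at the cut applies. *)
Lemma good_of_dominated : dominated_or_trivial f A x ->
  forall q, (q < d)%N -> class_end f A q x -> exists2 k : R, 0 < k & good_orbit q f A k x.
Proof.
move=> dt q qd [qE|lt].
  have [k k0 H] := good_last R q f; exists k => // y _.
  by case: d / qE A uA H => B uB H; exact: H.
have [qE|pnd] := eqVneq q.+1 d.
  have [k k0 H] := good_last R q f; exists k => // y _.
  by case: d / qE A uA H => B uB H; exact: H.
have q1d : (q.+1 < d)%N by rewrite ltn_neqAle pnd.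
have [j jk jE] := cut_exists q1d lt.
case: dt => [dom|tr]; last by move: jk; rewrite tr; case: (j) => // -[].
have dm := dominated_at_cut dom jk.
have cf y (oy : orbitz f x y) := cut_facts jk oy.
have := @dominated_good R d M f M_compact A cA uA q q1d (orbitz f x) (upper_space j)
  (lower_space x j) x (orbit_self f x) (@orbit_step _ f x)
  (fun y oy => let: And3 _ h _ := cf y oy in etrans h jE)
  (fun y oy => let: And3 _ _ h := cf y oy in etrans h (congr1 (subn d) jE))
  (fun y oy => let: And3 h _ _ := cf y oy in h)
  (upper_step jk) (lower_step j) dm.
by move=> [k k0 H]; exists k.
Qed.
End Point.
#[local] Opaque exponent_sum.
Local Notation fi := (homeo_inv f).
Local Notation w := minor_sum.

(** [star] with the past as Y and the modified segment followed by the future as X, at the direction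
    of v. The inverse of the past contracts v at rate l, and the modification places v on the line
    of [X m y *m u], which the future expands at rate l' only. *)
Lemma drop_core q P m y v u c l l' : regular f A (L ^~ y) y -> (q.+1 < d)%N ->
  l = L q.+1 y - L q y -> l' = L q.+2 y - L q.+1 y -> l' < l ->
  slow_fwd f A y l' u -> slow_bwd f A y (- l) v -> v != 0 ->
  (forall i, P i \in unitmx) -> pert f A P m y *m v = c *: (X m y *m u) ->
  exists n0, forall n k, (n0 <= n)%N -> (n <= 4 * k)%N -> (4 * k <= 3 * n)%N ->
    w q.+1 (X (n - k - m) (iter m f y) *m pert f A P m y *m X k (iter k fi y)) <
      expR (n%:R * (L q.+1 y - (l - l') / 8)).
Proof.
move=> ry pd lE l'E ll' Hu Hv v0 uP Lv; set g := l - l'.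
have g0 : 0 < g by rewrite subr_gt0.
have g64 : 0 < g / 64 by rewrite divr_gt0.
have [n2 H2] := Hu _ g64; have [n3 H3] := Hv _ g64.
have [C C0 HC] := star R d q.
have [n1 H1] := reg_bounds3 ry pd g64.
set Q := pert f A P m y in Lv *; have uQ : Q \in unitmx by exact: pert_unit.
have nv : 0 < `|v| by rewrite normr_gt0.
pose D1 := w q.+1 Q; pose D2 := `|c| * `|u| / `|v|; pose D3 := w q Q.
have D10 : 0 <= D1 by exact: minor_sum_ge0.
have D20 : 0 <= D2 by rewrite divr_ge0 // mulr_ge0.
have D30 : 0 <= D3 by exact: minor_sum_ge0.
pose c3 := `|m%:R * L q.+1 y| + m%:R * g + `|m%:R * l'|.
have g5 : 0 < 5 / 64 * g by rewrite mulr_gt0 // divr_gt0.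
have [n4 H4] := const_expR (C * (D1 + D2 * D3) * expR c3 + 1) g5.
(* Both k and n - k are at least n / 4, so the factors 4 bring them past the thresholds of the two
   slow estimates. *)
exists (maxn n1 (maxn (4 * n2) (maxn (4 * n3) (maxn n4 (4 * m).+1)))) => n k.
rewrite !geq_max => /and5P[n1n n2n n3n n4n mn] n4k k4n.
have [k_gt0 N_gt0 nn2 nn3 E] : [/\ (0 < k)%N, (0 < n - k - m)%N, (n2 <= n - k)%N, (n3 <= k)%N &
   (n = (n - k - m) + k + m)%N] by clear -n2n n3n mn n4k k4n; split; lia.
have [kn1 Nn nkE kn] : [/\ (k <= k <= 4 * n)%N, (m + (n - k - m) <= 4 * n)%N, ((n - k - m) + m = n - k)%N & (k <= n)%N].
  by clear -mn n4k k4n; split; lia.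
set N := (n - k - m)%N in N_gt0 E Nn nkE *.
have [n_gt0 [B0 B1 B2]] := H1 n n1n.
have up0 := bnd_up B0 N_gt0 Nn; have up1 := bnd_up B1 N_gt0 Nn.
have up1b := bnd_upb B1 k_gt0 kn1; have up2b := bnd_upb B2 k_gt0 kn1.
pose e := `|v|^-1 *: v.
have e1 : `|e| = 1 by rewrite /e normrZ gtr0_norm ?invr_gt0 // mulVf ?gt_eqF.
have uY : X k (iter k fi y) \in unitmx by exact: cocycle_nat_unit.
have S := HC (X N (iter m f y) *m Q) (X k (iter k fi y)) e e1 uY.
have We : `|X N (iter m f y) *m Q *m e| <= `|c| * `|u| / `|v| * expR ((n - k)%:R * (l' + g / 64)).
  rewrite /e -scalemxAr normrZ gtr0_norm ?invr_gt0 // -mulmxA Lv -scalemxAr mulmxA -cocycle_natD nkE.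
  rewrite normrZ [leLHS]mulrA; have := H2 _ nn2.
  move=> /(ler_wpM2l (ltac:(by rewrite mulr_ge0 // invr_ge0) : 0 <= `|v|^-1 * `|c|)) h.
  by apply: le_trans h _; apply: eq_ler; ring.
have Ye : `|invmx (X k (iter k fi y)) *m e| <= expR (k%:R * (- l + g / 64)).
  rewrite /e -scalemxAr normrZ gtr0_norm ?invr_gt0 // ler_pdivrMl // mulrC.
  exact: H3.
have W1 : w q.+1 (X N (iter m f y) *m Q) <= expR (N%:R * L q.+1 y + g / 64 * n%:R) * D1.
  exact: le_trans (minor_sumM _ _ _) (ler_wpM2r D10 up1).
have W0 : w q (X N (iter m f y) *m Q) <= expR (N%:R * L q y + g / 64 * n%:R) * w q Q.
  exact: le_trans (minor_sumM _ _ _) (ler_wpM2r (minor_sum_ge0 q Q) up0).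
have nE : n%:R = N%:R + k%:R + m%:R :> R by rewrite -!natrD -E.
have n4kR : n%:R <= 4 * k%:R :> R by rewrite -natrM ler_nat.
have k4nR : 4 * k%:R <= 3 * n%:R :> R by rewrite -!natrM ler_nat.
have [E1 E2] := drop_arith lE l'E (erefl : g = l - l') (ltW g0) (ler0n R m) nE n4kR k4nR.
have nkR : (n - k)%:R = n%:R - k%:R :> R by exact: natrB.
pose Z := n%:R * (L q.+1 y - g / 8) + c3 - 5 / 64 * g * n%:R.
have {}S := @drop_combine R C _ _ _ _ _ _ _ D1 D2 D3 _ _ _ _ _ _ Z (ltW C0) (minor_sum_ge0 _ _)
  (minor_sum_ge0 _ _) (normr_ge0 _) (normr_ge0 _) (minor_sum_ge0 _ _) (minor_sum_ge0 _ _) D10 D20 D30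
  S W1 up2b Ye We W0 up1b E1.
rewrite -nkR in E2; have {}S := S E2.
apply: le_lt_trans S _; exact: drop_end (H4 n n4n).
Qed.

Lemma drop_estimate x j P m y v u c : regular_orbit x -> (0 < j < oseledets_number f A x)%N ->
  orbitz f x y -> v \in upper_space j y -> u \in lower_space x j y -> v != 0 ->
  (forall i, P i \in unitmx) -> pert f A P m y *m v = c *: (X m y *m u) ->
  exists n0, forall n k, (n0 <= n)%N -> (n <= 4 * k)%N -> (4 * k <= 3 * n)%N ->
    w (cut x j) (X (n - k - m) (iter m f y) *m pert f A P m y *m X k (iter k fi y)) <
      expR (n%:R * (L (cut x j) y - (lam f A (cut x j).-1 x - lam f A (cut x j) x) / 8)).
Proof.
move=> reg jk oy vE uF v0 uP Lv.
have p0 : (0 < cut x j)%N := cut_gt0 reg jk.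
have [_ [_ pd]] := cut_exponents reg jk.
have gap := cut_gap reg jk.
have Hu := lower_slow reg jk oy uF; have Hv := upper_slow reg jk oy vE.
have [q pE] : exists q, cut x j = q.+1 by exists (cut x j).-1; rewrite prednK.
rewrite {}pE /= in pd gap Hu Hv *.
rewrite -(lam_orbit pd oy) -(lam_orbit (ltnW pd) oy) in gap Hu Hv *.
exact: (drop_core (reg y oy) pd (erefl _) (erefl _) gap Hu Hv v0 uP Lv).
Qed.
Variable G : set 'M[R]_d.
Hypothesis HG : closed_subgroup_GL G.

Lemma upper_iter x j y n v : regular_orbit x -> (0 < j < oseledets_number f A x)%N ->
  orbitz f x y -> v \in upper_space j y -> X n y *m v \in upper_space j (iter n f y).
Proof.
move=> reg jk oy vE; elim: n => [|n IH] /=; first by rewrite mul1mx.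
have on : orbitz f x (iter n f y) by exact: orbit_iter.
have E := upper_step reg jk on; rewrite -mulmxA.
have : A (iter n f y) *m (X n y *m v) \in img (A (iter n f y)) (upper_space j (iter n f y)).
  by rewrite (img_unitE _ _ (uA _)) (mulKmx (uA _)).
by rewrite E.
Qed.

(** A periodic orbit is finite, so the slow estimates hold from a common time on at all its points,
    and the splitting is dominated at every cut. *)
Lemma aperiodic_of_not_dominated x r : regular_orbit x -> ~ oseledets_dominated_at f A x ->
  (0 < r)%N -> iter r f x <> x.
Proof.
move=> reg nd r0 per; have [j jk H] := not_dominated_cut reg nd.
have gap := cut_gap reg jk; set l := lam f A _ x in gap; set l' := lam f A _ x in gap.
pose dl := (l' - l) / 4; have dl0 : 0 < dl by rewrite divr_gt0 // subr_gt0.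
have oi i : orbitz f x (iter i f x) by apply: orbit_iter; exact: orbit_self.
have [n1 H1] := uniform_nat r (fun i => slow_uniform
  (fun v vF => lower_slow reg jk (oi i) vF) dl0).
have [n2 H2] := uniform_nat r (fun i => slow_uniform
  (fun v vE => upper_slow reg jk (oi i) vE) dl0).
have [n3 H3] := const_expR (2 * (d%:R * d%:R)) (divr_gt0 (ltac:(by rewrite subr_gt0) : 0 < l' - l) (ltr0n R 2)).
have [m [m1 m2 m3]] : exists m, [/\ (n1 <= m)%N, (n2 <= m)%N & (n3 <= m)%N].
  by exists (maxn n1 (maxn n2 n3)); rewrite !leq_max !leqnn !orbT.
have [y [oy [v [u [vE uF lt]]]]] := H m.
have [i ir yE] := periodic_orbit r0 per oy.
have om : orbitz f x (iter m f y) by exact: orbit_iter.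
have [i' ir' yE'] := periodic_orbit r0 per om.
have hu : `|X m y *m u| <= expR (m%:R * (l + dl)) * `|u| by have := H1 i ir m m1 u; rewrite -yE; apply.
have hv : `|v| <= expR (m%:R * (- l' + dl)) * `|X m y *m v|.
  have := H2 i' ir' m m2 (X m y *m v); rewrite -yE' iter_homeoK mulKmx; last exact: cocycle_nat_unit.
  by apply; exact: upper_iter oy vE.
have := lt; rewrite ltNge => /negP; apply.
apply: (@le_trans _ _ (d%:R * d%:R * expR (- ((l' - l) / 2 * m%:R)) * (`|X m y *m v| * `|u|))).
  apply: (@le_trans _ _ ((d%:R * `|X m y *m u|) * (d%:R * `|v|))).
    by rewrite ler_pM ?enorm_ge0 ?enorm_le_norm.
  have -> : - ((l' - l) / 2 * m%:R) = m%:R * (l + dl) + m%:R * (- l' + dl) by rewrite /dl; field.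
  rewrite expRD mulrACA -!mulrA ler_wpM2l // ler_wpM2l //.
  apply: le_trans (ler_pM _ _ hu hv) _ => //; apply: eq_ler; ring.
have h4 : d%:R * d%:R * expR (- ((l' - l) / 2 * m%:R)) <= 2^-1.
  by rewrite expRN ler_pdivrMr ?expR_gt0 // ler_pdivlMl // H3.
apply: ler_pM; [|exact: mulr_ge0|exact: h4|].
  by apply: mulr_ge0; [exact: mulr_ge0|exact: expR_ge0].
by apply: ler_pM => //; exact: norm_le_enorm.
Qed.

(* The points whose orbit segment can be modified on m steps so as to make the p-th exterior
   power grow at rate below th over every window of length n with y near its middle. *)
Definition droppable (e : R) m p (th : R) n : set M := [set y | exists P, (forall j, reachable G e (P j)) /\
  forall k, (n <= 4 * k)%N -> (4 * k <= 3 * n)%N ->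
  w p (X (n - k - m) (iter m f y) *m pert f A P m y *m X k (iter k fi y)) < expR (n%:R * th)].

Lemma bad_point x : regular_orbit x -> ~ oseledets_dominated_at f A x ->
  exists p, [/\ (0 < p)%N, (p < d)%N, lam f A p x < lam f A p.-1 x &
  forall (e : R) m, (forall y v u, v != 0 -> u != 0 ->
      2^-1 * (enorm (X m y *m v) * enorm u) < enorm (X m y *m u) * enorm v ->
      exists P, (forall j, reachable G e (P j)) /\
      exists2 c : R, c != 0 & pert f A P m y *m v = c *: (X m y *m u)) ->
    exists2 y, orbitz f x y & exists n0, forall n, (n0 <= n)%N ->
      droppable e m p (L p x - (lam f A p.-1 x - lam f A p x) / 8) n y].
Proof.
move=> reg nd; have [j jk H] := not_dominated_cut reg nd.
have c0 := cut_gt0 reg jk; have [_ [_ cd]] := cut_exponents reg jk.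
have gap := cut_gap reg jk.
exists (cut x j); split=> //.
move=> e m He; have [y [oy [v [u [vE uF lt]]]]] := H m; exists y => //.
have v0 : v != 0.
  by apply: contraTneq lt => ->; rewrite mulmx0 !enorm0 mul0r !mulr0 ltxx.
have u0 : u != 0.
  by apply: contraTneq lt => ->; rewrite mulmx0 !enorm0 mul0r !mulr0 ltxx.
have [P [HP [c _ Pv]]] := He y v u v0 u0 lt.
have uP i : P i \in unitmx.
  by have [gam [_ _ <- Hg]] := HP i; have [Gg _] := Hg 1; have := subgroup_unit HG Gg.
have [n0 Hn0] := drop_estimate reg jk oy vE uF v0 uP Pv.
have pd : (cut x j <= d)%N by have [_ [_ /ltnW]] := cut_exponents reg jk.
have Lxy : L (cut x j) y = L (cut x j) x.
  by apply: (orbit_ind (h := L (cut x j)) _ oy) => z _; have := exponent_sum_inv f M_compact cA uA z pd.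
exists n0 => n nn; exists P; split; first exact: HP.
by move=> k nk kn; rewrite -Lxy; exact: Hn0.
Qed.
End Cuts.

(** * Towers over aperiodic points *)

Section Towers.
Variables (R : realType) (M : ptopologicalType) (mu : probability (borel M) R).
Hypotheses (M_compact : compact [set: M]) (M_hausdorff : hausdorff_space M) (mu_regular : borel_regular mu).
Variable f : homeomorphism M.
Hypothesis mu_invariant : preserves mu f.
Local Notation S := (borel M).
Local Notation fi := (homeo_inv f).
Implicit Types (U V K W : set M).

Definition pr V : R := fine (mu (V : set S)).

Lemma prE V : measurable (V : set S) -> mu (V : set S) = (pr V)%:E.
Proof. by move=> mV; rewrite /pr fineK // fin_num_measure. Qed.

Lemma pr_ge0 V : 0 <= pr V.
Proof. by rewrite /pr fine_ge0. Qed.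

Lemma pr_le V W : measurable (V : set S) -> measurable (W : set S) -> V `<=` W -> pr V <= pr W.
Proof. by move=> mV mW VW; rewrite -lee_fin -!prE //; apply: le_measure => //; exact: mem_set. Qed.

Lemma pr_setU V W : measurable (V : set S) -> measurable (W : set S) -> pr (V `|` W) <= pr V + pr W.
Proof.
move=> mV mW; rewrite -lee_fin EFinD -!prE //; last exact: measurableU.
exact: measureU2.
Qed.

Lemma pr_setUd V W : measurable (V : set S) -> measurable (W : set S) -> V `&` W = set0 ->
  pr (V `|` W) = pr V + pr W.
Proof.
move=> mV mW VW; apply: EFin_inj; rewrite EFinD -!prE //; last exact: measurableU.
by rewrite measureU.
Qed.

Lemma measurable_iter n V : measurable (V : set S) -> measurable (iter n f @^-1` V : set S).
Proof.
move=> mV; rewrite -[X in measurable X]setTI.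
by apply: (continuous_measurable_self (continuous_iter (n := n) (@homeo_fun_continuous M f))).
Qed.

Lemma measurable_iter_inv n V : measurable (V : set S) -> measurable (iter n fi @^-1` V : set S).
Proof.
move=> mV; rewrite -[X in measurable X]setTI.
by apply: (continuous_measurable_self (continuous_iter (n := n) (@homeo_inv_continuous M f))).
Qed.

Lemma pr_iter n V : measurable (V : set S) -> pr (iter n f @^-1` V) = pr V.
Proof.
move=> mV; rewrite /pr; congr fine.
elim: n V mV => [//|n IH] V mV.
have -> : iter n.+1 f @^-1` V = iter n f @^-1` (f @^-1` V) by [].
by rewrite IH ?mu_invariant //; exact: (measurable_iter 1).
Qed.

Definition within n V : set M := [set x | exists2 s, (s <= n)%N & V (iter s f x)].

Lemma withinS n V : within n.+1 V = within n V `|` (iter n.+1 f @^-1` V).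
Proof.
apply/seteqP; split=> x.
  by move=> [s]; rewrite leq_eqVlt => /predU1P[->|sn] Vs; [right|left; exists s].
by move=> [[s sn Vs]|Vs]; [exists s => //; exact: leqW|exists n.+1].
Qed.

Lemma within0 V : within 0 V = V.
Proof.
apply/seteqP; split=> x; first by move=> [s]; rewrite leqn0 => /eqP ->.
by move=> Vx; exists 0%N.
Qed.

Lemma measurable_within n V : measurable (V : set S) -> measurable (within n V : set S).
Proof.
move=> mV; elim: n => [|n IH]; first by rewrite within0.
by rewrite withinS; apply: measurableU => //; exact: measurable_iter.
Qed.

Lemma pr_within n V : measurable (V : set S) -> pr (within n V) <= n.+1%:R * pr V.
Proof.
move=> mV; elim: n => [|n IH]; first by rewrite within0 mul1r.
rewrite withinS; apply: le_trans (pr_setU (measurable_within _ mV) (measurable_iter _ mV)) _.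
by rewrite pr_iter // -[n.+2%:R]natr1 mulrDl mul1r lerD2r.
Qed.

Lemma inner_compact V (e : R) : measurable (V : set S) -> 0 < e ->
  exists K, [/\ compact K, K `<=` V & pr V <= pr K + e].
Proof.
move=> mV e0; have [_ VE] := mu_regular mV.
have fin : ereal_sup [set mu K | K in [set K : set M | compact K /\ K `<=` V]] \is a fin_num.
  by rewrite -VE fin_num_measure.
have [_ [K [cK KV] <-] lt] := ub_ereal_sup_adherent e0 fin.
exists K; split=> //; rewrite -VE prE // in lt.
have mK : measurable (K : set S).
  by rewrite -[X in measurable X]setCK; apply: measurableC; apply: sub_sigma_algebra; apply: closed_openC; exact: compact_closed.
by rewrite prE // -EFinB lte_fin in lt; lra.
Qed.

Lemma outer_open V (e : R) : measurable (V : set S) -> 0 < e ->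
  exists O, [/\ open O, V `<=` O & pr O <= pr V + e].
Proof.
move=> mV e0; have [VE _] := mu_regular mV.
have fin : ereal_inf [set mu U | U in [set U : set M | open U /\ V `<=` U]] \is a fin_num.
  by rewrite -VE fin_num_measure.
have [_ [W [oW VW] <-] lt] := lb_ereal_inf_adherent e0 fin.
have mW : measurable (W : set S) by exact: sub_sigma_algebra.
by exists W; split=> //; rewrite -VE !prE // -EFinD lte_fin in lt; exact: ltW.
Qed.

Lemma compact_measurable K : compact K -> measurable (K : set S).
Proof.
move=> cK; rewrite -[X in measurable X]setCK; apply: measurableC; apply: sub_sigma_algebra.
by apply: closed_openC; exact: compact_closed.
Qed.

Lemma displace (g : M -> M) x : continuous g -> g x <> x ->
  exists N, [/\ open N, N x & forall y, N y -> ~ N (g y)].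
Proof.
move=> cg gx; have := M_hausdorff; rewrite open_hausdorff => H.
have [|[A B] /= [/set_mem Ax /set_mem Bgx] [oA oB /eqP AB]] := H x (g x); first by apply/eqP => /esym.
exists (A `&` g @^-1` B); split=> //.
  by apply: openI => //; apply: open_comp => // y _; exact: cg.
by move=> y [_ By] [Ay _]; have : (A `&` B) (g y) by []; rewrite AB.
Qed.

Definition aperiodic : set M := [set x | forall r, (0 < r)%N -> iter r f x <> x].

(** Points moved by an iterate have neighbourhoods disjoint from their image, M being Hausdorff;
    hence they form an open set, and the aperiodic points a countable intersection of such sets. *)
Lemma measurable_aperiodic : measurable (aperiodic : set S).
Proof.
have -> : aperiodic = \bigcap_r [set x | iter r.+1 f x <> x].
  apply/seteqP; split=> x H r; first by move=> _; exact: H.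
  by case: r => // r _; exact: H.
apply: bigcapT_measurable => r; apply: sub_sigma_algebra.
rewrite (_ : [set x | _] = \bigcup_(N in [set N | open N /\ forall y, N y -> ~ N (iter r.+1 f y)]) N).
  by apply: bigcup_open => N [].
apply/seteqP; split=> x.
  move=> /(displace (continuous_iter (n := r.+1) (@homeo_fun_continuous M f)))[N [oN Nx HN]].
  by exists N.
by move=> [N [oN HN] Nx]; rewrite /= => E; apply: (HN x Nx); rewrite /= E.
Qed.

Lemma displace_iter x h : aperiodic x -> exists N, [/\ open N, N x &
  forall r y, (0 < r <= h)%N -> N y -> ~ N (iter r f y)].
Proof.
move=> ax; elim: h => [|h [N [oN Nx HN]]].
  by exists setT; split=> //; [exact: openT|move=> r y; case: r].
have [N' [oN' N'x HN']] := displace (continuous_iter (n := h.+1) (@homeo_fun_continuous M f)) (ax h.+1 isT).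
exists (N `&` N'); split=> //; first exact: openI.
move=> r y /andP[r0]; rewrite leq_eqVlt => /predU1P[->|rh] [Ny N'y] [Nr N'r].
  exact: (HN' y N'y).
by apply: (HN r y _ Ny Nr); rewrite r0.
Qed.

Definition around h V : set M := [set y | exists2 r, (r <= h)%N & V (iter r f y) \/ V (iter r fi y)].

Lemma measurable_around h V : measurable (V : set S) -> measurable (around h V : set S).
Proof.
move=> mV; have -> : around h V = \bigcup_(r in [set r | (r <= h)%N]) (iter r f @^-1` V `|` iter r fi @^-1` V).
  by apply/seteqP; split=> y [r rh Hr]; exists r.
apply: bigcup_measurable => r _; apply: measurableU.
  exact: measurable_iter.
exact: measurable_iter_inv.
Qed.

Section Greedy.
Variables (I : Type) (U : I -> set M) (E K : set M) (h : nat).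
Hypotheses (oU : forall i, open (U i)) (mK : measurable (K : set S)) (KE : K `<=` E).

Fixpoint pairwise_disjoint (ws : seq (I * set M)) : Prop :=
  if ws is w :: ws' then (forall v x, List.In v ws' -> w.2 x -> ~ v.2 x) /\ pairwise_disjoint ws' else True.

Definition union_of (ws : seq (I * set M)) : set M := [set x | exists2 w, List.In w ws & w.2 x].

Lemma union_of_cons w ws : union_of (w :: ws) = w.2 `|` union_of ws.
Proof.
apply/seteqP; split=> x.
  by move=> [v [<-|vws] vx]; [left|right; exists v].
by move=> [wx|[v vws vx]]; [exists w => //; left|exists v => //; right].
Qed.

Lemma measurable_union_of ws : (forall w, List.In w ws -> measurable (w.2 : set S)) ->
  measurable (union_of ws : set S).
Proof.
elim: ws => [|w ws IH] H; first by rewrite (_ : union_of _ = set0) //; apply/seteqP; split=> x // -[].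
rewrite union_of_cons; apply: measurableU; first by apply: H; left.
by apply: IH => v vws; apply: H; right.
Qed.

(* Greedily remove from each set of the cover what is close, along orbits, to the points chosen
   before, then approximate from inside by compact sets. *)
Lemma greedy (xs : seq (I * set M)) (e : R) : 0 < e ->
  (forall w, List.In w xs -> [/\ open w.2, w.2 `<=` U w.1 &
     forall r y, (0 < r <= h)%N -> w.2 y -> ~ w.2 (iter r f y)]) ->
  exists V, exists ws : seq (I * set M), [/\ measurable (V : set S),
    (forall y, K y -> union_of xs y -> around h V y),
    (forall r y, (0 < r <= h)%N -> V y -> ~ V (iter r f y)),
    V `<=` K & [/\ (forall w, List.In w ws -> compact w.2 /\ w.2 `<=` U w.1 `&` K),
    pairwise_disjoint ws, union_of ws `<=` V & pr V <= pr (union_of ws) + (size xs)%:R * e]].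
Proof.
move=> e0; elim: xs => [|[i O] xs IH] H.
  exists set0, [::]; split=> //; first by move=> y _ [w []].
  split=> //; first by move=> x [w []].
  by rewrite mul0r addr0 /union_of (_ : [set x | _] = set0) //; apply/seteqP; split=> x // -[w []].
have [|V [ws [mV KV sepV VK [cw dw wV prV]]]] := IH; first by move=> w wxs; apply: H; right.
have [/= oO OU sepO] := H (i, O) (or_introl erefl).
pose P := (O `&` K) `\` around h V.
have mP : measurable (P : set S).
  apply: measurableD; last exact: measurable_around.
  by apply: measurableI => //; exact: sub_sigma_algebra.
have PV : P `&` V = set0.
  by apply/seteqP; split=> y // -[[_ nV] Vy]; apply: nV; exists 0%N => //; left.
have [C [cC CP prC]] := inner_compact mP e0.
have mC := compact_measurable cC.
have ms : measurable (union_of ws : set S).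
  by apply: measurable_union_of => w /cw[/compact_measurable].
exists (P `|` V), ((i, C) :: ws); split.
- exact: measurableU.
- move=> y Ky; rewrite union_of_cons => -[/= Oy|sy].
    have [[r rh Vr]|nV] := pselect (around h V y).
      by exists r => //; case: Vr => [?|?]; [left|right]; right.
    by exists 0%N => //; left; left.
  by have [r rh Vr] := KV y Ky sy; exists r => //; case: Vr => [?|?]; [left|right]; right.
- move=> r y rh; have /andP[r0 rh'] := rh; move=> [[[Oy Ky] nV]|Vy] [[[Or Kr] nVr]|Vr].
  + exact: (sepO r y rh Oy).
  + by apply: nV; exists r => //; left.
  + by apply: nVr; exists r => //; right; rewrite iter_homeoK.
  + exact: (sepV r y rh Vy).
- by move=> y [[[_ Ky] _]|/VK].
split.
- move=> w [<- /=|/cw //]; split=> // y /CP[[Oy Ky] _]; split=> //; exact: OU.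
- split=> // v x vws /= /CP Px vx.
  have : (P `&` V) x by split=> //; apply: wV; exists v.
  by rewrite PV.
- rewrite union_of_cons => x [/= /CP|/wV]; by [left|right].
- rewrite (pr_setUd mP mV PV) union_of_cons /=.
  have Cs : C `&` union_of ws = set0.
    by apply/seteqP; split=> y // -[/CP Py /wV Vy]; rewrite -PV.
  rewrite (pr_setUd mC ms Cs) -natr1 mulrDl mul1r.
  by move: prC prV; set a := _%:R * e; lra.
Qed.
End Greedy.

Lemma map_In (T1 : eqType) (T2 : Type) (g : T1 -> T2) (s : seq T1) w :
  List.In w (map g s) <-> exists2 x, x \in s & w = g x.
Proof.
elim: s => [|a s IH] /=; first by split=> // -[x]; rewrite in_nil.
split.
  by move=> [<-|/IH[x xs ->]]; [exists a; rewrite ?mem_head|exists x; rewrite // in_cons xs orbT].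
move=> [x]; rewrite in_cons => /predU1P[->|xs] wE; first by left; rewrite wE.
by right; apply/IH; exists x.
Qed.

(** A substitute for the Rokhlin lemma: the base meets none of its first h iterates, yet from most
    points of Z one comes across it. The factor 3 h + 1 counts h steps to reach E, h steps to the
    base in either direction, and a preliminary shift by h that turns past visits into future
    ones. *)
Lemma tower (I : Type) (i0 : I) (U : I -> set M) (E Z : set M) (h : nat) (ka : R) :
  (forall i, open (U i)) -> measurable (E : set S) -> measurable (Z : set S) ->
  E `<=` \bigcup_i U i -> E `<=` aperiodic -> Z `<=` within h E ->
  0 < ka -> ka <= pr Z ->
  exists ws : seq (I * set M), [/\ (forall w, List.In w ws -> compact w.2 /\ w.2 `<=` U w.1 `&` E),
    pairwise_disjoint ws,
    (forall r y, (0 < r <= h)%N -> union_of ws y -> ~ union_of ws (iter r f y)) &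
    ka <= 2 * (3 * h).+1%:R * pr (union_of ws)].
Proof.
move=> oU mE mZ EU Eap ZE ka0 kaZ.
(* The approximation of E by K and that of V by the compact pieces cost ka / 4 each, leaving ka /
   2. *)
pose e1 := ka / 4 / h.+1%:R; have e10 : 0 < e1 by rewrite !divr_gt0.
have [K [cK KE prK]] := inner_compact mE e10.
have mK := compact_measurable cK.
have ex x : {p : I * set M | K x -> [/\ open p.2, p.2 `<=` U p.1, p.2 x &
     forall r y, (0 < r <= h)%N -> p.2 y -> ~ p.2 (iter r f y)]}.
  apply: cid; have [Kx|nK] := pselect (K x); last by exists (i0, set0) => /nK.
  have [i _ Ux] := EU x (KE x Kx); have [N [oN Nx HN]] := displace_iter h (Eap x (KE x Kx)).
  exists (i, U i `&` N) => _ /=; split; [exact: openI|by move=> y []|by []|].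
  by move=> r y rh [_ Ny] [_]; exact: HN.
pose p x := sval (ex x); have pP x (Kx : K x) := svalP (ex x) Kx.
have : cover_compact K by rewrite -compact_cover.
move=> /(_ M K (fun x => (p x).2))[||D' D'K Kcov].
- by move=> x /pP[].
- by move=> x Kx; exists x => //; have [] := pP x Kx.
pose xs := map p (finmap.enum_fset D'); pose N := size xs.
pose e2 := ka / 4 / ((3 * h).+1%:R * N.+1%:R).
have e20 : 0 < e2 by rewrite !divr_gt0 // mulr_gt0.
have [|V [ws [mV KV sepV VK [cw dw wV prV]]]] := @greedy I U K h mK xs e2 e20.
  move=> w /map_In[x xD ->]; have Kx : K x by apply/set_mem; exact: D'K.
  by have [] := pP x Kx.
exists ws; split=> //.
- by move=> w /cw[h1 h2]; split=> // x /h2[Ux /KE].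
- by move=> r y rh /wV Vy /wV; exact: sepV Vy.
have mJ : measurable (E `\` K : set S) by exact: measurableD.
have Zsub : iter h f @^-1` Z `<=` within (3 * h) V `|` iter h f @^-1` (within h (E `\` K)).
  move=> z Zz'.
  have [q qh Eq] := ZE _ Zz'; have [Kq|nK] := pselect (K (iter q f (iter h f z))); last first.
    by right; exists q.
  left; have [|r rh Hr] := KV _ Kq.
    have [x xD px] := Kcov _ Kq; exists (p x) => //; apply/map_In; exists x => //.
  case: Hr; last first.
    rewrite -iterD.
    have -> : (q + h = r + (q + h - r))%N by rewrite subnKC //; clear -rh; lia.
    by rewrite iterD iter_homeoK => Vr; exists (q + h - r)%N => //; clear -qh; lia.
  by rewrite -!iterD => Vr; exists (r + q + h)%N => //; clear -rh qh; lia.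
have h1 : pr Z <= (3 * h).+1%:R * pr V + h.+1%:R * pr (E `\` K).
  rewrite -(pr_iter h mZ); apply: le_trans (pr_le (measurable_iter h mZ) _ Zsub) _.
    by apply: measurableU; [exact: measurable_within|apply: measurable_iter; exact: measurable_within].
  apply: le_trans (pr_setU (measurable_within _ mV) (measurable_iter _ (measurable_within _ mJ))) _.
  by apply: lerD; [exact: pr_within|rewrite pr_iter ?pr_within //; exact: measurable_within].
have h2 : pr (E `\` K) <= e1.
  have := pr_setUd mK mJ; rewrite setDUK // setDIK => /(_ erefl) prE'; rewrite prE' in prK.
  by lra.
have h3 : h.+1%:R * pr (E `\` K) <= ka / 4.
  by apply: le_trans (ler_wpM2l _ h2) _ => //; rewrite /e1 mulrC divfK.
have h4 : (3 * h).+1%:R * (N%:R * e2) <= ka / 4.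
  have E2 : ka / 4 = (3 * h).+1%:R * N.+1%:R * e2 by rewrite /e2 [RHS]mulrC divfK // mulf_neq0 ?pnatr_eq0.
  by rewrite E2 mulrA ler_wpM2r ?(ltW e20) // ler_wpM2l // ler_nat.
have h5 : (3 * h).+1%:R * pr V <= (3 * h).+1%:R * pr (union_of ws) + ka / 4.
  apply: le_trans (ler_wpM2l _ prV) _ => //; rewrite mulrDr lerD2l; exact: h4.
by rewrite -mulrA; set z := _ * pr (union_of ws) in h5 *; lra.
Qed.
End Towers.

(** * Continuous perturbations with values in G, supported near the towers *)

Section Patch.
Variables (R : realType) (d : nat) (M : ptopologicalType).
Hypotheses (M_compact : compact [set: M]) (M_hausdorff : hausdorff_space M).
Variable G : set 'M[R]_d.
Hypothesis HG : closed_subgroup_GL G.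

Lemma closed_union_of (I : Type) (ws : seq (I * set M)) : (forall w, List.In w ws -> compact w.2) ->
  closed (union_of ws).
Proof.
elim: ws => [|w ws IH] H.
  by rewrite (_ : union_of _ = set0); [exact: closed0|apply/seteqP; split=> x // -[v []]].
rewrite union_of_cons; apply: closedU; last by apply: IH => v vws; apply: H; right.
by apply: compact_closed => //; apply: H; left.
Qed.

(** Q is a product of factors, one for each compact piece, running along a path from 1 to the
    prescribed value. The factor of one piece lives where u > 2/3 and the remaining ones where u <
    1/3, so at most one factor differs from 1 at any point and the bound e is kept. *)
Lemma multiplier (e : R) (cs : seq ('M[R]_d * set M)) (O : set M) : 0 <= e ->
  (forall c, List.In c cs -> compact c.2 /\ (c.2 !=set0 -> reachable G e c.1)) ->
  pairwise_disjoint cs ->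
  open O -> union_of cs `<=` O ->
  exists Q : M -> 'M[R]_d, [/\ continuous Q, (forall x, G (Q x) /\ mnorm (Q x - 1%:M) <= e),
    (forall c x, List.In c cs -> c.2 x -> Q x = c.1) & forall x, ~ O x -> Q x = 1%:M].
Proof.
move=> e0; elim: cs O => [|c cs IH] O H dis oO sO.
  exists (fun=> 1%:M); split=> // [x|x]; first exact: cvg_cst.
  by split; [exact: subgroup1 HG|rewrite subrr mnorm0].
have [cC rc] := H c (or_introl erefl); have [dc dis'] := dis.
have [gam [cg g0 g1 Hg]] : exists gam : R -> 'M[R]_d, [/\ continuous gam, gam 0 = 1%:M,
    c.2 !=set0 -> gam 1 = c.1 & forall s, G (gam s) /\ mnorm (gam s - 1%:M) <= e].
  have [/rc[gam [h1 h2 h3 h4]]|ne] := pselect (c.2 !=set0); first by exists gam; split.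
  exists (fun=> 1%:M); split=> [x|||s]; [exact: cvg_cst|by []|by move=> /ne|].
  by split; [exact: subgroup1 HG|rewrite subrr mnorm0].
have cN : closed (union_of cs `|` ~` O).
  apply: closedU; last exact: open_closedC.
  by apply: closed_union_of => v vcs; have [] := H v (or_intror vcs).
have NC : (union_of cs `|` ~` O) `&` c.2 = set0.
  apply/seteqP; split=> x // -[[[v vcs vx]|nO] cx]; first exact: (dc v x vcs cx vx).
  by apply: nO; apply: sO; exists c => //; left.
have [u [cu u0 u1 _]] := @urysohn_ext_itv M R (compact_normal M_hausdorff M_compact) _ _ 0 1 cN
  (compact_closed M_hausdorff cC) NC ltr01.
have oO' : open (O `&` [set x | u x < 3^-1]).
  apply: openI => //; rewrite (_ : [set x | _] = u @^-1` [set y | y < 3^-1]) //.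
  by apply: open_comp; [move=> x _; exact: cu|exact: open_lt].
have [||Q' [cQ GQ QC QO]] := IH (O `&` [set x | u x < 3^-1]) _ dis' oO' _.
- by move=> v vcs; apply: H; right.
- move=> x [v vcs vx]; split; first by apply: sO; exists v => //; right.
  rewrite /= (_ : u x = 0) ?invr_gt0 //.
  by apply: u0; exists x => //; left; exists v.
(* The positive part of 3 u - 2, which vanishes for u <= 2/3 and equals 1 at u = 1. *)
pose b x := 2^-1 * ((3 * u x - 2) + `|3 * u x - 2|).
have cv x : (fun y => 3 * u y - 2) @ x --> 3 * u x - 2.
  by apply: cvgB; [apply: cvgM; [exact: cvg_cst|exact: cu]|exact: cvg_cst].
have cb : continuous b.
  move=> x; apply: cvgM; first exact: cvg_cst.
  by apply: cvgD; [exact: cv|apply: cvg_norm; exact: cv].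
have b0 x : u x <= 2 / 3 -> b x = 0.
  by move=> ux; rewrite /b ler0_norm ?subrr ?mulr0 //; lra.
have one x : Q' x = 1%:M \/ gam (b x) = 1%:M.
  have [h|h] := ltP (u x) (3^-1); last by left; apply: QO => -[_ /=]; rewrite ltNge h.
  by right; rewrite b0 //; lra.
exists (fun x => Q' x *m gam (b x)); split.
- move=> x; apply: cont_at_mulmx; first exact: cQ.
  by apply: (continuous_comp (f := b) (g := gam)); [exact: cb|exact: cg].
- move=> x; case: (one x) => ->; first by rewrite mul1mx; exact: Hg.
  by rewrite mulmx1; exact: GQ.
- move=> v x [<-|vcs] vx.
    have ux : u x = 1 by apply: u1; exists x.
    rewrite QO; last by rewrite /= ux => -[_]; lra.
    rewrite mul1mx /b ux (_ : 3 * 1 - 2 = 1); last by lra.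
    by rewrite normr1 mulrC divff // g1 //; exists x.
  rewrite b0; first by rewrite g0 mulmx1; exact: QC.
  by rewrite (_ : u x = 0); [lra|apply: u0; exists x => //; left; exists v].
- move=> x nO; rewrite QO; last by move=> [].
  rewrite b0 ?g0 ?mulmx1 //.
  by rewrite (_ : u x = 0); [lra|apply: u0; exists x => //; right].
Qed.
End Patch.

Lemma In_cat (T : Type) (s t : seq T) x : List.In x (s ++ t) <-> List.In x s \/ List.In x t.
Proof. by elim: s => [|a s IH] /=; [split=> [?|[]//]; right|rewrite IH; tauto]. Qed.

Lemma pairwise_disjoint_cat (M : ptopologicalType) (I : Type) (s t : seq (I * set M)) :
  pairwise_disjoint s -> pairwise_disjoint t ->
  (forall v w x, List.In v s -> List.In w t -> v.2 x -> ~ w.2 x) -> pairwise_disjoint (s ++ t).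
Proof.
elim: s => [//|a s IH] /= [ha hs] ht H; split.
  move=> v x /In_cat[vs|vt] ax; first exact: ha vs ax.
  by apply: (H a v x _ vt ax); left.
by apply: IH => // v w x vs; apply: H; right.
Qed.

Section Segments.
Variables (R : realType) (d : nat) (M : ptopologicalType) (f : homeomorphism M) (h m : nat).
Hypothesis mh : (m <= h)%N.
Local Notation I := (nat -> 'M[R]_d).
Implicit Types ws : seq (I * set M).

Fixpoint segment (w : I * set M) l : seq ('M[R]_d * set M) :=
  if l is k.+1 then (w.1 k, iter k f @` w.2) :: segment w k else [::].

Fixpoint segments ws : seq ('M[R]_d * set M) :=
  if ws is w :: ws' then segment w m ++ segments ws' else [::].

Lemma segmentP w l c : List.In c (segment w l) <-> exists2 k, (k < l)%N & c = (w.1 k, iter k f @` w.2).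
Proof.
elim: l => [|l IH] /=; first by split=> // -[].
rewrite IH; split.
  by move=> [<-|[k kl ->]]; [exists l|exists k; rewrite // ltnS ltnW].
move=> [k]; rewrite ltnS leq_eqVlt => /predU1P[->|kl] ->; first by left.
by right; exists k.
Qed.

Lemma segmentsP ws c : List.In c (segments ws) <->
  exists w k, [/\ List.In w ws, (k < m)%N & c = (w.1 k, iter k f @` w.2)].
Proof.
elim: ws => [|w ws IH] /=; first by split=> // -[w [k []]].
rewrite In_cat IH segmentP; split.
  move=> [[k km ->]|[v [k [vws km ->]]]]; first by exists w, k; split=> //; left.
  by exists v, k; split=> //; right.
move=> [v [k [[<-|vws] km ->]]]; first by left; exists k.
by right; exists v, k.
Qed.

Lemma iter_homeo_inj k : injective (iter k f).
Proof. by move=> x y E; rewrite -(iter_homeoK f k x) E iter_homeoK. Qed.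

Lemma separated_iter (V : set M) y z k l :
  (forall r x, (0 < r <= h)%N -> V x -> ~ V (iter r f x)) -> V y -> V z ->
  (k <= l)%N -> (l <= k + h)%N -> iter k f y = iter l f z -> k = l /\ y = z.
Proof.
move=> sep Vy Vz kl lkh E.
have yE : y = iter (l - k) f z by apply: (@iter_homeo_inj k); rewrite -iterD subnKC.
move: kl; rewrite leq_eqVlt => /predU1P[klE|kl].
  by split=> //; rewrite yE klE subnn.
case: (sep (l - k)%N z _ Vz); last by rewrite -yE.
by rewrite subn_gt0 kl /= leq_subLR.
Qed.

Lemma segments_disjoint ws : pairwise_disjoint ws ->
  (forall r x, (0 < r <= h)%N -> union_of ws x -> ~ union_of ws (iter r f x)) ->
  pairwise_disjoint (segments ws).
Proof.
elim: ws => [//|w ws IH] [dw dws] sep.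
have sep' r x : (0 < r <= h)%N -> union_of ws x -> ~ union_of ws (iter r f x).
  by move=> rh Ux Ur; apply: (sep r x rh); rewrite union_of_cons; right.
have seg l : (l <= h)%N -> pairwise_disjoint (segment w l).
  elim: l => [//|l IHl] lh /=; split; last by apply: IHl; exact: ltnW.
  move=> v x /segmentP[k kl ->] /= [y wy yE] [z wz zE].
  have Uy : union_of (w :: ws) y by exists w => //; left.
  have Uz : union_of (w :: ws) z by exists w => //; left.
  have lkh : (l <= k + h)%N by clear -lh; lia.
  have [E _] := separated_iter sep Uz Uy (ltnW kl) lkh (etrans zE (esym yE)).
  by move: kl; rewrite E ltnn.
apply: pairwise_disjoint_cat; last 1 first.
- move=> _ _ x /segmentP[k km ->] /segmentsP[v [l [vws lm ->]]] /= [y wy yE] [z vz zE].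
  have Uy : union_of (w :: ws) y by exists w => //; left.
  have Uz : union_of (w :: ws) z by exists v => //; right.
  have kE : iter k f y = iter l f z by rewrite yE zE.
  have yz : y = z.
    have [kl|lk] := leqP k l.
      have lkh : (l <= k + h)%N by clear -lm mh; lia.
      by have [] := separated_iter sep Uy Uz kl lkh kE.
    have klh : (k <= l + h)%N by clear -km mh; lia.
    by have [] := separated_iter sep Uz Uy (ltnW lk) klh (esym kE).
  by apply: (dw v y vws wy); rewrite yz.
- exact: seg.
- exact: IH.
Qed.

Lemma segments_compact ws (G : set 'M[R]_d) (e : R) :
  (forall w, List.In w ws -> compact w.2 /\ (w.2 !=set0 -> forall j, reachable G e (w.1 j))) ->
  forall c, List.In c (segments ws) -> compact c.2 /\ (c.2 !=set0 -> reachable G e c.1).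
Proof.
move=> H c /segmentsP[w [k [wws km ->]]] /=; have [cw rw] := H w wws; split; last first.
  by move=> [_ [x wx _]]; apply: rw; exists x.
apply: continuous_compact => //; apply: continuous_subspaceT.
exact: (continuous_iter (n := k) (@homeo_fun_continuous M f)).
Qed.
End Segments.

Section OpenDroppable.
Variables (R : realType) (d : nat) (M : ptopologicalType) (f : homeomorphism M) (A : M -> 'M[R]_d).
Hypothesis cA : continuous A.
Variable G : set 'M[R]_d.
Local Notation fi := (homeo_inv f).
Local Notation X := (cocycle_nat f A).

Lemma continuous_pert P n : continuous (pert f A P n).
Proof.
elim: n => [|n IH] x; first exact: cvg_cst.
suff : {for x, continuous (fun y => A (iter n f y) *m P n *m pert f A P n y)} by [].
apply: cont_at_mulmx; last exact: IH.
apply: cont_at_mulmx; last exact: cvg_cst.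
apply: (continuous_comp (f := iter n f) (g := A)); last exact: cA.
exact: (continuous_iter (n := n) (@homeo_fun_continuous M f)).
Qed.

(** With P fixed the condition is open in y. [droppable] is the union of these sets over all P, and
    the tower assigns a single P to each compact piece. *)
Definition drop_set (e : R) m p (th : R) n (P : nat -> 'M[R]_d) : set M := [set y |
  (forall j, reachable G e (P j)) /\ forall k, (n <= 4 * k)%N -> (4 * k <= 3 * n)%N ->
  minor_sum p (X (n - k - m) (iter m f y) *m pert f A P m y *m X k (iter k fi y)) < expR (n%:R * th)].

Lemma droppableE e m p th n : droppable f A G e m p th n = \bigcup_P drop_set e m p th n P.
Proof.
apply/seteqP; split=> y; first by move=> [P [h1 h2]]; exists P.
by move=> [P _ [h1 h2]]; exists P.
Qed.

Lemma open_finite_forall (O : nat -> set M) n : (forall k, open (O k)) ->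
  open [set y | forall k, (k < n)%N -> O k y].
Proof.
move=> oO; elim: n => [|n IH].
  by rewrite (_ : [set y | _] = setT); [exact: openT|apply/seteqP; split].
rewrite (_ : [set y | _] = [set y | forall k, (k < n)%N -> O k y] `&` O n); first exact: openI.
apply/seteqP; split=> y.
  by move=> H; split=> [k kn|]; apply: H => //; exact: ltnW.
by move=> [H Oy] k; rewrite ltnS leq_eqVlt => /predU1P[->|/H].
Qed.

Lemma open_drop_set e m p th n P : open (drop_set e m p th n P).
Proof.
have [rP|nP] := pselect (forall j, reachable G e (P j)); last first.
  by rewrite (_ : drop_set _ _ _ _ _ _ = set0); [exact: open0|apply/seteqP; split=> y // -[]].
pose h k y := minor_sum p (X (n - k - m) (iter m f y) *m pert f A P m y *m X k (iter k fi y)).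
rewrite (_ : drop_set _ _ _ _ _ _ = [set y | forall k, (k < n.+1)%N ->
    [set y | (n <= 4 * k)%N -> (4 * k <= 3 * n)%N -> h k y < expR (n%:R * th)] y]).
  apply: open_finite_forall => k.
  have [c|nc] := boolP ((n <= 4 * k)%N && (4 * k <= 3 * n)%N); last first.
    rewrite (_ : [set y | _] = setT); first exact: openT.
    by apply/seteqP; split=> y // _ /= h1 h2; move: nc; rewrite h1 h2.
  have [c1 c2] := andP c.
  rewrite (_ : [set y | _] = h k @^-1` [set r : R | r < expR (n%:R * th)]); last first.
    by apply/seteqP; split=> y /=; [apply|move=> h1 _ _].
  have oD : open [set r : R | r < expR (n%:R * th)] by exact: open_lt.
  apply: (open_comp _ oD) => y _; suff : {for y, continuous (h k)} by [].
  apply: cont_at_minor_sum; apply: cont_at_mulmx; first apply: cont_at_mulmx.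
  - apply: (continuous_comp (f := iter m f) (g := X (n - k - m))).
      exact: (continuous_iter (n := m) (@homeo_fun_continuous M f)).
    exact: (continuous_cocycle_nat (f := f) cA).
  - exact: continuous_pert.
  - apply: (continuous_comp (f := iter k fi) (g := X k)).
      exact: (continuous_iter (n := k) (@homeo_inv_continuous M f)).
    exact: (continuous_cocycle_nat (f := f) cA).
apply/seteqP; split=> y; first by move=> [_ H] k _; exact: H.
move=> H; split=> // k h1 h2; apply: H => //; clear -h2; lia.
Qed.
End OpenDroppable.

(** * The drop of the integrated exponent *)

Section BoundedMax.
Context (dd : measure_display) (T : measurableType dd) (R : realType).

Lemma bmf_max (h k : T -> R) : bmf h -> bmf k -> bmf (fun x => Num.max (h x) (k x)).
Proof.
move=> bh bk; rewrite (_ : (fun x => _) = (fun x => 2^-1 * ((h x + k x) + `|h x - k x|))).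
  by apply: bmfZ; apply: bmfD; [exact: bmfD|apply: bmf_norm; exact: bmfB].
by apply/funext => x; rewrite maxr_absE mulrC.
Qed.

Lemma bmf_bigmax (I : Type) (r : seq I) (h : I -> T -> R) : (forall i, bmf (h i)) ->
  bmf (fun x => \big[Num.max/0]_(i <- r) h i x).
Proof.
move=> bh; elim: r => [|i r IH].
  by rewrite (_ : (fun x => _) = fun=> 0); [exact: bmf_cst|apply/funext => x; rewrite big_nil].
rewrite (_ : (fun x => _) = fun x => Num.max (h i x) (\big[Num.max/0]_(j <- r) h j x)); first exact: bmf_max.
by apply/funext => x; rewrite big_cons.
Qed.
End BoundedMax.

Section Perturbed.
#[local] Opaque exponent_sum.
Variables (R : realType) (d : nat) (M : ptopologicalType) (f : homeomorphism M) (A Q : M -> 'M[R]_d) (O : set M) (n m : nat).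
Variable ws : seq ((nat -> 'M[R]_d) * set M).
Hypotheses (mn : (m <= n)%N) (sep : forall r x, (0 < r <= 2 * n)%N -> union_of ws x -> ~ union_of ws (iter r f x)).
Hypotheses (QC : forall c x, List.In c (segments f m ws) -> c.2 x -> Q x = c.1) (QO : forall x, ~ O x -> Q x = 1%:M).
Let B x := A x *m Q x.
Local Notation XA := (cocycle_nat f A).
Local Notation XB := (cocycle_nat f B).

Lemma cocycle_off k a x : (forall i, (a <= i)%N -> (i < a + k)%N -> ~ O (iter i f x)) ->
  XB k (iter a f x) = XA k (iter a f x).
Proof.
elim: k => [//|k IH] H /=; rewrite IH; last by move=> i ai ik; apply: H => //; rewrite addnS ltnW.
rewrite /B QO ?mulmx1 // -iterD addnC; apply: H; first exact: leq_addr.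
by rewrite addnS.
Qed.

Lemma cocycle_pert w y l : List.In w ws -> w.2 y -> (l <= m)%N -> XB l y = pert f A w.1 l y.
Proof.
move=> wws wy; elim: l => [//|l IH] lm /=; rewrite IH; last exact: ltnW.
rewrite /B (QC (c := (w.1 l, iter l f @` w.2))) //; last by exists y.
by apply/segmentsP; exists w, l.
Qed.

(** Two hits of the modified region within one window belong to the same visit of the base, since
    the base is disjoint from its first 2 n iterates. *)
Lemma hit_unique x i0 i l0 l y0 y : (i0 < n)%N -> (i < n)%N -> (l0 < m)%N -> (l < m)%N ->
  union_of ws y0 -> union_of ws y -> iter i0 f x = iter l0 f y0 -> iter i f x = iter l f y ->
  (i + l0 = i0 + l)%N.
Proof.
move=> i0n iN l0m lm V0 V E0 E.
have EE : iter (i + l0) f y0 = iter (i0 + l) f y.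
  by rewrite !iterD -E0 -E -!iterD addnC.
have [b1 b2] : (i0 + l <= i + l0 + 2 * n)%N /\ (i + l0 <= i0 + l + 2 * n)%N by clear -i0n iN l0m lm mn; lia.
have [le|lt] := leqP (i + l0) (i0 + l).
  by have [] := separated_iter sep V0 V le b1 EE.
by have [] := separated_iter sep V V0 (ltnW lt) b2 (esym EE).
Qed.

Variable x : M.
Hypothesis good : forall i, (i < n)%N -> O (iter i f x) -> union_of (segments f m ws) (iter i f x).

Lemma hit i : (i < n)%N -> O (iter i f x) -> exists w l y,
  [/\ List.In w ws, (l < m)%N, w.2 y & iter i f x = iter l f y].
Proof.
move=> iN Oi; have [c /segmentsP[w [l [wws lm ->]]] /= [y wy E]] := good iN Oi.
by exists w, l, y; split.
Qed.

Lemma cocycle_split k l : (k + l <= n)%N ->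
  XB n x = XB (n - k - l) (iter (k + l) f x) *m XB l (iter k f x) *m XB k x.
Proof.
move=> kl; rewrite -mulmxA -[in XB k x](erefl : iter 0 f x = x) -cocycle_natD.
rewrite (_ : iter (k + l) f x = iter (l + k) f x); last by rewrite addnC.
by rewrite -cocycle_natD; congr (XB _ x); clear -kl; lia.
Qed.

Lemma cocycle_middle k w : (0 < m)%N -> (k + m <= n)%N -> List.In w ws -> w.2 (iter k f x) ->
  XB n x = XA (n - k - m) (iter m f (iter k f x)) *m pert f A w.1 m (iter k f x) *m XA k x.
Proof.
move=> m0 km wws wk; have kn : (k < n)%N by clear -m0 km; lia.
have Vk : union_of ws (iter k f x) by exists w.
rewrite (cocycle_split km) (cocycle_pert wws wk (leqnn m)); congr (_ *m _ *m _).
  rewrite cocycle_off; first by rewrite addnC iterD.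
  move=> i h1 h2 Oi; have iN : (i < n)%N by clear -h2 km; lia.
  have [v [l [y [vws lm vy E]]]] := hit iN Oi.
  have := hit_unique kn iN m0 lm Vk (ex_intro2 _ _ v vws vy) (erefl : iter k f x = iter 0 f _) E.
  by clear -h1 lm; lia.
rewrite -[XB k x]/(XB k (iter 0 f x)) cocycle_off // => i _ h2 Oi.
have iN : (i < n)%N by clear -h2 kn; lia.
have [v [l [y [vws lm vy E]]]] := hit iN Oi.
have := hit_unique kn iN m0 lm Vk (ex_intro2 _ _ v vws vy) (erefl : iter k f x = iter 0 f _) E.
by clear -h2; lia.
Qed.

(** At most one modified segment meets the window, so outside a stretch of length at most m the
    perturbed cocycle is the original one. Truncated subtraction and the minimum with n handle a
    segment cut by an end of the window. *)
Lemma cocycle_window : exists a b, [/\ (a <= b)%N, (b <= n)%N, (b <= a + m)%N,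
  XB a x = XA a x & XB (n - b) (iter b f x) = XA (n - b) (iter b f x)].
Proof.
have [[i0 [i0n O0]]|none] := pselect (exists i0, (i0 < n)%N /\ O (iter i0 f x)); last first.
  exists n, n; rewrite leqnn leq_addr subnn; split=> //.
  rewrite -[XB n x]/(XB n (iter 0 f x)) cocycle_off // => i _ iN Oi.
  by apply: none; exists i.
have [w [l0 [y0 [wws l0m wy0 E0]]]] := hit i0n O0.
have V0 : union_of ws y0 by exists w.
have [a [b [ab bn bam Ha Hb]]] : exists a b, [/\ (a <= b)%N, (b <= n)%N, (b <= a + m)%N,
   (forall i, (i < a)%N -> (i + l0 < i0)%N) & (forall i, (b <= i)%N -> (i < n)%N -> (i0 + m <= i + l0)%N)].
  exists (i0 - l0)%N, (minn n (i0 + m - l0))%N; clear -i0n l0m mn; split; try lia.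
exists a, b; split=> //.
  rewrite -[XB a x]/(XB a (iter 0 f x)) cocycle_off // => i _ ia Oi.
  have iN : (i < n)%N by clear -ia ab bn; lia.
  have [v [l [y [vws lm vy E]]]] := hit iN Oi.
  have := hit_unique i0n iN l0m lm V0 (ex_intro2 _ _ v vws vy) E0 E.
  by have := Ha i ia; clear; lia.
apply: cocycle_off => i bi ib Oi.
have iN : (i < n)%N by clear -ib bn; lia.
have [v [l [y [vws lm vy E]]]] := hit iN Oi.
have := hit_unique i0n iN l0m lm V0 (ex_intro2 _ _ v vws vy) E0 E.
by have := Hb i bi iN; clear -lm; lia.
Qed.
End Perturbed.

(** The visits contribute g ka / 24, and 1/24 - 3/200 > 1/48 leaves room for the three errors. *)
Lemma drop_integral_arith (R : realFieldType) (lb la mB n g ka s C c ex m bad : R) :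
  0 < n -> 0 < g -> 0 < ka -> 0 <= C -> 0 <= c -> n * lb <= mB ->
  mB <= n * la + 2 * n * ex + C * m - n * g * s + n * c * bad ->
  ka <= 24 * s -> 2 * ex <= g * ka / 200 -> C * m <= n * (g * ka / 200) -> c * bad <= g * ka / 200 ->
  lb <= la - g * ka / 48.
Proof.
move=> n0 g0 ka0 C0 c0 h1 h2 h3 h4 h5 h6.
rewrite -(ler_pM2l n0); apply: le_trans h1 (le_trans h2 _).
have k1 : n * g * ka <= n * g * (24 * s) by rewrite ler_wpM2l // mulr_ge0 // ltW.
have k2 : n * (2 * ex) <= n * (g * ka / 200) by rewrite ler_wpM2l // ltW.
have k3 : n * (c * bad) <= n * (g * ka / 200) by rewrite ler_wpM2l // ltW.
have k4 : 0 <= n * (g * ka) by rewrite !mulr_ge0 // ltW.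
by lra.
Qed.

Lemma drop_bad_arith (R : realFieldType) (l n Lx ex C1 C0 g m v ne : R) : 0 <= n -> 0 <= m -> 0 <= ne ->
  l <= C0 * n -> - C1 <= Lx -> v <= 1 -> 0 <= ex -> 0 < g -> 0 <= C1 -> 0 <= C0 ->
  l <= n * Lx + 2 * ne * ex + (C0 + C1) * m - n * g * v + n * (C0 + C1 + g).
Proof.
move=> n0 m0 ne0 h1 h2 h3 h4 h5 h6 h7.
have k1 : n * - C1 <= n * Lx by rewrite ler_wpM2l.
have k2 : n * g * v <= n * g by rewrite ler_piMr // mulr_ge0 // ltW.
have k3 : 0 <= 2 * ne * ex by rewrite !mulr_ge0.
have k4 : 0 <= (C0 + C1) * m by rewrite mulr_ge0 // addr_ge0.
by lra.
Qed.

Lemma drop_good_arith (R : realFieldType) (l n b g Lx ex C1 C0 m ne : R) : 0 <= n -> 0 <= m -> 0 <= ne ->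
  l <= n * (b - g) -> b <= Lx -> 0 <= ex -> 0 <= C1 -> 0 <= C0 ->
  l <= n * Lx + 2 * ne * ex + (C0 + C1) * m - n * g.
Proof.
move=> n0 m0 ne0 h1 h2 h3 h4 h5.
have k1 : n * b <= n * Lx by rewrite ler_wpM2l.
have k3 : 0 <= 2 * ne * ex by rewrite !mulr_ge0.
have k4 : 0 <= (C0 + C1) * m by rewrite mulr_ge0 // addr_ge0.
by lra.
Qed.

Lemma drop_window_arith (R : realFieldType) (l l1 l2 l3 l4 n n1 n2 n3 Lx ex C1 C0 m ne : R) :
  0 <= n2 -> l <= l1 + l2 -> l1 <= l3 + l4 -> l4 <= C0 * n2 -> l3 <= n3 * Lx + ne * ex ->
  l2 <= n1 * Lx + ne * ex -> n2 <= m -> n = n1 + n2 + n3 -> - C1 <= Lx -> 0 <= C1 -> 0 <= C0 ->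
  l <= n * Lx + 2 * ne * ex + (C0 + C1) * m.
Proof.
move=> n20 h1 h2 h3 h4 h5 h6 -> h7 h8 h9.
have k1 : n2 * - C1 <= n2 * Lx by rewrite ler_wpM2l.
have k2 : (C0 + C1) * n2 <= (C0 + C1) * m by rewrite ler_wpM2l // addr_ge0.
by lra.
Qed.

Lemma quarter_arith (R : realFieldType) (x a : R) : x <= a / 800 -> 2 * (2 * x) <= a / 200.
Proof. by move=> h; lra. Qed.

Lemma level_arith (R : realFieldType) (b g l gap : R) : l < b + g -> 16 * g <= gap -> l - gap / 8 <= b - g.
Proof. by move=> h1 h2; lra. Qed.

Section IntegralDrop.
#[local] Opaque exponent_sum mean.
Variables (R : realType) (d : nat) (M : ptopologicalType) (mu : probability (borel M) R) (f : homeomorphism M).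
Hypotheses (M_compact : compact [set: M]) (M_hausdorff : hausdorff_space M).
Hypotheses (mu_regular : borel_regular mu) (mu_invariant : preserves mu f).
Local Notation S := (borel M).
Local Notation bmS := (@bmf _ S R).
Local Notation pr := (pr mu).
Variable A : M -> 'M[R]_d.
Hypotheses (cA : continuous A) (uA : forall x, A x \in unitmx).
Variable G : set 'M[R]_d.
Hypotheses (HG : closed_subgroup_GL G) (GA : forall x, G (A x)).

Section Index.
Variable p : nat.
Hypothesis pd : (p <= d)%N.
Local Notation L := (exponent_sum f A p).

(** The largest overshoot of the log minors of A over their expected value, on stretches of length
    at most n starting in the window, per unit of window length. By [reg_up] it tends to 0 almost
    everywhere, so its mean does too. *)
Definition excess n (x : M) : R := \big[Num.max/0]_(a < n.+1) \big[Num.max/0]_(k < n.+1)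
  ((n.+1%:R)^-1 * (log_minor f A p k (iter a f x) - k%:R * L x)).

Lemma excess_bound n a k x : (a <= n)%N -> (k <= n)%N ->
  log_minor f A p k (iter a f x) <= k%:R * L x + n.+1%:R * excess n x.
Proof.
move=> an kn; rewrite -lerBlDl -ler_pdivrMl ?ltr0n //.
have h1 := le_bigmax 0 (fun a : 'I_n.+1 => \big[Num.max/0]_(k < n.+1)
  ((n.+1%:R)^-1 * (log_minor f A p k (iter a f x) - k%:R * L x))) (Ordinal (an : (a < n.+1)%N)).
apply: le_trans h1.
exact: (le_bigmax 0 (fun k : 'I_n.+1 =>
  ((n.+1%:R)^-1 * (log_minor f A p k (iter a f x) - k%:R * L x))) (Ordinal (kn : (k < n.+1)%N))).
Qed.

Lemma excess_ge0 n x : 0 <= excess n x.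
Proof. exact: bigmax_ge_id. Qed.

Lemma excess_le n x (c : R) : 0 <= c -> (forall a k, (a <= n)%N -> (k <= n)%N ->
  log_minor f A p k (iter a f x) - k%:R * L x <= c * n.+1%:R) -> excess n x <= c.
Proof.
move=> c0 H; apply: bigmax_le => // a _; apply: bigmax_le => // k _.
by rewrite ler_pdivrMl ?ltr0n // [leRHS]mulrC; apply: H; rewrite -ltnS.
Qed.

Lemma bmf_excess n : bmS (excess n).
Proof.
apply: bmf_bigmax => a; apply: bmf_bigmax => k; apply: bmfZ; apply: bmfB; last first.
  by apply: bmfZ; exact: (bmf_exponent_sum f M_compact cA uA pd).
apply: bmf_comp; last exact: (bmf_log_minor f M_compact cA uA _ pd).
exact: (continuous_measurable_self (continuous_iter (n := a) (@homeo_fun_continuous M f))).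
Qed.

Lemma excess_small (e : R) : 0 < e -> exists n0, forall n, (n0 <= n)%N -> mean mu (excess n) <= e.
Proof.
move=> e0; have [C C0 [gC _ _]] := log_minor_step f M_compact cA uA pd.
have [_ [C' LC]] := bmf_exponent_sum f M_compact cA uA pd.
have [|n x||n0 Hn0] := @mean_small_ae _ S R mu excess (C + C') e _ _ _ e0.
- by move=> n; have [] := bmf_excess n.
- rewrite ger0_norm ?excess_ge0 //; apply: excess_le => [|a k an kn]; first by rewrite addr_ge0 // (le_trans _ (LC x)).
  have kn' : k%:R <= n.+1%:R :> R by rewrite ler_nat leqW.
  apply: le_trans (ler_norm _) (le_trans (ler_normB _ _) _); rewrite normrM normr_nat.
  apply: (@le_trans _ _ (C * k%:R + k%:R * C')); first by rewrite lerD // ler_wpM2l.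
  have C'0 : 0 <= C' by apply: le_trans (LC x).
  by rewrite mulrDl [k%:R * C']mulrC lerD // ler_wpM2l.
- apply: (ae_imp _ (ae_regular M_compact mu_invariant cA uA)) => x reg a a0.
  have [n0 Hn0] := reg_up reg pd a0; exists n0 => n nn.
  have [H _] := Hn0 n nn.
  rewrite ger0_norm ?excess_ge0 //; apply: excess_le => [|i k ni kn]; first exact: ltW.
  case: k kn => [|k] kn; first by rewrite /= mul0r subr0 mulr_ge0 // ltW.
  have ik : (i + k.+1 <= 4 * n)%N by clear -ni kn; lia.
  have pos : 0 < minor_sum p (cocycle_nat f A k.+1 (iter i f x)).
    by apply: minor_sum_gt0 => //; exact: cocycle_nat_unit.
  have := H i k.+1 isT ik; rewrite -ler_ln ?posrE ?expR_gt0 // expRK.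
  rewrite -[ln _]/(log_minor f A p k.+1 (iter i f x)) => h.
  have : a * n%:R <= a * n.+1%:R by rewrite ler_wpM2l ?(ltW a0) // ler_nat.
  by lra.
exists n0 => n /Hn0; rewrite (_ : (fun x => _) = excess n) //.
by apply/funext => x; rewrite ger0_norm ?excess_ge0.
Qed.

Lemma close_log_minor : exists2 C : R, 0 <= C & exists2 dl : R, 0 < dl &
  forall B : M -> 'M[R]_d, (forall x, B x \in unitmx) -> close A B dl ->
  forall n x, log_minor f B p n x <= C * n%:R.
Proof.
have [C C0 HC] := log_minor_bound M_compact cA uA pd.
have c1 x : {for A x, continuous (fun Z : 'M[R]_d => ln (minor_sum p Z))}.
  apply: cont_at_ln; first exact: minor_sum_gt0.
  exact: (cont_at_minor_sum (F := fun Y : 'M[R]_d => Y)).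
have [dl dl0 H] := uniform_continuity (V := R^o) M_compact cA c1 ltr01.
exists (C + 1); first by rewrite addr_ge0.
exists dl => // B uB clB; elim=> [|n IH] x; first by rewrite /= mulr0.
have h1 := log_minorD f uB 1 n x pd; rewrite add1n in h1.
have h2 : log_minor f B p 1 (iter n f x) <= C + 1.
  rewrite /= mulmx1; have [k1 _] := HC (iter n f x).
  by have := H (iter n f x) (B (iter n f x)) (clB _); rewrite ler_distl => /andP[_]; lra.
by rewrite -natr1 mulrDr mulr1; apply: le_trans h1 _; apply: lerD.
Qed.

Local Notation V ws := (union_of (ws : seq ((nat -> 'M[R]_d) * set M))).

(** Used with j = 2 N: the times N to 3 N are the middle half of a window of length 4 N, where a
    visit to the base yields a drop. *)
Definition visit (W : set M) N j : set M := [set x | exists2 k, (N <= k)%N && (k <= N + j)%N & W (iter k f x)].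

Lemma visitS W N j : visit W N j.+1 = visit W N j `|` iter (N + j.+1) f @^-1` W.
Proof.
apply/seteqP; split=> x.
  move=> [k /andP[Nk]]; rewrite leq_eqVlt => /predU1P[->|kj] Wk; first by right.
  by left; exists k => //; rewrite Nk /=; move: kj; rewrite addnS ltnS.
move=> [[k /andP[Nk kj] Wk]|Wx]; first by exists k => //; rewrite Nk addnS leqW.
by exists (N + j.+1)%N => //; rewrite leq_addr leqnn.
Qed.

Lemma visit0 W N : visit W N 0 = iter N f @^-1` W.
Proof.
apply/seteqP; split=> x; last by move=> Wx; exists N => //; rewrite leqnn addn0 leqnn.
by move=> [k]; rewrite addn0 -eqn_leq => /eqP ->.
Qed.

Lemma measurable_visit W N j : measurable (W : set S) -> measurable (visit W N j : set S).
Proof.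
move=> mW; elim: j => [|j IH]; first by rewrite visit0; exact: measurable_iter.
by rewrite visitS; apply: measurableU => //; exact: measurable_iter.
Qed.

Lemma pr_visit W N j h : measurable (W : set S) -> (j <= h)%N ->
  (forall r x, (0 < r <= h)%N -> W x -> ~ W (iter r f x)) -> pr (visit W N j) = j.+1%:R * pr W.
Proof.
move=> mW jh sep; elim: j jh => [|j IH] jh; first by rewrite visit0 mul1r (pr_iter mu_invariant).
rewrite visitS (pr_setUd mu (measurable_visit _ _ mW) (measurable_iter f _ mW)); last first.
  apply/seteqP; split=> x // -[[k /andP[Nk kj] Wk] Wx].
  have [h1 h2] : (0 < N + j.+1 - k <= h)%N /\ (N + j.+1 = (N + j.+1 - k) + k)%N.
    by clear -Nk kj jh; lia.
  by apply: (sep _ _ h1 Wk); rewrite -iterD -h2.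
by rewrite IH ?(ltnW jh) // (pr_iter mu_invariant) // -[j.+2%:R]natr1 mulrDl mul1r.
Qed.

Variables (e C0 dl0 : R) (m : nat) (b g ka : R) (Z : set M).
Let E N : set M := (droppable f A G e m p (b - g) (4 * N) `&` [set x | b <= L x]) `&` aperiodic f.
Hypotheses (e0 : 0 < e) (m0 : (0 < m)%N) (C00 : 0 <= C0) (g0 : 0 < g) (ka0 : 0 < ka).
Hypothesis HC0 : forall B : M -> 'M[R]_d, (forall x, B x \in unitmx) -> close A B dl0 ->
  forall n x, log_minor f B p n x <= C0 * n%:R.
Hypotheses (small_e : forall x, mnorm (A x) * e <= dl0) (mZ : measurable (Z : set S)) (kaZ : ka <= pr Z).
Variable N0 : nat.
Hypothesis HZ : forall N, (N0 <= N)%N -> Z `<=` within f (8 * N) (E N).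

Lemma measurable_drop_level N : measurable (E N : set S).
Proof.
apply: measurableI; last exact: measurable_aperiodic.
apply: measurableI.
  apply: sub_sigma_algebra; rewrite droppableE.
  by apply: bigcup_open => P _; exact: open_drop_set.
have [mL _] := bmf_exponent_sum f M_compact cA uA pd.
rewrite (_ : [set x | _] = setT `&` L @^-1` [set` `[b, +oo[]); first exact: mL.
by apply/seteqP; split=> x /=; rewrite in_itv /= andbT; [split|case].
Qed.

Lemma exponent_sum_iter k x : L (iter k f x) = L x.
Proof.
elim: k => [//|k IH]; rewrite iterS -IH.
by have := exponent_sum_inv f M_compact cA uA (iter k f x) pd.
Qed.

(** A window meeting the transition region D gets the crude bound; one whose middle visits the base
    gets the drop; any other differs from the unperturbed one on at most m steps, and the two
    unperturbed stretches account for twice the excess. *)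
Lemma drop_pointwise C1 N Q O ws : (m <= N)%N -> (forall x, `|L x| <= C1) ->
  (forall w, List.In w ws -> w.2 `<=` drop_set f A G e m p (b - g) (4 * N) w.1 `&` E N) ->
  (forall r x, (0 < r <= 8 * N)%N -> V ws x -> ~ V ws (iter r f x)) ->
  (forall x, Q x \in unitmx) -> (forall x, mnorm (Q x - 1%:M) <= e) ->
  (forall c x, List.In c (segments f m ws) -> c.2 x -> Q x = c.1) ->
  (forall x, ~ O x -> Q x = 1%:M) ->
  let B x := A x *m Q x in let D := O `\` union_of (segments f m ws) in
  forall x, log_minor f B p (4 * N) x <= (4 * N)%:R * L x + 2 * (4 * N).+1%:R * excess (4 * N) x +
    (C0 + C1) * m%:R - (4 * N)%:R * g * \1_(visit (V ws) N (2 * N)) x +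
    (4 * N)%:R * (C0 + C1 + g) * \1_(within f (4 * N) D) x.
Proof.
move=> mN LC Hws sep uQ eQ QC QO B D x; set n := (4 * N)%N.
have C10 : 0 <= C1 by apply: le_trans (LC x).
have uB y : B y \in unitmx by rewrite unitmx_mul uA uQ.
have clB : close A B dl0.
  move=> y; have -> : B y - A y = A y *m (Q y - 1%:M) by rewrite mulmxBr mulmx1.
  apply: le_trans (norm_le_mnorm _) (le_trans (mnormM _ _) (le_trans _ (small_e y))).
  by rewrite ler_wpM2l // mnorm_ge0.
have HB := HC0 uB clB; have LL := LC x; rewrite ler_norml in LL; have [L1 L2] := andP LL.
have ex0 := excess_ge0 n x; have n0 : 0 <= n%:R :> R by [].
have v1 : \1_(visit (V ws) N (2 * N)) x <= 1 :> R.
  by rewrite indicE; case: (x \in _); rewrite ?lexx ?ler01.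
have [bad|nbad] := pselect (within f n D x).
  rewrite [X in _ <= _ + _ * X]indicE mem_set // mulr1.
  exact: drop_bad_arith n0 (ler0n _ m) (ler0n _ n.+1) (HB n x) L1 v1 ex0 g0 C10 C00.
rewrite [X in _ <= _ + _ * X]indicE memNset // mulr0 addr0.
have good i : (i < n)%N -> O (iter i f x) -> union_of (segments f m ws) (iter i f x).
  move=> iN Oi; apply: contrapT => nU; apply: nbad; exists i; first exact: ltnW.
  by split.
have mn : (m <= n)%N by rewrite /n; clear -mN; lia.
have sep' r y : (0 < r <= 2 * n)%N -> V ws y -> ~ V ws (iter r f y).
  by move=> h; apply: sep; rewrite /n in h; clear -h; lia.
have [[k /andP[Nk kN] [w wws wk]]|nv] := pselect (visit (V ws) N (2 * N) x).
  rewrite indicE mem_set; last by exists k; [rewrite Nk|exists w].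
  rewrite mulr1.
  have [km k4 k4'] : [/\ (k + m <= n)%N, (n <= 4 * k)%N & (4 * k <= 3 * n)%N].
    by rewrite /n; clear -Nk kN mN; split; lia.
  have [[_ Hdrop] [[_ bL] _]] := Hws w wws _ wk.
  have kE : iter k (homeo_inv f) (iter k f x) = x by rewrite iter_homeoK.
  have := Hdrop k k4 k4'; rewrite kE -(cocycle_middle A mn sep' QC QO good m0 km wws wk) => lt.
  have pos : 0 < minor_sum p (cocycle_nat f B n x) by apply: minor_sum_gt0 => //; exact: cocycle_nat_unit.
  have lnB : log_minor f B p n x <= n%:R * (b - g).
    have -> : log_minor f B p n x = ln (minor_sum p (cocycle_nat f B n x)).
      by rewrite /n; case: (N) m0 mN => [|N'] //; rewrite leqn0 => /lt0n_neq0/negbTE ->.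
    by rewrite -[leRHS]expRK ler_ln ?posrE ?expR_gt0 // ltW.
  have LxE : L (iter k f x) = L x.
    exact: exponent_sum_iter.
  rewrite /= LxE in bL.
  exact: drop_good_arith n0 (ler0n _ m) (ler0n _ n.+1) lnB bL ex0 C10 C00.
rewrite indicE memNset // mulr0 subr0.
have [a [c [ac cn cam Ea Ec]]] := cocycle_window A mn sep' QO good.
have nE : n = ((n - c) + ((c - a) + a))%N by rewrite (subnK ac) subnK.
have h1 := log_minorD f uB (n - c) ((c - a) + a) x pd; rewrite -nE in h1.
have h2 := log_minorD f uB (c - a) a x pd.
rewrite (subnK ac) in h1 h2.
have g1 : log_minor f B p a x = log_minor f A p a (iter 0 f x) by rewrite /log_minor; case: (a) Ea => // a' ->.
have g2 : log_minor f B p (n - c) (iter c f x) = log_minor f A p (n - c) (iter c f x).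
  by rewrite /log_minor; case: (n - c)%N Ec => // q ->.
have h3 := HB (c - a)%N (iter a f x).
have b1 := excess_bound x (leq0n n) (leq_trans ac cn).
have b2 := excess_bound x cn (leq_subr c n).
rewrite g1 in h2; rewrite g2 in h1.
have cam' : (c - a)%:R <= m%:R :> R by rewrite ler_nat leq_subLR.
have nR : n%:R = (n - c)%:R + (c - a)%:R + a%:R :> R by rewrite -!natrD -addnA -nE.
exact: drop_window_arith (ler0n _ (c - a)) h1 h2 h3 b1 b2 cam' nR L1 C10 C00.
Qed.
Lemma integral_drop : exists B : M -> 'M[R]_d, [/\ continuous B, (forall x, G (B x)),
  (forall x, `|B x - A x| <= mnorm (A x) * e) &
  mean mu (exponent_sum f B p) <= mean mu L - g * ka / 48].
Proof.
have bL := bmf_exponent_sum f M_compact cA uA pd.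
have [_ [C1 LC]] := bL; have C10 : 0 <= C1 by apply: le_trans (LC point).
have gk : 0 < g * ka by rewrite mulr_gt0.
have [n1 Hn1] := excess_small (divr_gt0 gk (ltr0n R 800)).
have [n2 Hn2] := archi_le ((C0 + C1) * m%:R) (divr_gt0 gk (ltr0n R 200)).
pose N := maxn N0 (maxn m (maxn n1 n2)); pose n := (4 * N)%N.
have [NN0 mN n1n n2n N_gt0] : [/\ (N0 <= N)%N, (m <= N)%N, (n1 <= n)%N, (n2 <= n)%N & (0 < N)%N].
  by rewrite /n /N; clear -m0; split; lia.
have mE := measurable_drop_level N.
have EU : E N `<=` \bigcup_P drop_set f A G e m p (b - g) (4 * N) P.
  by move=> x [[Dx _] _]; rewrite -droppableE.
have Eap : E N `<=` aperiodic f by move=> x [].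
have [ws [Hws dis sep kaV]] := tower M_hausdorff mu_regular mu_invariant (fun=> 1%:M)
  (open_drop_set f cA G e m p (b - g) (4 * N)) mE mZ EU Eap (HZ NN0) ka0 kaZ.
have mh : (m <= 8 * N)%N by clear -mN; lia.
have dseg := segments_disjoint mh dis sep.
have cseg := @segments_compact R d M f m ws G e.
have {}cseg : forall c, List.In c (segments f m ws) -> compact c.2 /\ (c.2 !=set0 -> reachable G e c.1).
  apply: cseg => w /Hws[cw wU]; split=> // -[x wx] j.
  by have [[h _] _] := wU x wx.
pose Cu := union_of (segments f m ws).
have clC : closed Cu by apply: (closed_union_of M_hausdorff) => c /cseg[].
have mC : measurable (Cu : set S).
  by rewrite -[X in measurable X]setCK; apply: measurableC; apply: sub_sigma_algebra; exact: closed_openC.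
pose c4 := C0 + C1 + g; have c40 : 0 < c4 by rewrite ltr_wpDl // addr_ge0.
(* Chosen so that the windows meeting D contribute at most g ka / 200 to the mean, per unit of
   window length. *)
have eta0 : 0 < g * ka / 200 / (c4 * n.+1%:R) by rewrite divr_gt0 ?divr_gt0 // mulr_gt0.
have [W [oW CW prW]] := outer_open mu_regular mC eta0.
have mW : measurable (W : set S) by exact: sub_sigma_algebra.
pose D := W `\` Cu; have mD : measurable (D : set S) by exact: measurableD.
have prD : pr D <= g * ka / 200 / (c4 * n.+1%:R).
  have := pr_setUd mu mC mD; rewrite setDUK // setDIK => /(_ erefl) prE.
  by rewrite prE lerD2l in prW.
have [Q [cQ GQ QC QO]] := multiplier M_compact M_hausdorff HG (ltW e0) cseg dseg oW CW.
have uQ x : Q x \in unitmx by have [Gx _] := GQ x; have := subgroup_unit HG Gx.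
pose B x := A x *m Q x.
have cB : continuous B by move=> x; apply: cont_at_mulmx; [exact: cA|exact: cQ].
have uB x : B x \in unitmx by rewrite unitmx_mul uA uQ.
exists B; split=> //.
- by move=> x; apply: subgroupM => //; have [] := GQ x.
- move=> x; have -> : B x - A x = A x *m (Q x - 1%:M) by rewrite mulmxBr mulmx1.
  apply: le_trans (norm_le_mnorm _) (le_trans (mnormM _ _) _).
  by rewrite ler_wpM2l ?mnorm_ge0 //; have [] := GQ x.
have eQ x : mnorm (Q x - 1%:M) <= e by have [] := GQ x.
have Hws' w : List.In w ws -> w.2 `<=` drop_set f A G e m p (b - g) (4 * N) w.1 `&` E N by move=> /Hws[].
have pw := @drop_pointwise C1 N Q W ws mN LC Hws' sep uQ eQ QC QO.
have mV : measurable (union_of ws : set S).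
  by apply: measurable_union_of => w /Hws[/(compact_measurable M_hausdorff)].
have mvis := measurable_visit N (2 * N) mV; have mbad := measurable_within f n mD.
set vis := visit _ _ _ in mvis pw; set bad := within f n D in mbad.
have bex := bmf_excess n.
have bvis : bmS (\1_vis) by exact: bmf_indic.
have bbad : bmS (\1_bad) by exact: bmf_indic.
have b1 := bmfZ n%:R bL; have b2 := bmfZ (2 * n.+1%:R) bex; have b3 := bmfZ (n%:R * g) bvis.
have b4 := bmfZ (n%:R * (C0 + C1 + g)) bbad.
have b5 := @bmf_cst _ S R ((C0 + C1) * m%:R).
have b12 := bmfD b1 b2; have b125 := bmfD b12 b5; have b1253 := bmfB b125 b3.
have bB := bmf_log_minor f M_compact cB uB n pd.
have mle := mean_le mu bB (bmfD b1253 b4) pw.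
rewrite (meanD mu b1253 b4) (meanB mu b125 b3) (meanD mu b12 b5) (meanD mu b1 b2) in mle.
rewrite (meanZ mu _ bL) (meanZ mu _ bex) (meanZ mu _ bvis) (meanZ mu _ bbad) mean_cst in mle.
rewrite !mean_indic // -/(pr vis) -/(pr bad) in mle.
have n_gt0 : 0 < n%:R :> R by rewrite ltr0n /n muln_gt0.
have mge := mean_log_minor_ge M_compact mu_invariant cB uB n pd.
have ex1 : mean mu (excess n) <= g * ka / 800 by exact: Hn1.
have ex0 : 0 <= mean mu (excess n).
  rewrite -[leLHS](@mean_cst _ S R mu 0); apply: mean_le => // [|x]; first exact: bmf_cst.
  exact: excess_ge0.
(* For height 8 N the tower gives ka <= 2 (24 N + 1) times the measure of the base, while the visits
   occupy 2 N + 1 disjoint copies of it. *)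
have kaS : ka <= 24 * pr vis.
  have jh : (2 * N <= 8 * N)%N by rewrite leq_mul2r orbT.
  rewrite /vis (pr_visit N mV jh sep); apply: le_trans kaV _.
  rewrite mulrA ler_wpM2r ?pr_ge0 // -!natrM ler_nat; clear; lia.
have badS : c4 * pr bad <= g * ka / 200.
  have := le_trans (pr_within mu_invariant n mD) (ler_wpM2l (ler0n R n.+1) prD).
  rewrite -(ler_pM2l c40) => h; apply: le_trans h _; apply: eq_ler.
  by rewrite mulrA [LHS]mulrC divfK // gt_eqF // mulr_gt0.
apply: (@drop_integral_arith R _ _ (mean mu (log_minor f B p n)) n%:R g ka (pr vis) (C0 + C1) c4
  (2 * mean mu (excess n)) m%:R (pr bad)) => //.
- by rewrite addr_ge0.
- exact: ltW.
- apply: le_trans mle _; rewrite -/c4 -!addrA lerD2l lerD2r.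
  have : 1 <= n%:R :> R by rewrite ler1n /n muln_gt0.
  rewrite (_ : 2 * n%:R * (2 * _) = 2 * (2 * n%:R) * mean mu (excess n)); last by ring.
  by move=> n1'; rewrite ler_wpM2r // ler_wpM2l // -natr1; lra.
- exact: quarter_arith ex1.
- by rewrite [leRHS]mulrC; exact: Hn2.
Qed.
End Index.

Hypotheses (d_gt0 : (0 < d)%N) (G_transitive : projectively_transitive G).
Local Notation L := (exponent_sum f A).

Lemma droppable_mono e m p (a b : R) n y : a <= b -> droppable f A G e m p a n y -> droppable f A G e m p b n y.
Proof.
move=> ab [P [HP H]]; exists P; split=> // k h1 h2; apply: lt_le_trans (H k h1 h2) _.
by rewrite ler_expR ler_wpM2l.
Qed.

Lemma aperiodic_orbit x y : aperiodic f x -> orbitz f x y -> aperiodic f y.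
Proof.
move=> ax oy r r0 E; apply: (ax r r0).
have := orbit_ind (h := fun z => iter r f z = z) (x := x) _ oy => <- // z _.
apply/propext; rewrite -iterSr iterS; split=> [|->//].
by move/(congr1 (homeo_inv f)); rewrite !homeo_funK.
Qed.

Lemma around_mono h h' (V V' : set M) : (h <= h')%N -> V `<=` V' -> around f h V `<=` around f h' V'.
Proof.
move=> hh VV x [r rh Hr]; exists r; first exact: leq_trans hh.
by case: Hr => /VV; [left|right].
Qed.

(** A quantitative level of failure of domination: [L p x] lies in a band of width g and the gap is
    at least 16 g, so lowering the rate by gap / 8 brings it below b - g throughout the band. *)
Definition bad_at p (b g : R) (x : M) : Prop := [/\ aperiodic f x, b <= L p x, L p x < b + g,
  16 * g <= lam f A p.-1 x - lam f A p x &
  forall (e : R) m, (forall y v u, v != 0 -> u != 0 ->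
      2^-1 * (enorm (cocycle_nat f A m y *m v) * enorm u) < enorm (cocycle_nat f A m y *m u) * enorm v ->
      exists P, (forall j, reachable G e (P j)) /\
      exists2 c : R, c != 0 & pert f A P m y *m v = c *: (cocycle_nat f A m y *m u)) ->
    exists2 y, orbitz f x y & exists n0, forall n, (n0 <= n)%N ->
      droppable f A G e m p (L p x - (lam f A p.-1 x - lam f A p x) / 8) n y].

Lemma nonneg_floor (x g : R) : 0 < g -> exists z : int, z%:~R * g <= x /\ x < z%:~R * g + g.
Proof.
move=> g0; exists (Num.floor (x / g)).
have h1 : (Num.floor (x / g))%:~R <= x / g by exact: floor_le_tmp.
have h2 : x / g < (Num.floor (x / g) + 1)%:~R by exact: lt_succ_floor.
by move: h1 h2; rewrite ler_pdivlMr // ltr_pdivrMr // intrD mulrDl mul1r.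
Qed.

(** Countably many triples, an index p, a width 1 / (i + 1) and an integer multiple of that width,
    exhaust almost all points without domination; hence one level is not negligible. *)
Lemma bad_level : ~ {ae mu, forall x, dominated_or_trivial f A x} ->
  exists p b g, [/\ (0 < p)%N, (p < d)%N, 0 < g & ~ {ae mu, forall x, ~ bad_at p b g x}].
Proof.
move=> nae; apply: contrapT => H; apply: nae.
pose lev (t : nat * nat * int) x := [/\ (0 < t.1.1)%N, (t.1.1 < d)%N &
  bad_at t.1.1 (t.2%:~R * (t.1.2.+1%:R^-1)) (t.1.2.+1%:R^-1) x].
have ae1 : {ae mu, forall x, forall n t, unpickle n = Some t -> ~ lev t x}.
  apply: ae_all_nat => n; case E : (unpickle n : option (nat * nat * int)) => [t|]; last first.
    by apply: (ae_imp (P := fun=> True)) => //; exact: aeW.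
  have [[p0 pd]|np] := pselect ((0 < t.1.1)%N /\ (t.1.1 < d)%N); last first.
    apply: (ae_imp (P := fun=> True)); last exact: aeW.
    by move=> x _ _ [<-] [h1 h2 _]; apply: np.
  have : {ae mu, forall x, ~ bad_at t.1.1 (t.2%:~R * (t.1.2.+1%:R^-1)) (t.1.2.+1%:R^-1) x}.
    apply: contrapT => nb; apply: H; exists t.1.1, (t.2%:~R * (t.1.2.+1%:R^-1)), (t.1.2.+1%:R^-1).
    by split=> //; rewrite invr_gt0.
  by apply: ae_imp => x nb _ [<-] [_ _ /nb].
apply: (ae_imp2 _ ae1 (ae_orbit_regular M_compact mu_invariant cA uA)) => x nlev reg.
left; apply: contrapT => nd.
have [p [p0 pd gap Hp]] := bad_point M_compact cA uA HG reg nd.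
have gap0 : 0 < lam f A p.-1 x - lam f A p x by rewrite subr_gt0.
have [i Hi] := archi_le 16 gap0.
have {}Hi : 16 * i.+1%:R^-1 <= lam f A p.-1 x - lam f A p x.
  by rewrite ler_pdivrMr ?ltr0n //; apply: Hi; exact: leqnSn.
have [z [z1 z2]] := nonneg_floor (L p x) (ltac:(by rewrite invr_gt0) : 0 < i.+1%:R^-1 :> R).
apply: (nlev (pickle (p, i, z)) (p, i, z)); first by rewrite pickleK.
split=> //=; split=> // r r0.
have := aperiodic_of_not_dominated uA reg nd r0; exact.
Qed.

Lemma large_stage (F : nat -> set M) (ka : R) : (forall i, measurable (F i : set S)) ->
  (forall i, F i `<=` F i.+1) -> 0 < ka -> ka <= pr (\bigcup_i F i) -> exists i, ka / 2 <= pr (F i).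
Proof.
move=> mF Fmono ka0 kaF; have mU : measurable (\bigcup_i F i : set S) by exact: bigcupT_measurable.
have nd : nondecreasing_seq (F : nat -> set S).
  by apply/nondecreasing_seqP => n; apply/subsetPset; exact: Fmono.
have := nondecreasing_cvg_mu mF mU nd (mu := mu).
move=> cv.
apply: contrapT => H; have lt i : pr (F i) <= ka / 2.
  by rewrite leNgt; apply/negP => h; apply: H; exists i; exact: ltW.
have h : (mu (\bigcup_i (F i : set S)) <= (ka / 2)%:E)%E.
  move/cvg_lim: (cv) => <- //; apply: lime_le; first by apply/cvg_ex; eexists; exact: cv.
  by apply: nearW => i /=; have := prE mu (mF i) => ->; rewrite lee_fin.
have : ((pr (\bigcup_i F i))%:E <= (ka / 2)%:E)%E by rewrite -(prE mu mU); exact: h.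
by rewrite lee_fin; lra.
Qed.

(** The bad points need not form a measurable set. Om is a measurable set containing them, built
    from all perturbation sizes at once; its measure, and with it tau, is therefore fixed before e
    is given. *)
Lemma not_dominated_drop : ~ {ae mu, forall x, dominated_or_trivial f A x} ->
  exists p tau, [/\ (0 < p)%N, (p < d)%N, 0 < tau &
  forall e : R, 0 < e -> exists B : M -> 'M[R]_d, [/\ continuous B, (forall x, G (B x)), close A B e &
    mean mu (exponent_sum f B p) <= mean mu (L p) - tau]].
Proof.
move=> /bad_level[p [b [g [p0 pd g0 nae]]]]; have pd' := ltnW pd.
have ep k : 0 < k.+1%:R^-1 :> R by rewrite invr_gt0.
have loc k := local_perturbation f uA M_compact cA d_gt0 HG G_transitive (ep k).
pose m k := s2val (cid2 (loc k)).
have m0 k : (0 < m k)%N by exact: s2valP (cid2 (loc k)).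
have Hm k := s2valP' (cid2 (loc k)).
pose E k N : set M := (droppable f A G k.+1%:R^-1 (m k) p (b - g) (4 * N) `&` [set x | b <= L p x])
  `&` aperiodic f.
have mE k N : measurable (E k N : set S).
  exact: (measurable_drop_level pd' k.+1%:R^-1 (m k) b g N).
(* The time from which a point is droppable depends on the point; Y k i collects those for which i
   suffices, and [large_stage] later picks one i. *)
pose Y k i : set M := \bigcap_(N in [set N | (i <= N)%N]) E k N.
have mY k i : measurable (Y k i : set S) by apply: bigcap_measurable => [|N _]; [exists i => /=|exact: mE].
pose F k i := around f i (Y k i).
have mF k i : measurable (F k i : set S) by exact: measurable_around.
have Fmono k i : F k i `<=` F k i.+1.
  apply: around_mono; first exact: leqnSn.
  by move=> y Hy N /= iN; apply: Hy; exact: ltnW.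
pose Om : set M := \bigcap_k \bigcup_i F k i.
have mOm : measurable (Om : set S) by apply: bigcapT_measurable => k; exact: bigcupT_measurable.
have bO x : bad_at p b g x -> Om x.
  move=> [ax bL Lb gap H] k _; have [y oy [n0 Hn0]] := H _ _ (Hm k).
  have Lyx : L p y = L p x.
    by apply: (orbit_ind (h := L p) _ oy) => z _; have := exponent_sum_inv f M_compact cA uA z pd'.
  have Yy : Y k n0 y.
    move=> N /= nN; split; last exact: aperiodic_orbit oy.
    split; last by rewrite /= Lyx.
    have n4 : (n0 <= 4 * N)%N by clear -nN; lia.
    exact: droppable_mono (level_arith Lb gap) (Hn0 _ n4).
  have [q Hq] : exists q : nat, iter q f y = x \/ iter q (homeo_inv f) y = x.
    case: oy => -[q|q] ->; first by exists q; right; exact: iter_homeoK.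
    by exists q.+1; left; exact: iter_homeo_invK.
  exists (maxn n0 q); first by [].
  exists q; first exact: leq_maxr.
  have YY : Y k (maxn n0 q) y.
    by move=> N /=; rewrite geq_max => /andP[n0N _]; exact: Yy.
  by case: Hq => <-; [right; rewrite iter_homeoK|left; rewrite iter_homeo_invK].
have ka0 : 0 < pr Om.
  rewrite lt_neqAle pr_ge0 andbT; apply/negP => /eqP/esym O0; apply: nae.
  exists Om; split=> //; first by rewrite (prE mu mOm) O0.
  by move=> x /= /contrapT; exact: bO.
have [C0 C00 [dl0 dl00 HC0]] := close_log_minor pd'.
have [K K_ge HK] : exists2 K : R, 1 <= K & forall x, mnorm (A x) <= K.
  have [K K1 HK] := continuous_mx_bounded M_compact cA; exists (d%:R * K).
    by rewrite mulr_ege1 // ler1n.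
  by move=> x; rewrite /mnorm ler_wpM2l.
have K0 : 0 < K by apply: lt_le_trans K_ge.
exists p, (g * (pr Om / 2) / 48); split=> //; first by rewrite !divr_gt0 // mulr_gt0 // divr_gt0.
move=> e e0; have me0 : 0 < Num.min e dl0 / K by rewrite divr_gt0 // lt_min e0.
have [k Hk] := archi_le 1 me0.
have {}Hk x : mnorm (A x) * k.+1%:R^-1 <= Num.min e dl0.
  have := Hk k.+1 (leqnSn k); rewrite mulrAC ler_pdivlMr // mul1r => h.
  by rewrite ler_pdivrMr ?ltr0n //; exact: le_trans (HK x) h.
have small x : mnorm (A x) * k.+1%:R^-1 <= dl0 by apply: le_trans (Hk x) _; rewrite ge_min lexx orbT.
have OmF : Om `<=` \bigcup_i F k i by move=> x; exact.
have mUF : measurable (\bigcup_i F k i : set S) by exact: bigcupT_measurable.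
have [i Hi] := large_stage (mF k) (Fmono k) ka0 (pr_le mu mOm mUF OmF).
have mZ : measurable (iter i f @^-1` F k i : set S) by exact: measurable_iter.
have kaZ : pr Om / 2 <= pr (iter i f @^-1` F k i) by rewrite (pr_iter mu_invariant).
(* After the shift by i, a visit up to i steps earlier or later becomes a visit within 2 i <= 8 N
   forward steps. *)
have HZ N : (i <= N)%N -> iter i f @^-1` F k i `<=` within f (8 * N) (E k N).
  move=> iN x [r ri [Yr|Yr]].
    exists (r + i)%N; first by clear -ri iN; lia.
    by rewrite iterD; exact: Yr.
  exists (i - r)%N; first by clear -iN; lia.
  have -> : iter (i - r) f x = iter r (homeo_inv f) (iter i f x).
    by rewrite -{2}(subnKC ri) iterD iter_homeoK.
  exact: Yr.
have [B [cB GB clB drop]] := integral_drop pd'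
  (ep k) (m0 k) C00 g0 (divr_gt0 ka0 (ltr0n R 2)) HC0 small mZ kaZ HZ.
exists B; split=> // x; apply: le_trans (clB x) (le_trans (Hk x) _).
by rewrite ge_min lexx.
Qed.
End IntegralDrop.

Local Notation ev A := (set_val A : _ -> matrix _ _ _).

(** * The space of continuous maps into G *)

Section ContMaps.
Variables (R : realType) (d : nat) (M : ptopologicalType) (G : set 'M[R]_d).
Implicit Types (A B : cont_maps M G).

Lemma cont_maps_continuous A : continuous (ev A).
Proof. by have [] := set_valP A. Qed.

Lemma cont_maps_mem A x : G (ev A x).
Proof. by have [_ H] := set_valP A; exact: H. Qed.

Lemma cont_maps_of (B : M -> 'M[R]_d) : continuous B -> (forall x, G (B x)) ->
  exists B' : cont_maps M G, set_val B' = B.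
Proof.
move=> cB GB; have h : (B : {uniform M -> 'M[R]_d}) \in cont_maps M G by apply: mem_set; split.
by exists (@exist {uniform M -> 'M[R]_d} (fun b => b \in cont_maps M G) B h).
Qed.

Lemma nbhs_cont_maps A (P : set (cont_maps M G)) : nbhs A P <->
  exists2 e : R, 0 < e & forall B, close (ev A) (set_val B) e -> P B.
Proof.
split=> [[_ [[U oU <-] /= UA sub]]|[e e0 H]].
  have : nbhs (set_val A : {uniform M -> 'M[R]_d}) U by exact: open_nbhs_nbhs.
  move=> /uniform_nbhs[E [entE sE]].
  have [e /= e0 He] : exists2 e : R, 0 < e & [set xy : 'M[R]_d * 'M[R]_d | ball xy.1 e xy.2] `<=` E.
    by move: entE; rewrite -entourage_ballE.
  exists (e / 2); first by rewrite divr_gt0.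
  move=> B clB; apply: sub; apply: sE => x _; apply: He => /=; rewrite -ball_normE /= distrC.
  by apply: le_lt_trans (clB x) _; rewrite ltr_pdivrMr // ltr_pMr // ltr1n.
have c : {for A, continuous (set_val : cont_maps M G -> {uniform M -> 'M[R]_d})}.
  exact: initial_continuous.
have : nbhs (set_val A : {uniform M -> 'M[R]_d})
  [set h : {uniform M -> 'M[R]_d} | forall y, `|(h : M -> 'M[R]_d) y - ev A y| < e].
  apply/uniform_nbhs; exists [set xy : 'M[R]_d * 'M[R]_d | ball xy.1 e xy.2].
  split; first by rewrite -entourage_ballE; exists e.
  by move=> h /= Hh y; have := Hh y Logic.I; rewrite -ball_normE /= distrC.
move=> /c; rewrite nbhs_simpl /= => c'; apply: filterS c' => B HB.
by apply: H => x; apply: ltW; exact: HB.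
Qed.

Section Baire.
Hypotheses (M_compact : compact [set: M]) (HG : closed_subgroup_GL G).

(** Invertible matrices are not closed among all matrices: controlling the inverses as well makes
    the distance complete. *)
Definition bi_close (A B : M -> 'M[R]_d) (e : R) := close A B e /\
  close (fun x => invmx (A x)) (fun x => invmx (B x)) e.

Lemma bi_close_of_close A (e : R) : 0 < e -> exists2 dl : R, 0 < dl &
  forall B, close (ev A) (set_val B) dl -> bi_close (set_val A) (set_val B) e.
Proof.
move=> e0; have cA := @cont_maps_continuous A.
have [|dl dl0 H] := @uniform_continuity R d M M_compact _ (fun Z : 'M[R]_d => invmx Z) _ e cA _ e0.
  by move=> x; apply: cont_at_invmx; [exact: subgroup_unit HG _ (cont_maps_mem A x)|exact: cvg_id].
exists (Num.min dl e); first by rewrite lt_min dl0.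
move=> B clB; split; first by apply: closeW clB; rewrite ge_min lexx orbT.
by move=> x; apply: H; apply: le_trans (clB x) _; rewrite ge_min lexx.
Qed.

Lemma bi_close_complete (u : nat -> cont_maps M G) (e : nat -> R) :
  (forall n k, bi_close (set_val (u n)) (set_val (u (n + k)%N)) (e n)) ->
  (forall eta : R, 0 < eta -> exists n, e n <= eta) ->
  exists l : cont_maps M G, forall n, bi_close (set_val (u n)) (set_val l) (e n).
Proof.
move=> H small.
pose v n x := ev (u n) x.
have lim x : exists l : 'M[R]_d, forall n, `|v n x - l| <= e n.
  by apply: mx_complete => // n k; have [h _] := H n k; rewrite distrC; exact: h.
have limV x : exists l : 'M[R]_d, forall n, `|invmx (v n x) - l| <= e n.
  by apply: mx_complete => // n k; have [_ h] := H n k; rewrite distrC; exact: h.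
pose l x := sval (cid (lim x)); have lP x n : `|v n x - l x| <= e n := svalP (cid (lim x)) n.
pose l' x := sval (cid (limV x)).
have l'P x n : `|invmx (v n x) - l' x| <= e n := svalP (cid (limV x)) n.
have Gv n x : G (v n x) by exact: cont_maps_mem.
have e_ge n : 0 <= e n by apply: le_trans (lP point n).
(* The limit of the inverses is the inverse of the limit, which keeps l invertible and hence, by
   closedness, in G. *)
have inv x : l x *m l' x = 1%:M.
  apply/eqP; rewrite -subr_eq0 -normr_le0; apply/ler_addgt0Pr => eta eta0; rewrite add0r.
  pose K : R := d%:R * (`|l x| + 1) + d%:R * (`|l' x| + 1) + 1.
  have K0 : 0 < K by rewrite ltr_pwDr // addr_ge0 // mulr_ge0 // addr_ge0.
  have m0 : 0 < Num.min 1 (eta / K) by rewrite lt_min ltr01 divr_gt0.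
  have [n Hn] := small _ m0.
  move: Hn; rewrite le_min => /andP[e1 eK].
  have -> : l x *m l' x - 1%:M = (l x - v n x) *m l' x + v n x *m (l' x - invmx (v n x)).
    rewrite mulmxBl mulmxBr (mulmxV (subgroup_unit HG (Gv n x))) addrA subrK //.
  have h1 : `|(l x - v n x) *m l' x| <= d%:R * (e n * `|l' x|).
    apply: le_trans (mnormMl _ _) _; rewrite /mnorm -mulrA ler_wpM2l // ler_wpM2r //.
    by rewrite distrC.
  have h2 : `|v n x *m (l' x - invmx (v n x))| <= d%:R * ((`|l x| + 1) * e n).
    apply: le_trans (mnormMl _ _) _; rewrite /mnorm -mulrA ler_wpM2l //; apply: ler_pM => //.
      rewrite -[v n x](subrK (l x)) addrC; apply: le_trans (ler_normD _ _) _.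
      by rewrite lerD2l; apply: le_trans (lP x n) e1.
    by rewrite distrC.
  apply: le_trans (ler_normD _ _) _; apply: le_trans (lerD h1 h2) _.
  apply: (@le_trans _ _ (e n * K)); last by rewrite -ler_pdivlMr.
  have a : 0 <= d%:R * e n by rewrite mulr_ge0.
  by rewrite /K; have := e_ge n; lra.
have ul x : l x \in unitmx by have [] := mulmx1_unit (inv x).
have l'E x : l' x = invmx (l x) by rewrite -[LHS]mul1mx -(mulVmx (ul x)) -mulmxA inv mulmx1.
have Gl x : G (l x).
  apply: subgroup_limit (ul x) _ => // eta /small[n Hn].
  by exists (v n x) => //; apply: le_trans (lP x n) Hn.
have cl : continuous l.
  move=> x; apply/cvgrPdist_le => eta eta0; have e3 : 0 < eta / 3 by rewrite divr_gt0.
  have [n Hn] := small _ e3.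
  have := @cont_maps_continuous (u n) x => /cvgrPdist_le /(_ _ e3); apply: filterS => y Hy.
  have h1 := le_trans (lP x n) Hn; have h2 := le_trans (lP y n) Hn.
  have -> : l x - l y = (l x - v n x) + ((v n x - v n y) + (v n y - l y)).
    by rewrite (subrKA (v n y)) (subrKA (v n x)).
  apply: le_trans (ler_normD _ _) _; have := ler_normD (v n x - v n y) (v n y - l y).
  have := Hy; rewrite -/(v n x) -/(v n y) (distrC (l x)); lra.
have [l0 l0E] := cont_maps_of cl Gl; exists l0 => n; rewrite l0E; split=> x.
  by rewrite distrC; exact: lP.
by rewrite -l'E distrC; exact: l'P.
Qed.

Lemma cont_maps_baire (F : nat -> set (cont_maps M G)) :
  (forall i, open (F i)) -> (forall i, dense (F i)) -> dense (\bigcap_i F i).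
Proof.
move=> opn dns U [A UA] oU.
have : nbhs A U by exact: open_nbhs_nbhs.
move=> /nbhs_cont_maps[r r0 Hr].
pose D A B e := bi_close (set_val (A : cont_maps M G)) (set_val (B : cont_maps M G)) (e : R).
have refl B : D B B 0 by split=> x; rewrite subrr normr0.
have mono B C a b : a <= b -> D B C a -> D B C b.
  by move=> ab [h1 h2]; split; apply: closeW; eassumption.
have tri B C E a b : D B C a -> D C E b -> D B E (a + b).
  have t (p q s : M -> 'M[R]_d) : close p q a -> close q s b -> close p s (a + b).
    move=> h1 h2 x; have := lerD (h1 x) (h2 x); apply: le_trans.
    by rewrite [leRHS]addrC -(subrKA (q x) (s x)); exact: ler_normD.
  by move=> [h1 h2] [h3 h4]; split; apply: t; eassumption.
have opn' i B : F i B -> exists2 s : R, 0 < s & forall C, D B C s -> F i C.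
  move=> FB; have : nbhs B (F i) by apply: open_nbhs_nbhs; split=> //; exact: opn.
  by move=> /nbhs_cont_maps[s s0 Hs]; exists s => // C [h _]; exact: Hs.
have dns' i B (s : R) : 0 < s -> exists2 C, F i C & D B C s.
  move=> s0; have [dl dl0 H] := bi_close_of_close B s0.
  have : nbhs B [set C : cont_maps M G | close (set_val B : M -> 'M[R]_d) (set_val C) dl].
    by apply/nbhs_cont_maps; exists dl.
  rewrite nbhsE => -[V [oV VB] sV].
  by have [C [VC FC]] := dns i V (ex_intro _ B VB) oV; exists C => //; apply: H; exact: sV.
have [B [h _] HB] := baire_category refl mono tri bi_close_complete opn' dns' A r0.
by exists B; split; [exact: Hr|move=> i _; exact: HB].
Qed.
End Baire.
End ContMaps.

(** * Continuity points and genericity *)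

Lemma below_midpoint (R : realType) (a b c : R) : a < c -> b <= a + (c - a) / 2 -> b < c.
Proof. by move=> *; lra. Qed.

Lemma dist_le_of_band (R : realType) (a b e : R) : b <= a + e -> a - e <= b -> `|a - b| <= e.
Proof. by move=> *; rewrite ler_distl; lra. Qed.

Lemma far_of_drop (R : realType) (a b t : R) : 0 < t -> b <= a - t -> `|a - b| <= t / 2 -> False.
Proof. by rewrite ler_distl => *; lra. Qed.

Section FinalStep.
Variables (R : realType) (d : nat) (M : ptopologicalType) (mu : probability (borel M) R) (f : homeomorphism M) (G : set 'M[R]_d).
Hypotheses (d_gt0 : (0 < d)%N) (M_compact : compact [set: M]) (M_hausdorff : hausdorff_space M).
Hypotheses (mu_regular : borel_regular mu) (mu_invariant : preserves mu f).
Hypotheses (HG : closed_subgroup_GL G) (G_transitive : projectively_transitive G).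
Implicit Types A B : cont_maps M G.
#[local] Opaque mean exponent_sum.

Let unitA A x : ev A x \in unitmx.
Proof. exact: (subgroup_unit HG (cont_maps_mem A x)). Qed.

Local Notation LEp A p := (LE mu f (ev A) p).

Lemma LE_upper A p (e : R) : (p <= d)%N -> 0 < e ->
  nbhs A [set B | LEp B p <= LEp A p + e].
Proof.
move=> pd e0; have cA := @cont_maps_continuous _ _ _ _ A.
have [dl dl0 H] := exponent_sum_upper M_compact mu_invariant cA (@unitA A) pd e0.
apply/nbhs_cont_maps; exists dl => // B clB /=.
rewrite !(LE_mean M_compact mu_invariant _ (@unitA _) pd); try exact: cont_maps_continuous.
exact: H (@cont_maps_continuous _ _ _ _ B) (@unitA B) clB.
Qed.

Lemma LE_lower A p (e : R) : (p <= d)%N -> 0 < e ->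
  {ae mu, forall x, dominated_or_trivial f (set_val A) x} ->
  nbhs A [set B | LEp A p - e <= LEp B p].
Proof.
move=> pd e0 dt; have cA := @cont_maps_continuous _ _ _ _ A.
have good : {ae mu, forall x, forall q, (q < d)%N -> class_end f (set_val A) q x ->
    exists2 k : R, 0 < k & good_orbit q f (set_val A) k x}.
  have reg := ae_orbit_regular M_compact mu_invariant cA (@unitA A).
  apply: ae_imp2 reg dt => x rx dx q qd ce.
  have := good_of_dominated M_compact cA (@unitA A) rx dx qd ce.
  by [].
have [dl dl0 H] := exponent_sum_lower M_compact mu_invariant cA (@unitA A) good pd e0.
apply/nbhs_cont_maps; exists dl => // B clB /=.
rewrite !(LE_mean M_compact mu_invariant _ (@unitA _) pd); try exact: cont_maps_continuous.
exact: H (@cont_maps_continuous _ _ _ _ B) (@unitA B) clB.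
Qed.

Lemma continuous_LE_map A :
  {for A, continuous (LE_map mu f (G := G))} <->
  forall p, (0 < p < d)%N -> forall e : R, 0 < e -> nbhs A [set B | `|LEp A p - LEp B p| <= e].
Proof.
split=> [/cvgrPdist_le H p /andP[p0 pd] e /H|H].
  apply: filterS => B /=; apply: le_trans.
  have jd : (p.-1 < d.-1)%N by lia.
  have := le_mx_entry (LE_map mu f A - LE_map mu f B) 0 (Ordinal jd).
  by rewrite !mxE /= prednK.
apply/(cvgrPdist_le (FF := nbhs_filter A)) => e e0.
have [|j jd|dl dl0 Hdl] := @common_radius R d.-1 (fun j dl => forall B,
    close (ev A) (set_val B) dl -> `|LEp A j.+1 - LEp B j.+1| <= e).
- by move=> i a b ab h B clB; apply: h; apply: closeW clB.
- have jd' : (0 < j.+1 < d)%N by lia.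
  exact/nbhs_cont_maps/H.
apply/nbhs_cont_maps; exists dl => // B clB /=; apply: mx_norm_le; first exact: ltW.
by move=> i j; rewrite !mxE; exact: Hdl.
Qed.

Lemma continuity_point A :
  {for A, continuous (LE_map mu f (G := G))} <->
  {ae mu, forall x, dominated_or_trivial f (set_val A) x}.
Proof.
split=> [/continuous_LE_map H|dt].
  apply: contrapT => nd; have cA := @cont_maps_continuous _ _ _ _ A.
  have [p [tau [p0 pd tau0 Hp]]] := not_dominated_drop M_compact M_hausdorff mu_regular
    mu_invariant cA (@unitA A) HG (cont_maps_mem A) d_gt0 G_transitive nd.
  have pd' : (0 < p < d)%N by rewrite p0.
  have t2 : 0 < tau / 2 by rewrite divr_gt0.
  have [dl dl0 Hdl] := (nbhs_cont_maps A _).1 (H p pd' _ t2).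
  have [B [cB GB clB le]] := Hp _ dl0.
  have [B' BE] := cont_maps_of cB GB.
  have := Hdl B'; rewrite /= BE => /(_ clB).
  rewrite !(LE_mean M_compact mu_invariant _ _ (ltnW pd)) //; first last.
  - by move=> x; exact: (subgroup_unit HG (GB x)).
  exact: far_of_drop tau0 le.
apply/continuous_LE_map => p /andP[_ pd] e e0.
apply: filterS2 (LE_upper A (ltnW pd) e0) (LE_lower (ltnW pd) e0 dt) => B /= h1 h2.
exact: dist_le_of_band h1 h2.
Qed.

(** The first set is open by upper semicontinuity, the second by construction; what is missed lies
    on the boundary of the first set, so the union is also dense. *)
Definition jump_free p (c : R) : set (cont_maps M G) :=
  [set A : cont_maps M G | LEp A p < c] `|` ([set A : cont_maps M G | c <= LEp A p])°.

Lemma open_jump_free p c : (p <= d)%N -> open (jump_free p c).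
Proof.
move=> pd; apply: openU; last exact: open_interior.
rewrite openE => A /= lt; have e0 : 0 < (c - LEp A p) / 2 by rewrite divr_gt0 // subr_gt0.
by apply: filterS (LE_upper A pd e0) => B /=; exact: below_midpoint.
Qed.

Lemma dense_jump_free p c : dense (jump_free p c).
Proof.
move=> U [A UA] oU; have [[B [UB lt]]|H] := pselect (exists B, U B /\ LEp B p < c).
  by exists B; split=> //; left.
exists A; split=> //; right; rewrite /interior /=.
have : nbhs A U by exact: open_nbhs_nbhs.
by apply: filterS => B UB /=; rewrite leNgt; apply/negP => lt; apply: H; exists B.
Qed.

Lemma generic_continuity :
  residual [set A | {for A, continuous (LE_map mu f (G := G))}].
Proof.
pose F i := if unpickle i is Some (p, q) then
  if (p <= d)%N then jump_free p (@ratr R q) else setT else setT.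
have oF i : open (F i).
  rewrite /F; case: unpickle => [[p q]|]; last exact: openT.
  by case: ifP => pd; [exact: open_jump_free|exact: openT].
have dT : dense [set: cont_maps M G] by move=> U [A UA] _; exists A.
have dF i : dense (F i).
  rewrite /F; case: unpickle => [[p q]|] //.
  by case: ifP => _ //; exact: dense_jump_free.
exists (\bigcap_i F i); split; first by exists F.
  exact: cont_maps_baire.
move=> A FA /=; apply/continuous_LE_map => p /andP[_ pd] e e0.
have lt : LEp A p - e < LEp A p by lra.
(* A rational just below [LEp A p]: as A is not in the first part of [jump_free], nearby maps stay
   above q, which is lower semicontinuity at A. *)
have [q] := rat_in_itvoo lt; rewrite in_itv /= => /andP[q1 q2].
have := FA (pickle (p, q)) Logic.I; rewrite /F pickleK (ltnW pd) => -[/= h|]; first by lra.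
rewrite /interior /= => h.
apply: filterS2 (LE_upper A (ltnW pd) e0) h => B /= h1 h2; exact: dist_le_of_band h1 (le_trans (ltW q1) h2).
Qed.
End FinalStep.

Theorem theorem5 (R : realType) (d : nat) (M : ptopologicalType)
    (mu : probability (g_sigma_algebraType (@open M)) R)
    (f : homeomorphism M) (G : set 'M[R]_d)
    (d_gt0 : (0 < d)%N)
    (M_compact : compact [set: M]) (M_hausdorff : hausdorff_space M)
    (mu_regular : borel_regular mu) (mu_invariant : preserves mu f)
    (G_subgroup : closed_subgroup_GL G)
    (G_transitive : projectively_transitive G) :
  (forall A0 : cont_maps M G,
     {for A0, continuous (LE_map mu f (G := G))} <->
     {ae mu, forall x, oseledets_dominated_at f (set_val A0) x \/
                       oseledets_trivial_at f (set_val A0) x}) /\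
  (exists2 S : set (cont_maps M G), residual S &
     forall A : cont_maps M G, S A ->
     {ae mu, forall x, oseledets_trivial_at f (set_val A) x \/
                       oseledets_dominated_at f (set_val A) x}).
Proof.
split; first by move=> A0; exact: continuity_point.
exists [set A | {for A, continuous (LE_map mu f (G := G))}]; first exact: generic_continuity.
move=> A /= /continuity_point => /(_ d_gt0 M_compact M_hausdorff mu_regular mu_invariant
  G_subgroup G_transitive).
by apply: ae_imp => x [h|h]; [right|left].
Qed.
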